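(* Let $(M^n,g)$ be a closed Riemannian manifold, $k\ge2$, $\alpha\in(0,1)$ and $C,\rho>0$. There is $\varepsilon_0=\varepsilon_0(C,\rho)>0$ such that for every $0<\varepsilon<\varepsilon_0$ and every closed separating $C^{k,\alpha}$ hypersurface $Y\subset M$, $M=M^+\sqcup_YM^-$, with $\|A_Y\|_{C^{k-2,\alpha}}\le C$ and $r_{\mathrm{inj}}(Y)\ge\rho$, the operator $$L_{\varepsilon,u}=\varepsilon^2\Delta_g-W''(u):H^1_{\varepsilon,0}(M^\pm)\to H^{-1}_\varepsilon(M^\pm)$$ has a bounded inverse, where $u=u^\pm_{Y,\varepsilon}$.
   Context: $W(u)=\frac{(1-u^2)^2}{4}$, $E_\varepsilon(u,\Omega)=\int_\Omega\frac\varepsilon2|\nabla u|^2+\frac1\varepsilon W(u)$. $u^+_{Y,\varepsilon}$ (resp. $u^-_{Y,\varepsilon}$) is the positive (resp. negative) minimizer of $E_\varepsilon$ on $M^+$ (resp. $M^-$) among functions vanishing on $Y=\partial M^\pm$; it exists and is unique for $\varepsilon$ small. $A_Y$ is the second fundamental form and $r_{\mathrm{inj}}(Y)$ the injectivity radius of the normal exponential map of $Y$. Norms: $\|f\|_{H^1_\varepsilon}^2=\varepsilon\|f\|_{L^2}^2+\varepsilon^3\|\nabla f\|_{L^2}^2$; $H^1_{\varepsilon,0}(M^\pm)$ consists of $H^1_\varepsilon$ functions with zero trace on $Y$; $\|f\|_{H^{-1}_\varepsilon}=\sup_{0\ne g\in H^1_{\varepsilon,0}}\|g\|_{H^1_\varepsilon}^{-1}\int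 fg$ (dual norm). *)

(* Defs.v *)
From HB Require Import structures.
From mathcomp Require Import all_boot all_order all_algebra.
From mathcomp Require Import all_classical all_reals all_analysis.
Set Implicit Arguments.
Unset Strict Implicit.
Unset Printing Implicit Defensive.
Import Order.TTheory GRing.Theory Num.Theory.
Import numFieldNormedType.Exports.
Local Open Scope classical_set_scope.
Local Open Scope ring_scope.

Section Euclidean.
Variable R : realType.

Definition partial m (a : 'I_m) (f : 'rV[R]_m -> R) : 'rV[R]_m -> R :=
  fun x => 'D_(delta_mx 0 a) f x.

Definition continuous_in m (D : set 'rV[R]_m) (f : 'rV[R]_m -> R) : Prop :=
  forall x, D x -> {for x, continuous f}.

Definition locally_holder (alpha : R) m (D : set 'rV[R]_m)
    (f : 'rV[R]_m -> R) : Prop :=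
  forall x, D x -> exists U (K : R), nbhs x U /\
    forall y z, D y -> D z -> U y -> U z ->
      `|f y - f z| <= K * `|y - z| `^ alpha.

(* On an open set D: the partial derivatives of order <= k exist and those of
   order k satisfy P. *)
Fixpoint of_class m (P : set 'rV[R]_m -> ('rV[R]_m -> R) -> Prop) (k : nat)
    (D : set 'rV[R]_m) (f : 'rV[R]_m -> R) : Prop :=
  if k is k'.+1 then
    forall a : 'I_m, (forall x, D x -> derivable f x (delta_mx 0 a)) /\
                     of_class P k' D (partial a f)
  else P D f.

Definition smooth m (D : set 'rV[R]_m) (f : 'rV[R]_m -> R) : Prop :=
  forall k, of_class (@continuous_in m) k D f.

Definition class_Ckalpha (k : nat) (alpha : R) m (D : set 'rV[R]_m)
    (f : 'rV[R]_m -> R) : Prop :=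
  of_class (@locally_holder alpha m) k D f.

(* Lebesgue integral over R^m of a nonnegative Borel function, computed as an
   iterated integral (Tonelli). *)
Fixpoint lebesgue_int (m : nat) : ('rV[R]_m -> \bar R) -> \bar R :=
  if m is m'.+1 then
    fun F => (\int[lebesgue_measure]_t
      lebesgue_int (fun y : 'rV[R]_m' => F (row_mx (const_mx t : 'rV_1) y)))%E
  else fun F => F 0.

Definition bilin d (G : 'M[R]_d) (v w : 'rV[R]_d) : R := (v *m G *m w^T) 0 0.

(* Christoffel symbol Gamma^c_{ab} of the coordinate metric G. *)
Definition christoffel d (G : 'rV[R]_d -> 'M[R]_d) (x : 'rV[R]_d)
    (a b c : 'I_d) : R :=
  2^-1 * \sum_(e < d) invmx (G x) c e *
    (partial a (fun y => G y b e) x + partial b (fun y => G y a e) x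
     - partial e (fun y => G y a b) x).

(* Covariant tensor fields in coordinates: T s y is the component at y with
   index list s; only lists whose size is the rank of T matter. *)
Definition tensor d := seq 'I_d -> 'rV[R]_d -> R.

Definition covariant_derivative d (G : 'rV[R]_d -> 'M[R]_d) (T : tensor d) :
    tensor d :=
  fun s y => if s is a :: s' then
      partial a (T s') y
      - \sum_(l < size s') \sum_(b < d)
          christoffel G y a (nth a s' l) b * T (set_nth b s' l b) y
    else 0.

Definition tensor_eval d r (T : tensor d) (y : 'rV[R]_d)
    (v : 'I_r -> 'rV[R]_d) : R :=
  \sum_(s : r.-tuple 'I_d) T s y * \prod_(l < r) v l 0 (tnth s l).

Definition parallel_along d (G : 'rV[R]_d -> 'M[R]_d) (c E : R -> 'rV[R]_d) :
    Prop :=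
  forall t, derivable E t 1 /\ forall b,
    (derive1 E t) 0 b =
    - \sum_(a < d) \sum_(e < d)
        christoffel G (c t) a e b * (derive1 c t) 0 a * E t 0 e.

End Euclidean.

(* A closed Riemannian manifold of dimension n.  By compactness the smooth
   structure is generated by a finite atlas.  [phi i] is the i-th chart, with
   inverse [psi i], and [gij i] is the metric in its coordinates; [phi i] and
   [psi i] are only meaningful on [dom i] and [phi i @` dom i]. *)
Record closed_riemannian (R : realType) (n : nat) := ClosedRiemannian {
  carrier :> ptopologicalType;
  chart : finType;
  dom : chart -> set carrier;
  phi : chart -> carrier -> 'rV[R]_n;
  psi : chart -> 'rV[R]_n -> carrier;
  gij : chart -> 'rV[R]_n -> 'M[R]_n;
  carrier_compact : compact [set: carrier];
  carrier_hausdorff : hausdorff_space carrier;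
  dom_cover : forall p, exists i, dom i p;
  dom_open : forall i, open (dom i);
  img_open : forall i, open (phi i @` dom i);
  phiK : forall i p, dom i p -> psi i (phi i p) = p;
  phi_continuous : forall i p, dom i p -> {for p, continuous (phi i)};
  psi_continuous : forall i x, (phi i @` dom i) x -> {for x, continuous (psi i)};
  transition_smooth : forall i j a,
    smooth (phi i @` (dom i `&` dom j)) (fun x => phi j (psi i x) 0 a);
  gij_smooth : forall i a b, smooth (phi i @` dom i) (fun x => gij i x a b);
  gij_sym : forall i x, (phi i @` dom i) x -> (gij i x)^T = gij i x;
  gij_pos : forall i x v, (phi i @` dom i) x -> v != 0 -> 0 < bilin (gij i x) v v;
  gij_transition : forall i j p, dom i p -> dom j p ->
    let J := jacobian (fun x => phi j (psi i x)) (phi i p) in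
    gij i (phi i p) = J *m gij j (phi j p) *m J^T
}.

Section Manifold.
Variables (R : realType) (n : nat) (M : closed_riemannian R n).

Definition borel := g_sigma_algebraType (@open M).

Definition metric_at (i : chart M) (p : M) : 'M[R]_n := gij i (phi i p).

(* Evaluates a chart-independent quantity in some chart around p. *)
Definition in_chart (p : M) (F : chart M -> R) : R :=
  if [pick i | `[< dom i p >]] is Some i then F i else 0.

Definition is_volume (vol : set borel -> \bar R) : Prop :=
  forall i (A : set borel), measurable A -> A `<=` dom i ->
    vol A = lebesgue_int (fun x : 'rV[R]_n =>
      (\1_(phi i @` A) x * Num.sqrt (\det (gij i x)))%:E).

Definition smooth_fun (f : M -> R) : Prop :=
  forall i, smooth (phi i @` dom i) (f \o psi i).

(* A covector field, given by its components in each chart. *)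
Definition covector_field := chart M -> M -> 'rV[R]_n.

Definition is_covector_field (w : covector_field) : Prop :=
  forall i j p, dom i p -> dom j p ->
    w i p = w j p *m (jacobian (fun x => phi j (psi i x)) (phi i p))^T.

Definition covector_inner (w z : covector_field) (p : M) : R :=
  in_chart p (fun i => bilin (invmx (metric_at i p)) (w i p) (z i p)).

Definition is_geodesic (c : R -> M) : Prop :=
  continuous c /\
  forall t i, dom i (c t) ->
    let x := fun s => phi i (c s) in
    [/\ derivable x t 1, derivable (derive1 x) t 1
      & forall e, (derive1 (derive1 x) t) 0 e =
          - \sum_(a < n) \sum_(b < n) christoffel (@gij _ _ M i) (x t) a b e
              * (derive1 x t) 0 a * (derive1 x t) 0 b].

Definition speed (c : R -> M) (t : R) : R :=
  in_chart (c t) (fun i => let v := derive1 (phi i \o c) t in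
    Num.sqrt (bilin (metric_at i (c t)) v v)).

End Manifold.

Section Hypersurface.
Variables (R : realType) (n : nat) (M : closed_riemannian R n.+1).
Variables (k : nat) (alpha : R) (Y : set M).

Definition param_jacobian (V : 'rV[R]_n -> M) (i : chart M) (y : 'rV[R]_n) :
    'M[R]_(n, n.+1) := jacobian (fun z => phi i (V z)) y.

(* X : D -> Y is a C^{k,alpha} local parametrization of Y: an immersion which
   is a homeomorphism onto a relatively open subset of Y. *)
Definition local_param (D : set 'rV[R]_n) (X : 'rV[R]_n -> M) : Prop :=
  [/\ open D,
      (forall y, D y -> {for y, continuous X}) /\ {in D &, injective X},
      forall D', open D' -> D' `<=` D ->
        exists2 O : set M, open O & X @` D' = Y `&` O,
      forall i c, class_Ckalpha k alpha (D `&` X @^-1` dom i)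
                    (fun y => phi i (X y) 0 c)
    & forall i y, D y -> dom i (X y) -> row_free (param_jacobian X i y)].

Definition closed_hypersurface : Prop :=
  [/\ Y !=set0, closed Y
    & forall p, Y p -> exists D X, local_param D X /\ (X @` D) p].

(* The open sets Mp and Mm are the interiors of the two sides M^+ and M^-,
   whose common boundary is Y. *)
Definition separates (Mp Mm : set M) : Prop :=
  [/\ open Mp, open Mm, Mp `&` Mm = set0, Mp `|` Mm = ~` Y
    & closure Mp `\` Mp = Y /\ closure Mm `\` Mm = Y].

Definition induced_metric (X : 'rV[R]_n -> M) (y : 'rV[R]_n) : 'M[R]_n :=
  \matrix_(a, b) in_chart (X y) (fun i =>
    bilin (metric_at i (X y)) (row a (param_jacobian X i y))
                              (row b (param_jacobian X i y))).

Definition is_area (area : set (borel M) -> \bar R) : Prop :=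
  area (~` Y) = 0%E /\
  forall D X, local_param D X ->
    forall A : set (borel M), measurable A -> A `<=` X @` D ->
    area A = lebesgue_int (fun y : 'rV[R]_n =>
      (\1_(D `&` X @^-1` A) y * Num.sqrt (\det (induced_metric X y)))%:E).

(* v consists of the components in the chart i of a tangent vector at p. *)
Definition normal_at (i : chart M) (p : M) (v : 'rV[R]_n.+1) : Prop :=
  forall D X y, local_param D X -> D y -> X y = p ->
    param_jacobian X i y *m metric_at i p *m v^T = 0.

(* The unit normal pointing into S, in the coordinates of the chart i. *)
Definition unit_normal (S : set M) (i : chart M) (p : M) : 'rV[R]_n.+1 :=
  xget 0 [set v | [/\ normal_at i p v, bilin (metric_at i p) v v = 1
                    & \forall t \near 0^'+, S (psi i (phi i p + t *: v))]].

(* A_ab = g(nu, nabla_a (d_b X)) *)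
Definition second_fundamental_form (S : set M) (X : 'rV[R]_n -> M) :
    tensor R n :=
  fun s y => if s is [:: a; b] then
      in_chart (X y) (fun i =>
        let x := fun c z => phi i (X z) 0 c in
        \sum_(c < n.+1)
          (partial a (partial b (x c)) y
           + \sum_(d < n.+1) \sum_(e < n.+1)
               christoffel (@gij _ _ M i) (phi i (X y)) d e c
                 * partial a (x d) y * partial b (x e) y)
          * (metric_at i (X y) *m (unit_normal S i (X y))^T) c 0)
    else 0.

Definition nabla_A (S : set M) (j : nat) (X : 'rV[R]_n -> M) : tensor R n :=
  iter j (covariant_derivative (induced_metric X)) (second_fundamental_form S X).

Definition sup_norm_nabla_A (S : set M) (j : nat) : \bar R :=
  ereal_sup [set x | exists D X y (v : 'I_(j.+2) -> 'rV[R]_n),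
    [/\ local_param D X, D y,
        forall l, bilin (induced_metric X y) (v l) (v l) <= 1
      & x = `|tensor_eval (nabla_A S j X) y v|%:E]].

(* alpha-Hoelder seminorm of the tensor nabla^j A: its values at the endpoints
   of a curve in Y of length at most l <= 1 are compared by parallel transport
   along the curve. *)
Definition holder_seminorm_nabla_A (S : set M) (j : nat) : \bar R :=
  ereal_sup [set x | exists D X (c : R -> 'rV[R]_n) (l : R)
      (E : 'I_(j.+2) -> R -> 'rV[R]_n),
    [/\ local_param D X /\ (0 < l <= 1),
        forall t, [/\ D (c t), derivable c t 1 & {for t, continuous (derive1 c)}],
        forall t, 0 <= t <= 1 ->
          bilin (induced_metric X (c t)) (derive1 c t) (derive1 c t) <= l ^+ 2,
        forall q, parallel_along (induced_metric X) c (E q) /\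
          bilin (induced_metric X (c 0)) (E q 0) (E q 0) <= 1
      & x = (`|tensor_eval (nabla_A S j X) (c 1) (fun q => E q 1)
               - tensor_eval (nabla_A S j X) (c 0) (fun q => E q 0)|
             / l `^ alpha)%:E]].

(* C^{k-2,alpha} norm of A; the choice of side S only affects its sign. *)
Definition holder_norm_A (S : set M) : \bar R :=
  (\sum_(j < k.-1) sup_norm_nabla_A S j + holder_seminorm_nabla_A S k.-2)%E.

(* Geodesics c with c(0) in Y and c'(0) normal to Y correspond to the vectors
   v = c'(0) of the normal bundle of Y, and c(1) is the normal exponential map
   at v. *)
Definition normal_geodesic (c : R -> M) : Prop :=
  [/\ is_geodesic c, Y (c 0)
    & forall i, dom i (c 0) -> normal_at i (c 0) (derive1 (phi i \o c) 0)].

Definition normal_injectivity_radius : \bar R :=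
  ereal_sup [set x | exists r : R, x = r%:E /\ 0 < r /\
    forall c1 c2, normal_geodesic c1 -> normal_geodesic c2 ->
      speed c1 0 < r -> speed c2 0 < r -> c1 1 = c2 1 -> c1 = c2].

End Hypersurface.

Section AllenCahn.
Variables (R : realType) (n : nat) (M : closed_riemannian R n.+1).
Variable vol : {measure set (borel M) -> \bar R}.
Variable Y : set M.
Variable area : {measure set (borel M) -> \bar R}.

Definition double_well (u : R) : R := (1 - u ^+ 2) ^+ 2 / 4.

(* w is the weak differential on the open set S of f, and is in L^2(S).  The
   coordinate integral over dx is written as dvol / sqrt(det g). *)
Definition weak_differential (S : set (borel M)) (f : M -> R)
    (w : covector_field M) : Prop :=
  [/\ is_covector_field w,
      forall i a, measurable_fun (S `&` dom i : set (borel M))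
                    (fun p : borel M => w i p 0 a),
      (\int[vol]_(p in S) (covector_inner w w p)%:E < +oo)%E
    & forall (i : chart M) (a : 'I_n.+1) (eta : M -> R), smooth_fun eta ->
        closure [set p | eta p != 0] `<=` S `&` dom i ->
        \int[vol]_(p in (S `&` dom i : set (borel M)))
           (f p * partial a (eta \o psi i) (phi i p)
              / Num.sqrt (\det (metric_at i p)))
        = - \int[vol]_(p in (S `&` dom i : set (borel M)))
           (w i p 0 a * eta p / Num.sqrt (\det (metric_at i p)))].

Definition weak_diff (S : set (borel M)) (f : M -> R) : covector_field M :=
  xget (fun _ _ => 0) [set w | weak_differential S f w].

Definition H1 (S : set (borel M)) (f : M -> R) : Prop :=
  [/\ measurable_fun S (f : borel M -> R),
      (\int[vol]_(p in S) (f p ^+ 2)%:E < +oo)%E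
    & exists w, weak_differential S f w].

(* <grad f, grad h>; equals the inner product of the differentials *)
Definition grad_inner (S : set (borel M)) (f h : M -> R) (p : M) : R :=
  covector_inner (weak_diff S f) (weak_diff S h) p.

Definition H1_norm (eps : R) (S : set (borel M)) (f : M -> R) : R :=
  Num.sqrt (eps * \int[vol]_(p in S) (f p ^+ 2)
            + eps ^+ 3 * \int[vol]_(p in S) grad_inner S f f p).

(* h in L^2(Y) is the trace of f in H^1(S): the trace operator is the
   continuous extension of the restriction of smooth functions to Y. *)
Definition has_trace (S : set (borel M)) (f h : M -> R) : Prop :=
  measurable_fun (Y : set (borel M)) (h : borel M -> R) /\
  exists f_ : nat -> M -> R,
    [/\ forall j, smooth_fun (f_ j),
        H1_norm 1 S (fun p => f_ j p - f p) @[j --> \oo] --> (0 : R)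
      & (\int[area]_(p in (Y : set (borel M))) ((f_ j p - h p) ^+ 2)%:E)%E
          @[j --> \oo] --> (0 : \bar R)%E].

Definition H10 (S : set (borel M)) (f : M -> R) : Prop :=
  H1 S f /\ has_trace S f (fun _ => 0).

Definition energy (eps : R) (S : set (borel M)) (u : M -> R) : \bar R :=
  (\int[vol]_(p in S)
     (eps / 2 * grad_inner S u u p + eps^-1 * double_well (u p))%:E)%E.

Definition minimizer (eps : R) (S : set (borel M)) (u : M -> R) : Prop :=
  H10 S u /\ forall v, H10 S v -> (energy eps S u <= energy eps S v)%E.

Definition positive_minimizer (eps : R) (S : set (borel M)) (u : M -> R) :=
  minimizer eps S u /\ {ae vol, forall p : borel M, S p -> 0 < u p}.

Definition negative_minimizer (eps : R) (S : set (borel M)) (u : M -> R) :=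
  minimizer eps S u /\ {ae vol, forall p : borel M, S p -> u p < 0}.

Definition dual_norm (eps : R) (S : set (borel M)) (F : (M -> R) -> R) : \bar R :=
  ereal_sup [set x | exists h, [/\ H10 S h, H1_norm eps S h != 0
                             & x = (F h / H1_norm eps S h)%:E]].

(* H^{-1}_eps: the bounded linear functionals on H^1_{eps,0}; only the values
   of F on H10 matter, and H1_norm is a norm modulo a.e. equality. *)
Definition Hm1 (eps : R) (S : set (borel M)) (F : (M -> R) -> R) : Prop :=
  [/\ forall (a : R) f h, H10 S f -> H10 S h ->
        F (fun p => a * f p + h p) = a * F f + F h,
      forall h, H10 S h -> H1_norm eps S h = 0 -> F h = 0
    & (dual_norm eps S F < +oo)%E].

(* The distribution (eps^2 Delta - W''(u)) f, with Delta = div grad. *)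
Definition linearized (eps : R) (S : set (borel M)) (u f : M -> R) :
    (M -> R) -> R :=
  fun h => eps ^+ 2 * (- \int[vol]_(p in S) grad_inner S f h p)
           - \int[vol]_(p in S) (derive1 (derive1 double_well) (u p) * f p * h p).

Definition has_bounded_inverse (eps : R) (S : set (borel M))
    (L : (M -> R) -> ((M -> R) -> R)) : Prop :=
  (forall f, H10 S f -> Hm1 eps S (L f)) /\
  exists (inv : ((M -> R) -> R) -> (M -> R)) (K : R),
    (forall F, Hm1 eps S F ->
       [/\ H10 S (inv F), forall h, H10 S h -> L (inv F) h = F h
         & ((H1_norm eps S (inv F))%:E <= K%:E * dual_norm eps S F)%E]) /\
    (forall f, H10 S f ->
       {ae vol, forall p : borel M, S p -> inv (L f) p = f p}).

End AllenCahn.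

(* Main.v *)
Require Import Defs.
From HB Require Import structures.
From mathcomp Require Import all_boot all_order all_algebra.
From mathcomp Require Import all_classical all_reals all_analysis.
From mathcomp Require Import measurable_realfun ring lra.
Set Implicit Arguments.
Unset Strict Implicit.
Unset Printing Implicit Defensive.
Import Order.TTheory GRing.Theory Num.Theory.
Import numFieldNormedType.Exports.
Local Open Scope classical_set_scope.
Local Open Scope ring_scope.

(* Write W for the double well and L for the linearized operator, so that -L
   is the form Q(f) = eps^2 int |grad f|^2 + int W''(u) f^2 with
   W''(u) = (u^2 - 1) + 2 u^2.  Truncating u shows |u| <= 1.  The energy is
   convex along sqrt (u^2 + s f^2), so minimality of u gives
   eps^2 int |grad f|^2 + int (u^2 - 1) f^2 >= 0, that is
   Q(f) >= 2 int u^2 f^2.  As u does not vanish, the set where u^2 is small has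
   small volume, and uniform integrability of f^2 for bounded families in H^1
   turns this into coercivity of Q on H^1_0; the Riesz representation theorem
   then inverts L.  Uniform integrability is elementary: in a chart, or next to
   the boundary on a one-sided cylinder over a graph, f at a point is compared
   with its average over a short segment, and the error is controlled by the
   gradient.  The argument works for every eps > 0, so eps0 = 1 will do. *)

(** * Functions of class C^k on Euclidean space *)

Section EuclideanCalculus.
Variable R : realType.

(** The hidden convexity rests on two facts: [|d sqrt (a^2 + b^2)|^2 <= |da|^2 + |db|^2], and [W] is
    a quadratic polynomial in the square of its argument. Second-order information on [u] thus comes
    from comparing energies, without the Euler-Lagrange equation or regularity at the boundary. The
    obstacle is that [H10] is defined through smooth functions whose restrictions to [Y] tend to
    zero, so a competitor must arise from a composition that preserves smoothness. Truncation and
    square root are therefore replaced by expressions in [sqrt (x^2 + y^2 + t^2)], with [t] tied to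
    the parameter of the variation so that its effect is of second order. The form controls only
    [int u^2 f^2], and [u] degenerates at [Y]; coercivity needs that the L^2 mass of [f] does not
    concentrate where [u] is small. Uniform integrability serves here in place of a compact
    embedding. Near [Y] it is proved by sliding the domain into [S] along a coordinate direction
    transversal to [Y], whose lines meet [Y] locally at most once. *)

Lemma is_derive_line m (f : 'rV[R]_m -> R) x v s d :
  is_derive (s *: v + x) v f d -> is_derive s (1 : R) (fun t : R => f (t *: v + x)) d.
Proof.
move=> [df <-].
have E : (fun h : R => h^-1 *: (((fun t : R => f (t *: v + x)) \o shift s) (h *: 1) - f (s *: v + x)))
       = (fun h : R => h^-1 *: ((f \o shift (s *: v + x)) (h *: v) - f (s *: v + x))).
  apply/funext => h /=; congr (_ *: (f _ - _)).
  by rewrite /shift /= [h%:A]mulr1 scalerDl addrA.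
by split; rewrite /derivable /derive E.
Qed.

Lemma is_derive_lineV m (f : 'rV[R]_m -> R) x v s d :
  is_derive s (1 : R) (fun t : R => f (t *: v + x)) d -> is_derive (s *: v + x) v f d.
Proof.
move=> [df <-].
have E : (fun h : R => h^-1 *: (((fun t : R => f (t *: v + x)) \o shift s) (h *: 1) - f (s *: v + x)))
       = (fun h : R => h^-1 *: ((f \o shift (s *: v + x)) (h *: v) - f (s *: v + x))).
  apply/funext => h /=; congr (_ *: (f _ - _)).
  by rewrite /shift /= [h%:A]mulr1 scalerDl addrA.
by move: df; rewrite /derivable /derive E => df; split; rewrite /derivable /derive.
Qed.

Lemma is_derive_chain m (q : 'rV[R]_m -> R) (g : R -> R) x v dq dg :
  is_derive x v q dq -> is_derive (q x) (1 : R) g dg ->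
  is_derive x v (g \o q) (dg * dq).
Proof.
move=> hq hg.
have -> : x = (0 : R) *: v + x by rewrite scale0r add0r.
apply: is_derive_lineV.
apply: (@is_derive1_comp R g (fun t => q (t *: v + x))).
  by rewrite scale0r add0r.
by apply: is_derive_line; rewrite scale0r add0r.
Qed.

Lemma ball_rVP m (x : 'rV[R]_m) (r : R) y : 0 < r ->
  ball x r y <-> (forall j, `|x 0 j - y 0 j| < r).
Proof.
move=> r0; split; first by move=> [_ h] j; exact: h.
by move=> h; split => // i j; rewrite ord1; exact: h.
Qed.

Lemma normr_rV_le m (x : 'rV[R]_m) j : `|x 0 j| <= `|x|.
Proof.
rewrite [leRHS]/Num.norm /= mx_normrE; apply/bigmax_geP; right => /=.
by exists (0, j).
Qed.

Lemma normr_rV_leP m (x : 'rV[R]_m) r : 0 <= r ->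
  (forall j, `|x 0 j| <= r) -> `|x| <= r.
Proof.
move=> r0 h; rewrite [leLHS]/Num.norm /= mx_normrE.
by apply/bigmax_leP; split => //= -[i j] _ /=; rewrite ord1.
Qed.


(** The conditions [|s| <= |t|] and [0 <= s * t] put [s] between 0 and [t] for either sign of [t],
    so one statement serves increments in both directions. *)
Lemma MVT_coord m (f : 'rV[R]_m -> R) (a : 'I_m) (x : 'rV[R]_m) (t : R) :
  (forall s : R, `|s| <= `|t| -> 0 <= s * t ->
    derivable f (s *: delta_mx 0 a + x) (delta_mx 0 a)) ->
  exists2 s : R, `|s| <= `|t| /\ 0 <= s * t &
    f (t *: delta_mx 0 a + x) - f x = partial a f (s *: delta_mx 0 a + x) * t.
Proof.
move=> df; set e := delta_mx 0 a; pose g (s : R) := f (s *: e + x).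
have hd (s : R) : `|s| <= `|t| -> 0 <= s * t ->
    is_derive s 1 g (partial a f (s *: e + x)).
  by move=> s1 s2; have /derivableP := df _ s1 s2; exact: is_derive_line.
have g0 : g 0 = f x by rewrite /g scale0r add0r.
have [t0|t0] := leP 0 t.
  have hd' (s : R) : 0 <= s <= t -> is_derive s 1 g (partial a f (s *: e + x)).
    by move=> /andP[s0 st]; apply: hd; rewrite ?mulr_ge0// !ger0_norm.
  have [||c] := @MVT_segment R g (fun s => partial a f (s *: e + x)) 0 t t0.
  - by move=> s; rewrite in_itv /= => /andP[s0 st]; apply: hd'; rewrite !ltW.
  - by apply: derivable_within_continuous => s; rewrite in_itv /= => /hd'[].
  rewrite in_itv /= subr0 g0 => /andP[c0 ct] E.
  by exists c => //; rewrite !ger0_norm // mulr_ge0.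
have hd' (s : R) : t <= s <= 0 -> is_derive s 1 g (partial a f (s *: e + x)).
  move=> /andP[s0 st]; apply: hd; last by rewrite mulr_le0 // ltW.
  by rewrite (ler0_norm st) (ltr0_norm t0) lerN2.
have [||c] := @MVT_segment R g (fun s => partial a f (s *: e + x)) t 0 (ltW t0).
- by move=> s; rewrite in_itv /= => /andP[s0 st]; apply: hd'; rewrite !ltW.
- by apply: derivable_within_continuous => s; rewrite in_itv /= => /hd'[].
rewrite in_itv /= sub0r g0 => /andP[c0 ct] E.
exists c; last by rewrite -/(g t) -opprB E mulrN opprK.
by rewrite (ler0_norm ct) (ltr0_norm t0) lerN2 mulr_le0 // ltW.
Qed.

(* Telescoping along a path that changes one coordinate at a time; the path
   stays in the ball because balls of the sup norm are cubes. *)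
Lemma increment_partials m (f : 'rV[R]_m -> R) (x0 : 'rV[R]_m) (r : R) y z :
  (forall x a, ball x0 r x -> derivable f x (delta_mx 0 a)) ->
  ball x0 r y -> ball x0 r z ->
  exists xi : 'I_m -> 'rV[R]_m, (forall a, ball x0 r (xi a)) /\
    f z - f y = \sum_(a < m) partial a f (xi a) * (z 0 a - y 0 a).
Proof.
move=> df By Bz; have r0 : 0 < r by case: By.
pose p k := \row_(j < m) (if (j < k)%N then z 0 j else y 0 j).
have Bp (a : 'I_m) (s : R) : `|s| <= `|z 0 a - y 0 a| ->
    0 <= s * (z 0 a - y 0 a) -> ball x0 r (s *: delta_mx 0 a + p a).
  move=> sle s0; apply/ball_rVP => // j; rewrite !mxE.
  move: By Bz => /ball_rVP => /(_ r0) By /ball_rVP => /(_ r0) Bz.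
  rewrite eqxx /=; have [->|ja] := eqVneq j a; last first.
    by rewrite mulr0 add0r; case: ifP.
  rewrite ltnn mulr1.
  move: (By a) (Bz a) sle s0; move: (z 0 a) (y 0 a) (x0 0 a) => za ya xa.
  rewrite !ltr_norml => /andP[h1 h2] /andP[h3 h4] sle s0; apply/andP.
  have [d0|d0] := leP 0 (za - ya).
    move: sle; rewrite (ger0_norm d0) ler_norml => /andP[h5 h6].
    have [s1|s1] := leP 0 s; first by split; lra.
    have : s * (za - ya) = 0 by apply/eqP; rewrite eq_le s0 andbT nmulr_rle0.
    by move/eqP; rewrite mulf_eq0 => /orP[] /eqP ?; split; lra.
  move: sle; rewrite (ltr0_norm d0) ler_norml => /andP[h5 h6].
  have s1 : s <= 0 by move: s0; rewrite nmulr_lge0.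
  by split; lra.
have pE (k : 'I_m) : p k.+1 = (z 0 k - y 0 k) *: delta_mx 0 k + p k.
  apply/rowP => j; rewrite !mxE eqxx /= ltnS leq_eqVlt.
  have [jk|jk] := eqVneq j k; first by rewrite jk !eqxx ltnn /= mulr1 subrK.
  by rewrite -(inj_eq val_inj) in jk; rewrite (negbTE jk) /= mulr0 add0r.
have /fin_all_exists [xi hxi] (a : 'I_m) : exists u, ball x0 r u /\
    f (p a.+1) - f (p a) = partial a f u * (z 0 a - y 0 a).
  have [|s [s1 s2] E] := @MVT_coord m f a (p a) (z 0 a - y 0 a).
    by move=> s s1 s2; apply: df; exact: Bp.
  by exists (s *: delta_mx 0 a + p a); split; [exact: Bp|rewrite pE].
exists xi; split => [a|]; first by have [] := hxi a.
have <- : \sum_(a < m) (f (p a.+1) - f (p a)) =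
    \sum_(a < m) partial a f (xi a) * (z 0 a - y 0 a).
  by apply: eq_bigr => a _; have [] := hxi a.
rewrite -(big_mkord xpredT (fun a => f (p a.+1) - f (p a))).
rewrite telescope_sumr //; congr (f _ - f _); apply/rowP => j; rewrite mxE //.
by rewrite ltn_ord.
Qed.

(** Strict differentiability: both endpoints vary near [x0]. The one-point case gives the
    differential; the two-point case gives the local injectivity behind [hypersurface_graph]. *)
Lemma C1_increment m (D : set 'rV[R]_m) (f : 'rV[R]_m -> R) x0 (e : R) :
  open D -> D x0 -> 0 < e ->
  (forall a x, D x -> derivable f x (delta_mx 0 a)) ->
  (forall a, {for x0, continuous (partial a f)}) ->
  exists2 r, 0 < r & forall y z, ball x0 r y -> ball x0 r z ->
    `|f z - f y - \sum_(a < m) partial a f x0 * (z 0 a - y 0 a)| <= e * `|z - y|.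
Proof.
move=> oD Dx0 e0 df cf.
(* [K] replaces [m] as a divisor, since [m] may be 0. *)
have [K K0 mK] : exists2 K : R, 0 < K & m%:R <= K.
  by exists (m%:R + 1); rewrite ?ltr_wpDl// ?lerDl.
have : nbhs x0 (D `&` [set x | forall a, ball (partial a f x0) (e / K) (partial a f x)]).
  apply: filterI; first exact: open_nbhs_nbhs.
  have : \forall x \near x0, forall a : 'I_m,
      ball (partial a f x0) (e / K) (partial a f x).
    apply: (@filter_forall _ _ (fun a x => ball (partial a f x0) (e / K) (partial a f x)) (nbhs x0) _) => a.
    apply: cf; apply: nbhsx_ballx; exact: divr_gt0.
  by apply: filterS.
move=> /nbhs_ballP[r r0 hr]; exists r => // y z By Bz.
have [|xi [Bxi ->]] := @increment_partials m f x0 r y z _ By Bz.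
  by move=> x a /hr[Dx _]; exact: df.
rewrite -sumrB; apply: le_trans (ler_norm_sum _ _ _) _.
apply: (@le_trans _ _ (\sum_(a < m) (e / K) * `|z - y|)).
  apply: ler_sum => a _; rewrite -mulrBl normrM; apply: ler_pM => //.
    rewrite distrC; apply: ltW; have [_ /(_ a)] := hr _ (Bxi a).
    by rewrite -ball_normE.
  by have := normr_rV_le (z - y) a; rewrite !mxE.
rewrite sumr_const card_ord -mulr_natl mulrA ler_wpM2r// mulrCA ger_pMr//.
by rewrite ler_pdivrMr // mul1r.
Qed.

Lemma cvg_bigsum T (F : set_system T) {FF : Filter F} (I : Type) (r : seq I)
    (f : I -> T -> R) (l : I -> R) :
  (forall i, f i x @[x --> F] --> l i) ->
  (\sum_(i <- r) f i x) @[x --> F] --> \sum_(i <- r) l i.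
Proof.
move=> h; elim: r => [|i r IH].
  by rewrite big_nil; under eq_fun do rewrite big_nil; exact: cvg_cst.
by rewrite big_cons; under eq_fun do rewrite big_cons; exact: cvgD.
Qed.

Lemma differentiable_of_littleo (V W : normedModType R) (f : V -> W)
    (df : {linear V -> W}) x : continuous df ->
  (forall e, 0 < e -> \forall h \near (0 : V),
     `|f (h + x) - f x - df h| <= e * `|h|) ->
  differentiable f x /\ 'd f x = df :> (V -> W).
Proof.
move=> cdf hdf.
have H : f \o shift x = cst (f x) + df +o_ 0 id.
  apply/eqaddoP => e e0; near=> h; rewrite fctE /cst /= opprD addrA.
  by near: h; exact: hdf.
have E : 'd f x = df :> (_ -> _) by exact: diff_unique.
by split => //; apply/diff_locallyP; rewrite E.
Unshelve. all: by end_near. Qed.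

Definition rVdot m (c v : 'rV[R]_m) : R := \sum_(a < m) c 0 a * v 0 a.

Fact rVdot_is_linear m (c : 'rV[R]_m) : linear (rVdot c).
Proof.
move=> k u v; rewrite /rVdot scaler_sumr -big_split /=; apply: eq_bigr => a _.
by rewrite !mxE mulrDr scalerAr.
Qed.
HB.instance Definition _ m (c : 'rV[R]_m) :=
  GRing.isLinear.Build R 'rV[R]_m R _ (rVdot c) (@rVdot_is_linear m c).

Lemma rVdot_continuous m (c : 'rV[R]_m) : continuous (rVdot c).
Proof.
move=> x; apply: (@cvg_bigsum _ (nbhs x) _ _ _ (fun a v => c 0 a * v 0 a)) => a.
apply: cvgM; first exact: cvg_cst.
exact: coord_continuous.
Qed.

Lemma C1_differentiable m (D : set 'rV[R]_m) (f : 'rV[R]_m -> R) x0 :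
  open D -> D x0 -> (forall a x, D x -> derivable f x (delta_mx 0 a)) ->
  (forall a, {for x0, continuous (partial a f)}) ->
  differentiable f x0 /\
  forall v, 'd f x0 v = \sum_(a < m) partial a f x0 * v 0 a.
Proof.
move=> oD Dx0 df cf; pose c := \row_a partial a f x0.
have [|df1 E] := @differentiable_of_littleo _ _ f (rVdot c) x0 (@rVdot_continuous m c).
  move=> e e0; have [r r0 hr] := C1_increment oD Dx0 e0 df cf.
  apply/nbhs_ballP; exists r => // h /=; rewrite -ball_normE /= sub0r normrN => hr'.
  have := hr x0 (h + x0); rewrite addrK.
  have -> : \sum_(a < m) partial a f x0 * ((h + x0) 0 a - x0 0 a) = rVdot c h.
    by apply: eq_bigr => a _; rewrite !mxE addrK.
  apply; first exact: ballxx.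
  by rewrite -ball_normE /= opprD addrCA subrr addr0 normrN.
by split => // v; rewrite E /rVdot; apply: eq_bigr => a _; rewrite mxE.
Qed.

Local Notation Ck := (of_class (@continuous_in R _)).

Lemma Ck1P m (D : set 'rV[R]_m) f : Ck 1 D f ->
  (forall a x, D x -> derivable f x (delta_mx 0 a)) /\
  (forall a x, D x -> {for x, continuous (partial a f)}).
Proof. by move=> h; split => a x Dx; have [h1 h2] := h a; [exact: h1|exact: h2]. Qed.

Lemma Ck1_differentiable m (D : set 'rV[R]_m) f x : open D -> Ck 1 D f -> D x ->
  differentiable f x /\ forall v, 'd f x v = \sum_(a < m) partial a f x * v 0 a.
Proof.
move=> oD /Ck1P[h1 h2] Dx; apply: (C1_differentiable oD Dx h1) => a; exact: h2.
Qed.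

Lemma CkW m k (D : set 'rV[R]_m) f : open D -> Ck k.+1 D f -> Ck k D f.
Proof.
move=> oD; elim: k f => [|k IH] f.
  by move=> h x Dx; apply: differentiable_continuous; have [] := Ck1_differentiable oD h Dx.
by move=> h a; have [h1 h2] := h a; split => //; exact: IH.
Qed.

Lemma Ck_le m k l (D : set 'rV[R]_m) f : (k <= l)%N -> open D -> Ck l D f -> Ck k D f.
Proof.
move=> kl oD; rewrite -(subnK kl); elim: (l - k)%N => // j IH h; apply: IH.
by apply: CkW; rewrite // -addSn.
Qed.

Lemma Ck_eq m k (D : set 'rV[R]_m) f g : open D -> (forall x, D x -> f x = g x) ->
  Ck k D f -> Ck k D g.
Proof.
move=> oD; elim: k f g => [|k IH] f g /= fg h.
  move=> x Dx; have nfg : \forall y \near x, f y = g y.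
    by apply: filterS (open_nbhs_nbhs (conj oD Dx)).
  rewrite /prop_for /continuous_at -(fg _ Dx).
  apply: cvg_trans (h _ Dx); apply: (@near_eq_cvg _ _ (nbhs x)).
  by apply: filterS nfg => y ->.
move=> a; have [h1 h2] := h a.
have nfg x : D x -> \forall y \near x, f y = g y.
  by move=> Dx; apply: filterS (open_nbhs_nbhs (conj oD Dx)).
split; first by move=> x Dx; apply: near_eq_derivable (h1 _ Dx); exact: nfg.
apply: IH h2 => x Dx; apply: near_eq_derive; exact: nfg.
Qed.

Lemma Ck_local m k (D : set 'rV[R]_m) f :
  (forall x, D x -> exists2 U, U x & Ck k U f) -> Ck k D f.
Proof.
elim: k f => [|k IH] f /= h.
  by move=> x Dx; have [U Ux] := h _ Dx; exact.
move=> a; split; first by move=> x Dx; have [U Ux hU] := h _ Dx; have [h1 _] := hU a; exact: h1.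
by apply: IH => x Dx; have [U Ux hU] := h _ Dx; exists U => //; have [] := hU a.
Qed.

Lemma Ck_der m k (D : set 'rV[R]_m) (f : 'rV[R]_m -> R) (g : 'I_m -> 'rV[R]_m -> R) :
  open D ->
  (forall a x, D x -> is_derive x (delta_mx 0 a) f (g a x)) ->
  (forall a, Ck k D (g a)) -> Ck k.+1 D f.
Proof.
move=> oD df Cg a; split; first by move=> x Dx; have [] := df a x Dx.
by apply: Ck_eq (Cg a) => // x Dx; have [_ <-] := df a x Dx.
Qed.

Lemma Ck_is_derive m k (D : set 'rV[R]_m) f a x : Ck k.+1 D f -> D x ->
  is_derive x (delta_mx 0 a) f (partial a f x).
Proof. by move=> h Dx; have [h1 _] := h a; apply/derivableP; exact: h1. Qed.

Lemma Ck_partial m k (D : set 'rV[R]_m) f a : Ck k.+1 D f -> Ck k D (partial a f).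
Proof. by move=> h; have [] := h a. Qed.

Lemma Ck_cst m k (D : set 'rV[R]_m) (c : R) : open D -> Ck k D (fun=> c).
Proof.
move=> oD; elim: k c => [|k IH] c; first by move=> x _; exact: cst_continuous.
by apply: (@Ck_der _ _ _ _ (fun _ _ => 0)) => // a x Dx; exact: is_derive_cst.
Qed.

Lemma CkD m k (D : set 'rV[R]_m) f g : open D -> Ck k D f -> Ck k D g ->
  Ck k D (fun x => f x + g x).
Proof.
move=> oD; elim: k f g => [|k IH] f g hf hg.
  by move=> x Dx; exact: (continuousD (hf _ Dx) (hg _ Dx)).
apply: (@Ck_der _ _ _ _ (fun a x => partial a f x + partial a g x)) => //.
  move=> a x Dx; apply: (@is_deriveD _ _ _ f g); exact: Ck_is_derive Dx.
by move=> a; apply: IH; exact: Ck_partial.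
Qed.

Lemma CkM m k (D : set 'rV[R]_m) f g : open D -> Ck k D f -> Ck k D g ->
  Ck k D (fun x => f x * g x).
Proof.
move=> oD; elim: k f g => [|k IH] f g hf hg.
  by move=> x Dx; exact: (continuousM (hf _ Dx) (hg _ Dx)).
apply: (@Ck_der _ _ _ _ (fun a x => f x * partial a g x + g x * partial a f x)) => //.
  move=> a x Dx; apply: (@is_deriveM _ _ f g); exact: Ck_is_derive Dx.
by move=> a; apply: CkD => //; apply: IH; by [exact: Ck_partial|exact: CkW].
Qed.

Lemma CkZ m k (D : set 'rV[R]_m) c f : open D -> Ck k D f -> Ck k D (fun x => c * f x).
Proof. by move=> oD hf; apply: CkM => //; exact: Ck_cst. Qed.

Lemma Ck_prod m k (D : set 'rV[R]_m) (I : Type) (r : seq I) (F : I -> 'rV[R]_m -> R) :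
  open D -> (forall i, Ck k D (F i)) -> Ck k D (fun x => \prod_(i <- r) F i x).
Proof.
move=> oD hF; elim: r => [|i r IH].
  by apply: (Ck_eq (f := fun=> 1)) => // [x _|]; [rewrite big_nil|exact: Ck_cst].
by apply: (Ck_eq (f := fun x => F i x * \prod_(i <- r) F i x)) => // [x _|];
  [rewrite big_cons|exact: CkM].
Qed.

(* Closure under composition with a family of functions on the line that is
   stable under differentiation up to linear combinations. *)
Lemma Ck_comp_invsqrt m k (D : set 'rV[R]_m) q : open D ->
  (forall x, D x -> 0 <= q x) -> Ck k D q ->
  Ck k D (fun x => (Num.sqrt (1 + q x))^-1).
Proof.
move=> oD q0; pose rho (t : R) := (Num.sqrt (1 + t))^-1.
have drho (t : R) : 0 <= t -> is_derive t 1 rho (- 2^-1 * rho t ^+ 3).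
  move=> t0; have p : 0 < 1 + t by rewrite ltr_wpDr.
  have sp : 0 < Num.sqrt (1 + t) by rewrite sqrtr_gt0.
  rewrite /rho; apply: is_derive_eq.
    apply: is_deriveV; first by rewrite gt_eqF.
    apply: (@is_derive1_comp _ Num.sqrt (fun t => 1 + t)); first exact: is_derive1_sqrt.
  by rewrite add0r mulr1 /GRing.scale /=; field; rewrite gt_eqF.
elim: k => [|k IH] Cq.
  move=> x Dx; apply: (@continuous_comp _ _ _ q rho); first exact: Cq.
  apply: differentiable_continuous; apply/derivable1_diffP.
  by have [] := drho _ (q0 _ Dx).
have Cr : Ck k D (fun x => rho (q x)) by apply: IH; exact: CkW.
apply: (@Ck_der _ _ _ _ (fun a x => - 2^-1 * rho (q x) ^+ 3 * partial a q x)) => //.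
  move=> a x Dx; apply: (is_derive_chain (g := rho)); first exact: Ck_is_derive Dx.
  by apply: drho; exact: q0.
move=> a; apply: CkM => //; last exact: Ck_partial.
apply: CkZ => //; apply: (Ck_eq (f := fun x => rho (q x) * (rho (q x) * rho (q x)))) => //.
by apply: CkM => //; exact: CkM.
Qed.

(** The functions [x^-j exp(-1/x)], extended by 0 to [x <= 0]. The whole family is needed because
    differentiation moves [j] to [j + 1] and [j + 2]. *)
Definition flat_exp (j : nat) (x : R) : R :=
  if 0 < x then x^-1 ^+ j * expR (- x^-1) else 0.

Lemma flat_exp_ge0 j x : 0 <= flat_exp j x.
Proof.
rewrite /flat_exp; case: ifPn => // x0; rewrite mulr_ge0 ?expR_ge0// exprn_ge0//.
by rewrite invr_ge0 ltW.
Qed.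

(** With [y = 1/x] and [n = j + 2], the bound [exp y >= (y/n)^n] follows from [exp z >= 1 + z]; the
    two surplus powers leave [x^2]. A quadratic bound yields a zero derivative at the origin. *)
Lemma flat_exp_bound j : exists2 c : R, 0 < c & forall x, flat_exp j x <= c * x ^+ 2.
Proof.
set n := j.+2; exists (n%:R ^+ n) => [|x]; first by rewrite exprn_gt0// ltr0n.
rewrite /flat_exp; case: ifPn => [x0|_]; last first.
  by rewrite mulr_ge0 ?sqr_ge0 ?exprn_ge0.
have n0 : (0 : R) < n%:R by rewrite ltr0n.
have y0 : 0 < x^-1 by rewrite invr_gt0.
set y := x^-1 in y0 *; have -> : x = y^-1 by rewrite /y invrK.
have h : (y / n%:R) ^+ n <= expR y.
  have -> : expR y = expR (y / n%:R) ^+ n.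
    by rewrite -expRM_natl; congr expR; rewrite mulrC divfK// gt_eqF.
  rewrite lerXn2r// ?nnegrE ?expR_ge0 ?divr_ge0 ?ltW//.
  by apply: lt_le_trans (expR_ge1Dx _); rewrite ltrDr.
rewrite expRN ler_pdivrMr ?expR_gt0//.
have aux (N z : R) : 0 < N -> 0 < z -> z ^+ j = N ^+ n * z^-1 ^+ 2 * (z / N) ^+ n.
  move=> N0 z0; rewrite expr_div_n /n !exprS; field.
  by rewrite !gt_eqF ?exprn_gt0.
rewrite (aux n%:R y)//.
by rewrite ler_wpM2l// mulr_ge0 ?sqr_ge0 ?exprn_ge0.
Qed.

Lemma is_derive_flat_exp j x :
  is_derive x (1 : R) (flat_exp j) (flat_exp j.+2 x - j%:R * flat_exp j.+1 x).
Proof.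
have [x0|x0|->] := ltgtP x 0.
- have nx : \forall y \near x, y < 0 by exact: lt_nbhsl.
  apply: (near_eq_is_derive (f := cst 0)).
    by apply: filterS nx => y y0; rewrite /flat_exp ltNge ltW.
  rewrite {1 2}/flat_exp ltNge (ltW x0) /= mulr0 subr0; exact: is_derive_cst.
- have nx : \forall y \near x, 0 < y by exact: lt_nbhsr.
  apply: (@near_eq_is_derive _ _ _ (fun y : R => y^-1 ^+ j * expR (- y^-1)) (flat_exp j)).
    by apply: filterS nx => y y0; rewrite /flat_exp y0.
  rewrite {1 2}/flat_exp x0.
  have hV : is_derive x (1 : R) (fun y : R => y^-1) (- x^-1 ^+ 2).
    have h := @is_deriveV R id x 1 1 _ (is_derive_id _ _).
    by apply: is_derive_eq (h _) _; rewrite ?gt_eqF// [_ *: _]mulr1 exprVn.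
  have hE : is_derive x (1 : R) (fun y : R => expR (- y^-1)) (expR (- x^-1) * x^-1 ^+ 2).
    apply: is_derive1_comp.
    by apply: is_derive_eq (is_deriveN hV) _; rewrite opprK.
  have hX := @is_deriveX R _ (fun y : R => y^-1) j x 1 _ hV.
  have -> : (fun y : R => y^-1 ^+ j * expR (- y^-1)) =
      ((fun y : R => y^-1) ^+ j * (fun y => expR (- y^-1))).
    by apply/funext => y; rewrite mulrfctE exprfctE.
  apply: is_derive_eq (is_deriveM hX hE) _.
  rewrite exprfctE /GRing.scale /=; case: j {hX} => [|j].
    by rewrite !mul0r !mulr0 addr0 !expr0 mul1r subr0 mulrC.
  by rewrite !exprS /=; move: (x^-1) (expR _) => X EE; ring.
have [c c0 hc] := flat_exp_bound j.
have g0 k : flat_exp k 0 = 0 by rewrite /flat_exp ltxx.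
rewrite !g0 mulr0 subr0.
have H : (fun h : R => h^-1 *: ((flat_exp j \o shift 0) (h *: 1) - flat_exp j 0)) @ 0^' --> (0 : R).
  apply/cvgrPdist_le => e e0; near=> h.
  rewrite sub0r normrN g0 subr0 /= /shift /= addr0 [h%:A]mulr1 normrM normfV.
  have h0 : h != 0 by near: h; exact: nbhs_dnbhs_neq.
  rewrite ler_pdivrMl ?normr_gt0// ger0_norm ?flat_exp_ge0//.
  apply: le_trans (hc h) _; rewrite -real_normK ?num_real// expr2 mulrCA.
  apply: ler_wpM2l => //; rewrite -ler_pdivlMl// mulrC.
  have : `|0 - h| <= e / c; last by rewrite sub0r normrN.
  near: h; apply: nbhs_dnbhs; apply/nbhs_ballP.
  exists (e / c) => [|y]; first exact: divr_gt0.
  by rewrite /= -ball_normE /= => /ltW.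
split; first by apply/cvg_ex; exists 0.
exact/cvg_lim.
Unshelve. all: by end_near. Qed.

Lemma Ck_comp_flat_exp m k (D : set 'rV[R]_m) q j : open D -> Ck k D q ->
  Ck k D (fun x => flat_exp j (q x)).
Proof.
move=> oD; elim: k j => [|k IH] j Cq.
  move=> x Dx; apply: (@continuous_comp _ _ _ q (flat_exp j)); first exact: Cq.
  apply: differentiable_continuous; apply/derivable1_diffP.
  by have [] := is_derive_flat_exp j (q x).
apply: (@Ck_der _ _ _ _ (fun a x => (flat_exp j.+2 (q x) - j%:R * flat_exp j.+1 (q x))
   * partial a q x)) => //.
  move=> a x Dx; apply: (is_derive_chain (g := flat_exp j)); first exact: Ck_is_derive Dx.
  exact: is_derive_flat_exp.
have Cq' := CkW oD Cq.
move=> a; apply: CkM => //; last exact: Ck_partial.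
apply: (Ck_eq (f := fun x => flat_exp j.+2 (q x) + - j%:R * flat_exp j.+1 (q x))) => //.
  by move=> x _; rewrite mulNr.
by apply: CkD => //; [exact: IH|apply: CkZ => //; exact: IH].
Qed.

Lemma flat_exp0_le1 x : flat_exp 0 x <= 1.
Proof.
rewrite /flat_exp; case: ifPn => // x0; rewrite expr0 mul1r -[leRHS]expR0 ler_expR.
by rewrite oppr_le0 invr_ge0 ltW.
Qed.

Lemma flat_exp0_gt0 x : (flat_exp 0 x != 0) = (0 < x).
Proof.
by rewrite /flat_exp; case: ifPn => // x0; rewrite ?eqxx// expr0 mul1r gt_eqF// expR_gt0.
Qed.

(** For [x > 0] the exponent [-1/((k+1) x)] tends to 0, so the rescaled flat functions approximate
    the indicator of the positive axis; this is the profile of the bumps below. *)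
Lemma flat_exp0_cvg x : flat_exp 0 (k.+1%:R * x) @[k --> \oo] --> ((0 < x)%R%:R : R).
Proof.
have [x0|x0] := ltP 0 x; last first.
  rewrite (_ : (fun _ => _) = cst 0); first exact: cvg_cst.
  by apply/funext => k; rewrite /flat_exp pmulr_rgt0// ltNge x0.
rewrite (_ : (fun _ => _) = fun k : nat => expR (- (x^-1 * k.+1%:R^-1))); last first.
  by apply/funext => k; rewrite /flat_exp pmulr_rgt0// x0 expr0 mul1r invfM mulrC.
rewrite -[1%:R]expR0; apply: continuous_cvg; first exact: continuous_expR.
rewrite -oppr0; apply: cvgN; rewrite -(mulr0 x^-1).
by apply: cvgM; [exact: cvg_cst|exact: cvg_harmonic].
Qed.

Lemma Ck1_differentiable_rV m p (D : set 'rV[R]_m) (T : 'rV[R]_m -> 'rV[R]_p) x :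
  open D -> (forall b, Ck 1 D (fun y => T y 0 b)) -> D x ->
  differentiable T x /\
  forall a b, jacobian T x a b = partial a (fun y => T y 0 b) x.
Proof.
move=> oD CT Dx.
have dT : differentiable T x.
  have -> : T = \sum_(b < p) (fun y => T y 0 b *: (delta_mx 0 b : 'rV[R]_p)).
    apply/funext => y; rewrite fct_sumE; exact: row_sum_delta.
  apply: differentiable_sum => b; apply: differentiableZl.
  by have [] := Ck1_differentiable oD (CT b) Dx.
split=> // a b; rewrite /jacobian mxE -deriveE//.
rewrite derive_mx; last exact: diff_derivable.
by rewrite mxE.
Qed.

Lemma Ck1_chain m p (D : set 'rV[R]_m) (E : set 'rV[R]_p) (T : 'rV[R]_m -> 'rV[R]_p)
    (f : 'rV[R]_p -> R) x a :
  open D -> (forall b, Ck 1 D (fun y => T y 0 b)) -> D x ->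
  open E -> Ck 1 E f -> E (T x) ->
  partial a (f \o T) x = \sum_(b < p) partial b f (T x) * jacobian T x a b.
Proof.
move=> oD CT Dx oE Cf ETx; have [dT _] := Ck1_differentiable_rV oD CT Dx.
have [df E1] := Ck1_differentiable oE Cf ETx.
rewrite /partial deriveE; last exact: differentiable_comp.
rewrite diff_comp //= E1; apply: eq_bigr => b _; congr (_ * _).
by rewrite /jacobian mxE.
Qed.

End EuclideanCalculus.

(** * Borel measurability in topological and coordinate spaces *)

Section BorelSpaces.
Variable R : realType.

Definition bor (X : ptopologicalType) := g_sigma_algebraType (@open X).

Lemma open_bor (X : ptopologicalType) (A : set X) : open A -> measurable (A : set (bor X)).
Proof. by move=> oA; apply: sub_sigma_algebra. Qed.

Lemma closed_bor (X : ptopologicalType) (A : set X) : closed A -> measurable (A : set (bor X)).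
Proof.
by move=> cA; rewrite -(setCK A); apply: measurableC; apply: open_bor; exact: closed_openC.
Qed.

Lemma open_preimage (X Y : ptopologicalType) (D : set X) (f : X -> Y) (U : set Y) :
  open D -> (forall x, D x -> {for x, continuous f}) -> open U -> open (D `&` f @^-1` U).
Proof.
move=> oD cf oU; rewrite openE => x [Dx fU]; apply: filterI; first exact: open_nbhs_nbhs.
by apply: (cf _ Dx); exact: open_nbhs_nbhs.
Qed.

Lemma continuous_measurable_real (X : ptopologicalType) (D : set X) (f : X -> R) :
  open D -> (forall x, D x -> {for x, continuous f}) ->
  measurable_fun (D : set (bor X)) (f : bor X -> R).
Proof.
move=> oD cf; apply: (measurability _ (RGenOpens.measurableE R)).
by move=> _ [_ [a [b ->]] <-]; apply: open_bor; apply: open_preimage => //; exact: interval_open.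
Qed.

Lemma continuous_measurable_bor (X Y : ptopologicalType) (D : set X) (f : X -> Y) :
  open D -> (forall x, D x -> {for x, continuous f}) ->
  measurable_fun (D : set (bor X)) (f : bor X -> bor Y).
Proof.
move=> oD cf; apply: (@measurability _ _ (bor X) (bor Y) D f (@open Y)) => //.
by move=> _ [U oU <-]; apply: open_bor; exact: open_preimage.
Qed.

(* A countable family of cubes fine enough to fit between any point and any
   of its neighbourhoods. *)
Lemma countable_cubes m : exists (c : nat -> 'rV[R]_m) (r : nat -> R),
  (forall k, 0 < r k) /\
  forall U x, open U -> U x -> exists k, ball (c k) (r k) x /\ ball (c k) (2 * r k) `<=` U.
Proof.
pose d (k : nat) : 'rV[rat]_m * nat := odflt (0, 0%N) (unpickle k).
exists (fun k => map_mx ratr (d k).1), (fun k => (d k).2.+1%:R^-1).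
split=> [k|U x oU Ux]; first by rewrite invr_gt0.
have /nbhs_ballP[e e0 xeU] : nbhs x U by exact: open_nbhs_nbhs.
(* A point of the doubled cube is at most three radii from [x]: one to the centre and two from
   it. *)
have [n hn] : exists n : nat, (n.+1%:R^-1 : R) < e / 3.
  have [n _ /(_ _ (leqnn _))] := near_infty_natSinv_lt (PosNum (divr_gt0 e0 (ltr0Sn R 2))).
  by exists n.
have n0 : 0 < (n.+1%:R^-1 : R) by rewrite invr_gt0.
have /fin_all_exists [q hq] (j : 'I_m) : exists q : rat, `|ratr q - x 0 j| < (n.+1%:R^-1 : R).
  have [|q] := @rat_in_itvoo R (x 0 j - n.+1%:R^-1) (x 0 j + n.+1%:R^-1).
    by rewrite ltrD2l gtrN.
  by rewrite in_itv /= => /andP[h1 h2]; exists q; rewrite ltr_distl h1 h2.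
exists (pickle (\row_j q j, n)); rewrite /d pickleK /=; split.
  by apply/ball_rVP => // j; rewrite !mxE.
move=> y /ball_rVP hy; apply: xeU; apply/ball_rVP => // j.
have := hy (mulr_gt0 (ltr0Sn R 1) n0) j; rewrite !mxE; have := hq j.
move: (n.+1%:R^-1 : R) hn (ratr (q j) : R) => nn hn qj.
rewrite !ltr_norml => /andP[h1 h2] /andP[h3 h4].
by apply/andP; split; lra.
Qed.

(** An open set is a countable union of cubes, and the preimage of a cube is a finite intersection
    of preimages of intervals; hence measurability of the coordinates suffices. *)
Lemma measurable_rV d (T : measurableType d) m (D : set T) (F : T -> 'rV[R]_m) :
  measurable D -> (forall j, measurable_fun D (fun t => F t 0 j)) ->
  measurable_fun D (F : T -> bor 'rV[R]_m).
Proof.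
move=> mD mF; apply: (@measurability _ _ T (bor 'rV[R]_m) D F (@open 'rV[R]_m)) => //.
move=> _ [U oU <-]; have [c [r [r0 hc]]] := countable_cubes m.
have -> : D `&` F @^-1` U = \bigcup_(k in [set k | ball (c k) (r k) `<=` U])
    (D `&` F @^-1` ball (c k) (r k)).
  apply/seteqP; split => [t [Dt /= FU]|t [k kU [Dt /kU]]//].
  have [k [k1 k2]] := hc _ _ oU FU; exists k => //=.
  apply: subset_trans k2; apply: le_ball.
  by have := r0 k; move=> ?; lra.
rewrite bigcup_mkcond; apply: bigcupT_measurable => k; case: ifPn => // _.
have -> : D `&` F @^-1` ball (c k) (r k) =
    \bigcap_(j in [set: 'I_m]) (D `&` (fun t => F t 0 j) @^-1` `]c k 0 j - r k, c k 0 j + r k[) `&` D.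
  apply/seteqP; split => [t [Dt /= /ball_rVP h]|t [h Dt]].
    split => // j _; split => //=; have := h (r0 k) j.
    by rewrite in_itv /= ltr_norml => /andP[h1 h2]; apply/andP; split; lra.
  split => //=; apply/ball_rVP => // j; have [//|_ /=] := h j.
  by rewrite in_itv /= ltr_norml => /andP[h1 h2]; apply/andP; split; lra.
apply: measurableI => //; apply: fin_bigcap_measurable => // j _.
by apply: mF => //; exact: measurable_itv.
Qed.

Lemma measurable_coord m (D : set 'rV[R]_m) j : measurable (D : set (bor 'rV[R]_m)) ->
  measurable_fun (D : set (bor 'rV[R]_m)) (fun x : bor 'rV[R]_m => x 0 j).
Proof.
move=> mD; apply: (@measurable_funS _ _ _ _ setT) => //.
by apply: continuous_measurable_real => [|x _]; [exact: openT|exact: coord_continuous].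
Qed.

End BorelSpaces.

(** * Lebesgue measure on coordinate spaces *)

Section LebesgueMeasure.
Variable R : realType.
Local Notation borV m := (bor 'rV[R]_m).

Section SigmaFiniteCopy.
Context d (T : measurableType d) (mu : {measure set T -> \bar R}).
Hypothesis sf : sigma_finite setT mu.

(** Tonelli's theorem takes a bundled sigma-finite measure; the copy attaches that structure to a
    measure whose sigma-finiteness is a hypothesis. *)
Definition sigma_finite_copy of sigma_finite setT mu := (mu : set T -> \bar R).
HB.instance Definition _ := Measure.copy (sigma_finite_copy sf) mu.
HB.instance Definition _ := Measure_isSigmaFinite.Build _ _ _ (sigma_finite_copy sf) sf.

Lemma sigma_finite_measureP :
  exists nu : {sigma_finite_measure set T -> \bar R}, forall A, nu A = mu A.
Proof. by exists (sigma_finite_copy sf). Qed.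

End SigmaFiniteCopy.

Definition row_cons m (ty : measurableTypeR R * borV m) : borV m.+1 :=
  row_mx (const_mx ty.1 : 'rV_1) ty.2.

Lemma row_consl m (ty : measurableTypeR R * borV m) :
  row_cons ty 0 (lshift m (ord0 : 'I_1)) = ty.1.
Proof.
have := row_mxEl (const_mx ty.1 : 'rV[R]_1) (ty.2 : 'rV[R]_m) 0 ord0.
by rewrite [X in _ = X -> _]mxE.
Qed.

Lemma row_consr m (ty : measurableTypeR R * borV m) j :
  row_cons ty 0 (rshift 1 j) = ty.2 0 j.
Proof. exact: (row_mxEr (const_mx ty.1 : 'rV[R]_1) (ty.2 : 'rV[R]_m)). Qed.

Lemma measurable_row_cons m : measurable_fun setT (@row_cons m).
Proof.
apply: measurable_rV => // j.
case: (split_ordP (j : 'I_(1 + m))) => k ->.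
  rewrite (ord1 k) (_ : (fun t => _) = fst); first exact: measurable_fst.
  by apply/funext => t; rewrite row_consl.
rewrite (_ : (fun t => _) = (fun y : borV m => y 0 k) \o snd); last first.
  by apply/funext => t; rewrite row_consr.
by apply: (@measurableT_comp _ _ _ _ _ _ (fun y : borV m => y 0 k));
  [exact: measurable_coord|exact: measurable_snd].
Qed.

Lemma ball0_bigcup m : \bigcup_(k : nat) ball (0%R : 'rV[R]_m) k.+1%:R = setT.
Proof.
apply/seteqP; split => // x _; exists (Num.truncn `|x|) => //.
by rewrite -ball_normE /= sub0r normrN truncnS_gt.
Qed.

(** [lebesgue_int] is only an iterated integral. The measure behind it is built by induction: the
    Dirac measure at the single point of dimension 0, then the image under [row_cons] of the product
    of the line with the previous measure, where Tonelli's theorem identifies the integrals.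
    Finiteness on balls supplies the sigma-finiteness needed for the next product. *)
Lemma lebesgue_rV_exists m :
  exists mu : {sigma_finite_measure set (borV m) -> \bar R},
    (forall F : borV m -> \bar R, measurable_fun setT F -> (forall x, 0 <= F x)%E ->
       lebesgue_int F = (\int[mu]_x F x)%E) /\
    forall r, (mu (ball (0%R : 'rV[R]_m) r) < +oo)%E.
Proof.
elim: m => [|m [mu [IH mufin]]].
  have [|nu hnu] := @sigma_finite_measureP _ (borV 0) (@dirac _ (borV 0) 0 R : {measure set (borV 0) -> \bar R}).
    exists (fun=> setT) => [|i]; first by rewrite bigcup_const.
    split; first exact: measurableT.
    by rewrite [X in (X < _)%E]diracE ltry.
  exists nu; split=> [F mF F0|r]; last first.
    by rewrite hnu [X in (X < _)%E]diracE ltry.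
  rewrite (eq_measure_integral (@dirac _ (borV 0) 0 R)); last by move=> A mA _; exact: hnu.
  by rewrite integral_dirac// diracT mul1e.
pose P : {measure set (measurableTypeR R * borV m) -> \bar R} := (lebesgue_measure \x mu)%E.
pose nu0 : {measure set (borV m.+1) -> \bar R} :=
  measure_function_pushforward__canonical__measure_function_Measure P
    (@measurable_row_cons m).
have PE (A : set (measurableTypeR R)) (B : set (borV m)) : measurable A -> measurable B ->
    P (A `*` B) = (lebesgue_measure A * mu B)%E.
  by move=> mA mB; exact: product_measure1E.
have nu0E A : nu0 A = P (@row_cons m @^-1` A) by [].
have nufin r : (nu0 (ball (0%R : 'rV[R]_m.+1) r) < +oo)%E.
  have [r0|r0] := ltP 0 r; last first.
    have -> : ball (0%R : 'rV[R]_m.+1) r = set0.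
      by apply/seteqP; split => // x [r1 _]; move: r0; rewrite leNgt r1.
    by rewrite measure0 ltry.
  apply: (@le_lt_trans _ _ (P (`]- r, r[%classic `*` ball (0%R : 'rV[R]_m) r))).
    rewrite nu0E; apply: le_measure; rewrite ?inE.
    - rewrite -[X in measurable X]setTI; apply: measurable_row_cons => //.
      by apply: open_bor; exact: ball_open.
    - by apply: measurableX => //; apply: open_bor; exact: ball_open.
    - move=> [t y] /= /ball_rVP => /(_ r0) h; split.
        have := h (lshift m (ord0 : 'I_1)); rewrite row_consl mxE sub0r normrN /=.
        by rewrite in_itv /= -ltr_norml.
      apply/ball_rVP => // j; have := h (rshift 1 j).
      by rewrite row_consr !mxE.
  rewrite PE//; last by apply: open_bor; exact: ball_open.
  rewrite lte_mul_pinfty//.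
  by rewrite lebesgue_measure_itv /=; case: ifPn.
have [|nu hnu] := @sigma_finite_measureP _ _ nu0.
  exists (fun k => ball (0%R : 'rV[R]_m.+1) k.+1%:R); first by rewrite ball0_bigcup.
  by move=> k; split; [apply: open_bor; exact: ball_open|exact: nufin].
exists nu; split=> [F mF F0|r]; last by rewrite hnu.
rewrite (eq_measure_integral nu0); last by move=> A mA _; exact: hnu.
pose H (ty : measurableTypeR R * borV m) := F (row_cons ty).
have mH : measurable_fun setT H := measurableT_comp mF (@measurable_row_cons m).
rewrite (ge0_integral_pushforward (@measurable_row_cons m))//.
rewrite -[RHS]/(\int[(lebesgue_measure \x mu)%E]_x H x)%E fubini_tonelli1//=; last by move=> x; exact: F0.
apply: eq_integral => t _; rewrite /fubini_F -IH//; last by move=> x; exact: F0.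
exact: measurableT_comp mH _.
Qed.

(** The image of the measure under translation agrees with it on half-open intervals, and these
    values determine Lebesgue measure. *)
Lemma lebesgue_translate (G : measurableTypeR R -> \bar R) (c : R) :
  measurable_fun setT G -> (forall t, 0 <= G t)%E ->
  (\int[lebesgue_measure]_t G (t + c)%R = \int[lebesgue_measure]_t G t)%E.
Proof.
move=> mG G0.
have mc : measurable_fun setT ((fun t : R => t + c) : measurableTypeR R -> measurableTypeR R).
  by apply: measurable_funD => //; exact: measurable_id.
rewrite -[LHS](@ge0_integral_pushforward _ _ _ _ _ _ mc lebesgue_measure setT)//.
apply: eq_measure_integral => A mA _; apply/esym.
apply: (@lebesgue_measure_unique _ (measure_function_pushforward__canonical__measure_function_Measure lebesgue_measure mc)) => //= _ [[a b]] _ <-.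
rewrite /pushforward.
have -> : (fun t : R => t + c) @^-1` [set` Interval (BRight a) (BRight b)] =
    [set` Interval (BRight (a - c)) (BRight (b - c))].
  by apply/seteqP; split => t /=; rewrite !in_itv /= ltrBlDr lerBrDr.
rewrite !lebesgue_measure_itv /= !lte_fin ltrD2r; case: ifPn => // _.
by rewrite -!EFinD; congr (_%:E); ring.
Qed.

Lemma lebesgue_int_translate m (F : borV m -> \bar R) (v : 'rV[R]_m) :
  measurable_fun setT F -> (forall x, 0 <= F x)%E ->
  lebesgue_int (fun x => F (x + v)) = lebesgue_int F.
Proof.
elim: m F v => [|m IH] F v mF F0 /=.
  by rewrite (_ : 0 + v = 0)//; apply/rowP => -[].
have [mu [muE _]] := lebesgue_rV_exists m.
pose H (ty : measurableTypeR R * borV m) := F (row_cons ty).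
have mH : measurable_fun setT H := measurableT_comp mF (@measurable_row_cons m).
have mHt t : measurable_fun setT (fun y => H (t, y)).
  exact: measurableT_comp mH _.
pose G (t : measurableTypeR R) := lebesgue_int (fun y => H (t, y)).
have H0 ty : (0 <= H ty)%E by exact: F0.
have GE : G = fubini_F mu H by apply/funext => t; rewrite /G muE.
rewrite -(@lebesgue_translate G (v 0 (lshift m (ord0 : 'I_1)))).
- apply: eq_integral => t _; rewrite /G.
  rewrite -(IH (fun y => H (t + v 0 (lshift m (ord0 : 'I_1)), y)) (@rsubmx _ 1 1 m v)) //.
  apply: (congr1 (@lebesgue_int R m)); apply/funext => y.
  rewrite /H; congr F; apply/rowP => j.
  case: (split_ordP (j : 'I_(1 + m))) => k ->; rewrite mxE.
    by rewrite (ord1 k) row_consl (row_consl (t, y)).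
  by rewrite row_consr (row_consr (t, y)) /= !mxE.
- rewrite GE; exact: measurable_fun_fubini_tonelli_F.
- by move=> t; rewrite GE; apply: integral_ge0.
Qed.

End LebesgueMeasure.

Section LebesgueDef.
Variable R : realType.

Definition lebV m : {sigma_finite_measure set (bor 'rV[R]_m) -> \bar R} :=
  projT1 (cid (lebesgue_rV_exists R m)).

Lemma lebesgue_intE m (F : bor 'rV[R]_m -> \bar R) :
  measurable_fun setT F -> (forall x, 0 <= F x)%E -> lebesgue_int F = (\int[lebV m]_x F x)%E.
Proof. by have [h _] := projT2 (cid (lebesgue_rV_exists R m)); exact: h. Qed.

Lemma lebV_ball m r : (lebV m (ball (0%R : 'rV[R]_m) r) < +oo)%E.
Proof. by have [_ h] := projT2 (cid (lebesgue_rV_exists R m)); exact: h. Qed.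

Lemma measurable_translate m (v : 'rV[R]_m) :
  measurable_fun setT ((fun x => x + v) : bor 'rV[R]_m -> bor 'rV[R]_m).
Proof.
apply: measurable_rV => // j; under eq_fun do rewrite mxE.
by apply: measurable_funD => //; exact: measurable_coord.
Qed.

Lemma lebV_translate m (F : bor 'rV[R]_m -> \bar R) (v : 'rV[R]_m) :
  measurable_fun setT F -> (forall x, 0 <= F x)%E ->
  (\int[lebV m]_x F (x + v)%R = \int[lebV m]_x F x)%E.
Proof.
move=> mF F0; rewrite -!lebesgue_intE//; first exact: lebesgue_int_translate.
exact: measurableT_comp mF (measurable_translate v).
Qed.

End LebesgueDef.

(** * Change of variables with a density *)

Section Density.
Context d1 d2 (T1 : measurableType d1) (T2 : measurableType d2) (R : realType).
Variables (m1 : {measure set T1 -> \bar R}) (m2 : {measure set T2 -> \bar R}).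
Variables (D : set T1) (E : set T2) (p : T2 -> T1) (h : T2 -> R).
Hypotheses (mD : measurable D) (mE : measurable E) (mp : measurable_fun E p).
Hypotheses (mh : measurable_fun E h) (h0 : forall x, E x -> 0 <= h x).
Hypothesis pE : forall x, E x -> D (p x).
Hypothesis m1E : forall A, measurable A -> A `<=` D ->
  m1 A = (\int[m2]_(x in E) (\1_A (p x) * h x)%:E)%E.
Local Open Scope ereal_scope.
Import HBNNSimple.

(** [m1E] concerns sets only; simple functions and monotone convergence extend it to integrals. All
    data live on [D] and [E], because a chart and its inverse carry no meaning outside their
    domains. *)
Lemma integral_density (F : T1 -> \bar R) :
  measurable_fun D F -> (forall x, D x -> 0 <= F x) ->
  \int[m1]_(x in D) F x = \int[m2]_(x in E) (F (p x) * (h x)%:E).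
Proof.
move=> mF F0; pose f_ := nnsfun_approx mD mF.
have mfp (g : T1 -> R) : measurable_fun setT g -> measurable_fun E (fun x => g (p x)).
  by move=> mg; exact: (measurable_comp _ _ mg mp).
transitivity (limn (fun n => \int[m1]_(x in D) (f_ n x)%:E)).
  rewrite -monotone_convergence//.
  - apply: eq_integral => y /[!inE] yD; apply/esym/cvg_lim => //.
    exact: cvg_nnsfun_approx.
  - by move=> n; exact/measurable_EFinP/measurable_funP.
  - by move=> n y _; rewrite lee_fin.
  - by move=> y _ m n mn; rewrite lee_fin; exact/lefP/nd_nnsfun_approx.
rewrite [X in limn X](_ : _ = (fun n => \int[m2]_(x in E) (f_ n (p x) * h x)%:E)).
  rewrite -monotone_convergence//; last 3 first.
    - move=> n; apply/measurable_EFinP; apply: measurable_funM => //.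
      exact: mfp.
    - by move=> n x Ex; rewrite lee_fin mulr_ge0// h0.
    - move=> x Ex m n mn; rewrite lee_fin ler_wpM2r ?h0//.
      exact/lefP/nd_nnsfun_approx.
  apply: eq_integral => x /[!inE] Ex; apply/cvg_lim => //.
  under eq_fun do rewrite EFinM.
  apply: cvgeZr => //.
  by apply: cvg_nnsfun_approx => //; exact: pE.
apply/funext => n.
have mk k : measurable (f_ n @^-1` [set k]) by exact: measurable_sfunP.
transitivity (\sum_(k \in range (f_ n)) (k%:E * m1 (D `&` f_ n @^-1` [set k]))).
  under eq_integral do rewrite fimfunE -fsumEFin//.
  rewrite ge0_integral_fsum//; last 2 first.
  - by move=> y; exact/measurable_EFinP/measurable_funM.
  - by move=> y x _; rewrite nnfun_muleindic_ge0.
  apply: eq_fsbigr => r _; rewrite integralZl_indic_nnsfun// integral_indic//=.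
  by rewrite setIC.
transitivity (\sum_(k \in range (f_ n))
    \int[m2]_(x in E) (k * (\1_(f_ n @^-1` [set k]) (p x) * h x))%:E).
  apply: eq_fsbigr => k _; rewrite (m1E (measurableI _ _ mD (mk k)) (@subIsetl _ _ _)).
  (* The simple functions are nonnegative, so a negative [k] has an empty level set; any other [k]
     can be taken out of the integral. *)
  have [k0|k0] := ltP k 0%R.
    rewrite (_ : D `&` _ = set0); last first.
      by rewrite (preimage_nnfun0 _ k0) setI0.
    rewrite !integral0_eq ?mule0// => x _; last by rewrite indic0 mul0r.
    by rewrite (preimage_nnfun0 _ k0) indic0 mul0r mulr0.
  under [RHS]eq_integral do rewrite EFinM.
  rewrite ge0_integralZl//; last 2 first.
  - apply/measurable_EFinP; apply: measurable_funM => //.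
    by apply: mfp; exact: measurable_indic.
  - by move=> x Ex; rewrite lee_fin mulr_ge0// h0.
  congr (_ * _); apply: eq_integral => x /[!inE] Ex; congr (_ * _)%:E.
  by rewrite indicI /= indicE mem_set ?mul1r//; exact: pE.
rewrite -ge0_integral_fsum//.
- apply: eq_integral => x _; rewrite fsumEFin//; congr _%:E.
  rewrite [X in (X * _)%R]fimfunE mulr_fsuml//.
  by apply: eq_fsbigr => k _; rewrite mulrA.
- move=> k; apply/measurable_EFinP; apply: measurable_funM => //.
  apply: measurable_funM => //; apply: mfp; exact: measurable_indic.
- move=> k x Ex; rewrite mulrA EFinM mule_ge0// ?lee_fin ?h0//.
  by have := nnfun_muleindic_ge0 (f_ n) k (p x).
Qed.

(** Multiplication by a nonnegative [h] commutes with taking positive and negative parts. *)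
Lemma integral_density_signed (F : T1 -> \bar R) : measurable_fun D F ->
  \int[m1]_(x in D) F x = \int[m2]_(x in E) (F (p x) * (h x)%:E).
Proof.
move=> mF; rewrite [LHS]integralE [RHS]integralE.
rewrite integral_density//; last exact: measurable_funepos.
rewrite integral_density//; last exact: measurable_funeneg.
congr (_ - _); apply: eq_integral => x /[!inE] /h0 hx.
  by rewrite !funeposE maxe_pMl// mul0e.
by rewrite !funenegE maxe_pMl// mul0e mulNe.
Qed.

End Density.

(** * Positive definite matrices *)

Section PosDef.
Variable R : realType.

Lemma bilinDl d (G : 'M[R]_d) v w z : bilin G (v + w) z = bilin G v z + bilin G w z.
Proof. by rewrite /bilin !mulmxDl mxE. Qed.

Lemma bilinZl d (G : 'M[R]_d) a v z : bilin G (a *: v) z = a * bilin G v z.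
Proof. by rewrite /bilin -!scalemxAl mxE. Qed.

Lemma bilinC d (G : 'M[R]_d) v w : G^T = G -> bilin G v w = bilin G w v.
Proof.
move=> sG; rewrite /bilin -[v *m G *m w^T]trmxK [in LHS]mxE.
by rewrite !trmx_mul trmxK sG mulmxA.
Qed.

Definition posdef d (G : 'M[R]_d) :=
  G^T = G /\ forall v, v != 0 -> 0 < bilin G v v.

Lemma posdef_ge0 d (G : 'M[R]_d) v : posdef G -> 0 <= bilin G v v.
Proof.
move=> [_ pG]; have [->|v0] := eqVneq v 0; last exact/ltW/pG.
by rewrite /bilin mul0mx mul0mx mxE.
Qed.

(** Positivity of the form at [c v - b w], with [b = G(v, w)] and [c = G(w, w)], is [c] times the
    claim. *)
Lemma posdef_CS d (G : 'M[R]_d) v w : posdef G ->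
  (bilin G v w) ^+ 2 <= bilin G v v * bilin G w w.
Proof.
move=> pG; have sG := pG.1.
have [->|w0] := eqVneq w 0.
  by rewrite {1 3}/bilin trmx0 !mulmx0 mxE expr0n mulr0.
have ww := pG.2 _ w0; set b := bilin G v w; set c := bilin G w w in ww *.
have := posdef_ge0 (c *: v + (- b) *: w) pG.
rewrite bilinDl !bilinZl (bilinC v _ sG) (bilinC w _ sG) !bilinDl !bilinZl.
rewrite (bilinC w v sG) -/b -/c.
have -> : c * (c * bilin G v v + - b * b) + - b * (c * b + - b * c) =
  c * (bilin G v v * c - b ^+ 2) by ring.
by rewrite pmulr_rge0// subr_ge0.
Qed.

Lemma posdef_unit d (G : 'M[R]_d) : posdef G -> G \in unitmx.
Proof.
move=> [_ pG]; rewrite -row_free_unit -kermx_eq0; apply/eqP/row_matrixP => i.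
rewrite row0; apply/eqP; apply/negP => /negP h.
have := pG _ h; rewrite /bilin.
have /sub_kermxP -> : (row i (kermx G) <= kermx G)%MS by exact: row_sub.
by rewrite mul0mx mxE ltxx.
Qed.

Lemma posdef_inv d (G : 'M[R]_d) : posdef G -> posdef (invmx G).
Proof.
move=> pG; have uG := posdef_unit pG; split; first by rewrite trmx_inv pG.1.
move=> v v0; have E : bilin (invmx G) v v = bilin G (v *m invmx G) (v *m invmx G).
  by rewrite /bilin trmx_mul trmx_inv pG.1 -!mulmxA mulKVmx.
rewrite E; apply: pG.2; apply: contra v0 => /eqP h.
by rewrite -[v](mulmxKV uG) h mul0mx.
Qed.

(** Cauchy-Schwarz for the raised covector [w G^-1] against the basis vector [e_a]. It bounds a
    chart component by the invariant length, which is how invariant L^2 bounds reach coordinates. *)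
Lemma posdef_coord d (G : 'M[R]_d) (w : 'rV[R]_d) a : posdef G ->
  w 0 a ^+ 2 <= G a a * bilin (invmx G) w w.
Proof.
move=> pG; have uG := posdef_unit pG.
have -> : w 0 a = bilin G (w *m invmx G) (delta_mx 0 a).
  by rewrite /bilin mulmxKV// trmx_delta -colE mxE.
have -> : G a a = bilin G (delta_mx 0 a) (delta_mx 0 a).
  by rewrite /bilin trmx_delta -rowE -colE !mxE.
rewrite mulrC (_ : bilin (invmx G) w w = bilin G (w *m invmx G) (w *m invmx G)).
  exact: posdef_CS.
by rewrite /bilin trmx_mul trmx_inv pG.1 -!mulmxA mulKVmx.
Qed.

Lemma bilinE d (G : 'M[R]_d) v w :
  bilin G v w = \sum_(b < d) (\sum_(a < d) v 0 a * G a b) * w 0 b.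
Proof.
by rewrite /bilin mxE; apply: eq_bigr => b _; rewrite !mxE.
Qed.

Lemma cvg_bigprod T (F : set_system T) {FF : Filter F} (I : Type) (r : seq I)
    (f : I -> T -> R) (l : I -> R) :
  (forall i, f i x @[x --> F] --> l i) ->
  (\prod_(i <- r) f i x) @[x --> F] --> \prod_(i <- r) l i.
Proof.
move=> h; elim: r => [|i r IH].
  by rewrite big_nil; under eq_fun do rewrite big_nil; exact: cvg_cst.
by rewrite big_cons; under eq_fun do rewrite big_cons; exact: cvgM.
Qed.

Lemma continuous_det (T : topologicalType) d (G : T -> 'M[R]_d) x :
  (forall a b, {for x, continuous (fun y => G y a b)}) ->
  {for x, continuous (fun y => \det (G y))}.
Proof.
move=> h; rewrite /prop_for /continuous_at /determinant.
apply: (@cvg_bigsum _ _ (nbhs x) _ _ _ (fun s y => _)) => s.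
apply: cvgM; first exact: cvg_cst.
apply: (@cvg_bigprod _ (nbhs x) _ _ _ (fun i y => _)) => i; exact: h.
Qed.

(** Cramer's formula expresses the entries by determinants; invertibility is asked on a
    neighbourhood because [invmx] of a singular matrix is a mere convention. *)
Lemma continuous_invmx (T : topologicalType) d (G : T -> 'M[R]_d) x :
  (forall a b, {for x, continuous (fun y => G y a b)}) ->
  (\forall y \near x, G y \in unitmx) ->
  forall a b, {for x, continuous (fun y => invmx (G y) a b)}.
Proof.
move=> h uG a b; have ux := nbhs_singleton uG.
have : (fun y => (\det (G y))^-1 * cofactor (G y) b a) @ x --> invmx (G x) a b.
  rewrite /invmx ux !mxE; apply: cvgM.
    apply: cvgV; last exact: continuous_det.
    by rewrite -unitfE -unitmxE.
  rewrite /cofactor; apply: cvgM; first exact: cvg_cst.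
  apply: (@continuous_det _ _ (fun y => row' b (col' a (G y)))) => k l.
  by rewrite /prop_for /continuous_at !mxE; under eq_fun do rewrite !mxE; exact: h.
apply: cvg_trans; apply: (@near_eq_cvg _ _ (nbhs x)).
by apply: filterS uG => y uy; rewrite /invmx uy !mxE.
Qed.

(* The segment from the identity to a positive definite matrix avoids the
   singular matrices, so the determinant does not change sign along it. *)
Lemma posdef_det_gt0 d (G : 'M[R]_d) : posdef G -> 0 < \det G.
Proof.
move=> pG; pose f (t : R) := \det ((1 - t) *: 1%:M + t *: G).
have f0 : f 0 = 1 by rewrite /f subr0 scale1r scale0r addr0 det1.
have f1 : f 1 = \det G by rewrite /f subrr scale0r scale1r add0r.
have fn0 t : 0 <= t <= 1 -> f t != 0.
  move=> /andP[t0 t1]; rewrite -unitfE -unitmxE; apply: posdef_unit; split.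
    by rewrite linearD !linearZ /= trmx1 pG.1.
  move=> v v0; have -> : bilin ((1 - t) *: 1%:M + t *: G) v v =
      (1 - t) * bilin 1%:M v v + t * bilin G v v.
    by rewrite /bilin mulmxDr mulmxDl -!scalemxAr -!scalemxAl !mxE.
  have p1 : 0 < bilin 1%:M v v.
    rewrite /bilin mulmx1 mxE lt_neqAle eq_sym; apply/andP; split; last first.
      by apply: sumr_ge0 => a _; rewrite mxE -expr2 sqr_ge0.
    rewrite psumr_eq0; last by move=> a _; rewrite mxE -expr2 sqr_ge0.
    apply: contra v0 => /allP h; apply/eqP/rowP => a; apply/eqP.
    have := h a (mem_index_enum _); rewrite mxE /= -expr2 sqrf_eq0; by rewrite mxE.
  have p2 := pG.2 _ v0.
  have [->|tp] := eqVneq t 0; first by rewrite subr0 mul1r mul0r addr0.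
  by rewrite ltr_wpDl// ?mulr_ge0 ?subr_ge0// ?ltW// mulr_gt0// lt0r tp.
have fc : {within `[0, 1], continuous f}.
  apply: continuous_subspaceT => t.
  apply: (@continuous_det R^o _ (fun s : R^o => (1 - s) *: 1%:M + s *: G) t) => a b.
  rewrite /prop_for /continuous_at !mxE; under eq_fun do rewrite !mxE.
  apply: cvgD; apply: cvgM; try exact: cvg_cst; last exact: cvg_id.
  by apply: cvgB; [exact: cvg_cst|exact: cvg_id].
rewrite -f1 lt0r fn0 ?ler01 ?lexx//= leNgt; apply/negP => fneg.
have [|c cI /eqP] := @IVT R f 0 1 0 ler01 fc.
  by rewrite f0 ge_min le_max ler01 (ltW fneg) orbT.
by rewrite (negbTE (fn0 _ _)).
Qed.

End PosDef.

(** If [P K] failed, the sets whose complement in [K] satisfies [P] would form a proper filter; a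
    cluster point of it in [K] has a neighbourhood satisfying [P], whose complement belongs to the
    filter. This replaces the extraction of finite subcovers. *)
Lemma compact_union_induction (X : topologicalType) (K : set X) (P : set X -> Prop) :
  compact K -> P set0 -> (forall A B, P A -> P B -> P (A `|` B)) ->
  (forall A B, A `<=` B -> P B -> P A) ->
  (forall x, K x -> exists2 U, nbhs x U & P U) -> P K.
Proof.
move=> cK P0 PU Psub h; apply: contrapT => nPK.
pose F : set_system X := [set A | P (K `\` A)].
have FF : ProperFilter F.
  split; first by rewrite /F /= setD0.
  split; first by rewrite /F /= setDT.
    by move=> A B; rewrite /F /= setDIr; exact: PU.
  by move=> A B AB; rewrite /F /=; apply: Psub; exact: setDS.
have [x [Kx clx]] : K `&` cluster F !=set0 by apply: cK; rewrite /F /= setDv.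
have [U nU PUU] := h _ Kx.
have FC : F (~` U) by rewrite /F /= setDE setCK; apply: Psub PUU => y [].
by have [y [nyU yU]] := clx _ _ FC nU; exact: nyU.
Qed.

Lemma continuous_nbhs (X Y : topologicalType) (f : X -> Y) x (A : set Y) :
  {for x, continuous f} -> nbhs (f x) A -> nbhs x (f @^-1` A).
Proof. by move=> h nA; apply: h. Qed.

(** * Charts, the volume in coordinates, and its finiteness *)

Section ManifoldBasics.
Variables (R : realType) (n : nat) (M : closed_riemannian R n.+1).
Implicit Types (i j : chart M) (p : M) (x : 'rV[R]_n.+1).

Definition img i : set 'rV[R]_n.+1 := phi i @` dom i.

Lemma img_phi i p : dom i p -> img i (phi i p).
Proof. by move=> dp; exists p. Qed.

Lemma dom_psi i x : img i x -> dom i (psi i x).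
Proof. by move=> [p dp <-]; rewrite phiK. Qed.

Lemma psiK i x : img i x -> phi i (psi i x) = x.
Proof. by move=> [p dp <-]; rewrite phiK. Qed.

Lemma imgE i (A : set M) : A `<=` dom i -> phi i @` A = img i `&` psi i @^-1` A.
Proof.
move=> Ad; apply/seteqP; split => [x [p Ap <-]|x [ix Ax]].
  by split; [exact/img_phi/Ad|rewrite /= phiK//; exact: Ad].
by exists (psi i x) => //; rewrite psiK.
Qed.

Lemma image_open i (A : set M) : open A -> A `<=` dom i -> open (phi i @` A).
Proof.
move=> oA Ad; rewrite imgE//; apply: open_preimage => //; first exact: img_open.
by move=> x ix; exact: psi_continuous.
Qed.

Lemma preimage_open i (V : set 'rV[R]_n.+1) : open V -> open (dom i `&` phi i @^-1` V).
Proof.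
move=> oV; apply: open_preimage => //; first exact: dom_open.
by move=> p dp; exact: phi_continuous.
Qed.

Lemma measurable_dom i : measurable (dom i : set (borel M)).
Proof. by apply: (@open_bor M); exact: dom_open. Qed.

Lemma measurable_img i : measurable (img i : set (bor 'rV[R]_n.+1)).
Proof. by apply: open_bor; exact: img_open. Qed.

Lemma measurable_phi i : measurable_fun (dom i : set (borel M)) (phi i : borel M -> bor 'rV[R]_n.+1).
Proof.
apply: (@continuous_measurable_bor M) => [|p dp]; first exact: dom_open.
exact: phi_continuous.
Qed.

Lemma measurable_psi i : measurable_fun (img i : set (bor 'rV[R]_n.+1)) (psi i : bor 'rV[R]_n.+1 -> borel M).
Proof.
apply: (@continuous_measurable_bor _ M) => [|p dp]; first exact: img_open.
exact: psi_continuous.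
Qed.

Lemma smooth_continuous (D : set 'rV[R]_n.+1) f x : smooth D f -> D x -> {for x, continuous f}.
Proof. by move=> /(_ 0%N) h Dx; exact: h. Qed.

Lemma gij_continuous i x a b : img i x -> {for x, continuous (fun y => gij i y a b)}.
Proof. by move=> ix; apply: smooth_continuous ix; exact: gij_smooth. Qed.

Lemma gij_posdef i x : img i x -> posdef (gij i x).
Proof. by move=> ix; split=> [|v v0]; [exact: gij_sym|exact: gij_pos]. Qed.

Lemma metric_posdef i p : dom i p -> posdef (metric_at i p).
Proof. by move=> dp; apply: gij_posdef; exact: img_phi. Qed.

Definition sqdet i x : R := Num.sqrt (\det (gij i x)).

Lemma sqdet_gt0 i x : img i x -> 0 < sqdet i x.
Proof. by move=> ix; rewrite sqrtr_gt0; apply: posdef_det_gt0; exact: gij_posdef. Qed.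

Lemma sqdet_continuous i x : img i x -> {for x, continuous (sqdet i)}.
Proof.
move=> ix; apply: continuous_comp; last exact: sqrt_continuous.
by apply: continuous_det => a b; exact: gij_continuous.
Qed.

Lemma measurable_sqdet i : measurable_fun (img i : set (bor 'rV[R]_n.+1)) (sqdet i : bor 'rV[R]_n.+1 -> R).
Proof.
by apply: continuous_measurable_real => [|x ix]; [exact: img_open|exact: sqdet_continuous].
Qed.

Lemma continuous_chart i p (f : 'rV[R]_n.+1 -> R) : dom i p ->
  {for phi i p, continuous f} -> {for p, continuous (f \o phi i)}.
Proof. by move=> dp cf; apply: continuous_comp => //; exact: phi_continuous. Qed.

Variables (vol : {measure set (borel M) -> \bar R}) (hvol : is_volume vol).

(** Puts [is_volume] into the shape of the hypothesis [m1E] of [integral_density]: the indicator is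
    pulled back by [psi i], and integration is restricted to the image of [D]. *)
Lemma vol_density i (A D : set (borel M)) : measurable A -> measurable D -> D `<=` dom i -> A `<=` D ->
  vol A = (\int[lebV R n.+1]_(x in (img i `&` psi i @^-1` D : set (bor 'rV[R]_n.+1)))
     (\1_A (psi i x) * sqdet i x)%:E)%E.
Proof.
move=> mA mD Dd AD; have Ad : A `<=` dom i by exact: subset_trans Dd.
rewrite (hvol mA Ad).
have mE : measurable (img i `&` psi i @^-1` D : set (bor 'rV[R]_n.+1)).
  by apply: measurable_psi => //; exact: measurable_img.
have E : (fun x : bor 'rV[R]_n.+1 => (\1_(phi i @` A) x * Num.sqrt (\det (gij i x)))%:E)
   = ((fun x => (\1_A (psi i x) * sqdet i x)%:E) \_ (img i `&` psi i @^-1` D)).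
  apply/funext => x; rewrite patchE imgE// /sqdet; case: ifPn => [/[!inE] -[ix Dx]|].
    by rewrite !indicE in_setI mem_set//.
  rewrite notin_setE => h; rewrite indicE memNset ?mul0r//.
  by move=> -[ix Ax]; apply: h; split => //; exact: AD.
rewrite lebesgue_intE.
- by rewrite E -integral_mkcond.
- rewrite E; apply/(measurable_restrictT _ mE).
  apply/measurable_EFinP; apply: measurable_funM.
    have mind : measurable_fun setT (\1_A : borel M -> R) by exact: measurable_indic.
    have mpsi := measurable_funS (@measurable_img i) (@subIsetl _ _ (psi i @^-1` D)) (@measurable_psi i).
    exact: (measurableT_comp mind mpsi).
  exact: (measurable_funS (@measurable_img i) (@subIsetl _ _ _) (@measurable_sqdet i)).
- by move=> x; rewrite lee_fin mulr_ge0// ?sqrtr_ge0.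
Qed.

Lemma integral_chart i (D : set (borel M)) (F : borel M -> \bar R) :
  measurable D -> D `<=` dom i -> measurable_fun D F ->
  (\int[vol]_(p in D) F p =
   \int[lebV R n.+1]_(x in (img i `&` psi i @^-1` D : set (bor 'rV[R]_n.+1)))
     (F (psi i x) * (sqdet i x)%:E))%E.
Proof.
move=> mD Dd mF.
have mE : measurable (img i `&` psi i @^-1` D : set (bor 'rV[R]_n.+1)).
  by apply: measurable_psi => //; exact: measurable_img.
apply: (@integral_density_signed _ _ (borel M) (bor 'rV[R]_n.+1) R vol (lebV R n.+1) D
  (img i `&` psi i @^-1` D) (psi i) (sqdet i)) => //.
- exact: (measurable_funS (@measurable_img i) (@subIsetl _ _ _) (@measurable_psi i)).
- exact: (measurable_funS (@measurable_img i) (@subIsetl _ _ _) (@measurable_sqdet i)).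
- by move=> x _; exact: sqrtr_ge0.
- by move=> x [].
- by move=> A mA AD; exact: vol_density.
Qed.

Lemma vol_finite : (vol setT < +oo)%E.
Proof.
(* A measurable superset of finite volume is asked for, so that [P] passes to arbitrary subsets as
   the compactness induction requires. *)
pose P (A : set M) := exists2 B : set (borel M), measurable B /\ A `<=` B & (vol B < +oo)%E.
have [B [mB AB] vB] : P setT; last first.
  by apply: le_lt_trans vB; apply: le_measure; rewrite ?inE.
apply: (@compact_union_induction M).
- exact: carrier_compact.
- by exists set0; [split; [exact: measurable0|]|rewrite measure0].
- move=> A B [A' [mA AA'] vA] [B' [mB BB'] vB]; exists (A' `|` B').
    by split; [exact: measurableU|exact: setUSS].
  by apply: le_lt_trans (measureU2 _ _ _) _ => //; exact: lte_add_pinfty.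
- by move=> A B AB [B' [mB BB'] vB]; exists B' => //; split => //; exact: subset_trans BB'.
move=> p _; have [i dp] := dom_cover p.
have ip := img_phi dp.
have : nbhs (phi i p) (img i `&` sqdet i @^-1` [set y | y < sqdet i (phi i p) + 1]).
  apply: filterI; first by apply: open_nbhs_nbhs; split => //; exact: img_open.
  apply: continuous_nbhs; first exact: sqdet_continuous.
  by apply: lt_nbhsl; rewrite ltrDl.
move=> /nbhs_ballP[r r0 hr].
pose U := dom i `&` phi i @^-1` (ball (phi i p) r).
have oU : open U by apply: preimage_open; exact: ball_open.
exists U; first by apply: open_nbhs_nbhs; split => //; split => //; exact: ballxx.
exists U; first by split => //; exact: (@open_bor M).
have Ud : U `<=` dom i by move=> q [].
rewrite -[vol U]mul1e -integral_cst; last exact: (@open_bor M).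
have -> : (\int[vol]_(q in (U : set (borel M))) cst 1 q)%E = (\int[vol]_(q in (U : set (borel M))) 1)%E by [].
rewrite (integral_chart (i := i))//; last exact: (@open_bor M).
have mE : measurable (img i `&` psi i @^-1` U : set (bor 'rV[R]_n.+1)).
  by apply: measurable_psi => //; [exact: measurable_img|exact: (@open_bor M)].
have Eb : img i `&` psi i @^-1` U `<=` ball (phi i p) r.
  by move=> x [ix [_ /=]]; rewrite psiK.
pose c := sqdet i (phi i p) + 1; have c0 : 0 <= c by rewrite addr_ge0// sqrtr_ge0.
apply: (@le_lt_trans _ _ (\int[lebV R n.+1]_(x in (img i `&` psi i @^-1` U : set (bor 'rV[R]_n.+1))) c%:E)%E).
  apply: ge0_le_integral => //.
  - by move=> x [ix _]; rewrite mul1e lee_fin sqrtr_ge0.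
  - under eq_fun do rewrite mul1e; apply/measurable_EFinP.
    exact: (measurable_funS (@measurable_img i) (@subIsetl _ _ _) (@measurable_sqdet i)).
  - by move=> x /Eb /hr [_ /=]; rewrite mul1e lee_fin => /ltW.
rewrite integral_cst// lte_mul_pinfty//.
apply: (@le_lt_trans _ _ (lebV R n.+1 (ball (0%R : 'rV[R]_n.+1) (`|phi i p| + r)))).
  apply: le_measure; rewrite ?inE//; first by apply: open_bor; exact: ball_open.
  move=> x /Eb; rewrite -!ball_normE /= sub0r normrN => h.
  rewrite -[x](subrK (phi i p)) addrC (le_lt_trans (ler_normD _ _))// ltrD2l.
  by rewrite distrC.
exact: lebV_ball.
Qed.

End ManifoldBasics.

(** * Square-integrable functions *)

(** The source of the Cauchy-Schwarz inequalities for integrals and forms below. A negative [c], or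
    a nonzero [b] with [c = 0], is refuted by an explicit [t]. *)
Lemma quadratic_discriminant (R : realFieldType) (a b c : R) :
  (forall t, 0 <= a + 2 * t * b + t ^+ 2 * c) -> b ^+ 2 <= a * c.
Proof.
move=> h; have c0 : 0 <= c.
  rewrite leNgt; apply/negP => c0.
  have a0 : 0 <= a by have := h 0; rewrite mulr0 mul0r expr0n /= mul0r !addr0.
  (* With [t >= 1] and [t (-c) > a + 2 |b|], the term [t^2 c] outweighs the other two. *)
  pose t := (1 + a + 2 * `|b|) / - c + 1.
  have nc : 0 < - c by rewrite oppr_gt0.
  have N0 : 0 <= 1 + a + 2 * `|b| by have := normr_ge0 b; lra.
  have t1 : 1 <= t by rewrite /t lerDr divr_ge0// ltW.
  have tc : t * - c = 1 + a + 2 * `|b| - c.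
    by rewrite /t mulrDl mul1r divfK// gt_eqF.
  have := h t; have := ler_norm b.
  have : t * (t * - c) = t * (1 + a + 2 * `|b| - c) by rewrite tc.
  nra.
have [c00|cn] := eqVneq c 0; last first.
  have cp : 0 < c by rewrite lt0r cn.
  have := h (- b / c).
  have -> : a + 2 * (- b / c) * b + (- b / c) ^+ 2 * c = (a * c - b ^+ 2) / c.
    by field.
  by rewrite pmulr_lge0 ?invr_gt0// subr_ge0.
have [->|b0] := eqVneq b 0; first by rewrite expr0n /= c00 mulr0.
have := h (- (a + 1) / (2 * b)); rewrite c00 mulr0 addr0.
have -> : a + 2 * (- (a + 1) / (2 * b)) * b = -1 by field.
by rewrite ler0N1.
Qed.

Section SquareIntegrable.
Context d (T : measurableType d) (R : realType) (mu : {measure set T -> \bar R}).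
Variables (D : set T) (mD : measurable D).
Hypothesis muT : (mu setT < +oo)%E.
Implicit Types f g : T -> R.

Definition Int f := mu.-integrable D (EFin \o f).
Definition L2 f := measurable_fun D f /\ (\int[mu]_(x in D) (f x ^+ 2)%:E < +oo)%E.

Lemma muD_fin : (mu D < +oo)%E.
Proof. by apply: le_lt_trans muT; apply: le_measure; rewrite ?inE. Qed.

Lemma Int_meas f : Int f -> measurable_fun D f.
Proof. by move=> /integrableP[/measurable_EFinP]. Qed.

Lemma Int_eq f g : (forall x, D x -> f x = g x) -> Int f -> Int g.
Proof. by move=> fg; apply: eq_integrable => // x /[!inE] Dx /=; rewrite fg. Qed.

Lemma Int_le f g : measurable_fun D f -> (forall x, D x -> `|f x| <= g x) -> Int g -> Int f.
Proof.
move=> mf fg; apply: le_integrable => //; first exact/measurable_EFinP.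
by move=> x Dx /=; rewrite lee_fin (le_trans (fg _ Dx))// ler_norm.
Qed.

Lemma IntD f g : Int f -> Int g -> Int (fun x => f x + g x).
Proof. by move=> hf hg; exact: (integrableD mD hf hg). Qed.

Lemma IntZ c f : Int f -> Int (fun x => c * f x).
Proof. by move=> hf; exact: (integrableZl mD c hf). Qed.

Lemma IntB f g : Int f -> Int g -> Int (fun x => f x - g x).
Proof. by move=> hf hg; exact: (integrableB mD hf hg). Qed.

Lemma Int_norm f : Int f -> Int (fun x => `|f x|).
Proof. exact: integrable_norm. Qed.

Lemma Int_cst c : Int (fun=> c).
Proof.
apply/integrableP; split; first exact/measurable_EFinP.
by rewrite /= integral_cst// lte_mul_pinfty// muD_fin.
Qed.

Lemma Int_ge0P f : measurable_fun D f -> (forall x, D x -> 0 <= f x) ->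
  (\int[mu]_(x in D) (f x)%:E < +oo)%E -> Int f.
Proof.
move=> mf f0 fi; apply/integrableP; split; first exact/measurable_EFinP.
under eq_integral; first by move=> x /[!inE] Dx; rewrite gee0_abs ?lee_fin ?f0//; over.
exact: fi.
Qed.

Lemma Int_lty f : Int f -> (\int[mu]_(x in D) (f x)%:E < +oo)%E.
Proof. exact: integrable_lty. Qed.

Lemma RIntE f : Int f -> (\int[mu]_(x in D) f x)%:E = (\int[mu]_(x in D) (f x)%:E)%E.
Proof. by move=> hf; rewrite /Rintegral fineK//; exact: integrable_fin_num. Qed.

Lemma RIntD f g : Int f -> Int g -> \int[mu]_(x in D) (f x + g x) =
  \int[mu]_(x in D) f x + \int[mu]_(x in D) g x.
Proof. exact: RintegralD. Qed.

Lemma RIntB f g : Int f -> Int g -> \int[mu]_(x in D) (f x - g x) =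
  \int[mu]_(x in D) f x - \int[mu]_(x in D) g x.
Proof. exact: RintegralB. Qed.

Lemma RIntZ c f : Int f -> \int[mu]_(x in D) (c * f x) = c * \int[mu]_(x in D) f x.
Proof. exact: RintegralZl. Qed.

Lemma RInt_le f g : Int f -> Int g -> (forall x, D x -> f x <= g x) ->
  \int[mu]_(x in D) f x <= \int[mu]_(x in D) g x.
Proof. exact: le_Rintegral. Qed.

Lemma RInt_eq f g : (forall x, D x -> f x = g x) ->
  \int[mu]_(x in D) f x = \int[mu]_(x in D) g x.
Proof. by move=> fg; apply: eq_Rintegral => x /[!inE]; exact: fg. Qed.

Lemma L2_sq f : L2 f -> Int (fun x => f x ^+ 2).
Proof.
move=> [mf fi]; apply: Int_ge0P => //; first exact: measurable_funX.
by move=> x _; exact: sqr_ge0.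
Qed.

Lemma L2P f : measurable_fun D f -> Int (fun x => f x ^+ 2) -> L2 f.
Proof. by move=> mf /Int_lty. Qed.

Lemma L2_prod f g : L2 f -> L2 g -> Int (fun x => f x * g x).
Proof.
move=> hf hg; apply: (@Int_le _ (fun x => f x ^+ 2 + g x ^+ 2)).
- by apply: measurable_funM; [case: hf|case: hg].
- move=> x _; rewrite ler_norml; have := sqr_ge0 (f x - g x); have := sqr_ge0 (f x + g x).
  have := sqr_ge0 (f x); have := sqr_ge0 (g x) => h1 h2 h3 h4.
  by apply/andP; split; nra.
- by apply: IntD; exact: L2_sq.
Qed.

Lemma L2_bounded f K : measurable_fun D f -> (forall x, D x -> `|f x| <= K) -> L2 f.
Proof.
move=> mf fK; apply: L2P => //; apply: (@Int_le _ (fun=> K ^+ 2)); last exact: Int_cst.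
  exact: measurable_funX.
move=> x Dx; rewrite ger0_norm ?sqr_ge0// -real_normK ?num_real//.
by rewrite lerXn2r ?nnegrE//; [exact: le_trans (fK _ Dx)|exact: fK].
Qed.

Lemma L2_bddM f (q : T -> R) K : L2 f -> measurable_fun D q -> (forall x, D x -> `|q x| <= K) ->
  L2 (fun x => f x * q x).
Proof.
move=> hf mq qK; apply: L2P; first by apply: measurable_funM => //; case: hf.
apply: (@Int_le _ (fun x => K ^+ 2 * f x ^+ 2)).
- by apply: measurable_funX; apply: measurable_funM => //; case: hf.
- move=> x Dx; rewrite ger0_norm ?sqr_ge0// exprMn mulrC ler_wpM2r ?sqr_ge0//.
  by rewrite -real_normK ?num_real// lerXn2r ?nnegrE//; [exact: le_trans (qK _ Dx)|exact: qK].
- by apply: IntZ; exact: L2_sq.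
Qed.

Lemma L2D f g : L2 f -> L2 g -> L2 (fun x => f x + g x).
Proof.
move=> hf hg; apply: L2P; first by apply: measurable_funD; [case: hf|case: hg].
apply: (@Int_eq (fun x => f x ^+ 2 + (2 * (f x * g x) + g x ^+ 2))).
  by move=> x _; ring.
by apply: IntD; [exact: L2_sq|apply: IntD; [apply: IntZ; exact: L2_prod|exact: L2_sq]].
Qed.

Lemma L2Z c f : L2 f -> L2 (fun x => c * f x).
Proof.
move=> hf; apply: L2P; first by apply: measurable_funM => //; case: hf.
apply: (@Int_eq (fun x => c ^+ 2 * f x ^+ 2)); first by move=> x _; rewrite exprMn.
by apply: IntZ; exact: L2_sq.
Qed.

Lemma L2_cst c : L2 (fun=> c).
Proof. by apply: (@L2_bounded _ `|c|). Qed.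

Lemma L2B f g : L2 f -> L2 g -> L2 (fun x => f x - g x).
Proof.
move=> hf hg; have := L2D hf (L2Z (-1) hg); rewrite /L2.
by under eq_fun do rewrite mulN1r; under eq_integral do rewrite mulN1r.
Qed.

Lemma L2_Int f : L2 f -> Int f.
Proof.
by move=> hf; apply: Int_eq (L2_prod hf (L2_cst 1)) => x _; rewrite mulr1.
Qed.

Lemma L2_CS f g : L2 f -> L2 g -> (\int[mu]_(x in D) (f x * g x)) ^+ 2 <=
  (\int[mu]_(x in D) (f x ^+ 2)) * \int[mu]_(x in D) (g x ^+ 2).
Proof.
move=> hf hg; apply: quadratic_discriminant => t.
have -> : \int[mu]_(x in D) (f x ^+ 2) + 2 * t * \int[mu]_(x in D) (f x * g x)
   + t ^+ 2 * \int[mu]_(x in D) (g x ^+ 2) = \int[mu]_(x in D) ((f x + t * g x) ^+ 2).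
  have h1 := L2_sq hf; have h2 := L2_prod hf hg; have h3 := L2_sq hg.
  rewrite -RIntZ// -RIntZ// -RIntD//; last exact: IntZ.
  rewrite -RIntD//; [|by apply: IntD => //; exact: IntZ|exact: IntZ].
  by apply: RInt_eq => x _; ring.
by apply: Rintegral_ge0 => x _; exact: sqr_ge0.
Qed.

(** The series of [2^k g_k] has integral at most 2, hence is finite almost everywhere, and its sum
    bounds every term. Fast convergence in mean thus becomes almost everywhere convergence with a
    rate. *)
Lemma Int_ae_cvg0 (g : nat -> T -> R) :
  (forall k, measurable_fun D (g k)) -> (forall k x, D x -> 0 <= g k x) ->
  (forall k, (\int[mu]_(x in D) (g k x)%:E <= ((4^-1) ^+ k)%:E)%E) ->
  {ae mu, forall x, D x -> exists C : R, forall k, g k x <= C * 2^-1 ^+ k}.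
Proof.
move=> mg g0 ig; pose G k x := ((2 ^+ k * g k x)%:E : \bar R).
have mG k : measurable_fun D (G k) by apply/measurable_EFinP; apply: measurable_funM.
have G0 k x : D x -> (0 <= G k x)%E.
  by move=> Dx; rewrite lee_fin mulr_ge0 ?exprn_ge0// g0.
have GI k : (\int[mu]_(x in D) G k x <= ((2^-1) ^+ k)%:E)%E.
  rewrite /G; under eq_integral do rewrite EFinM.
  rewrite ge0_integralZl//; last 2 first.
  - exact/measurable_EFinP.
  - by move=> x Dx; rewrite lee_fin g0.
  have -> : ((2^-1) ^+ k : R) = 2 ^+ k * (4^-1) ^+ k.
    rewrite -exprMn; congr (_ ^+ _); lra.
  by rewrite EFinM lee_wpmul2l// lee_fin exprn_ge0.
have SI : (\int[mu]_(x in D) (\sum_(0 <= k <oo) G k x) < +oo)%E.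
  rewrite integral_nneseries//.
  apply: (@le_lt_trans _ _ (\sum_(0 <= k <oo) ((2^-1) ^+ k)%:E)%E).
    apply: lee_nneseries => k _; last exact: GI.
    by move=> _; apply: integral_ge0 => x; exact: G0.
  have -> : (\sum_(0 <= k <oo) ((2^-1) ^+ k)%:E = 2%:E :> \bar R)%E; last exact: ltry.
  apply/cvg_lim => //; have := @cvg_geometric_eseries_half R 2 0.
  rewrite /eseries /= expr0 divr1; apply: cvg_trans; apply: near_eq_cvg.
  apply: nearW => N; apply: eq_bigr => k _; congr _%:E.
  rewrite addn1 natrX exprS invfM mulrA divff ?mul1r// exprVn//.
have mS : measurable_fun D (fun x => \sum_(0 <= k <oo) G k x)%E.
  by apply: ge0_emeasurable_sum => // k x Dx _; exact: G0.
have IS : mu.-integrable D (fun x => \sum_(0 <= k <oo) G k x)%E.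
  apply/integrableP; split => //.
  under eq_integral; first by move=> x /[!inE] Dx; rewrite gee0_abs ?nneseries_ge0//; [over|move=> k _ _; exact: G0].
  exact: SI.
have [N [mN N0 hN]] := integrable_ae mD IS; exists N; split => //.
apply: subset_trans hN => x /= nx; apply: contra_not nx => fx Dx.
have {}fx := fx Dx; pose C := fine (\sum_(0 <= k <oo) G k x)%E.
exists C => k; rewrite -ler_pdivrMr ?exprn_gt0// exprVn invrK mulrC.
rewrite -lee_fin /C fineK//.
apply: le_trans (@nneseries_lim_ge _ (G ^~ x) xpredT 0 k.+1 _); last by move=> j _ _; exact: G0.
rewrite big_nat_recr//= leeDr//; apply: sume_ge0 => j _; exact: G0.
Qed.

Lemma RInt_cvg_pair (f_ : nat -> T -> R) f g :
  (forall k, L2 (f_ k)) -> L2 f -> L2 g ->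
  \int[mu]_(x in D) ((f_ k x - f x) ^+ 2) @[k --> \oo] --> (0 : R) ->
  \int[mu]_(x in D) (f_ k x * g x) @[k --> \oo] --> \int[mu]_(x in D) (f x * g x).
Proof.
move=> hf_ hf hg h; apply/cvgrPdist_le => e e0.
set c := \int[mu]_(x in D) (g x ^+ 2).
have c0 : 0 <= c by apply: Rintegral_ge0 => x _; exact: sqr_ge0.
have c1 : 0 < c + 1 by rewrite ltr_wpDl.
move/cvgrPdist_le : h => /(_ _ (divr_gt0 (exprn_gt0 2 e0) c1)); apply: filterS => k.
rewrite sub0r normrN ger0_norm; last by apply: Rintegral_ge0 => x _; exact: sqr_ge0.
move=> hk; rewrite distrC -RIntB; [|exact: L2_prod|exact: L2_prod].
rewrite (@RInt_eq _ (fun x => (f_ k x - f x) * g x)); last by move=> x _; ring.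
have := L2_CS (L2B (hf_ k) hf) hg; rewrite -/c => h.
rewrite -(ler_pXn2r (n := 2))// ?nnegrE ?(ltW e0)// real_normK ?num_real//.
apply: le_trans h _; rewrite ler_pdivlMr// in hk.
apply: le_trans hk; rewrite ler_wpM2l ?lerDl//.
by apply: Rintegral_ge0 => x _; exact: sqr_ge0.
Qed.

Lemma L2_ae0 f : L2 f -> \int[mu]_(x in D) (f x ^+ 2) = 0 ->
  {ae mu, forall x, D x -> f x = 0}.
Proof.
move=> hf h; have hs := L2_sq hf.
have [h1 _] := ae_eq_integral_abs mu mD (measurable_int _ hs).
have : (\int[mu]_(x in D) `|(EFin \o (fun x => f x ^+ 2)%R) x| = 0)%E.
  rewrite -[RHS]/(0%:E) -h RIntE//; apply: eq_integral => x _.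
  by rewrite /= ger0_norm ?sqr_ge0.
move=> /h1 [N [mN N0 hN]]; exists N; split => //; apply: subset_trans hN => x /= nx.
by apply: contra_not nx => fx Dx; have [/eqP] := fx Dx; rewrite sqrf_eq0 => /eqP.
Qed.

Lemma RInt_dct (f_ : nat -> T -> R) f g : (forall k, measurable_fun D (f_ k)) ->
  measurable_fun D f -> {ae mu, forall x, D x -> f_ k x @[k --> \oo] --> f x} ->
  Int g -> {ae mu, forall x, D x -> forall k, `|f_ k x| <= g x} ->
  Int f /\ \int[mu]_(x in D) f_ k x @[k --> \oo] --> \int[mu]_(x in D) f x.
Proof.
move=> mf_ mf cf hg fg.
have [||||h1 _ h2] := @dominated_convergence _ T R mu D mD
    (fun k => EFin \o f_ k) (EFin \o f) (EFin \o g) _ _ _ hg.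
- by move=> k; exact/measurable_EFinP.
- exact/measurable_EFinP.
- by apply: filterS cf => x h /h {}h; apply: cvg_EFin => //; exact: nearW.
- by apply: filterS fg => x h k Dx; rewrite lee_fin; exact: h.
split => //; apply: fine_cvg; rewrite fineK; first exact: h2.
exact: integrable_fin_num.
Qed.

End SquareIntegrable.

(** * Smooth functions and covector fields on the manifold *)

Section SmoothFunctions.
Variables (R : realType) (n : nat) (M : closed_riemannian R n.+1).
Implicit Types (i j : chart M) (p : M) (x : 'rV[R]_n.+1) (f h : M -> R).
Local Notation Ck := (of_class (@continuous_in R _)).

Lemma near_dom i p : dom i p -> \forall q \near p, dom i q.
Proof. by move=> dp; apply: open_nbhs_nbhs; split => //; exact: dom_open. Qed.

Lemma continuous_of_chart i p f : dom i p ->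
  {for phi i p, continuous (f \o psi i)} -> {for p, continuous f}.
Proof.
move=> dp cf; have := continuous_chart dp cf.
rewrite /prop_for /continuous_at /= phiK//; apply: cvg_trans.
apply: (@near_eq_cvg _ _ (nbhs p)); apply: filterS (near_dom dp) => q dq.
by rewrite /= phiK.
Qed.

Lemma smooth_fun_continuous f : smooth_fun f -> continuous f.
Proof.
move=> sf p; have [i dp] := dom_cover p; apply: (continuous_of_chart dp).
by apply: (sf i 0%N); exact: img_phi.
Qed.

Lemma continuous_bounded f : (forall p, {for p, continuous f}) ->
  exists2 K, 0 <= K & forall p, `|f p| <= K.
Proof.
move=> cf; pose P (A : set M) := exists2 K, 0 <= K & forall p, A p -> `|f p| <= K.
have [K K0 hK] : P setT; last by exists K => // p; exact: hK.
apply: (@compact_union_induction M).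
- exact: carrier_compact.
- by exists 0.
- move=> A B [K1 K10 h1] [K2 K20 h2]; exists (K1 + K2); first exact: addr_ge0.
  by move=> p [/h1 h|/h2 h]; apply: le_trans h _; rewrite ?lerDl ?lerDr.
- by move=> A B AB [K K0 h]; exists K => // p /AB; exact: h.
move=> p _; exists (f @^-1` ball (f p) 1).
  by apply: continuous_nbhs => //; exact: nbhsx_ballx.
exists (`|f p| + 1) => [|q]; first exact: addr_ge0.
rewrite /preimage -ball_normE /= => /ltW h.
by rewrite -[f q](subrK (f p)) addrC (le_trans (ler_normD _ _))// lerD2l distrC.
Qed.

Lemma smooth_fun_eq f h : (forall p, f p = h p) -> smooth_fun f -> smooth_fun h.
Proof. by move=> /funext ->. Qed.

Lemma smooth_fun_cst c : smooth_fun (fun _ : M => c).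
Proof. by move=> i k; apply: (@Ck_cst R n.+1 k _ c); exact: img_open. Qed.

Lemma smooth_funD f h : smooth_fun f -> smooth_fun h -> smooth_fun (fun p => f p + h p).
Proof. by move=> sf sh i k; exact: (@CkD R n.+1 k (img i) (f \o psi i) (h \o psi i) (@img_open _ _ M i) (sf i k) (sh i k)). Qed.

Lemma smooth_funM f h : smooth_fun f -> smooth_fun h -> smooth_fun (fun p => f p * h p).
Proof. by move=> sf sh i k; exact: (@CkM R n.+1 k (img i) (f \o psi i) (h \o psi i) (@img_open _ _ M i) (sf i k) (sh i k)). Qed.

Lemma smooth_funZ c f : smooth_fun f -> smooth_fun (fun p => c * f p).
Proof. by move=> sf; apply: smooth_funM => //; exact: smooth_fun_cst. Qed.

Lemma smooth_fun_invsqrt f : smooth_fun f -> (forall p, 0 <= f p) ->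
  smooth_fun (fun p => (Num.sqrt (1 + f p))^-1).
Proof.
move=> sf f0 i k; apply: (@Ck_comp_invsqrt R n.+1 k (img i) (f \o psi i)).
- exact: img_open.
- by move=> x _; exact: f0.
- exact: sf.
Qed.

Definition dform f : covector_field M :=
  fun i p => \row_a partial a (f \o psi i) (phi i p).

Lemma transition_Ck i j k a :
  Ck k (phi i @` (dom i `&` dom j)) (fun x => phi j (psi i x) 0 a).
Proof. exact: transition_smooth. Qed.

Lemma overlap_open i j : open (phi i @` (dom i `&` dom j)).
Proof. by apply: image_open => [|p []//]; apply: openI; exact: dom_open. Qed.

Lemma dform_covector f : smooth_fun f -> is_covector_field (dform f).
Proof.
move=> sf i j p dip djp; apply/rowP => a; rewrite !mxE.
set D := phi i @` (dom i `&` dom j).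
have Dx : D (phi i p) by exists p.
have oD : open D by exact: overlap_open.
have -> : partial a (f \o psi i) (phi i p) =
    partial a ((f \o psi j) \o (fun x => phi j (psi i x))) (phi i p).
  apply: near_eq_derive; apply: filterS (open_nbhs_nbhs (conj oD Dx)) => x [q [diq djq] <-].
  by rewrite /= phiK// phiK.
rewrite (@Ck1_chain R _ _ D (img j)) //.
- apply: eq_bigr => b _; rewrite phiK// !mxE //.
- by move=> b; exact: transition_Ck.
- exact: img_open.
- exact: sf.
- by rewrite phiK//; exact: img_phi.
Qed.

(** The single operation [a w + z] carries the linear structure; the difference [z - w] is
    [cv_axpy (-1) w z]. Functions follow the same pattern [c f + h]. *)
Definition cv_axpy (a : R) (w z : covector_field M) : covector_field M :=
  fun i p => a *: w i p + z i p.

Lemma cv_axpy_covector a w z : is_covector_field w -> is_covector_field z ->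
  is_covector_field (cv_axpy a w z).
Proof.
move=> cw cz i j p di dj; rewrite /cv_axpy (cw i j p di dj) (cz i j p di dj).
by rewrite mulmxDl -scalemxAl.
Qed.

(** [in_chart] selects its chart independently of [F], so all quantities at [p] evaluated through it
    can be read in one chart. *)
Lemma in_chart_pick p : exists2 i, dom i p & forall F : chart M -> R, in_chart p F = F i.
Proof.
rewrite /in_chart; case: pickP => [i /asboolP di|h]; first by exists i.
by have [i di] := dom_cover p; have := h i; rewrite asboolT.
Qed.

Lemma covector_inner_axpyl a w z y p :
  covector_inner (cv_axpy a w z) y p = a * covector_inner w y p + covector_inner z y p.
Proof.
rewrite /covector_inner; have [i di H] := in_chart_pick p; rewrite !H.
by rewrite bilinDl bilinZl.
Qed.

Lemma covector_innerC w z p : covector_inner w z p = covector_inner z w p.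
Proof.
rewrite /covector_inner; have [i di H] := in_chart_pick p; rewrite !H.
by apply: bilinC; have [] := posdef_inv (metric_posdef di).
Qed.

Lemma covector_inner_axpyr a w z y p :
  covector_inner y (cv_axpy a w z) p = a * covector_inner y w p + covector_inner y z p.
Proof. by rewrite covector_innerC covector_inner_axpyl !(covector_innerC y). Qed.

Lemma covector_inner_ge0 w p : 0 <= covector_inner w w p.
Proof.
rewrite /covector_inner; have [i di H] := in_chart_pick p; rewrite !H.
by apply: posdef_ge0; exact: posdef_inv (metric_posdef di).
Qed.

Lemma covector_inner_CS w z p :
  covector_inner w z p ^+ 2 <= covector_inner w w p * covector_inner z z p.
Proof.
rewrite /covector_inner; have [i di H] := in_chart_pick p; rewrite !H.
by apply: posdef_CS; exact: posdef_inv (metric_posdef di).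
Qed.

Lemma covector_inner_abs w z p :
  `|covector_inner w z p| <= covector_inner w w p + covector_inner z z p.
Proof.
have h := covector_inner_CS w z p; have := covector_inner_ge0 w p.
have := covector_inner_ge0 z p; move: h.
move: (covector_inner w z p) (covector_inner w w p) (covector_inner z z p) => b a c h c0 a0.
rewrite -(ler_pXn2r (n := 2))// ?nnegrE ?addr_ge0// real_normK ?num_real//.
by apply: le_trans h _; nra.
Qed.

Lemma metric_transition i j p : dom i p -> dom j p ->
  let J := jacobian (fun x => phi j (psi i x)) (phi i p) in
  J \in unitmx /\ metric_at i p = J *m metric_at j p *m J^T.
Proof.
move=> di dj J; have E := gij_transition di dj.
split; last exact: E.
have : metric_at i p \in unitmx by apply: posdef_unit; exact: metric_posdef.
by rewrite /metric_at E !unitmx_mul => /andP[/andP[]].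
Qed.

(** The Jacobians in the transformation laws of metric and covectors cancel, so any chart around [p]
    may replace the one selected by [in_chart]. *)
Lemma covector_innerE i w z p : is_covector_field w -> is_covector_field z -> dom i p ->
  covector_inner w z p = bilin (invmx (metric_at i p)) (w i p) (z i p).
Proof.
move=> cw cz di; rewrite /covector_inner; have [j dj H] := in_chart_pick p; rewrite H.
have [uJ E] := metric_transition dj di.
rewrite (cw j i p dj di) (cz j i p dj di) E.
move: (jacobian _ _) uJ => J uJ; have uG := posdef_unit (metric_posdef di).
have uJT : J^T \in unitmx by rewrite unitmx_tr.
set G := metric_at i p in uG *; set K := J *m G *m J^T.
have uK : K \in unitmx by rewrite /K !unitmx_mul uJ uG.
have E2 : w i p *m J^T *m invmx K = w i p *m invmx G *m invmx J.
  rewrite -[RHS](mulmxK uK); congr (_ *m _).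
  by rewrite /K !mulmxA (mulmxKV uJ) (mulmxKV uG).
by rewrite /bilin E2 trmx_mul trmxK mulmxA (mulmxKV uJ).
Qed.

Lemma covector_coord i w p a : is_covector_field w -> dom i p ->
  w i p 0 a ^+ 2 <= metric_at i p a a * covector_inner w w p.
Proof.
by move=> cw di; rewrite (covector_innerE cw cw di); apply: posdef_coord; exact: metric_posdef.
Qed.

Lemma metric_continuous i p a b : dom i p -> {for p, continuous (fun q => metric_at i q a b)}.
Proof.
move=> di; apply: (continuous_chart di (f := fun x => gij i x a b)).
by apply: gij_continuous; exact: img_phi.
Qed.

Lemma invmetric_continuous i p a b : dom i p ->
  {for p, continuous (fun q => invmx (metric_at i q) a b)}.
Proof.
move=> di; apply: continuous_invmx; first by move=> k l; exact: metric_continuous.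
by apply: filterS (near_dom di) => q dq; apply: posdef_unit; exact: metric_posdef.
Qed.

Definition cv_measurable (S : set (borel M)) (w : covector_field M) :=
  forall i a, measurable_fun (S `&` dom i : set (borel M)) (fun p : borel M => w i p 0 a).

Lemma measurable_invmetric i a b :
  measurable_fun (dom i : set (borel M)) (fun p : borel M => invmx (metric_at i p) a b).
Proof.
apply: (@continuous_measurable_real R M) => [|p dp]; first exact: dom_open.
exact: invmetric_continuous.
Qed.

Lemma measurable_cover (S : set (borel M)) (f : borel M -> R) : measurable S ->
  (forall i, measurable_fun (S `&` dom i : set (borel M)) f) -> measurable_fun S f.
Proof.
move=> mS h; have -> : S = \bigcup_(i in [set: chart M]) (S `&` dom i : set (borel M)).
  apply/seteqP; split => [p Sp|p [i _ []]//].
  by have [i di] := dom_cover p; exists i.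
move=> _ B mB; rewrite setI_bigcupl; apply: fin_bigcup_measurable; first exact: finite_finset.
move=> i _; apply: h => //; apply: measurableI => //; exact: measurable_dom.
Qed.

Lemma covector_inner_measurable (S : set (borel M)) w z : measurable S ->
  is_covector_field w -> is_covector_field z -> cv_measurable S w -> cv_measurable S z ->
  measurable_fun S (covector_inner w z : borel M -> R).
Proof.
move=> mS cw cz mw mz; apply: measurable_cover => // i.
have mSi : measurable (S `&` dom i : set (borel M)).
  by apply: measurableI => //; exact: measurable_dom.
apply: (eq_measurable_fun (fun p : borel M => \sum_b (\sum_a w i p 0 a * invmx (metric_at i p) a b) * z i p 0 b)).
  by move=> p /[!inE] -[_ di]; rewrite (covector_innerE cw cz di) bilinE.
apply: measurable_sum => b; apply: measurable_funM => //.
apply: measurable_sum => a; apply: measurable_funM => //.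
exact: (measurable_funS (measurable_dom i) (@subIsetr _ _ _) (measurable_invmetric a b)).
Qed.

Lemma dform_continuous i f p a : smooth_fun f -> dom i p ->
  {for p, continuous (fun q => dform f i q 0 a)}.
Proof.
move=> sf di.
have : {for p, continuous (fun q => partial a (f \o psi i) (phi i q))}.
  apply: (continuous_chart di (f := partial a (f \o psi i))).
  by have [_ h] := Ck1P (sf i 1%N); apply: h; exact: img_phi.
rewrite /prop_for /continuous_at !mxE => h; under eq_fun do rewrite mxE; exact: h.
Qed.

Lemma dform_measurable (S : set (borel M)) f : smooth_fun f -> measurable S -> cv_measurable S (dform f).
Proof.
move=> sf mS i a; apply: (measurable_funS (measurable_dom i) (@subIsetr _ _ _)).
apply: (@continuous_measurable_real R M) => [|p dp]; first exact: dom_open.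
exact: dform_continuous.
Qed.

Lemma dform_inner_continuous f h p : smooth_fun f -> smooth_fun h ->
  {for p, continuous (covector_inner (dform f) (dform h))}.
Proof.
move=> sf sh; have [i di] := dom_cover p.
have cf := dform_covector sf; have ch := dform_covector sh.
have : {for p, continuous (fun q => \sum_b (\sum_a dform f i q 0 a * invmx (metric_at i q) a b) * dform h i q 0 b)}.
  apply: (@cvg_bigsum _ _ (nbhs p) _ _ _ (fun b q => _)) => b.
  apply: cvgM; last exact: dform_continuous.
  apply: (@cvg_bigsum _ _ (nbhs p) _ _ _ (fun a q => _)) => a.
  apply: cvgM; first exact: dform_continuous.
  exact: invmetric_continuous.
rewrite /prop_for /continuous_at (covector_innerE cf ch di) bilinE.
apply: cvg_trans; apply: (@near_eq_cvg _ _ (nbhs p)).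
by apply: filterS (near_dom di) => q dq; rewrite (covector_innerE cf ch dq) bilinE.
Qed.

End SmoothFunctions.

Lemma prodr_itv01 (R : realDomainType) (I : Type) (r : seq I) (P : pred I) (F : I -> R) :
  (forall i, 0 <= F i <= 1) -> 0 <= \prod_(i <- r | P i) F i <= 1.
Proof.
move=> h; elim/big_rec: _ => [|i x _ /andP[x0 x1]]; first by rewrite ler01 lexx.
by have /andP[f0 f1] := h i; rewrite mulr_ge0//= mulr_ile1.
Qed.

(** * Smooth approximation of indicators of open sets *)

Section Bumps.
Variables (R : realType) (n : nat) (M : closed_riemannian R n.+1).
Implicit Types (i j : chart M) (p : M) (x : 'rV[R]_n.+1).
Local Notation Ck := (of_class (@continuous_in R _)).

Definition ccube m (c : 'rV[R]_m) (r : R) : set 'rV[R]_m := [set x | `|c - x| <= r].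

Lemma ccube_compact m (c : 'rV[R]_m) r : compact (ccube c r).
Proof.
apply: bounded_closed_compact; last exact: closed_closed_ball_.
exists (`|c| + r); split; first exact: num_real.
move=> t ht x /= hx; apply: le_trans (ltW ht).
rewrite -[x](subrK c) addrC (le_trans (ler_normD _ _))// lerD2l.
by rewrite distrC.
Qed.

Lemma ball_ccube m (c : 'rV[R]_m) r : ball c r `<=` ccube c r.
Proof. by move=> x; rewrite -ball_normE /= => /ltW. Qed.

Lemma image_compact i (K : set 'rV[R]_n.+1) : compact K -> K `<=` img i -> compact (psi i @` K).
Proof.
move=> cK Ki; apply: continuous_compact => //.
apply: continuous_in_subspaceT => x /[!inE] /Ki ix; exact: psi_continuous.
Qed.

Lemma compact_closedM (K : set M) : compact K -> closed K.
Proof. by apply: compact_closed; exact: carrier_hausdorff. Qed.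

(* Gluing: a function supported in a compact subset of a chart domain is smooth
   as soon as its expression in that chart is. *)
Lemma smooth_fun_of_chart i (K : set M) (eta : M -> R) :
  compact K -> K `<=` dom i -> (forall p, eta p != 0 -> K p) ->
  (forall j k, Ck k (phi j @` (dom j `&` dom i)) (eta \o psi j)) -> smooth_fun eta.
Proof.
move=> cK Kd sup h j k; apply: Ck_local => x jx.
have [dx|ndx] := pselect (dom i (psi j x)).
  exists (phi j @` (dom j `&` dom i)); last exact: h.
  by exists (psi j x); [split => //; exact: dom_psi|exact: psiK].
have oK : open (~` K) by apply: closed_openC; exact: compact_closedM.
have oU : open (img j `&` psi j @^-1` (~` K)).
  apply: open_preimage => //; first exact: img_open.
  by move=> y; exact: psi_continuous.
exists (img j `&` psi j @^-1` (~` K)); first by split => //= /Kd.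
apply: (Ck_eq (f := fun=> 0)) => //; last exact: Ck_cst.
by move=> y [_ /= ny]; apply/esym/eqP; apply: contra_notT ny => /sup.
Qed.

(** [K] confines all supports to one compact subset of a chart while the open set [U] is assembled
    from countably many pieces. *)
Definition approximable (K U : set M) := exists eta : nat -> M -> R,
  [/\ forall k, smooth_fun (eta k), forall k p, eta k p != 0 -> K p /\ U p,
      forall k p, 0 <= eta k p <= 1 & forall p, eta k p @[k --> \oo] --> (\1_U p : R)].

(** The bump is a product over coordinates of flat functions of [r^2 - (x_a - c_a)^2], which are all
    positive exactly on the cube; the factor [k + 1] drives it to the indicator. *)
Lemma approximable_cube i c0 r0 c r : 0 < r -> ccube c0 r0 `<=` img i ->
  ball c r `<=` ball c0 r0 -> approximable (psi i @` ccube c0 r0) (psi i @` ball c r).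
Proof.
move=> rp Ki sub.
pose q (a : 'I_n.+1) x := r ^+ 2 - (x 0 a - c 0 a) ^+ 2.
pose b (k : nat) x := \prod_(a < n.+1) flat_exp 0 (k.+1%:R * q a x).
have q0P x : (forall a, 0 < q a x) <-> ball c r x.
  have sqlt (u : R) : (u ^+ 2 < r ^+ 2) = (`|u| < r).
    by rewrite -(real_normK (num_real u)) ltr_pXn2r// ?nnegrE// ltW.
  by rewrite (ball_rVP _ _ rp); split => h a; have := h a; rewrite /q subr_gt0 sqlt distrC.
(* Outside [dom i] the value of [phi i] is arbitrary, hence the indicator. *)
pose eta (k : nat) (p : M) : R := \1_(dom i) p * b k (phi i p).
have b01 k x : 0 <= b k x <= 1.
  by apply: prodr_itv01 => a; rewrite flat_exp_ge0 flat_exp0_le1.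
have etan0 k p : eta k p != 0 -> dom i p /\ ball c r (phi i p).
  rewrite /eta mulf_eq0 negb_or indicE => /andP[h1 h2]; split.
    by move: h1; case: (boolP (p \in dom i)) => [/[!inE]//|]; rewrite eqxx.
  apply/q0P => a; have : flat_exp 0 (k.+1%:R * q a (phi i p)) != 0.
    by apply: contra h2 => h2; rewrite /b (bigD1 a)//= (eqP h2) mul0r.
  by rewrite flat_exp0_gt0 pmulr_rgt0.
have Kd : psi i @` ccube c0 r0 `<=` dom i by move=> _ [x /Ki ix <-]; exact: dom_psi.
have sup k p : eta k p != 0 -> (psi i @` ccube c0 r0) p.
  move=> /etan0[dp /sub/ball_ccube h]; exists (phi i p) => //; exact: phiK.
exists eta; split.
- move=> k; apply: (smooth_fun_of_chart (i := i) (K := psi i @` ccube c0 r0)) => //.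
  + by apply: image_compact => //; exact: ccube_compact.
  + exact: sup.
  move=> j l; have oD := @overlap_open _ _ M j i.
  apply: (Ck_eq (f := fun x => \prod_(a < n.+1) flat_exp 0 (k.+1%:R *
      (r ^+ 2 + - 1 * ((phi i (psi j x) 0 a + - c 0 a) * (phi i (psi j x) 0 a + - c 0 a)))))) => //.
    move=> x [p [djp dip] <-]; rewrite /= /eta phiK// indicE mem_set// mul1r.
    by apply: eq_bigr => a _; rewrite /q mulN1r -expr2.
  apply: Ck_prod => // a; apply: Ck_comp_flat_exp => //; apply: CkZ => //.
  apply: CkD => //; first exact: Ck_cst.
  have C1 : Ck l (phi j @` (dom j `&` dom i)) (fun x => phi i (psi j x) 0 a + - c 0 a).
    by apply: CkD => //; [exact: transition_Ck|exact: Ck_cst].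
  by apply: CkZ => //; exact: CkM.
- move=> k p hp; split; first exact: sup hp.
  by have [dp bp] := etan0 _ _ hp; exists (phi i p) => //; exact: phiK.
- move=> k p; have /andP[h1 h2] := b01 k (phi i p).
  by rewrite /eta indicE; case: (_ \in _); rewrite ?mul1r ?mul0r ?h1 ?h2 ?lexx ?ler01.
move=> p; have [dp|ndp] := pselect (dom i p); last first.
  rewrite indicE memNset; last first.
    move=> [x /sub/ball_ccube/Ki ix xp]; apply: ndp; rewrite -xp; exact: dom_psi.
  rewrite (_ : (fun k => _) = cst 0); first exact: cvg_cst.
  by apply/funext => k; rewrite /eta indicE memNset// mul0r.
have -> : \1_(psi i @` ball c r) p = \prod_(a < n.+1) ((0 < q a (phi i p))%R%:R : R).
  rewrite indicE; have [/q0P h|nh] := pselect (ball c r (phi i p)).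
    rewrite mem_set; last by exists (phi i p); [exact/q0P|exact: phiK].
    by rewrite big1// => a _; rewrite h.
  rewrite memNset; last first.
    move=> [x bx xp]; apply: nh; rewrite -xp psiK//.
    by apply: Ki; apply: ball_ccube; exact: sub.
  have /existsNP[a /negP ha] : ~ forall a, 0 < q a (phi i p) by move/q0P.
  by rewrite (bigD1 a)//= (negbTE ha) mul0r.
rewrite (_ : (fun k => _) = fun k => \prod_(a < n.+1) flat_exp 0 (k.+1%:R * q a (phi i p))).
  by apply: (@cvg_bigprod _ _ _ _ _ _ (fun a k => _)) => a; exact: flat_exp0_cvg.
by apply/funext => k; rewrite /eta indicE mem_set// mul1r.
Qed.

(** Diagonal choice: one minus the product of the [1 - eta_j,k] over [j <= k] dominates [eta_j,k] as
    soon as [j <= k], so it tends to 1 on the union, and it vanishes off it. *)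
Lemma approximable_bigcup (K : set M) (U : nat -> set M) :
  (forall k, approximable K (U k)) -> approximable K (\bigcup_k U k).
Proof.
move=> /choice[eta h].
pose z k p := 1 - \prod_(j < k.+1) (1 - eta j k p).
have p01 k p (j : nat) : 0 <= 1 - eta j k p <= 1.
  by have [_ _ /(_ k p)/andP[h1 h2] _] := h j; rewrite subr_ge0 h2 gerBl.
have P01 k p Q : 0 <= \prod_(j < k.+1 | Q j) (1 - eta j k p) <= 1 by apply: prodr_itv01.
exists z; split.
- move=> k; apply: (@smooth_fun_eq _ _ M (fun p => 1 + -1 * \prod_(j < k.+1) (1 - eta j k p))).
    by move=> p; rewrite mulN1r.
  apply: smooth_funD; first exact: smooth_fun_cst.
  apply: smooth_funZ; elim: k.+1 => [|m IH].
    by apply: (@smooth_fun_eq _ _ M (fun=> 1)); [move=> p; rewrite big_ord0|exact: smooth_fun_cst].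
  apply: (@smooth_fun_eq _ _ M (fun p => (\prod_(j < m) (1 - eta j k p)) * (1 + -1 * eta m k p))).
    by move=> p; rewrite big_ord_recr /= mulN1r.
  apply: smooth_funM => //; apply: smooth_funD; first exact: smooth_fun_cst.
  by apply: smooth_funZ; have [+ _ _ _] := h m; exact.
- move=> k p zp; have [j ej] : exists j : 'I_k.+1, eta j k p != 0.
    apply: contrapT => /forallNP h0; move: zp; rewrite /z big1 ?subrr ?eqxx// => j _.
    by have /negP/negPn/eqP -> := h0 j; rewrite subr0.
  by have [_ /(_ k p ej) [Kp Up] _ _] := h j; split => //; exists (val j).
- move=> k p; have /andP[h1 h2] := P01 k p xpredT.
  by rewrite /z subr_ge0 h2 gerBl.
move=> p; rewrite indicE; have [[j _ Ujp]|nU] := pselect ((\bigcup_k U k) p); last first.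
  rewrite memNset//; rewrite (_ : (fun k => _) = cst 0); first exact: cvg_cst.
  apply/funext => k; rewrite /z big1 ?subrr// => j _.
  have -> : eta j k p = 0; last by rewrite subr0.
  have [_ sup _ _] := h j; apply/eqP; apply: contra_notT nU => /sup[_ Up].
  by exists (val j).
rewrite mem_set; last by exists j.
have [_ _ _ /(_ p)] := h j; rewrite indicE mem_set// => ej.
apply: squeeze_cvgr ej (cvg_cst _).
near=> k; have /andP[z0 _] := P01 k p xpredT.
have jk : (j < k.+1)%N by near: k; exists j.
rewrite /z gerBl z0 andbT lerBrDl -lerBrDr (bigD1 (Ordinal jk))//= ler_piMr//.
  by have /andP[] := p01 k p j.
by have /andP[] := P01 k p (fun l => l != Ordinal jk).
Unshelve. all: by end_near.
Qed.


End Bumps.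

(** * Weak differentials *)

Lemma bounded_on_compact (R : realType) (X : topologicalType) (K : set X) (f : X -> R) :
  compact K -> (forall x, K x -> {for x, continuous f}) ->
  exists2 C, 0 <= C & forall x, K x -> `|f x| <= C.
Proof.
move=> cK cf; pose P (A : set X) := exists2 C : R, 0 <= C & forall x, A x -> `|f x| <= C.
apply: (@compact_union_induction X K P).
- exact: cK.
- by exists 0.
- move=> A B [K1 K10 h1] [K2 K20 h2]; exists (K1 + K2); first exact: addr_ge0.
  by move=> p [/h1 h|/h2 h]; apply: le_trans h _; rewrite ?lerDl ?lerDr.
- by move=> A B AB [C C0 h]; exists C => // p /AB; exact: h.
move=> p Kp; exists (f @^-1` ball (f p) 1).
  by apply: continuous_nbhs; [exact: cf|exact: nbhsx_ballx].
exists (`|f p| + 1) => [|q]; first exact: addr_ge0.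
rewrite /preimage -ball_normE /= => /ltW h.
by rewrite -[f q](subrK (f p)) addrC (le_trans (ler_normD _ _))// lerD2l distrC.
Qed.

(** Multiplication by [g > 0] gives [(u + g t b)^2 + (g I - u^2)]; for [g = 0] the hypothesis forces
    [u = 0]. *)
Lemma weighted_discriminant (R : realFieldType) (u b g I t : R) : u ^+ 2 <= g * I ->
  0 <= g -> 0 <= I -> 0 <= I + 2 * t * (u * b) + t ^+ 2 * (g * b ^+ 2).
Proof.
move=> hc g0 I0; have [g00|gp] := eqVneq g 0.
  have : u ^+ 2 <= 0 by rewrite (le_trans hc)// g00 mul0r.
  rewrite -[_ <= 0]andbT -(sqr_ge0 u) -eq_le sqrf_eq0 => /eqP ->.
  by rewrite g00 !mul0r !mulr0 !addr0.
have gpos : 0 < g by rewrite lt0r gp.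
rewrite -(pmulr_rge0 _ gpos).
have : 0 <= (u + g * (t * b)) ^+ 2 by exact: sqr_ge0.
by nra.
Qed.

Lemma normM_le_weighted (R : realFieldType) (u b g I : R) : u ^+ 2 <= g * I ->
  0 <= g -> 0 <= I -> `|u * b| <= I + g * b ^+ 2.
Proof.
move=> hc g0 I0.
have h1 := @weighted_discriminant _ u b g I 1 hc g0 I0.
have h2 := @weighted_discriminant _ u b g I (-1) hc g0 I0.
have h3 : 0 <= g * b ^+ 2 by rewrite mulr_ge0 ?sqr_ge0.
by rewrite ler_norml; apply/andP; split; lra.
Qed.

(** * Integration by parts in coordinates *)

Section DivergenceTheorem.
Variable R : realType.
Local Notation Ck := (of_class (@continuous_in R _)).
Local Notation borV m := (bor 'rV[R]_m).

Lemma lebV_translate_signed m (F : borV m -> \bar R) (v : 'rV[R]_m) :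
  measurable_fun setT F -> (\int[lebV R m]_x F (x + v)%R = \int[lebV R m]_x F x)%E.
Proof.
move=> mF; rewrite [LHS]integralE [RHS]integralE.
have h1 := @lebV_translate R m (F^\+)%E v (measurable_funepos mF) (funepos_ge0 F).
have h2 := @lebV_translate R m (F^\-)%E v (measurable_funeneg mF) (funeneg_ge0 F).
by rewrite -h1 -h2; congr (_ - _)%E; apply: eq_integral => x _; rewrite ?funeposE ?funenegE.
Qed.

Lemma integrable_compact_support m (F : borV m -> R) C r :
  measurable_fun setT F -> 0 <= C ->
  (forall x, `|F x| <= C * \1_(ball (0 : 'rV[R]_m) r) x) ->
  (lebV R m).-integrable setT (EFin \o F).
Proof.
move=> mF C0 hF.
have mB : measurable (ball (0 : 'rV[R]_m) r : set (borV m)).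
  by apply: open_bor; exact: ball_open.
apply/integrableP; split; first exact/measurable_EFinP.
apply: (@le_lt_trans _ _ (\int[lebV R m]_x (C * \1_(ball (0 : 'rV[R]_m) r) x)%:E)%E).
  apply: ge0_le_integral => //.
  - by apply/measurable_EFinP; exact: measurableT_comp.
  - by apply/measurable_EFinP; apply: measurable_funM => //; exact: measurable_indic.
  - by move=> x _; rewrite lee_fin; exact: hF.
under eq_integral do rewrite EFinM.
rewrite ge0_integralZl//; last by apply/measurable_EFinP; exact: measurable_indic.
by rewrite integral_indic// setIT lte_mul_pinfty//; exact: lebV_ball.
Qed.

(** Translation invariance makes the integral of each difference quotient vanish; the mean value
    theorem bounds the quotients and identifies their limit, and dominated convergence concludes. *)
Lemma integral_partial0 m (a : 'I_m) (G : borV m -> R) r :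
  Ck 1 setT G -> (forall x, ~ ball (0 : 'rV[R]_m) r x -> G x = 0) ->
  (\int[lebV R m]_x (partial a G x)%:E = 0)%E.
Proof.
move=> CG G0; set e : 'rV[R]_m := delta_mx 0 a.
have [dG cG] := Ck1P CG.
have cG0 : continuous (G : 'rV[R]_m -> R).
  by move=> x; exact: (CkW openT CG).
have mcont (f : 'rV[R]_m -> R) : continuous f -> measurable_fun setT (f : borV m -> R).
  by move=> cf; apply: continuous_measurable_real => [|x _]; [exact: openT|exact: cf].
have mG : measurable_fun setT G by exact: mcont.
have mdG : measurable_fun setT (partial a G : borV m -> R).
  by apply: mcont => x; exact: cG.
have dG0 x : ~ ccube (0 : 'rV[R]_m) r x -> partial a G x = 0.
  move=> nx; have -> : partial a G x = partial a (fun=> 0) x; last exact: derive_cst.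
  apply: near_eq_derive.
  have oC : open (~` ccube (0 : 'rV[R]_m) r) by apply: closed_openC; exact: closed_closed_ball_.
  by apply: filterS (open_nbhs_nbhs (conj oC nx)) => y ny; apply: G0 => /ball_ccube.
have [C C0 hC] : exists2 C, 0 <= C & forall x, `|partial a G x| <= C.
  have [C C0 h] := bounded_on_compact (@ccube_compact R m 0 r) (f := partial a G) (fun x _ => cG a x Logic.I).
  exists C => // x; have [/h//|/dG0 ->] := pselect (ccube (0 : 'rV[R]_m) r x).
  by rewrite normr0.
have [C' C'0 hC'] : exists2 C', 0 <= C' & forall x, `|G x| <= C' * \1_(ball (0 : 'rV[R]_m) r) x.
  have [C' C'0 h] := bounded_on_compact (@ccube_compact R m 0 r) (f := G) (fun x _ => cG0 x).
  exists C' => // x; have [bx|nx] := pselect (ball (0 : 'rV[R]_m) r x).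
    by rewrite indicE mem_set// mulr1; apply: h; exact: ball_ccube.
  by rewrite (G0 _ nx) normr0 indicE memNset// mulr0.
have IG := integrable_compact_support mG C'0 hC'.
pose t (k : nat) : R := k.+1%:R^-1.
have t0 k : 0 < t k by rewrite invr_gt0.
have t1 k : t k <= 1 by rewrite invf_le1// ler1n.
pose f_ (k : nat) (x : borV m) : R := (t k)^-1 * (G (x + t k *: e) - G x).
have f_E k x : exists2 s : R, `|s| <= t k & f_ k x = partial a G (s *: e + x).
  have [|s [s1 _] E] := @MVT_coord R m G a x (t k); first by move=> s _ _; exact: dG.
  exists s; first by rewrite (le_trans s1)// ger0_norm// ltW.
  by rewrite /f_ [x + _]addrC E mulrC mulfK// gt_eqF.
have mf_ k : measurable_fun setT (f_ k).
  apply: measurable_funM => //; apply: measurable_funB => //.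
  exact: measurableT_comp mG (measurable_translate (t k *: e)).
have If_ k : (\int[lebV R m]_x (f_ k x)%:E = 0)%E.
  have mGv := measurableT_comp mG (measurable_translate (t k *: e)).
  have IGv : (lebV R m).-integrable setT (fun x : borV m => (G (x + t k *: e))%:E).
    apply/integrableP; split; first exact/measurable_EFinP.
    have [_] := integrableP _ _ _ IG; apply: le_lt_trans.
    rewrite -[leRHS](@lebV_translate_signed m _ (t k *: e))//.
    by apply/measurable_EFinP; exact: measurableT_comp.
  rewrite /f_; under eq_integral do rewrite EFinM EFinB.
  rewrite integralZl//; last exact: integrableB.
  rewrite integralB// (@lebV_translate_signed m (EFin \o G))//; last exact/measurable_EFinP.
  by rewrite subee ?mule0//; exact: integrable_fin_num.
(* The shifts have length at most 1, so the quotients vanish off the ball of radius [r + 1]. *)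
have mB : measurable (ball (0 : 'rV[R]_m) (r + 1) : set (borV m)).
  by apply: open_bor; exact: ball_open.
have f_b k x : `|f_ k x| <= C * \1_(ball (0 : 'rV[R]_m) (r + 1)) x.
  have [bx|nx] := pselect (ball (0 : 'rV[R]_m) (r + 1) x).
    by rewrite indicE mem_set// mulr1; have [s _ ->] := f_E k x.
  rewrite indicE memNset// mulr0 /f_ !G0 ?subrr ?mulr0 ?normr0//.
    by apply: contra_not nx; apply: le_ball; rewrite lerDl.
  apply: contra_not nx; rewrite -!ball_normE /= !sub0r !normrN => h.
  rewrite -[x](addrK (t k *: e)) (le_lt_trans (ler_normB _ _))// ltr_leD//.
  rewrite normrZ ger0_norm ?(ltW (t0 k))// mulr_ile1 ?(ltW (t0 k))//.
  apply: normr_rV_leP => // j; rewrite mxE /=.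
  by case: (j == a); rewrite ?normr1 ?normr0.
have Ig : (lebV R m).-integrable setT (EFin \o (fun x : borV m => C * \1_(ball (0 : 'rV[R]_m) (r + 1)) x)).
  apply: (@integrable_compact_support _ _ C (r + 1)) => //.
    by apply: measurable_funM => //; exact: measurable_indic.
  by move=> x; rewrite ger0_norm// mulr_ge0.
have cf_ x : f_ k x @[k --> \oo] --> partial a G x.
  apply/cvgrPdist_lt => eps eps0.
  have := cG a x Logic.I; move=> /cvgrPdist_lt /(_ _ eps0) /nbhs_ballP[d d0 hd].
  near=> k; have [s st ->] := f_E k x; apply: hd; rewrite -ball_normE /=.
  rewrite opprD addrCA subrr addr0 normrN normrZ.
  have e1 : `|e| <= 1.
    by apply: normr_rV_leP => // j; rewrite mxE /=; case: (j == a); rewrite ?normr1 ?normr0.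
  apply: (@le_lt_trans _ _ (t k)); first by rewrite -[leRHS]mulr1 ler_pM.
  by near: k; exact: (near_infty_natSinv_lt (PosNum d0)).
have [|||||_ _ h] := @dominated_convergence _ _ R (lebV R m) setT measurableT
    (fun k => EFin \o f_ k) (EFin \o partial a G)
    (EFin \o (fun x : borV m => C * \1_(ball (0 : 'rV[R]_m) (r + 1)) x)).
- by move=> k; exact/measurable_EFinP.
- exact/measurable_EFinP.
- by apply: aeW => x _; apply: cvg_EFin; [exact: nearW|exact: cf_].
- exact: Ig.
- by apply: aeW => x k _; rewrite lee_fin.
apply/esym; apply: (cvg_unique _ _ h) => //.
rewrite (_ : [sequence _]_n = cst 0%E); first exact: cvg_cst.
by apply/funext => k; exact: If_.
Unshelve. all: by end_near.
Qed.

End DivergenceTheorem.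

Section IntegralSubset.
Context d (T : measurableType d) (R : realType) (mu : {measure set T -> \bar R}).
Variables (A B : set T) (mA : measurable A) (mB : measurable B) (AB : A `<=` B).
Implicit Types f : T -> R.

Lemma Int_subset f : Int mu B f -> Int mu A f.
Proof. exact: integrableS. Qed.

Lemma RInt_subset f : Int mu B f -> (forall x, B x -> 0 <= f x) ->
  \int[mu]_(x in A) f x <= \int[mu]_(x in B) f x.
Proof.
move=> hf f0; rewrite -lee_fin (RIntE mA (Int_subset hf)) (RIntE mB hf).
apply: ge0_subset_integral => //; first by have [] := integrableP _ _ _ hf.
Qed.

Lemma L2_subset f : L2 mu B f -> L2 mu A f.
Proof.
move=> hf; have [mf _] := hf; split; first exact: measurable_funS mf.
exact: (Int_lty mA (Int_subset (L2_sq hf))).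
Qed.

End IntegralSubset.

(** * Pairings of functions and covector fields with test functions *)

Section WeakDifferential.
Variables (R : realType) (n : nat) (M : closed_riemannian R n.+1).
Variables (vol : {measure set (borel M) -> \bar R}) (hvol : is_volume vol).
Variables (S : set M) (oS : open S).
Implicit Types (i j : chart M) (p : M) (x : 'rV[R]_n.+1) (f h : M -> R) (w z : covector_field M).
Local Notation Ck := (of_class (@continuous_in R _)).

Let volT : (vol setT < +oo)%E := vol_finite hvol.

Lemma mS : measurable (S : set (borel M)).
Proof. exact: (@open_bor M). Qed.

Lemma open_SI i : open (S `&` dom i).
Proof. by apply: openI => //; exact: dom_open. Qed.

Lemma mSI i : measurable (S `&` dom i : set (borel M)).
Proof. by apply: (@open_bor M); exact: open_SI. Qed.

Definition cvL2 w := [/\ is_covector_field w, cv_measurable (S : set (borel M)) w &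
  (\int[vol]_(p in (S : set (borel M))) (covector_inner w w p)%:E < +oo)%E].

Lemma cvL2_Int w : cvL2 w -> Int vol (S : set (borel M)) (covector_inner w w).
Proof.
move=> [cw mw iw]; apply: Int_ge0P => //.
  exact: (covector_inner_measurable mS).
by move=> p _; exact: covector_inner_ge0.
Qed.

Lemma cvL2_Int2 w z : cvL2 w -> cvL2 z -> Int vol (S : set (borel M)) (covector_inner w z).
Proof.
move=> hw hz; apply: (Int_le mS _ _ (IntD mS (cvL2_Int hw) (cvL2_Int hz))).
  by case: hw hz => [? ? _] [? ? _]; exact: (covector_inner_measurable mS).
by move=> p _; exact: covector_inner_abs.
Qed.

Lemma cvL2_axpy a w z : cvL2 w -> cvL2 z -> cvL2 (cv_axpy a w z).
Proof.
move=> hw hz; have [cw mw _] := hw; have [cz mz _] := hz; split.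
- exact: cv_axpy_covector.
- move=> i b; rewrite (_ : (fun p => _) = fun p => a * w i p 0 b + z i p 0 b).
    by apply: measurable_funD => //; exact: measurable_funM.
  by apply/funext => p; rewrite !mxE.
apply: (Int_lty mS); apply: (@Int_eq _ _ _ vol _ mS (fun p => a ^+ 2 * covector_inner w w p +
  (2 * a * covector_inner w z p + covector_inner z z p))).
  move=> p _; rewrite covector_inner_axpyl !covector_inner_axpyr (covector_innerC z w).
  by ring.
apply: (IntD mS); first by apply: (IntZ mS); exact: cvL2_Int.
by apply: (IntD mS); [apply: (IntZ mS); exact: cvL2_Int2|exact: cvL2_Int].
Qed.

Lemma dform_cvL2 f : smooth_fun f -> cvL2 (dform f).
Proof.
move=> sf; split; [exact: dform_covector|exact: dform_measurable mS|].
have [C C0 hC] := @continuous_bounded _ _ _ (covector_inner (dform f) (dform f))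
  (fun p => dform_inner_continuous sf sf).
apply: (Int_lty mS); apply: (Int_le mS _ _ (Int_cst mS volT C)).
  by apply: (covector_inner_measurable mS); (exact: dform_covector || exact: dform_measurable mS).
by move=> p _; exact: hC.
Qed.

Lemma smooth_L2 f : smooth_fun f -> L2 vol (S : set (borel M)) f.
Proof.
move=> sf; have [C C0 hC] := continuous_bounded (smooth_fun_continuous sf).
apply: (L2_bounded mS volT (K := C)) => //.
by apply: (continuous_measurable_real (X := M)) => // p _; exact: smooth_fun_continuous.
Qed.

Section TestFunction.
Variables (i : chart M) (a : 'I_n.+1) (eta : M -> R).
Hypothesis (seta : smooth_fun eta).
Hypothesis (sup : closure [set p | eta p != 0] `<=` S `&` dom i).
Let K := closure [set p | eta p != 0].
Let O : set (borel M) := S `&` dom i.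
Let mO : measurable O := mSI i.

(** Division by the volume density turns the integral against [vol] into a Lebesgue integral in the
    chart; [test_val] is the companion for the other side of the integration by parts. *)
Definition test_deriv p := partial a (eta \o psi i) (phi i p) / Num.sqrt (\det (metric_at i p)).
Definition test_val p := eta p / Num.sqrt (\det (metric_at i p)).

Lemma sqdet_phi_gt0 p : dom i p -> 0 < Num.sqrt (\det (metric_at i p)).
Proof. by move=> dp; have := sqdet_gt0 (img_phi dp). Qed.

Lemma sqdet_phi_continuous p : dom i p ->
  {for p, continuous (fun q => Num.sqrt (\det (metric_at i q)))}.
Proof.
move=> dp; apply: (continuous_chart dp (f := sqdet i)).
by apply: sqdet_continuous; exact: img_phi.
Qed.

Let supp_compact : compact K.
Proof.
apply: (subclosed_compact _ (@carrier_compact _ _ M)) => //.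
exact: closed_closure.
Qed.

Let supp_bounded (F : M -> R) : (forall p, dom i p -> {for p, continuous F}) ->
  (forall p, dom i p -> ~ K p -> F p = 0) ->
  exists2 C, 0 <= C & forall p, O p -> `|F p| <= C.
Proof.
move=> cF F0; have [|C C0 hC] := bounded_on_compact supp_compact (f := F).
  by move=> p /sup[_ dp]; exact: cF.
exists C => // p [_ dp]; have [/hC//|/(F0 _ dp) ->] := pselect (K p).
by rewrite normr0.
Qed.

Lemma eta0 p : ~ K p -> eta p = 0.
Proof. by move=> nK; apply/eqP; apply: contra_notT nK => h; exact: subset_closure. Qed.

Lemma test_deriv_continuous p : dom i p -> {for p, continuous test_deriv}.
Proof.
move=> dp; apply: cvgM.
  apply: (continuous_chart dp (f := partial a (eta \o psi i))).
  by have [_ h] := Ck1P (seta i 1%N); apply: h; exact: img_phi.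
apply: cvgV; last exact: sqdet_phi_continuous.
by rewrite gt_eqF// sqdet_phi_gt0.
Qed.

Lemma test_val_continuous p : dom i p -> {for p, continuous test_val}.
Proof.
move=> dp; apply: cvgM; first exact: smooth_fun_continuous.
apply: cvgV; last exact: sqdet_phi_continuous.
by rewrite gt_eqF// sqdet_phi_gt0.
Qed.

Lemma partial_eta0 p : dom i p -> ~ K p -> partial a (eta \o psi i) (phi i p) = 0.
Proof.
move=> dp nK; have -> : partial a (eta \o psi i) (phi i p) = partial a (fun=> 0) (phi i p).
  apply: near_eq_derive.
  have oU : open (phi i @` (dom i `&` ~` K)).
    apply: image_open => [|q []//]; apply: openI; first exact: dom_open.
    by apply: closed_openC; exact: closed_closure.
  have Up : (phi i @` (dom i `&` ~` K)) (phi i p) by exists p.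
  apply: filterS (open_nbhs_nbhs (conj oU Up)) => x [q [dq nq] <-].
  by rewrite /= phiK// eta0.
exact: derive_cst.
Qed.

Lemma test_deriv_bounded : exists2 C, 0 <= C & forall p, O p -> `|test_deriv p| <= C.
Proof.
apply: supp_bounded => [p dp|p dp nK]; first exact: test_deriv_continuous.
by rewrite /test_deriv partial_eta0// mul0r.
Qed.

Lemma test_deriv_measurable : measurable_fun O (test_deriv : borel M -> R).
Proof.
apply: (continuous_measurable_real (X := M)) => [|p [_ dp]]; first exact: open_SI.
exact: test_deriv_continuous.
Qed.

Lemma test_val_measurable : measurable_fun O (test_val : borel M -> R).
Proof.
apply: (continuous_measurable_real (X := M)) => [|p [_ dp]]; first exact: open_SI.
exact: test_val_continuous.
Qed.

Lemma L2_test_Int f : L2 vol (S : set (borel M)) f -> Int vol O (fun p => f p * test_deriv p).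
Proof.
move=> /(L2_subset mO mS (@subIsetl _ _ _)) hf.
have [C C0 hC] := test_deriv_bounded.
exact: (L2_Int mO volT (L2_bddM mO hf test_deriv_measurable hC)).
Qed.

(** The weight in [(w_a test_val)^2 <= |w|^2 weight], which follows from [covector_coord]. *)
Let weight p := metric_at i p a a * test_val p ^+ 2.

Let weight_Int : Int vol O weight.
Proof.
have cw p : dom i p -> {for p, continuous weight}.
  move=> dp; apply: cvgM; first exact: metric_continuous.
  by apply: cvgM; exact: test_val_continuous.
have [|C C0 hC] := supp_bounded cw.
  by move=> p dp nK; rewrite /weight /test_val eta0// mul0r expr0n /= mulr0.
apply: (Int_le mO _ hC (Int_cst mO volT C)).
by apply: (continuous_measurable_real (X := M)) => [|p [_ dp]]; [exact: open_SI|exact: cw].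
Qed.

Lemma cv_test_Int w : cvL2 w -> Int vol O (fun p => w i p 0 a * test_val p).
Proof.
move=> hw; have [cw mw _] := hw.
apply: (Int_le mO _ _ (IntD mO (Int_subset mO mS (@subIsetl _ _ _) (cvL2_Int hw)) weight_Int)).
  exact: (@measurable_funM _ _ _ _ _ (test_val : borel M -> R) (mw i a) test_val_measurable).
move=> p [_ dp]; have hc := covector_coord a cw dp.
have := covector_inner_ge0 w p; have := posdef_ge0 (delta_mx 0 a) (metric_posdef dp).
rewrite /bilin trmx_delta -rowE -colE !mxE /weight => g0 I0.
move: hc g0 I0; move: (w i p 0 a) (metric_at i p a a) (covector_inner w w p) (test_val p).
move=> u g I b hc g0 I0.
exact: normM_le_weighted.
Qed.

(** Makes the pairing with a fixed test function continuous in [w] for the L^2 norm, as [WD_limit]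
    requires. *)
Lemma cv_test_CS w : cvL2 w -> (\int[vol]_(p in O) (w i p 0 a * test_val p)) ^+ 2 <=
  (\int[vol]_(p in (S : set (borel M))) covector_inner w w p) * \int[vol]_(p in O) weight p.
Proof.
move=> hw; have [cw _ _] := hw; have Iw := Int_subset mO mS (@subIsetl _ _ _) (cvL2_Int hw).
apply: (@le_trans _ _ ((\int[vol]_(p in O) covector_inner w w p) * \int[vol]_(p in O) weight p)).
  apply: quadratic_discriminant => t; have h1 := cv_test_Int hw; have h2 := weight_Int.
  rewrite -(RIntZ mO)// -(RIntZ mO)// -(RIntD mO)//; last exact: (IntZ mO).
  rewrite -(RIntD mO)//; [|by apply: (IntD mO) => //; exact: (IntZ mO)|exact: (IntZ mO)].
  apply: Rintegral_ge0 => p [_ dp]; have hc := covector_coord a cw dp.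
  have := covector_inner_ge0 w p; have := posdef_ge0 (delta_mx 0 a) (metric_posdef dp).
  rewrite /bilin trmx_delta -rowE -colE !mxE /weight.
  move: hc; move: (w i p 0 a) (metric_at i p a a) (covector_inner w w p) (test_val p).
  move=> u g I b hc g0 I0.
  exact: weighted_discriminant.
apply: ler_wpM2r.
  apply: Rintegral_ge0 => p [_ dp]; rewrite mulr_ge0 ?sqr_ge0//.
  have := posdef_ge0 (delta_mx 0 a) (metric_posdef dp).
  by rewrite /bilin trmx_delta -rowE -colE !mxE.
apply: (RInt_subset mO mS (@subIsetl _ _ _)); first exact: cvL2_Int.
by move=> p _; exact: covector_inner_ge0.
Qed.

End TestFunction.

End WeakDifferential.

Lemma sqr_cvg0 (R : realType) (u v : nat -> R) (C : R) : (forall k, u k ^+ 2 <= v k * C) ->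
  v k @[k --> \oo] --> (0 : R) -> u k @[k --> \oo] --> (0 : R).
Proof.
move=> h v0; have h2 : u k ^+ 2 @[k --> \oo] --> (0 : R).
  apply: (@squeeze_cvgr nat \oo _ R (fun=> 0) (fun k => v k * C)).
  - by near=> k; rewrite sqr_ge0 h.
  - exact: cvg_cst.
  - by rewrite -[X in _ --> X](mul0r C); apply: cvgM => //; exact: cvg_cst.
apply: norm_cvg0; have := @continuous_cvg _ _ _ _ _ _ _ _ (@sqrt_continuous R 0) h2.
rewrite sqrtr0 (_ : _ \o _ = fun k => `|u k|); first exact.
by apply/funext => k /=; rewrite sqrtr_sqr.
Unshelve. all: by end_near.
Qed.

(** Open sets are stable under intersection and generate the Borel sets, so by Dynkin's argument the
    integrals over all Borel sets vanish. *)
Lemma open_integrals_ae0 (R : realType) (X : ptopologicalType)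
    (mu : {measure set (bor X) -> \bar R}) (y : bor X -> R) : Int mu setT y ->
  (forall V : set X, open V -> (\int[mu]_(x in (V : set (bor X))) (y x)%:E = 0)%E) ->
  {ae mu, forall x, y x = 0}.
Proof.
move=> Iy hV; have IyS (A : set (bor X)) : measurable A -> mu.-integrable A (EFin \o y).
  by move=> mA; apply: integrableS Iy.
have IyT : (\int[mu]_x (y x)%:E = 0)%E by apply: hV; exact: openT.
have P A : measurable A -> (\int[mu]_(x in A) (y x)%:E = 0)%E.
  move=> mA; move: (A) mA.
  apply: (@dynkin_induction _ (bor X) (@open X)
    (fun A => (\int[mu]_(x in (A : set (bor X))) (y x)%:E = 0)%E)) => //.
  - by move=> U V; exact: openI.
  - move=> B mB hB; have := IyT; rewrite -(setUv B) integral_setU//.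
    + by rewrite hB add0e.
    + exact: measurableC.
    + by rewrite setUv; have [] := integrableP _ _ _ Iy.
    + by apply/disj_setPCl.
  move=> F mF tF hF; rewrite (integral_bigcup tF mF); last first.
    by apply: IyS; exact: bigcup_measurable.
  by rewrite eseries0.
have h : ae_eq mu setT (EFin \o y) (cst 0%E).
  apply: integral_ae_eq => //; first by move=> E _ mE; rewrite P// integral0.
by apply: filterS h => x /(_ Logic.I) [].
Qed.

(** * Linearity, closedness and uniqueness of the weak differential *)

Section WeakDifferentialTheory.
Variables (R : realType) (n : nat) (M : closed_riemannian R n.+1).
Variables (vol : {measure set (borel M) -> \bar R}) (hvol : is_volume vol).
Variables (S : set M) (oS : open S).
Implicit Types (i j : chart M) (p : M) (x : 'rV[R]_n.+1) (f h : M -> R) (w z : covector_field M).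
Local Notation Ck := (of_class (@continuous_in R _)).
Local Notation L2S := (L2 vol (S : set (borel M))).
Local Notation cvL2 := (cvL2 vol S).
Local Notation O i := (S `&` dom i : set (borel M)).

Let volT : (vol setT < +oo)%E := vol_finite hvol.
Let mO i : measurable (O i) := mSI oS i.

(** [weak_differential] with the test data grouped into [test_deriv] and [test_val], so that both
    integrals are pairings whose integrability is already known. *)
Definition WD f w := cvL2 w /\ forall i a eta, smooth_fun eta ->
  closure [set p | eta p != 0] `<=` S `&` dom i ->
  \int[vol]_(p in O i) (f p * test_deriv i a eta p) =
  - \int[vol]_(p in O i) (w i p 0 a * test_val i eta p).

Lemma WDP f w : weak_differential vol (S : set (borel M)) f w <-> WD f w.
Proof.
split=> [[cw mw iw h]|[[cw mw iw] h]]; split => // i a eta se sup.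
  rewrite [RHS](_ : _ = - \int[vol]_(p in O i)
    (w i p 0 a * eta p / Num.sqrt (\det (metric_at i p)))).
    by rewrite -(h i a eta se sup); apply: RInt_eq => p _; rewrite mulrA.
  by congr (- _); apply: RInt_eq => p _; rewrite mulrA.
have := h i a eta se sup; rewrite /test_deriv /test_val => E.
under [LHS]eq_Rintegral do rewrite -mulrA.
by rewrite E; under [in RHS]eq_Rintegral do rewrite -mulrA.
Qed.

Lemma WD_axpy c f h w z : L2S f -> L2S h -> WD f w -> WD h z ->
  WD (fun p => c * f p + h p) (cv_axpy c w z).
Proof.
move=> hf hh [cw dw] [cz dz]; split; first exact: cvL2_axpy.
move=> i a eta se sup.
have I1 := L2_test_Int hvol oS a se sup hf; have I2 := L2_test_Int hvol oS a se sup hh.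
have J1 := cv_test_Int hvol oS a se sup cw; have J2 := cv_test_Int hvol oS a se sup cz.
rewrite (@RInt_eq _ _ _ vol _ _ (fun p => c * (f p * test_deriv i a eta p) + h p * test_deriv i a eta p)); last first.
  by move=> p _; ring.
rewrite [in RHS](@RInt_eq _ _ _ vol _ _ (fun p => c * (w i p 0 a * test_val i eta p) + z i p 0 a * test_val i eta p)); last first.
  by move=> p _; rewrite !mxE; ring.
rewrite (RIntD (mO i))//; last exact: IntZ.
rewrite [in RHS](RIntD (mO i))//; last exact: IntZ.
by rewrite !(RIntZ (mO i))// dw// dz//; ring.
Qed.

(** The weak differential is a closed operator: for fixed test data both pairings are continuous in
    L^2. *)
Lemma WD_limit (f_ : nat -> M -> R) f (w_ : nat -> covector_field M) w : (forall k, L2S (f_ k)) -> L2S f -> (forall k, WD (f_ k) (w_ k)) ->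
  cvL2 w -> \int[vol]_(p in (S : set (borel M))) ((f_ k p - f p) ^+ 2) @[k --> \oo] --> (0 : R) ->
  \int[vol]_(p in (S : set (borel M))) covector_inner (cv_axpy (-1) w (w_ k)) (cv_axpy (-1) w (w_ k)) p
    @[k --> \oo] --> (0 : R) ->
  WD f w.
Proof.
move=> hf_ hf h_ hw cf cw; split => // i a eta se sup.
have I1 := L2_test_Int hvol oS a se sup hf.
have I2 k := L2_test_Int hvol oS a se sup (hf_ k).
have J1 := cv_test_Int hvol oS a se sup hw.
have J2 k := cv_test_Int hvol oS a se sup (h_ k).1.
have [C C0 hC] := test_deriv_bounded a se sup.
have mSO : O i `<=` S by exact: subIsetl.
have Ltest : L2 vol (O i) (test_deriv i a eta).
  exact: (L2_bounded (mO i) volT (test_deriv_measurable oS a se) hC).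
have l1 : \int[vol]_(p in O i) (f_ k p * test_deriv i a eta p) @[k --> \oo] -->
    \int[vol]_(p in O i) (f p * test_deriv i a eta p).
  apply: (RInt_cvg_pair (mO i)) => //.
  - by move=> k; exact: (L2_subset (mO i) (mS oS) mSO (hf_ k)).
  - exact: (L2_subset (mO i) (mS oS) mSO hf).
  - apply: (@squeeze_cvgr nat \oo _ R (fun=> 0) _ _ _ _ _ cf); last exact: cvg_cst.
    near=> k; apply/andP; split; first by apply: Rintegral_ge0 => p _; exact: sqr_ge0.
    apply: (RInt_subset (mO i) (mS oS) mSO); last by move=> p _; exact: sqr_ge0.
    by apply: L2_sq; apply: L2B => //; exact: mS.
have l2 : (- \int[vol]_(p in O i) (w_ k i p 0 a * test_val i eta p)) @[k --> \oo] -->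
    (- \int[vol]_(p in O i) (w i p 0 a * test_val i eta p)).
  apply: cvgN; apply/subr_cvg0.
  apply: (sqr_cvg0 _ cw) => k.
  rewrite -(RIntB (mO i))//.
  rewrite (@RInt_eq _ _ _ vol _ _ (fun p => cv_axpy (-1) w (w_ k) i p 0 a * test_val i eta p)); last first.
    by move=> p _; rewrite !mxE; ring.
  apply: (cv_test_CS hvol oS a se sup).
  by apply: cvL2_axpy => //; exact: (h_ k).1.
apply: (cvg_unique _ l1) => //.
rewrite (_ : (fun k => _) = fun k => - \int[vol]_(p in O i) (w_ k i p 0 a * test_val i eta p)); first exact: l2.
by apply/funext => k; exact: (h_ k).2.
Unshelve. all: by end_near.
Qed.

(** In the chart the two integrands add up to the [a]-th partial derivative of [f eta] divided by
    the volume density. The density cancels, and [integral_partial0] applies to the extension of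
    [f eta] by zero. *)
Lemma WD_smooth f : smooth_fun f -> WD f (dform f).
Proof.
move=> sf; split; first exact: dform_cvL2.
move=> i a eta se sup.
set K := closure [set p | eta p != 0] in sup.
have cK : compact K.
  apply: (subclosed_compact _ (@carrier_compact _ _ M)) => //.
  exact: closed_closure.
have Kd : K `<=` dom i by move=> p /sup[].
have If := L2_test_Int hvol oS a se sup (smooth_L2 hvol oS sf).
have Iw := cv_test_Int hvol oS a se sup (dform_cvL2 hvol oS sf).
apply/eqP; rewrite -subr_eq0 opprK -(RIntD (mO i))//.
pose Kx := phi i @` K.
have cKx : compact Kx.
  apply: continuous_compact => //; apply: continuous_in_subspaceT => p /[!inE] Kp.
  by apply: phi_continuous; exact: Kd.
have oC : open (~` Kx).
  by apply: closed_openC; apply: compact_closed => //; exact: norm_hausdorff.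
(* The indicator produces the extension by zero: outside the image of the chart, [psi i] is
   arbitrary. *)
pose G : 'rV[R]_n.+1 -> R := fun x => f (psi i x) * (eta (psi i x) * \1_Kx x).
have eta0K p : ~ K p -> eta p = 0.
  by move=> nK; apply/eqP; apply: contra_notT nK => h; exact: subset_closure.
have Gimg x : img i x -> G x = f (psi i x) * eta (psi i x).
  move=> ix; rewrite /G indicE; have [/set_mem Kxx|nK] := boolP (x \in Kx); first by rewrite mulr1.
  rewrite [eta _]eta0K ?mul0r// => Kp; move: nK; rewrite notin_setE; apply.
  by exists (psi i x) => //; exact: psiK.
have G0 x : ~ Kx x -> G x = 0.
  by move=> nK; rewrite /G indicE memNset// !mulr0.
have CG : Ck 1 setT G.
  apply: Ck_local => x _; have [ix|nix] := pselect (img i x).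
    exists (img i) => //; apply: (Ck_eq (f := fun x => f (psi i x) * eta (psi i x))).
    - exact: img_open.
    - by move=> y iy; rewrite Gimg.
    - by apply: CkM; [exact: img_open|exact: sf|exact: se].
  exists (~` Kx); first by move=> [p /Kd dp E]; apply: nix; exists p.
  apply: (Ck_eq (f := fun=> 0)) => //; first by move=> y ny; rewrite G0.
  exact: Ck_cst.
have [r hr] : exists r, Kx `<=` ball (0 : 'rV[R]_n.+1) r.
  have /compact_bounded[B [_ /(_ (B + 1))]] := cKx; rewrite ltrDl ltr01 => /(_ isT) h.
  exists (B + 2) => x Kxx; rewrite -ball_normE /= sub0r normrN (le_lt_trans (h _ Kxx))//.
  by lra.
have Gr x : ~ ball (0 : 'rV[R]_n.+1) r x -> G x = 0.
  by move=> nb; apply: G0 => /hr.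
have E0 := integral_partial0 a CG Gr.
have Eimg x : img i x -> f (psi i x) * test_deriv i a eta (psi i x) +
    dform f i (psi i x) 0 a * test_val i eta (psi i x) = partial a G x / sqdet i x.
  move=> ix; have -> : partial a G x =
      partial a (fun x => f (psi i x) * eta (psi i x)) x.
    apply: near_eq_derive.
    by apply: filterS (open_nbhs_nbhs (conj (@img_open _ _ M i) ix)) => y; exact: Gimg.
  rewrite /partial deriveM; last 2 first.
  - by have [h _] := Ck1P (sf i 1%N); exact: h.
  - by have [h _] := Ck1P (se i 1%N); exact: h.
  rewrite /test_deriv /test_val /dform mxE /partial /metric_at psiK// /sqdet /GRing.scale /=.
  rewrite /comp; set u := 'D__ _ _; set v := 'D__ _ _; set q := Num.sqrt _.
  by ring.
have IE : (\int[vol]_(p in O i) (f p * test_deriv i a eta p + dform f i p 0 a * test_val i eta p)%:E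
   = \int[lebV R n.+1]_x (partial a G x)%:E)%E.
  rewrite (integral_chart hvol (i := i) (mO i))//; last first.
    by apply/measurable_EFinP; exact: (Int_meas (IntD (mO i) If Iw)).
  rewrite [RHS](_ : _ = \int[lebV R n.+1]_(x in (img i `&` psi i @^-1` (O i) : set (bor 'rV[R]_n.+1)))
      (partial a G x)%:E)%E.
    by apply: eq_integral => x /[!inE] -[ix _]; rewrite -EFinM Eimg// divfK// gt_eqF// sqdet_gt0.
  rewrite [RHS]integral_mkcond; apply: eq_integral => x _; rewrite patchE.
  case: ifPn => // /negP; rewrite inE => nE.
  have nK : ~ Kx x.
    by move=> [p Kp E]; apply: nE; rewrite -E; split; [exact/img_phi/Kd|rewrite /= phiK//; [exact: sup|exact: Kd]].
  have -> : partial a G x = partial a (fun=> 0) x; last by rewrite /partial derive_cst.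
  by apply: near_eq_derive; apply: filterS (open_nbhs_nbhs (conj oC nK)) => y; exact: G0.
by rewrite /Rintegral IE E0.
Qed.

Section Uniqueness.
Variable z : covector_field M.
Hypothesis hz : cvL2 z.
Hypothesis z0 : forall i a eta, smooth_fun eta ->
  closure [set p | eta p != 0] `<=` S `&` dom i ->
  \int[vol]_(p in O i) (z i p 0 a * test_val i eta p) = 0.

(** The quotient of [z_a] by the volume density, cut off to a cube, has zero integral over every
    open [V]: test functions converge boundedly to the indicator of the intersection of [V] with the
    cube. *)
Let local_claim i a c r : 0 < r -> ball c (2 * r) `<=` phi i @` O i ->
  {ae vol, forall p : borel M, (psi i @` ball c r) p -> z i p 0 a = 0}.
Proof.
move=> r0 sub; set U0 := psi i @` ball c r; set K0 := psi i @` ccube c r.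
have cb : ccube c r `<=` ball c (2 * r).
  by move=> x; rewrite /ccube -ball_normE /= => h; lra.
have bi : ball c r `<=` img i.
  by move=> x /ball_ccube /cb /sub [p [_ dp] <-]; exact: img_phi.
have ci : ccube c r `<=` img i by move=> x /cb /sub [p [_ dp] <-]; exact: img_phi.
have K0O : K0 `<=` O i.
  by move=> _ [x /cb /sub [p Op <-] <-]; rewrite phiK//; case: Op.
have U0K : U0 `<=` K0 by move=> _ [x /ball_ccube cx <-]; exists x.
have cK0 : compact K0 by apply: image_compact => //; exact: ccube_compact.
have U0E : U0 = dom i `&` phi i @^-1` ball c r.
  apply/seteqP; split => [_ [x bx <-]|p [dp bp]].
    by split; [exact/dom_psi/bi|rewrite /= psiK//; exact: bi].
  by exists (phi i p) => //; exact: phiK.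
have oU0 : open U0 by rewrite U0E; apply: preimage_open; exact: ball_open.
have mU0 : measurable (U0 : set (borel M)) by exact: (@open_bor M).
pose s p := (Num.sqrt (\det (metric_at i p)))^-1.
have cs p : dom i p -> {for p, continuous s}.
  move=> dp; apply: cvgV; last exact: sqdet_phi_continuous.
  by rewrite gt_eqF// sqdet_phi_gt0.
pose weight p := metric_at i p a a * s p ^+ 2.
have [|C C0 hC] := bounded_on_compact cK0 (f := weight).
  move=> p /K0O[_ dp]; apply: cvgM; first exact: metric_continuous.
  by apply: cvgM; exact: cs.
pose y (p : borel M) := z i p 0 a * s p.
have [cw mw _] := hz.
have Uo : (U0 : set (borel M)) `<=` O i by move=> p /U0K /K0O.
have US : (U0 : set (borel M)) `<=` S by move=> p /Uo[].
have IyU : Int vol (U0 : set (borel M)) y.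
  apply: (Int_le mU0 _ _ (IntD mU0 (Int_subset mU0 (mS oS) US (cvL2_Int oS hz)) (Int_cst mU0 volT C))).
    apply: measurable_funM; first exact: (measurable_funS (mO i) Uo (mw i a)).
    by apply: (continuous_measurable_real (X := M)) => // p /Uo[_ dp]; exact: cs.
  move=> p Up; have [_ dp] := Uo _ Up; have hc := covector_coord a cw dp.
  have := covector_inner_ge0 z p; have := posdef_ge0 (delta_mx 0 a) (metric_posdef dp).
  rewrite /bilin trmx_delta -rowE -colE !mxE => g0 I0.
  apply: (le_trans (normM_le_weighted (s p) hc g0 I0)); rewrite lerD2l.
  by apply: le_trans (hC p (U0K _ Up)); rewrite ler_norm.
have IY : Int vol setT (y \_ U0).
  by rewrite /Int -restrict_EFin; apply/integrable_restrict => //; rewrite setTI.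
suff : {ae vol, forall p : borel M, (y \_ U0) p = 0}.
  apply: filterS => p; rewrite patchE => h Up; move: h; rewrite mem_set//.
  have [_ dp] := Uo _ Up; move=> /eqP; rewrite mulf_eq0 => /orP[/eqP //|].
  by rewrite invr_eq0 gt_eqF// sqdet_phi_gt0.
apply: open_integrals_ae0 IY _ => V oV.
have mV : measurable (V : set (borel M)) by exact: (@open_bor M).
(* The intersection is a countable union of chart cubes, each approximable with supports in the
   compact [K0]. *)
have [eta [se es e01 ec]] : approximable K0 (V `&` U0).
  have [cc [rr [rr0 hcc]]] := @countable_cubes R n.+1.
  pose W := phi i @` (V `&` U0).
  have VUd : V `&` U0 `<=` dom i by move=> p [_ /Uo[]].
  have oW : open W by apply: image_open VUd; exact: openI.
  pose UU k := if `[< ball (cc k) (rr k) `<=` W >] then psi i @` ball (cc k) (rr k) else set0.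
  rewrite (_ : V `&` U0 = \bigcup_k UU k).
    apply: approximable_bigcup => k; rewrite /UU; case: asboolP => [h|_].
      apply: approximable_cube => // x /h [p [_ [x' bx' <-]] <-].
      by rewrite psiK//; exact: bi.
    exists (fun _ _ => 0); split => [_|k' p|k' p|p].
    - exact: smooth_fun_cst.
    - by rewrite eqxx.
    - by rewrite lexx ler01.
    - by rewrite indic0; exact: cvg_cst.
  apply/seteqP; split => [p VUp|p [k _]].
    have [|k [bk sk]] := hcc W (phi i p) oW; first by exists p.
    exists k => //; rewrite /UU asboolT; last first.
      apply: subset_trans sk; apply: le_ball.
      by have := rr0 k; lra.
    by exists (phi i p) => //; rewrite phiK//; exact: VUd.
  rewrite /UU; case: asboolP => // h [x /h [q qV <-] <-].
  by rewrite phiK//; exact: VUd.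
have supk k : closure [set p | eta k p != 0] `<=` S `&` dom i.
  apply: subset_trans K0O; rewrite [X in _ `<=` X](closure_id K0).1; last exact: compact_closedM.
  by apply: closure_subset => p /= /es[].
have zk k : \int[vol]_(p in (U0 : set (borel M))) (y p * eta k p) = 0.
  rewrite -(z0 a (se k) (supk k)) -[X in \int[vol]_(p in X) _ = _](setIidr Uo).
  rewrite Rintegral_mkcondr; apply: RInt_eq => p _; rewrite patchE.
  case: ifPn => [_|/negP]; first by rewrite /test_val /y /s; ring.
  rewrite inE => nU; rewrite /test_val; have [->|/es[_ []//]] := eqVneq (eta k p) 0.
  by rewrite mul0r mulr0.
have ml : \int[vol]_(p in (U0 : set (borel M))) (y p * eta k p) @[k --> \oo] -->
  \int[vol]_(p in (U0 : set (borel M))) (y p * \1_(V `&` U0) p).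
  apply: (RInt_dct mU0 _ _ _ (Int_norm IyU) _).2.
  - move=> k; apply: measurable_funM; first exact: Int_meas IyU.
    apply: (continuous_measurable_real (X := M)) => // p _.
    exact: smooth_fun_continuous.
  - apply: measurable_funM; first exact: Int_meas IyU.
    by apply: measurable_indic; exact: measurableI.
  - by apply: aeW => p Up; apply: cvgM; [exact: cvg_cst|exact: ec].
  - apply: aeW => p Up k; rewrite normrM ler_piMr//.
    by have /andP[h1 h2] := e01 k p; rewrite ger0_norm.
have : \int[vol]_(p in (U0 : set (borel M))) (y p * \1_(V `&` U0) p) = 0.
  apply/esym; apply: (cvg_unique _ _ ml) => //.
  by rewrite (_ : (fun k => _) = cst 0); [exact: cvg_cst|apply/funext => k; exact: zk].
have IyV : Int vol (U0 : set (borel M)) (fun p => y p * \1_(V `&` U0) p).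
  apply: (Int_le mU0 _ _ (Int_norm IyU)).
    apply: measurable_funM; first exact: Int_meas IyU.
    by apply: measurable_indic; exact: measurableI.
  by move=> p _; rewrite normrM ler_piMr// indicE; case: (_ \in _); rewrite ?normr1 ?normr0.
move=> h; have := RIntE mU0 IyV; rewrite h => E.
rewrite (_ : (\int[vol]_(p in (V : set (borel M))) ((y \_ U0) p)%:E)%E =
  (\int[vol]_(p in (V `&` U0 : set (borel M))) (y p)%:E)%E); last first.
  by rewrite integral_mkcondr; apply: eq_integral => p _; rewrite !patchE; case: ifP.
apply/esym; rewrite -[LHS]/(0%:E) E setIC integral_mkcondr; apply: eq_integral => p /[!inE] Up.
rewrite patchE indicE; case: ifPn => [/set_mem Vp|/negP]; first by rewrite mem_set ?mulr1.
by rewrite inE => nV; rewrite memNset ?mulr0// => -[].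
Qed.

(** Countably many cubes together with finitely many charts and components keep the exceptional set
    null. *)
Lemma cv_ae0 : {ae vol, forall p : borel M, S p -> forall i, dom i p -> z i p = 0}.
Proof.
have [c [r [r0 hc]]] := @countable_cubes R n.+1.
have h k : {ae vol, forall p : borel M, forall i (a : 'I_n.+1),
    ball (c k) (2 * r k) `<=` phi i @` O i -> (psi i @` ball (c k) (r k)) p -> z i p 0 a = 0}.
  apply: (@filter_forall _ _ (fun i (p : borel M) => forall a, _) (almost_everywhere vol) _) => i.
  apply: (@filter_forall _ _ (fun a (p : borel M) => _) (almost_everywhere vol) _) => a.
  have [sub|nsub] := pselect (ball (c k) (2 * r k) `<=` phi i @` O i); last by apply: aeW => p /nsub.
  by have := @local_claim i a (c k) (r k) (r0 k) sub; apply: filterS => p hp _.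
have := ae_foralln h; apply: filterS => p hp Sp i dp; apply/rowP => a; rewrite [RHS]mxE.
have oW : open (phi i @` O i) by apply: image_open => [|q []//]; exact: open_SI.
have [|k [bk sk]] := hc _ (phi i p) oW; first by exists p.
by apply: (hp k i a sk); exists (phi i p) => //; exact: phiK.
Qed.

End Uniqueness.

(** The difference is a weak differential of the zero function. This frees the later integrals from
    the choice made by [weak_diff]. *)
Lemma WD_uniq f w w' : L2S f -> WD f w -> WD f w' ->
  {ae vol, forall p : borel M, S p -> forall i, dom i p -> w i p = w' i p}.
Proof.
move=> hf hw hw'; have [hz z0] := WD_axpy (-1) hf hf hw' hw.
have h : forall i a eta, smooth_fun eta ->
    closure [set p | eta p != 0] `<=` S `&` dom i ->
    \int[vol]_(p in O i) (cv_axpy (-1) w' w i p 0 a * test_val i eta p) = 0.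
  move=> i a eta se sup; apply/eqP; rewrite -oppr_eq0 -z0//; apply/eqP.
  rewrite (@RInt_eq _ _ _ vol _ _ (fun=> 0)).
    by rewrite /Rintegral integral0.
  by move=> p _; rewrite mulN1r addNr mul0r.
have := cv_ae0 hz h; apply: filterS => p hp Sp i dp.
by have := hp Sp i dp; rewrite /cv_axpy scaleN1r addrC => /eqP; rewrite subr_eq0 => /eqP.
Qed.

Local Notation mS := (mS oS).

Lemma WD_inner_ae f h w z w' z' : L2S f -> L2S h -> WD f w -> WD h z -> WD f w' -> WD h z' ->
  {ae vol, forall p : borel M, S p -> covector_inner w z p = covector_inner w' z' p}.
Proof.
move=> hf hh hw hz hw' hz'.
have := WD_uniq hf hw hw'; apply: filterS2 (WD_uniq hh hz hz') => p h1 h2 Sp.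
have [i dp H] := in_chart_pick p.
by rewrite /covector_inner !H h1// h2.
Qed.

Lemma RInt_ae_eq (D : set (borel M)) (f g : borel M -> R) : measurable D ->
  measurable_fun D f -> measurable_fun D g ->
  {ae vol, forall p, D p -> f p = g p} -> \int[vol]_(p in D) f p = \int[vol]_(p in D) g p.
Proof.
move=> mD mf mg h; congr fine; apply: ae_eq_integral => //; try exact/measurable_EFinP.
by apply: (@filterS _ (almost_everywhere vol) _ _ _ _ h) => p hp Dp; rewrite hp.
Qed.

End WeakDifferentialTheory.

(** * Sobolev spaces *)

(** Arithmetic of the error bounds in [H10_comp], where [C] is the square of the Lipschitz constant,
    [g = 4^-k], and [c], [d] are the errors of the two coefficients. *)
Lemma composition_bound (R : realFieldType) (C g a b c d : R) : 0 <= C -> 0 <= g ->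
  0 <= c -> 0 <= d -> a <= g -> b <= g ->
  [/\ 2 * C * (a + b) <= 16 * C * g + 8 * (c + d),
      4 * C * (a + b) + 8 * (c + d) <= 16 * C * g + 8 * (c + d)
    & 2 * C * g + 2 * C * g <= 16 * C * g + 8 * (c + d)].
Proof.
move=> C0 g0 c0 d0 ag bg; have Cg := mulr_ge0 C0 g0.
have h1 : C * a <= C * g by rewrite ler_wpM2l.
have h2 : C * b <= C * g by rewrite ler_wpM2l.
by split; lra.
Qed.

Lemma four_term_bound (R : realFieldType) (u v c t1 t2 t3 t4 t5 t6 : R) : 0 <= c -> u <= c -> v <= c ->
  0 <= t1 -> 0 <= t2 -> t5 <= 2 * t3 + 2 * t4 -> t6 <= 2 * v * t2 + 2 * t5 ->
  2 * u * t1 + 2 * t6 <= 4 * c * (t1 + t2) + 8 * (t3 + t4).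
Proof.
move=> c0 uc vc p1 p2 h5 h6; have := mulr_ge0 c0 p1.
have h1 : u * t1 <= c * t1 by rewrite ler_wpM2r.
have h2 : v * t2 <= c * t2 by rewrite ler_wpM2r.
by lra.
Qed.

Section DifferentialCalculus.
Variables (R : realType) (n : nat) (M : closed_riemannian R n.+1).
Implicit Types (i : chart M) (p : M) (f h : M -> R).

Lemma dform_derivable i f p a : smooth_fun f -> dom i p ->
  derivable (f \o psi i) (phi i p) (delta_mx 0 a).
Proof. by move=> sf dp; have [h _] := Ck1P (sf i 1%N); apply: h; exact: img_phi. Qed.

Lemma dform_axpy i c f h p : smooth_fun f -> smooth_fun h -> dom i p ->
  dform (fun p => c * f p + h p) i p = c *: dform f i p + dform h i p.
Proof.
move=> sf sh dp; apply/rowP => a; rewrite !mxE /partial.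
have df := @dform_derivable i f p a sf dp; have dh := @dform_derivable i h p a sh dp.
rewrite (_ : _ \o psi i = c *: (f \o psi i : 'rV[R]_n.+1 -> R) + (h \o psi i : 'rV[R]_n.+1 -> R)); last exact/funext.
by rewrite (deriveD (derivableZ df) dh) (deriveZ c df).
Qed.

Lemma dform_M i f h p : smooth_fun f -> smooth_fun h -> dom i p ->
  dform (fun p => f p * h p) i p = f p *: dform h i p + h p *: dform f i p.
Proof.
move=> sf sh dp; apply/rowP => a; rewrite !mxE /partial.
have df := @dform_derivable i f p a sf dp; have dh := @dform_derivable i h p a sh dp.
rewrite (_ : _ \o psi i = (f \o psi i : 'rV[R]_n.+1 -> R) * (h \o psi i : 'rV[R]_n.+1 -> R)); last exact/funext.
by rewrite (deriveM df dh) /= (phiK dp).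
Qed.

Lemma dform_cst i c p : dform (fun _ : M => c) i p = 0.
Proof. by apply/rowP => a; rewrite !mxE /partial derive_cst. Qed.

End DifferentialCalculus.

Section SobolevSpace.
Variables (R : realType) (n : nat) (M : closed_riemannian R n.+1).
Variables (vol : {measure set (borel M) -> \bar R}) (hvol : is_volume vol).
Variables (S : set M) (oS : open S).
Implicit Types (i j : chart M) (p : M) (f h : M -> R) (w z : covector_field M).
Local Notation L2S := (L2 vol (S : set (borel M))).
Local Notation cvL2 := (cvL2 vol S).
Local Notation WD := (WD vol S).
Local Notation H1 := (H1 vol (S : set (borel M))).
Local Notation wd := (weak_diff vol (S : set (borel M))).
Local Notation mS := (mS oS).
Local Notation "∫ f" := (\int[vol]_(p in (S : set (borel M))) f p) (at level 36, f at level 36).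

Let volT : (vol setT < +oo)%E := vol_finite hvol.

Lemma H1P f : H1 f <-> L2S f /\ exists w, WD f w.
Proof.
by split=> [[mf If [w /WDP hw]]|[[mf If] [w /WDP hw]]]; [split=> //|split=> //]; exists w.
Qed.

Lemma H1_L2 f : H1 f -> L2S f. Proof. by case/H1P. Qed.

Lemma H1_wd f : H1 f -> WD f (wd f).
Proof.
move=> [_ _ [w hw]]; apply/WDP; rewrite /weak_diff.
by case: xgetP => [z -> //|/(_ w)].
Qed.

(** [DD] is the squared L^2 norm of an explicit covector field, [sq] that of a function, and [gg]
    the Dirichlet form, which goes through the chosen [weak_diff]. Estimates are made on [DD] and
    transferred by [ggE]. *)
Definition DD w := \int[vol]_(p in (S : set (borel M))) covector_inner w w p.
Definition sq f := \int[vol]_(p in (S : set (borel M))) (f p ^+ 2).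
Definition gg f h := \int[vol]_(p in (S : set (borel M))) grad_inner vol (S : set (borel M)) f h p.

Lemma sq_ge0 f : 0 <= sq f.
Proof. by apply: Rintegral_ge0 => p _; exact: sqr_ge0. Qed.

Lemma DD_ge0 w : 0 <= DD w.
Proof. by apply: Rintegral_ge0 => p _; exact: covector_inner_ge0. Qed.

Lemma gg_ge0 f : 0 <= gg f f.
Proof. exact: DD_ge0. Qed.

Lemma grad_inner_Int f h : H1 f -> H1 h ->
  Int vol (S : set (borel M)) (grad_inner vol (S : set (borel M)) f h).
Proof. by move=> /H1_wd[cf _] /H1_wd[ch _]; exact: cvL2_Int2. Qed.

Lemma grad_innerE f h w z : H1 f -> H1 h -> WD f w -> WD h z ->
  {ae vol, forall p : borel M, S p -> grad_inner vol (S : set (borel M)) f h p = covector_inner w z p}.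
Proof.
move=> hf hh hw hz; exact: (WD_inner_ae hvol oS (H1_L2 hf) (H1_L2 hh) (H1_wd hf) (H1_wd hh)).
Qed.

Lemma ggE f h w z : H1 f -> H1 h -> WD f w -> WD h z ->
  gg f h = \int[vol]_(p in (S : set (borel M))) covector_inner w z p.
Proof.
move=> hf hh hw hz; apply: (RInt_ae_eq mS); last exact: grad_innerE.
  exact: (Int_meas (grad_inner_Int hf hh)).
by apply: (@Int_meas _ _ _ vol); apply: cvL2_Int2; [exact: oS|exact: hw.1|exact: hz.1].
Qed.

Lemma H1_axpy c f h : H1 f -> H1 h -> H1 (fun p => c * f p + h p).
Proof.
move=> hf hh; apply/H1P; split.
  by apply: (L2D mS); [apply: (L2Z mS); exact: H1_L2|exact: H1_L2].
by exists (cv_axpy c (wd f) (wd h)); apply: (WD_axpy hvol oS); (exact: H1_L2 || exact: H1_wd).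
Qed.

Lemma H1_smooth f : smooth_fun f -> H1 f.
Proof. by move=> sf; apply/H1P; split; [exact: smooth_L2|exists (dform f); exact: WD_smooth]. Qed.

Lemma ggC f h : gg f h = gg h f.
Proof. by apply: RInt_eq => p _; exact: covector_innerC. Qed.

Lemma gg_axpy c f h k : H1 f -> H1 h -> H1 k ->
  gg (fun p => c * f p + h p) k = c * gg f k + gg h k.
Proof.
move=> hf hh hk.
rewrite (ggE (H1_axpy c hf hh) hk (WD_axpy hvol oS c (H1_L2 hf) (H1_L2 hh) (H1_wd hf) (H1_wd hh)) (H1_wd hk)).
have I1 := grad_inner_Int hf hk; have I2 := grad_inner_Int hh hk.
rewrite /gg -(RIntZ mS)// -(RIntD mS)//; last exact: (IntZ mS).
by apply: RInt_eq => p _; rewrite covector_inner_axpyl.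
Qed.

Lemma gg_quad c f h : H1 f -> H1 h ->
  gg (fun p => c * f p + h p) (fun p => c * f p + h p) =
  c ^+ 2 * gg f f + 2 * c * gg f h + gg h h.
Proof.
move=> hf hh; have ha := H1_axpy c hf hh.
move: (gg_axpy c hf hh ha) (gg_axpy c hf hh hf) (gg_axpy c hf hh hh).
set k := fun p => _ => -> h1 h2.
rewrite (ggC f k) (ggC h k) h1 h2 (ggC h f); move: (gg f f) (gg f h) (gg h h) => a b d; ring.
Qed.

Lemma inner_axpy_le c w z p : covector_inner (cv_axpy c w z) (cv_axpy c w z) p <=
  2 * c ^+ 2 * covector_inner w w p + 2 * covector_inner z z p.
Proof.
have := covector_inner_ge0 (cv_axpy (- c) w z) p.
rewrite !covector_inner_axpyl !covector_inner_axpyr (covector_innerC z w).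
by set u := covector_inner w w p; set v := covector_inner w z p; set t := covector_inner z z p; nra.
Qed.

Lemma covector_inner_eq w z p : (forall i, dom i p -> w i p = z i p) ->
  covector_inner w w p = covector_inner z z p.
Proof. by move=> h; rewrite /covector_inner; have [i dp H] := in_chart_pick p; rewrite !H h. Qed.

Lemma DD_axpy_le c w z : cvL2 w -> cvL2 z ->
  DD (cv_axpy c w z) <= 2 * c ^+ 2 * DD w + 2 * DD z.
Proof.
move=> hw hz; have h1 := cvL2_Int oS hw; have h2 := cvL2_Int oS hz.
rewrite /DD -!(RIntZ mS)// -(RIntD mS)//; try exact: (IntZ mS).
apply: (RInt_le mS); [exact: (cvL2_Int oS (cvL2_axpy oS c hw hz))|by apply: (IntD mS); apply: (IntZ mS)|].
by move=> p _; exact: inner_axpy_le.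
Qed.

Definition cv_mul (g : M -> R) w : covector_field M := fun i p => g p *: w i p.

Lemma cv_mul_inner g w p :
  covector_inner (cv_mul g w) (cv_mul g w) p = g p ^+ 2 * covector_inner w w p.
Proof.
rewrite /covector_inner; have [i dp H] := in_chart_pick p; rewrite !H /cv_mul.
by rewrite bilinZl bilinC ?bilinZl ?mulrA//; have [] := posdef_inv (metric_posdef dp).
Qed.

Lemma cvL2_mul (g : borel M -> R) w C : measurable_fun (S : set (borel M)) g ->
  (forall p, S p -> `|g p| <= C) -> cvL2 w -> cvL2 (cv_mul g w).
Proof.
move=> mg gC hw; have [cw mw _] := hw.
have c1 : is_covector_field (cv_mul g w).
  by move=> i j p dip djp; rewrite /cv_mul (cw i j p dip djp) scalemxAl.
have c2 : cv_measurable (S : set (borel M)) (cv_mul g w).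
  move=> i a; rewrite (_ : (fun p => _) = fun p => g p * w i p 0 a); last first.
    by apply/funext => p; rewrite mxE.
  apply: measurable_funM; last exact: mw.
  by apply: (measurable_funS mS (@subIsetl _ _ _)).
split=> //; apply: (Int_lty mS).
apply: (Int_le mS _ _ (IntZ mS (C ^+ 2) (cvL2_Int oS hw))).
  by apply: (covector_inner_measurable mS).
move=> p Sp; rewrite ger0_norm ?covector_inner_ge0// cv_mul_inner ler_wpM2r ?covector_inner_ge0//.
rewrite -(real_normK (num_real (g p))) lerXn2r ?nnegrE//; last exact: gC.
by apply: le_trans (gC p Sp).
Qed.

Lemma ae_cvg_fast (f_ : nat -> M -> R) f : (forall k, L2S (f_ k)) -> L2S f ->
  (forall k, sq (fun p => -1 * f p + f_ k p) <= 4^-1 ^+ k) ->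
  {ae vol, forall p : borel M, S p -> f_ k p @[k --> \oo] --> f p}.
Proof.
move=> hk hf h; have hd k : L2S (fun p => -1 * f p + f_ k p) by apply: (L2D mS) => //; exact: (L2Z mS).
have h1 k : measurable_fun (S : set (borel M)) (fun p => (-1 * f p + f_ k p) ^+ 2).
  by apply: measurable_funX; have [] := hd k.
have h2 k : (\int[vol]_(p in (S : set (borel M))) ((-1 * f p + f_ k p) ^+ 2)%:E <= (4^-1 ^+ k)%:E)%E.
  by rewrite -(RIntE mS) ?lee_fin; [exact: h|exact: L2_sq].
have := Int_ae_cvg0 mS h1 (fun k p _ => sqr_ge0 _) h2.
apply: filterS => p hp Sp; have [C hC] := hp Sp.
apply/subr_cvg0; apply: (@sqr_cvg0 _ _ (fun k => 2^-1 ^+ k) C).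
  by move=> k; rewrite [leRHS]mulrC addrC -mulN1r.
by apply: cvg_expr; rewrite ger0_norm ?invr_ge0// invf_lt1// ltr1n.
Qed.

Lemma sq_axpy_le c f h : L2S f -> L2S h ->
  sq (fun p => c * f p + h p) <= 2 * c ^+ 2 * sq f + 2 * sq h.
Proof.
move=> hf hh; have h1 := L2_sq hf; have h2 := L2_sq hh.
rewrite /sq -!(RIntZ mS)// -(RIntD mS)//; try exact: (IntZ mS).
apply: (RInt_le mS); [exact: (L2_sq (L2D mS (L2Z mS c hf) hh))|by apply: (IntD mS); apply: (IntZ mS)|].
by move=> p _; have := sqr_ge0 (c * f p - h p); nra.
Qed.

(** * Functions of zero trace and their smooth approximants *)

Section ZeroTrace.
Variables (Y : set M) (cY : closed Y) (area : {measure set (borel M) -> \bar R}).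
Local Notation H10 := (H10 vol Y area (S : set (borel M))).

Let mY : measurable (Y : set (borel M)).
Proof. exact: (@closed_bor M). Qed.

Definition TY f : \bar R := (\int[area]_(p in (Y : set (borel M))) (f p ^+ 2)%:E)%E.

(** One error [e] bounds the squared L^2 distances of values and differentials and the squared norm
    of [h] on [Y]. The field [w] is explicit, so that it can be identified afterwards. *)
Definition smooth_approx f w h (e : R) :=
  [/\ smooth_fun h, sq (fun p => -1 * f p + h p) <= e,
      DD (cv_axpy (-1) w (dform h)) <= e & (TY h <= e%:E)%E].

Lemma H1_norm_sqr eps f : 0 < eps -> H1 f ->
  H1_norm vol eps (S : set (borel M)) f ^+ 2 = eps * sq f + eps ^+ 3 * gg f f.
Proof.
move=> e0 hf; rewrite /H1_norm sqr_sqrtr// addr_ge0// mulr_ge0//.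
- exact: ltW.
- exact: sq_ge0.
- by rewrite exprn_ge0 ?(ltW e0).
- exact: gg_ge0.
Qed.

(** The approximants give more than the vanishing trace: they certify that [w] is the weak
    differential of [f], so limits and compositions come with their differential. *)
Lemma H10_intro f w (f_ : nat -> M -> R) (e : nat -> R) : L2S f -> cvL2 w ->
  e k @[k --> \oo] --> (0 : R) -> (forall k, smooth_approx f w (f_ k) (e k)) ->
  H10 f /\ WD f w.
Proof.
move=> hf hw e0 hk.
have e_ge0 k : 0 <= e k by have [_ h _ _] := hk k; apply: le_trans h; exact: sq_ge0.
have hs k : H1 (f_ k) by apply: H1_smooth; have [] := hk k.
have WDf : WD f w.
  apply: (WD_limit hvol oS (f_ := f_) (w_ := fun k => dform (f_ k))) => //.
  - by move=> k; exact: H1_L2.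
  - by move=> k; apply: (WD_smooth hvol oS); have [] := hk k.
  - apply: (@squeeze_cvgr nat \oo _ R (fun=> 0) _ _ _ _ _ e0); last exact: cvg_cst.
    near=> k; apply/andP; split; first by apply: Rintegral_ge0 => p _; exact: sqr_ge0.
    have [_ h _ _] := hk k; apply: le_trans h.
    by rewrite /sq le_eqVlt; apply/orP; left; apply/eqP; apply: RInt_eq => p _; rewrite mulN1r addrC.
  - apply: (@squeeze_cvgr nat \oo _ R (fun=> 0) _ _ _ _ _ e0); last exact: cvg_cst.
    by near=> k; apply/andP; split; [exact: DD_ge0|have [] := hk k].
have Hf : H1 f by apply/H1P; split => //; exists w.
split=> //; split => //; split; first exact: measurable_cst.
exists f_; split; first by move=> k; have [] := hk k.
- pose g k p := -1 * f p + f_ k p.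
  rewrite (_ : (fun k => _) = fun k => Num.sqrt (sq (g k) + gg (g k) (g k))); last first.
    apply/funext => k; have -> : (fun p => f_ k p - f p) = g k.
      by apply/funext => p; rewrite /g mulN1r addrC.
    by rewrite /H1_norm expr1n !mul1r.
  rewrite -(@sqrtr0 R); apply: (@continuous_cvg _ _ _ _ _ _ Num.sqrt); first exact: sqrt_continuous.
  apply: (@squeeze_cvgr nat \oo _ R (fun=> 0) (fun k => 2 * e k)).
  + near=> k; apply/andP; split; first by rewrite addr_ge0 ?sq_ge0 ?gg_ge0.
    have [sk h1 h2 _] := hk k; rewrite mulrDl !mul1r lerD//.
    have hd := WD_axpy hvol oS (-1) hf (H1_L2 (hs k)) WDf (WD_smooth hvol oS sk).
    have ha := H1_axpy (-1) Hf (hs k).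
    by rewrite (ggE ha ha hd hd).
  + exact: cvg_cst.
  + by rewrite -[X in _ --> X](mulr0 2); apply: cvgM => //; exact: cvg_cst.
- apply: (@squeeze_cvge nat \oo _ R (fun=> 0%E) _ (fun k => (e k)%:E)).
  + near=> k; apply/andP; split; first by apply: integral_ge0 => p _; rewrite lee_fin sqr_ge0.
    by have [_ _ _ h] := hk k; move: h; rewrite /TY; under [in X in _ -> X]eq_integral do rewrite subr0.
  + exact: cvg_cst.
  + by apply: cvg_EFin => //; exact: nearW.
Unshelve. all: by end_near.
Qed.

(** The rate [4^-k] is chosen so that the values also converge almost everywhere, by
    [ae_cvg_fast]. *)
Lemma H10_elim f w : H10 f -> WD f w ->
  exists f_ : nat -> M -> R, forall k, smooth_approx f w (f_ k) (4^-1 ^+ k).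
Proof.
move=> [Hf [_ [f_ [sf Nf Tf]]]] WDf.
suff h k : exists h, smooth_approx f w h (4^-1 ^+ k) by have [g hg] := choice h; exists g.
have : 0 < 4^-1 ^+ k :> R by rewrite exprn_gt0// invr_gt0.
move: (_ ^+ k) => e e0.
have h1 : \forall j \near \oo, H1_norm vol 1 (S : set (borel M)) (fun p => f_ j p - f p) <= Num.sqrt e.
  have se0 : 0 < Num.sqrt e by rewrite sqrtr_gt0.
  move/cvgrPdist_le : Nf => /(_ _ se0); apply: filterS => j.
  by rewrite sub0r normrN; apply: le_trans; exact: ler_norm.
have h2 : \forall j \near \oo, (TY (f_ j) <= e%:E)%E.
  move: Tf; rewrite (_ : (fun j : nat => _) = (fun j : nat => TY (f_ j))); last first.
    by apply/funext => j; apply: eq_integral => p _; rewrite subr0.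
  move=> Tf; have : \forall j \near \oo, (TY (f_ j) < e%:E)%E.
    apply: (Tf [set y | (y < e%:E)%E]); apply: open_nbhs_nbhs.
    by split; [exact: open_ereal_lt_ereal|rewrite /= lte_fin].
  by apply: filterS => j; exact: ltW.
have [j [hj1 hj2]] : exists j : nat, H1_norm vol 1 (S : set (borel M)) (fun p => f_ j p - f p) <= Num.sqrt e /\ (TY (f_ j) <= e%:E)%E.
  by have [j _ /(_ j (leqnn j)) h] := filterI h1 h2; exists j.
have hs := H1_smooth (sf j).
have E : (fun p => f_ j p - f p) = (fun p => -1 * f p + f_ j p).
  by apply/funext => p; rewrite mulN1r addrC.
have ha := H1_axpy (-1) Hf hs.
have hd := WD_axpy hvol oS (-1) (H1_L2 Hf) (H1_L2 hs) WDf (WD_smooth hvol oS (sf j)).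
have hle : sq (fun p => -1 * f p + f_ j p) + DD (cv_axpy (-1) w (dform (f_ j))) <= e.
  have := H1_norm_sqr ltr01 ha; rewrite expr1n !mul1r (ggE ha ha hd hd) => <-.
  move: hj1; rewrite E; move: (sqrtr_ge0 e); rewrite -{3}(sqr_sqrtr (ltW e0)); move: (Num.sqrt e) => s s0.
  by have := sqrtr_ge0 (1 * sq (fun p => -1 * f p + f_ j p) + 1 ^+ 3 * gg (fun p => -1 * f p + f_ j p) (fun p => -1 * f p + f_ j p)); rewrite -/(H1_norm vol 1 S _); move=> N0 h; rewrite lerXn2r ?nnegrE.
have := sq_ge0 (fun p => -1 * f p + f_ j p); have := DD_ge0 (cv_axpy (-1) w (dform (f_ j))) => d0 q0.
exists (f_ j); split => //.
- by apply: le_trans hle; rewrite lerDl.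
- by apply: le_trans hle; rewrite lerDr.
Qed.

Lemma H10_H1 f : H10 f -> H1 f. Proof. by case. Qed.

Lemma TY_le (c d : R) g f h : 0 <= c -> 0 <= d -> smooth_fun g -> smooth_fun f -> smooth_fun h ->
  (forall p, g p ^+ 2 <= c * f p ^+ 2 + d * h p ^+ 2) ->
  (TY g <= c%:E * TY f + d%:E * TY h)%E.
Proof.
move=> c0 d0 sg sf sh gfh.
have ms k : smooth_fun k -> measurable_fun (Y : set (borel M)) (fun p : borel M => (k p ^+ 2)%:E).
  move=> sk; apply/measurable_EFinP; apply: measurable_funX.
  apply: (measurable_funS (measurableT) (@subsetT _ _)).
  by apply: (continuous_measurable_real (X := M)) => [|p _]; [exact: openT|exact: smooth_fun_continuous].
have k0 k p : (0 <= (k p ^+ 2 : R)%:E)%E by rewrite lee_fin sqr_ge0.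
have ck0 b k p : 0 <= b -> (0 <= b%:E * (k p ^+ 2 : R)%:E)%E.
  by move=> b0; rewrite mule_ge0.
rewrite /TY -!ge0_integralZl//; try exact: ms.
rewrite -ge0_integralD//.
- apply: ge0_le_integral => //; first exact: ms.
    by apply: emeasurable_funD; apply: emeasurable_funM => //; exact: ms.
  by move=> p _; rewrite -!EFinM -EFinD lee_fin.
- by move=> p _; exact: ck0.
- by apply: emeasurable_funM => //; exact: ms.
- by move=> p _; exact: ck0.
- by apply: emeasurable_funM => //; exact: ms.
Qed.

Lemma TY_axpy_le c f h : smooth_fun f -> smooth_fun h ->
  (TY (fun p => c * f p + h p)%R <= (2 * c ^+ 2)%:E * TY f + 2%:E * TY h)%E.
Proof.
move=> sf sh; apply: TY_le => //; first by rewrite mulr_ge0 ?sqr_ge0.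
  by apply: smooth_funD => //; exact: smooth_funZ.
by move=> p; have := sqr_ge0 (c * f p - h p); nra.
Qed.

Lemma H10_WD f : H10 f -> exists w, WD f w.
Proof. by move=> [/H1_wd h _]; exists (wd f). Qed.

Lemma cvg_geo4 : (4^-1 : R) ^+ k @[k --> \oo] --> (0 : R).
Proof. by apply: cvg_expr; rewrite ger0_norm ?invr_ge0// invf_lt1// ltr1n. Qed.

Lemma H10_axpy c f h : H10 f -> H10 h -> H10 (fun p => c * f p + h p).
Proof.
move=> Hf Hh; have [w hw] := H10_WD Hf; have [z hz] := H10_WD Hh.
have [f_ hf] := H10_elim Hf hw; have [h_ hh] := H10_elim Hh hz.
have Lf := H1_L2 (H10_H1 Hf); have Lh := H1_L2 (H10_H1 Hh).
apply: (@H10_intro _ (cv_axpy c w z) (fun k p => c * f_ k p + h_ k p)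
  (fun k => (2 * c ^+ 2 + 2) * 4^-1 ^+ k) _ _ _ _).1.
- by apply: (L2D mS) => //; exact: (L2Z mS).
- by apply: (cvL2_axpy oS); [exact: hw.1|exact: hz.1].
- by rewrite -[X in _ --> X](mulr0 (2 * c ^+ 2 + 2)); apply: cvgM; [exact: cvg_cst|exact: cvg_geo4].
move=> k; have [sf f1 f2 f3] := hf k; have [sh h1 h2 h3] := hh k.
have c0 := sqr_ge0 c.
have sfh : smooth_fun (fun p => c * f_ k p + h_ k p) by apply: smooth_funD => //; exact: smooth_funZ.
move: f1 f2 f3 h1 h2 h3; move: (4^-1 ^+ k) => e f1 f2 f3 h1 h2 h3; split=> //.
- rewrite (_ : sq _ = sq (fun p => c * (-1 * f p + f_ k p) + (-1 * h p + h_ k p))); last first.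
    by apply: RInt_eq => p _; congr (_ ^+ 2); ring.
  apply: (le_trans (sq_axpy_le c _ _)).
  + by apply: (L2D mS); [exact: (L2Z mS)|exact: smooth_L2].
  + by apply: (L2D mS); [exact: (L2Z mS)|exact: smooth_L2].
  + by rewrite [leRHS]mulrDl lerD// ler_wpM2l// mulr_ge0.
- rewrite (_ : DD _ = DD (cv_axpy c (cv_axpy (-1) w (dform (f_ k))) (cv_axpy (-1) z (dform (h_ k))))); last first.
    apply: RInt_eq => p _; apply: covector_inner_eq => i dp.
    rewrite /cv_axpy; rewrite (dform_axpy c sf sh dp).
    by apply/rowP => a; rewrite !mxE; ring.
  apply: (le_trans (DD_axpy_le c _ _)).
  + by apply: (cvL2_axpy oS); [exact: hw.1|exact: dform_cvL2].
  + by apply: (cvL2_axpy oS); [exact: hz.1|exact: dform_cvL2].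
  + by rewrite [leRHS]mulrDl lerD// ler_wpM2l// mulr_ge0.
- apply: (le_trans (TY_axpy_le c sf sh)).
  have -> : ((2 * c ^+ 2 + 2) * e)%:E = ((2 * c ^+ 2)%:E * e%:E + 2%:E * e%:E)%E.
    by rewrite -!EFinM -EFinD mulrDl.
  by rewrite leeD// lee_wpmul2l// lee_fin mulr_ge0.
Qed.

(** * Composition with Lipschitz functions of two variables *)

Section Composition.
(** [F1] and [F2] are the partial derivatives of [F], known through the chain rule on smooth
    functions, a common bound and sequential continuity. *)
Variables (F F1 F2 : R -> R -> R) (C : R).
Hypothesis C0 : 0 <= C.
Hypothesis Fsmooth : forall f h, smooth_fun f -> smooth_fun h ->
  smooth_fun (fun p => F (f p) (h p)).
Hypothesis Fdform : forall f h, smooth_fun f -> smooth_fun h -> forall i p, dom i p ->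
  dform (fun p => F (f p) (h p)) i p =
    F1 (f p) (h p) *: dform f i p + F2 (f p) (h p) *: dform h i p.
Hypothesis FL : forall x y x' y', `|F x y - F x' y'| <= C * (`|x - x'| + `|y - y'|).
Hypothesis F00 : F 0 0 = 0.
Hypothesis F1b : forall x y, `|F1 x y| <= C.
Hypothesis F2b : forall x y, `|F2 x y| <= C.
Hypothesis Fm : forall f h, measurable_fun (S : set (borel M)) (f : borel M -> R) ->
  measurable_fun (S : set (borel M)) (h : borel M -> R) ->
  [/\ measurable_fun (S : set (borel M)) (fun p : borel M => F (f p) (h p)),
     measurable_fun (S : set (borel M)) (fun p : borel M => F1 (f p) (h p))
   & measurable_fun (S : set (borel M)) (fun p : borel M => F2 (f p) (h p))].
Hypothesis Fc : forall (u v : nat -> R) x y, u k @[k --> \oo] --> x -> v k @[k --> \oo] --> y ->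
  F1 (u k) (v k) @[k --> \oo] --> F1 x y /\ F2 (u k) (v k) @[k --> \oo] --> F2 x y.

Let FL2 x y x' y' : (F x y - F x' y') ^+ 2 <= 2 * C ^+ 2 * ((x - x') ^+ 2 + (y - y') ^+ 2).
Proof.
have h := FL x y x' y'; rewrite -(real_normK (num_real (F x y - _))).
rewrite -(real_normK (num_real (x - x'))) -(real_normK (num_real (y - y'))).
move: h (normr_ge0 (F x y - F x' y')) (normr_ge0 (x - x')) (normr_ge0 (y - y')).
move: `|F x y - F x' y'| `|x - x'| `|y - y'| => a b c h a0 b0 c0.
have : a ^+ 2 <= (C * (b + c)) ^+ 2 by rewrite lerXn2r ?nnegrE ?mulr_ge0 ?addr_ge0.
by have := sqr_ge0 (C * (b - c)); nra.
Qed.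

(** The coefficients converge almost everywhere and differ by at most [2 C], so [(2 C)^2 |w|^2]
    dominates. *)
Let coefficient_cvg (G : R -> R -> R) f h (f_ h_ : nat -> M -> R) w :
  (forall x y, `|G x y| <= C) ->
  (forall f h, measurable_fun (S : set (borel M)) (f : borel M -> R) ->
    measurable_fun (S : set (borel M)) (h : borel M -> R) ->
    measurable_fun (S : set (borel M)) (fun p : borel M => G (f p) (h p))) ->
  (forall (u v : nat -> R) x y, u k @[k --> \oo] --> x -> v k @[k --> \oo] --> y ->
    G (u k) (v k) @[k --> \oo] --> G x y) ->
  L2S f -> L2S h -> (forall k, L2S (f_ k)) -> (forall k, L2S (h_ k)) -> cvL2 w ->
  {ae vol, forall p : borel M, S p -> f_ k p @[k --> \oo] --> f p} ->
  {ae vol, forall p : borel M, S p -> h_ k p @[k --> \oo] --> h p} ->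
  DD (cv_mul (fun p => G (f_ k p) (h_ k p) - G (f p) (h p)) w) @[k --> \oo] --> (0 : R).
Proof.
move=> Gb Gm Gc Lf Lh Lfk Lhk hw cf ch; have Iw := cvL2_Int oS hw; have [cw mw _] := hw.
have mG k : measurable_fun (S : set (borel M)) (fun p => G (f_ k p) (h_ k p) - G (f p) (h p)).
  by apply: measurable_funB; apply: Gm; [exact: (Lfk k).1|exact: (Lhk k).1|exact: Lf.1|exact: Lh.1].
have Gb2 k p : `|G (f_ k p) (h_ k p) - G (f p) (h p)| <= 2 * C.
  by rewrite (le_trans (ler_normB _ _))// mulrDl !mul1r lerD.
pose D k p := covector_inner (cv_mul (fun p => G (f_ k p) (h_ k p) - G (f p) (h p)) w)
   (cv_mul (fun p => G (f_ k p) (h_ k p) - G (f p) (h p)) w) p.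
have mD k : measurable_fun (S : set (borel M)) (D k).
  exact: (Int_meas (cvL2_Int oS (cvL2_mul (mG k) (fun p _ => Gb2 k p) hw))).
have h1 : {ae vol, forall p : borel M, S p -> D k p @[k --> \oo] --> (0 : R)}.
  apply: filterS2 cf ch => p h1 h2 Sp.
  rewrite (_ : (fun k => D k p) = fun k =>
    (G (f_ k p) (h_ k p) - G (f p) (h p)) ^+ 2 * covector_inner w w p); last first.
    by apply/funext => k; exact: cv_mul_inner.
  rewrite -[X in _ --> X](mul0r (covector_inner w w p)); apply: cvgM; last exact: cvg_cst.
  suff h0 : G (f_ k p) (h_ k p) - G (f p) (h p) @[k --> \oo] --> (0 : R).
    have -> : 0 = 0 * 0 :> R by rewrite mulr0.
    rewrite (_ : (fun k => _) = fun k => (G (f_ k p) (h_ k p) - G (f p) (h p)) * (G (f_ k p) (h_ k p) - G (f p) (h p))).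
      exact: cvgM.
    by apply/funext => k; rewrite expr2.
  apply/subr_cvg0.
  by apply: Gc; [exact: h1|exact: h2].
have h2 : {ae vol, forall p : borel M, S p -> forall k, `|D k p| <= (2 * C) ^+ 2 * covector_inner w w p}.
  apply: aeW => p Sp k; rewrite ger0_norm ?covector_inner_ge0// /D cv_mul_inner.
  rewrite ler_wpM2r ?covector_inner_ge0// -(real_normK (num_real (_ - _))).
  by rewrite lerXn2r ?nnegrE// mulr_ge0.
have [_] := RInt_dct mS mD (measurable_cst (0 : R)) h1 (IntZ mS _ Iw) h2.
by rewrite [X in _ --> X](_ : _ = 0)// /Rintegral integral0.
Qed.

(** Composing the smooth approximants gives smooth approximants. The error of their differentials
    splits into bounded coefficients times the old errors and coefficient errors times the fixed
    fields [w] and [z]; the latter vanish by [coefficient_cvg]. *)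
Lemma H10_comp f h w z : H10 f -> H10 h -> WD f w -> WD h z ->
  H10 (fun p => F (f p) (h p)) /\
  WD (fun p => F (f p) (h p)) (cv_axpy 1 (cv_mul (fun p => F1 (f p) (h p)) w)
                                   (cv_mul (fun p => F2 (f p) (h p)) z)).
Proof.
move=> Hf Hh hw hz; have [f_ hf] := H10_elim Hf hw; have [h_ hh] := H10_elim Hh hz.
have Lf := H1_L2 (H10_H1 Hf); have Lh := H1_L2 (H10_H1 Hh).
have Lfk k : L2S (f_ k) by apply: smooth_L2 => //; have [] := hf k.
have Lhk k : L2S (h_ k) by apply: smooth_L2 => //; have [] := hh k.
have cf := ae_cvg_fast Lfk Lf (fun k => let: And4 _ h _ _ := hf k in h).
have ch := ae_cvg_fast Lhk Lh (fun k => let: And4 _ h _ _ := hh k in h).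
have [mF mF1 mF2] := Fm Lf.1 Lh.1.
have c1 := @coefficient_cvg F1 f h f_ h_ w F1b (fun f h mf mh => let: And3 _ h _ := Fm mf mh in h)
  (fun u v x y hu hv => (Fc hu hv).1) Lf Lh Lfk Lhk hw.1 cf ch.
have c2 := @coefficient_cvg F2 f h f_ h_ z F2b (fun f h mf mh => let: And3 _ _ h := Fm mf mh in h)
  (fun u v x y hu hv => (Fc hu hv).2) Lf Lh Lfk Lhk hz.1 cf ch.
have LF f' h' : L2S f' -> L2S h' -> L2S (fun p => F (f' p) (h' p)).
  move=> L1 L2'; have [m _ _] := Fm L1.1 L2'.1; apply: (L2P mS) => //.
  have h1 := L2_sq L1; have h2 := L2_sq L2'.
  apply: (Int_le mS _ _ (IntZ mS (2 * C ^+ 2) (IntD mS h1 h2))); first exact: measurable_funX.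
  by move=> p _; rewrite ger0_norm ?sqr_ge0//; have := FL2 (f' p) (h' p) 0 0; rewrite F00 !subr0.
have cF : cvL2 (cv_axpy 1 (cv_mul (fun p => F1 (f p) (h p)) w) (cv_mul (fun p => F2 (f p) (h p)) z)).
  apply: (cvL2_axpy oS); first by apply: cvL2_mul mF1 (fun p _ => F1b _ _) hw.1.
  by apply: cvL2_mul mF2 (fun p _ => F2b _ _) hz.1.
(* The first term covers the contributions of [4^-k] to values, differentials and trace; the second
   contains the two coefficient errors. *)
pose e k := 16 * C ^+ 2 * 4^-1 ^+ k +
  8 * (DD (cv_mul (fun p => F1 (f_ k p) (h_ k p) - F1 (f p) (h p)) w) +
       DD (cv_mul (fun p => F2 (f_ k p) (h_ k p) - F2 (f p) (h p)) z)).
apply: (@H10_intro _ _ (fun k p => F (f_ k p) (h_ k p)) e) => //; first exact: LF.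
  have -> : 0 = 16 * C ^+ 2 * 0 + 8 * (0 + 0) :> R by rewrite mulr0 !add0r mulr0.
  apply: cvgD; first by apply: cvgM; [exact: cvg_cst|exact: cvg_geo4].
  by apply: cvgM; [exact: cvg_cst|exact: cvgD].
move=> k; have [sf f1 f2 f3] := hf k; have [sh h1 h2 h3] := hh k; rewrite /e.
have DD1 := DD_ge0 (cv_mul (fun p => F1 (f_ k p) (h_ k p) - F1 (f p) (h p)) w).
have DD2 := DD_ge0 (cv_mul (fun p => F2 (f_ k p) (h_ k p) - F2 (f p) (h p)) z).
have g4 : 0 <= 4^-1 ^+ k :> R by rewrite exprn_ge0// invr_ge0.
have C2 := sqr_ge0 C.
split.
- exact: Fsmooth.
- have q1 : L2S (fun p => -1 * f p + f_ k p) by apply: (L2D mS) => //; exact: (L2Z mS).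
  have q2 : L2S (fun p => -1 * h p + h_ k p) by apply: (L2D mS) => //; exact: (L2Z mS).
  apply: (@le_trans _ _ (2 * C ^+ 2 * (sq (fun p => -1 * f p + f_ k p) + sq (fun p => -1 * h p + h_ k p)))).
    rewrite /sq -(RIntD mS (L2_sq q1) (L2_sq q2)) -(RIntZ mS _ (IntD mS (L2_sq q1) (L2_sq q2))).
    apply: (RInt_le mS).
    + by apply: L2_sq; apply: (L2D mS); [apply: (L2Z mS)|]; exact: LF.
    + by apply: (IntZ mS); exact: (IntD mS (L2_sq q1) (L2_sq q2)).
    + move=> p _; rewrite !mulN1r ![- _ + _]addrC; exact: FL2.
  by have [] := composition_bound C2 g4 DD1 DD2 f1 h1.
- have q1 := cvL2_axpy oS (-1) hw.1 (dform_cvL2 hvol oS sf).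
  have q2 := cvL2_axpy oS (-1) hz.1 (dform_cvL2 hvol oS sh).
  have q3 : cvL2 (cv_mul (fun p => F1 (f_ k p) (h_ k p) - F1 (f p) (h p)) w).
    apply: (cvL2_mul (C := 2 * C) _ _ hw.1).
      by apply: measurable_funB => //; have [] := Fm (Lfk k).1 (Lhk k).1.
    by move=> p _; rewrite (le_trans (ler_normB _ _))// mulrDl !mul1r lerD.
  have q4 : cvL2 (cv_mul (fun p => F2 (f_ k p) (h_ k p) - F2 (f p) (h p)) z).
    apply: (cvL2_mul (C := 2 * C) _ _ hz.1).
      by apply: measurable_funB => //; have [] := Fm (Lfk k).1 (Lhk k).1.
    by move=> p _; rewrite (le_trans (ler_normB _ _))// mulrDl !mul1r lerD.
  have I1 := cvL2_Int oS q1; have I2 := cvL2_Int oS q2.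
  have I3 := cvL2_Int oS q3; have I4 := cvL2_Int oS q4.
  have I12 := IntZ mS (4 * C ^+ 2) (IntD mS I1 I2); have I34 := IntZ mS 8 (IntD mS I3 I4).
  apply: (@le_trans _ _ (4 * C ^+ 2 * (DD (cv_axpy (-1) w (dform (f_ k))) + DD (cv_axpy (-1) z (dform (h_ k)))) +
     8 * (DD (cv_mul (fun p => F1 (f_ k p) (h_ k p) - F1 (f p) (h p)) w) +
       DD (cv_mul (fun p => F2 (f_ k p) (h_ k p) - F2 (f p) (h p)) z)))).
    rewrite /DD -(RIntD mS I1 I2) -(RIntD mS I3 I4) -(RIntZ mS _ (IntD mS I1 I2)) -(RIntZ mS _ (IntD mS I3 I4)).
    rewrite -(RIntD mS I12 I34); apply: (RInt_le mS).
    + by apply: (cvL2_Int oS); apply: (cvL2_axpy oS) => //; apply: dform_cvL2 => //; exact: Fsmooth.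
    + exact: (IntD mS I12 I34).
    move=> p _; set A1 := cv_axpy (-1) w (dform (f_ k)); set A2 := cv_axpy (-1) z (dform (h_ k)).
    set A3 := cv_mul (fun p => F1 (f_ k p) (h_ k p) - F1 (f p) (h p)) w.
    set A4 := cv_mul (fun p => F2 (f_ k p) (h_ k p) - F2 (f p) (h p)) z.
    (* The error is [F1_k (df_k - w) + F2_k (dh_k - z) + (F1_k - F1) w + (F2_k - F2) z], where the
       index [k] means evaluation at [(f_k, h_k)]. *)
    rewrite (@covector_inner_eq _ (cv_axpy (F1 (f_ k p) (h_ k p)) A1
      (cv_axpy (F2 (f_ k p) (h_ k p)) A2 (cv_axpy 1 A3 A4)))); last first.
      move=> i dp; rewrite /A1 /A2 /A3 /A4 /cv_axpy /cv_mul Fdform//.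
      by apply/rowP => a; rewrite !mxE; ring.
    have b1 : F1 (f_ k p) (h_ k p) ^+ 2 <= C ^+ 2.
      by rewrite -(real_normK (num_real (F1 _ _))) lerXn2r ?nnegrE.
    have b2 : F2 (f_ k p) (h_ k p) ^+ 2 <= C ^+ 2.
      by rewrite -(real_normK (num_real (F2 _ _))) lerXn2r ?nnegrE.
    apply: (le_trans (inner_axpy_le _ _ _ p)).
    have := inner_axpy_le (F2 (f_ k p) (h_ k p)) A2 (cv_axpy 1 A3 A4) p.
    have := inner_axpy_le 1 A3 A4 p; rewrite expr1n mulr1.
    move=> h5 h6; apply: four_term_bound C2 b1 b2 _ _ h5 h6; exact: covector_inner_ge0.
  by have [] := composition_bound C2 g4 DD1 DD2 f2 h2.
- have CC : 0 <= 2 * C ^+ 2 by rewrite mulr_ge0.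
  apply: (le_trans (TY_le CC CC (Fsmooth sf sh) sf sh _)).
    by move=> p; have := FL2 (f_ k p) (h_ k p) 0 0; rewrite F00 !subr0 mulrDr.
  apply: (@le_trans _ _ ((2 * C ^+ 2)%:E * (4^-1 ^+ k)%:E + (2 * C ^+ 2)%:E * (4^-1 ^+ k)%:E)%E).
    by rewrite leeD// lee_wpmul2l// lee_fin.
  rewrite -!EFinM -EFinD lee_fin.
  by have [] := composition_bound C2 g4 DD1 DD2 f1 h1.
Qed.

End Composition.

End ZeroTrace.

End SobolevSpace.

(** Fatou's lemma is applied after multiplication by the indicator of the complement of the
    exceptional set, so that convergence holds everywhere on [D]. *)
Lemma fatou_bound d (T : measurableType d) (R : realType) (mu : {measure set T -> \bar R})
    (D : set T) (mD : measurable D) (F : nat -> T -> R) (G : T -> R) (B : \bar R) :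
  (forall m, measurable_fun D (F m)) -> (forall m x, D x -> 0 <= F m x) ->
  measurable_fun D G ->
  {ae mu, forall x, D x -> F m x @[m --> \oo] --> G x} ->
  (forall m, (\int[mu]_(x in D) (F m x)%:E <= B)%E) ->
  (\int[mu]_(x in D) (G x)%:E <= B)%E.
Proof.
move=> mF F0 mG [A [mA A0 hA]] FB.
pose I : T -> R := \1_(~` A); have mI : measurable_fun D I by apply: measurable_indic; exact: measurableC.
have I0 x : 0 <= I x by rewrite /I indicE.
have I1 x : I x <= 1 by rewrite /I indicE lern1; case: (_ \in _).
have -> : (\int[mu]_(x in D) (G x)%:E = \int[mu]_(x in D) limn_einf (fun m => (F m x * I x)%:E))%E.
  transitivity (\int[mu]_(x in D) (G x * I x)%:E)%E.
    apply: ae_eq_integral => //; first exact/measurable_EFinP.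
      by apply/measurable_EFinP; exact: measurable_funM.
    exists A; split => // x /= nx; apply: contrapT => nA; apply: nx => _.
    by rewrite /I indicE mem_set// mulr1.
  apply: eq_integral => x /[!inE] Dx.
  have h : (F m x * I x)%:E @[m --> \oo] --> (G x * I x)%:E.
    apply: cvg_EFin; first exact: nearW.
    rewrite /I indicE; have [/set_mem nA|/negP] := boolP (x \in ~` A).
      rewrite mulr1; under [X in X @ _]eq_fun do rewrite mulr1.
      by apply: contrapT => nc; apply: nA; apply: hA => /(_ Dx).
    by move=> _; rewrite mulr0; under [X in X @ _]eq_fun do rewrite mulr0; exact: cvg_cst.
  by rewrite is_cvg_limn_einfE; [exact/esym/cvg_lim|exact: cvgP h].
have mFI m : measurable_fun D (fun x => (F m x * I x)%:E).
  by apply/measurable_EFinP; exact: measurable_funM.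
have FI0 m x : D x -> (0 <= (F m x * I x)%:E)%E.
  by move=> Dx; rewrite lee_fin mulr_ge0// F0.
apply: le_trans (fatou mu mD mFI FI0) _.
have h m : (\int[mu]_(x in D) (F m x * I x)%:E <= B)%E.
  apply: le_trans (FB m); apply: ge0_le_integral => //.
  - by move=> x Dx; exact: FI0.
  - exact/measurable_EFinP.
  - by move=> x Dx; rewrite lee_fin ler_piMr// F0.
rewrite limn_einf_lim; apply: lime_le; first exact: is_cvg_einfs.
apply: nearW => m; apply: le_trans (h m).
by rewrite /einfs /=; apply: ereal_inf_lbound; exists m => /=.
Qed.

(** Square roots turn the hypothesis into domination of the increments by a geometric series of
    ratio [sqrt (1/2)]. *)
Lemma geometric_increments_cvg (R : realType) (u : nat -> R) (C : R) :
  (forall k, (u k.+1 - u k) ^+ 2 <= C * 2^-1 ^+ k) -> cvgn u.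
Proof.
move=> h; have C0 : 0 <= C by have := h 0%N; rewrite expr0 mulr1; apply: le_trans; exact: sqr_ge0.
pose z := Num.sqrt (2^-1 : R).
have z0 : 0 <= z by exact: sqrtr_ge0.
have z1 : `|z| < 1.
  by rewrite ger0_norm// -sqrtr1 ltr_sqrt// invf_lt1// ltr1n.
have hb k : `|u k.+1 - u k| <= geometric (Num.sqrt C) z k.
  rewrite /geometric /=; have := ler_wsqrtr (h k).
  rewrite sqrtr_sqr sqrtrM//; congr (_ <= _ * _).
  apply/eqP; rewrite -(eqrXn2 (n := 2)) ?sqrtr_ge0 ?exprn_ge0//.
  by rewrite sqr_sqrtr ?exprn_ge0 ?invr_ge0// exprAC sqr_sqrtr ?invr_ge0.
have cs : cvgn (series (fun k => u k.+1 - u k)).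
  apply: normed_cvg; apply: (series_le_cvg _ _ hb (is_cvg_geometric_series z1)) => k.
    exact: normr_ge0.
  by apply: le_trans (hb k); exact: normr_ge0.
have E : u = (fun k => u 0%N + series (fun k => u k.+1 - u k) k).
  by apply/funext => k; rewrite /series /= telescope_sumr// addrC subrK.
by rewrite E; apply: is_cvgD; [exact: is_cvg_cst|exact: cs].
Qed.

(** * Completeness of the space of functions of zero trace *)

Section Completeness.
Variables (R : realType) (n : nat) (M : closed_riemannian R n.+1).
Variables (vol : {measure set (borel M) -> \bar R}) (hvol : is_volume vol).
Variables (S : set M) (oS : open S).
Implicit Types (i j : chart M) (p : M) (f h : M -> R) (w z : covector_field M).
Local Notation L2S := (L2 vol (S : set (borel M))).
Local Notation cvL2 := (cvL2 vol S).
Local Notation WD := (WD vol S).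
Local Notation mS := (mS oS).
Local Notation sq := (sq vol S).
Local Notation DD := (DD vol S).
Local Notation gg := (gg vol S).

Lemma cv_axpy_measurable c w z : cv_measurable (S : set (borel M)) w ->
  cv_measurable (S : set (borel M)) z -> cv_measurable (S : set (borel M)) (cv_axpy c w z).
Proof.
move=> mw mz i a; rewrite (_ : (fun p => _) = fun p => c * w i p 0 a + z i p 0 a); last first.
  by apply/funext => p; rewrite !mxE.
by apply: measurable_funD => //; exact: measurable_funM.
Qed.

Lemma covector_inner_cvg (w_ : nat -> covector_field M) w p :
  (forall i a, dom i p -> w_ k i p 0 a @[k --> \oo] --> w i p 0 a) ->
  covector_inner (w_ k) (w_ k) p @[k --> \oo] --> covector_inner w w p.
Proof.
move=> h; have [i dp H] := in_chart_pick p; rewrite /covector_inner H bilinE.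
rewrite (_ : (fun k => _) = fun k => bilin (invmx (metric_at i p)) (w_ k i p) (w_ k i p)); last first.
  by apply/funext => k; rewrite H.
rewrite (_ : (fun k => _) = fun k => \sum_b (\sum_a w_ k i p 0 a * invmx (metric_at i p) a b) * w_ k i p 0 b); last first.
  by apply/funext => k; rewrite bilinE.
apply: (@cvg_bigsum R nat \oo _ _ _ (fun b k => (\sum_a w_ k i p 0 a * invmx (metric_at i p) a b) * w_ k i p 0 b)) => b.
apply: cvgM; last exact: h.
apply: (@cvg_bigsum R nat \oo _ _ _ (fun a k => w_ k i p 0 a * invmx (metric_at i p) a b)) => a.
by apply: cvgM; [exact: h|exact: cvg_cst].
Qed.

Section SmoothCauchy.
Variables (g : nat -> M -> R) (K : R).
Hypothesis sg : forall k, smooth_fun (g k).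
Hypothesis K0 : 0 < K.
Hypothesis hq : forall k m, (k <= m)%N -> sq (fun p => -1 * g k p + g m p) <= K * 4^-1 ^+ k.
Hypothesis hd : forall k m, (k <= m)%N ->
  DD (cv_axpy (-1) (dform (g k)) (dform (g m))) <= K * 4^-1 ^+ k.

Let Dw k m := cv_axpy (-1) (dform (g k)) (dform (g m)).
(** Normalized so that its integral is at most [4^-k], the input of [Int_ae_cvg0]. *)
Let e k p := (2 * K)^-1 * ((g k.+1 p - g k p) ^+ 2 + covector_inner (Dw k k.+1) (Dw k k.+1) p).

Let cDw k m : cvL2 (Dw k m).
Proof. by apply: (cvL2_axpy oS); exact: dform_cvL2. Qed.

Let qDw k m : L2S (fun p => -1 * g k p + g m p).
Proof. by apply: (L2D mS); [apply: (L2Z mS)|]; exact: smooth_L2. Qed.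

Let bad : exists A : set (borel M), [/\ measurable A, vol A = 0%E &
  forall p, S p -> ~ A p -> exists C : R, forall k, e k p <= C * 2^-1 ^+ k].
Proof.
have Ie k : Int vol (S : set (borel M)) (e k).
  apply: (IntZ mS); apply: (IntD mS); last exact: cvL2_Int.
  apply: (Int_eq mS _ (L2_sq (qDw k k.+1))) => p _.
  by rewrite mulN1r addrC.
have me k := Int_meas (Ie k).
have e0 k p : 0 <= e k p.
  by rewrite /e mulr_ge0 ?invr_ge0 ?mulr_ge0 ?addr_ge0 ?sqr_ge0 ?covector_inner_ge0 ?(ltW K0).
have he k : (\int[vol]_(p in (S : set (borel M))) (e k p)%:E <= (4^-1 ^+ k)%:E)%E.
  have I1 := L2_sq (qDw k k.+1); have I2 := cvL2_Int oS (cDw k k.+1).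
  rewrite -(RIntE mS (Ie k)) lee_fin /e.
  rewrite (@RInt_eq _ _ _ vol _ _ (fun p => (2 * K)^-1 * ((-1 * g k p + g k.+1 p) ^+ 2 + covector_inner (Dw k k.+1) (Dw k k.+1) p))); last first.
    by move=> p _; rewrite mulN1r [- _ + _]addrC.
  rewrite (RIntZ mS _ (IntD mS I1 I2)) (RIntD mS I1 I2).
  have K2 : 0 < 2 * K by rewrite mulr_gt0.
  rewrite ler_pdivrMl// [2 * K]mulrC -mulrA mulr2n mulrDl mul1r mulrDr.
  by rewrite lerD//; [exact: hq|exact: hd].
have [A [mA A0 hA]] := Int_ae_cvg0 mS me (fun k p _ => e0 k p) he.
exists A; split => // p Sp nA; apply: contrapT => nh; apply: nA; apply: hA => /= h.
exact: nh (h Sp).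
Qed.

(** The Riesz-Fischer argument, run jointly for values and components of differentials: both
    converge outside one null set, and Fatou's lemma carries the Cauchy bounds to the limit. The
    covector law survives because it is linear at each point. *)
Lemma smooth_cauchy_limit : exists f w, [/\ L2S f, cvL2 w,
  forall k, sq (fun p => -1 * f p + g k p) <= K * 4^-1 ^+ k &
  forall k, DD (cv_axpy (-1) w (dform (g k))) <= K * 4^-1 ^+ k].
Proof.
have [A [mA A0 hA]] := bad.
(* Multiplication by [I] sets the sequences to 0 on the exceptional set, so they converge at every
   point and have measurable limits. *)
pose I : M -> R := \1_(S `&` ~` A).
have K2 : 0 < 2 * K by rewrite mulr_gt0.
have eb k p C : e k p <= C -> (g k.+1 p - g k p) ^+ 2 <= 2 * K * C /\
    covector_inner (Dw k k.+1) (Dw k k.+1) p <= 2 * K * C.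
  rewrite /e ler_pdivrMl// => h; split; apply: le_trans h.
    by rewrite lerDl covector_inner_ge0.
  by rewrite lerDr sqr_ge0.
have cg p : cvgn (fun k => I p * g k p).
  rewrite /I indicE; have [/set_mem [Sp nA]|_] := boolP (p \in S `&` ~` A); last first.
    by under eq_fun do rewrite mul0r; exact: is_cvg_cst.
  under eq_fun do rewrite mul1r.
  have [C hC] := hA p Sp nA; apply: (@geometric_increments_cvg _ _ (2 * K * C)) => k.
  by have [h _] := eb _ _ _ (hC k); rewrite -mulrA.
have cd i p a : dom i p -> cvgn (fun k => I p * dform (g k) i p 0 a).
  move=> dp; rewrite /I indicE; have [/set_mem [Sp nA]|_] := boolP (p \in S `&` ~` A); last first.
    by under eq_fun do rewrite mul0r; exact: is_cvg_cst.
  under eq_fun do rewrite mul1r.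
  have [C hC] := hA p Sp nA.
  have gaa0 : 0 <= metric_at i p a a.
    have := posdef_ge0 (delta_mx 0 a) (metric_posdef dp).
    by rewrite /bilin trmx_delta -rowE -colE !mxE.
  apply: (@geometric_increments_cvg _ _ (metric_at i p a a * (2 * K * C))) => k.
  have [_ h] := eb _ _ _ (hC k); have [cw _ _] := cDw k k.+1.
  have -> : dform (g k.+1) i p 0 a - dform (g k) i p 0 a = Dw k k.+1 i p 0 a.
    by rewrite !mxE mulN1r addrC.
  apply: le_trans (covector_coord a cw dp) _.
  by rewrite -[leRHS]mulrA ler_wpM2l// -[leRHS]mulrA.
pose f p : R := limn (fun k => I p * g k p).
pose w : covector_field M := fun i p => \row_a (limn (fun k => I p * dform (g k) i p 0 a) : R).
have cf p : I p * g k p @[k --> \oo] --> f p by exact: cg.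
have cw i p a : dom i p -> I p * dform (g k) i p 0 a @[k --> \oo] --> w i p 0 a.
  by move=> dp; rewrite mxE; exact: cd.
have I1 p : S p -> ~ A p -> I p = 1 by move=> Sp nA; rewrite /I indicE mem_set.
have aeI (P : borel M -> Prop) : (forall p, S p -> I p = 1 -> P p) -> {ae vol, forall p, S p -> P p}.
  move=> h; exists A; split => // p /= np; apply: contrapT => nA; apply: np => Sp.
  by apply: h => //; exact: I1.
have mI : measurable_fun (S : set (borel M)) (I : borel M -> R).
  by apply: measurable_indic; apply: measurableI; [exact: mS|exact: measurableC].
have mf : measurable_fun (S : set (borel M)) (f : borel M -> R).
  apply: (measurable_fun_cvg (h := fun k (p : borel M) => I p * g k p)); last by move=> p _; exact: cf.
  by move=> k; apply: measurable_funM => //; have [] := smooth_L2 hvol oS (sg k).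
have mw : cv_measurable (S : set (borel M)) w.
  move=> i a; apply: (measurable_fun_cvg (h := fun k (p : borel M) => I p * dform (g k) i p 0 a)).
    move=> k; apply: measurable_funM; last exact: dform_measurable mS _ _.
    exact: (measurable_funS mS (@subIsetl _ _ _) mI).
  by move=> p [_ dp]; exact: cw.
have cow : is_covector_field w.
  move=> i j p di dj; apply/rowP => a; set J := jacobian _ _.
  have h2 : I p * dform (g k) i p 0 a @[k --> \oo] --> (w j p *m J^T) 0 a.
    rewrite mxE (_ : (fun k => _) = fun k => \sum_b (I p * dform (g k) j p 0 b) * J^T b a).
      apply: (@cvg_bigsum R nat \oo _ _ _ (fun b k => I p * dform (g k) j p 0 b * J^T b a)) => b.
      by apply: cvgM; [exact: cw|exact: cvg_cst].
    apply/funext => k; rewrite (dform_covector (sg k) di dj) mxE mulr_sumr.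
    by apply: eq_bigr => b _; rewrite mulrA.
  by apply: (cvg_unique _ (cw i p a di) h2).
have Q k : (\int[vol]_(p in (S : set (borel M))) ((-1 * f p + g k p) ^+ 2)%:E <= (K * 4^-1 ^+ k)%:E)%E.
  apply: (@fatou_bound _ _ _ vol _ mS (fun m p => (-1 * g (k + m)%N p + g k p) ^+ 2)).
  - by move=> m; apply: (Int_meas (L2_sq (qDw _ _))).
  - by move=> m p _; exact: sqr_ge0.
  - apply: measurable_funX; apply: measurable_funD; first exact: measurable_funM.
    by have [] := smooth_L2 hvol oS (sg k).
  - apply: aeI => p Sp Ip; have := cf p; rewrite Ip; under [X in X @ _]eq_fun do rewrite mul1r.
    move=> h; have hs : g (k + m)%N p @[m --> \oo] --> f p.
      by under [X in X @ _]eq_fun do rewrite addnC; move: h; rewrite -(cvg_shiftn k).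
    have hc : -1 * g (k + m)%N p + g k p @[m --> \oo] --> -1 * f p + g k p.
      by apply: cvgD; [apply: cvgM => //; exact: cvg_cst|exact: cvg_cst].
    rewrite expr2 (_ : (fun m => _) = fun m => (-1 * g (k + m)%N p + g k p) * (-1 * g (k + m)%N p + g k p)).
      exact: cvgM.
    by apply/funext => m; rewrite expr2.
  - move=> m; rewrite -(RIntE mS) ?lee_fin; last exact: (L2_sq (qDw _ _)).
    apply: le_trans (hq (leq_addr m k)); rewrite le_eqVlt; apply/orP; left; apply/eqP.
    by apply: RInt_eq => p _; ring.
have D k : (\int[vol]_(p in (S : set (borel M))) (covector_inner (cv_axpy (-1) w (dform (g k))) (cv_axpy (-1) w (dform (g k))) p)%:E <= (K * 4^-1 ^+ k)%:E)%E.
  apply: (@fatou_bound _ _ _ vol _ mS (fun m p => covector_inner (Dw (k + m)%N k) (Dw (k + m)%N k) p)).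
  - by move=> m; apply: (Int_meas (cvL2_Int oS (cDw _ _))).
  - by move=> m p _; exact: covector_inner_ge0.
  - apply: (covector_inner_measurable mS); try exact: cv_axpy_covector (dform_covector (sg k)).
    + by apply: cv_axpy_measurable => //; exact: dform_measurable mS.
    + by apply: cv_axpy_measurable => //; exact: dform_measurable mS.
  - apply: aeI => p Sp Ip; apply: covector_inner_cvg => i a dp.
    rewrite (_ : (fun m => _) = fun m => -1 * dform (g (k + m)%N) i p 0 a + dform (g k) i p 0 a); last first.
      by apply/funext => m; rewrite !mxE.
    have -> : cv_axpy (-1) w (dform (g k)) i p 0 a = -1 * w i p 0 a + dform (g k) i p 0 a by rewrite !mxE.
    apply: cvgD; last exact: cvg_cst.
    apply: cvgM; first exact: cvg_cst.
    have := cw i p a dp; rewrite Ip; under [X in X @ _]eq_fun do rewrite mul1r.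
    move=> h; under [X in X @ _]eq_fun do rewrite addnC.
    by move: h; rewrite -(cvg_shiftn k).
  - move=> m; rewrite -(RIntE mS) ?lee_fin; last exact: (cvL2_Int oS (cDw _ _)).
    apply: le_trans (hd (leq_addr m k)); rewrite le_eqVlt; apply/orP; left; apply/eqP.
    apply: RInt_eq => p _.
    rewrite /Dw !covector_inner_axpyl !covector_inner_axpyr (covector_innerC (dform (g k)) (dform (g (k + m)%N))).
    by ring.
have lf : L2S f.
  have h0 : L2S (fun p => -1 * f p + g 0%N p).
    split; last by apply: le_lt_trans (Q 0%N) _; rewrite ltry.
    apply: measurable_funD; first exact: measurable_funM.
    by have [] := smooth_L2 hvol oS (sg 0%N).
  have := L2D mS (L2Z mS (-1) h0) (smooth_L2 hvol oS (sg 0%N)).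
  by rewrite (_ : (fun p => _) = f)//; apply/funext => p; ring.
have lw : cvL2 w.
  have h0 : cvL2 (cv_axpy (-1) w (dform (g 0%N))).
    split; [by apply: cv_axpy_covector => //; exact: dform_covector| |].
      by apply: cv_axpy_measurable => //; exact: dform_measurable mS.
    by apply: le_lt_trans (D 0%N) _; rewrite ltry.
  have := cvL2_axpy oS (-1) h0 (dform_cvL2 hvol oS (sg 0%N)).
  rewrite (_ : cv_axpy _ _ _ = w)//; apply/funext => i; apply/funext => p; apply/rowP => a.
  by rewrite /cv_axpy !mxE; ring.
exists f, w; split => // k.
  rewrite -lee_fin (RIntE mS); first exact: Q.
  by apply: L2_sq; apply: (L2D mS); [exact: (L2Z mS)|exact: smooth_L2].
rewrite -lee_fin (RIntE mS); first exact: D.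
by apply: (cvL2_Int oS); apply: (cvL2_axpy oS) => //; exact: dform_cvL2.
Qed.

End SmoothCauchy.

Section Limit.
Variables (Y : set M) (cY : closed Y) (area : {measure set (borel M) -> \bar R}).
Local Notation H10 := (H10 vol Y area (S : set (borel M))).

Definition E1 f := sq f + gg f f.

Lemma E1_ge0 f : 0 <= E1 f.
Proof. by rewrite addr_ge0 ?sq_ge0 ?gg_ge0. Qed.

(** Each [f_k] is replaced by a smooth function with error [4^-k], so completeness reduces to smooth
    Cauchy sequences, and the limit receives smooth approximants whose traces tend to zero. *)
Lemma H10_complete (f_ : nat -> M -> R) : (forall k, H10 (f_ k)) ->
  (forall k m, (k <= m)%N -> E1 (fun p => -1 * f_ k p + f_ m p) <= 4^-1 ^+ k) ->
  exists2 f, H10 f & E1 (fun p => -1 * f p + f_ k p) @[k --> \oo] --> (0 : R).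
Proof.
move=> Hk hC.
have hw k : WD (f_ k) (weak_diff vol (S : set (borel M)) (f_ k)) by apply: (H1_wd); exact: H10_H1.
pose w k := weak_diff vol (S : set (borel M)) (f_ k).
have Lk k := H1_L2 (H10_H1 (Hk k)).
have hq k m : (k <= m)%N -> sq (fun p => -1 * f_ k p + f_ m p) <= 4^-1 ^+ k.
  by move=> km; apply: le_trans (hC k m km); rewrite lerDl gg_ge0.
have WDd k m := WD_axpy hvol oS (-1) (Lk k) (Lk m) (hw k) (hw m).
have hd k m : (k <= m)%N -> DD (cv_axpy (-1) (w k) (w m)) <= 4^-1 ^+ k.
  move=> km; apply: le_trans (hC k m km).
  have Ha := H1_axpy hvol oS (-1) (H10_H1 (Hk k)) (H10_H1 (Hk m)).
  by rewrite /E1 (ggE hvol oS Ha Ha (WDd k m) (WDd k m)) lerDr sq_ge0.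
have /choice[g hg] k : exists h, smooth_approx vol S Y area (f_ k) (w k) h (4^-1 ^+ k).
  by have [h hh] := H10_elim hvol oS (Hk k) (hw k); exists (h k).
have sg k : smooth_fun (g k) by have [] := hg k.
have le4 k m : (k <= m)%N -> (4^-1 : R) ^+ m <= 4^-1 ^+ k.
  by move=> km; apply: ler_wiXn2l; rewrite ?invr_ge0// invf_le1// ler1n.
have g40 k : 0 <= (4^-1 : R) ^+ k by rewrite exprn_ge0// invr_ge0.
have Lg k := smooth_L2 hvol oS (sg k).
have La c f h : L2S f -> L2S h -> L2S (fun p => c * f p + h p).
  by move=> hf hh; apply: (L2D mS) => //; exact: (L2Z mS).
have Cg k := dform_cvL2 hvol oS (sg k).
(* Comparing two smooth approximants through [f_k] and [f_m], with [(a + b)^2 <= 2 a^2 + 2 b^2] used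
   twice, gives at most ten times [4^-k]; 14 leaves room. *)
have [f [z [lf lz fq fd]]] : exists f z, [/\ L2S f, cvL2 z,
    forall k, sq (fun p => -1 * f p + g k p) <= 14 * 4^-1 ^+ k &
    forall k, DD (cv_axpy (-1) z (dform (g k))) <= 14 * 4^-1 ^+ k].
  apply: (smooth_cauchy_limit sg) => // k m km.
    rewrite (_ : sq _ = sq (fun p => -1 * (-1 * f_ k p + g k p) + (1 * (-1 * f_ k p + f_ m p) + (-1 * f_ m p + g m p)))); last first.
      by apply: RInt_eq => p _; congr (_ ^+ 2); ring.
    apply: le_trans (sq_axpy_le oS _ (La _ _ _ (Lk k) (Lg k)) (La _ _ _ (La _ _ _ (Lk k) (Lk m)) (La _ _ _ (Lk m) (Lg m)))) _.
    have := sq_axpy_le oS 1 (La (-1) _ _ (Lk k) (Lk m)) (La (-1) _ _ (Lk m) (Lg m)).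
    have [_ a1 _ _] := hg k; have [_ a2 _ _] := hg m.
    move: a1 a2 (hq k m km) (le4 k m km) (g40 k).
    move: (sq _) (sq _) (sq _) (sq _) (4^-1 ^+ k) (4^-1 ^+ m) => *; lra.
  rewrite (_ : DD _ = DD (cv_axpy (-1) (cv_axpy (-1) (w k) (dform (g k))) (cv_axpy 1 (cv_axpy (-1) (w k) (w m)) (cv_axpy (-1) (w m) (dform (g m)))))); last first.
    apply: RInt_eq => p _; apply: covector_inner_eq => i dp; apply/rowP => a.
    by rewrite /cv_axpy !mxE; ring.
  have ca c u v : cvL2 u -> cvL2 v -> cvL2 (cv_axpy c u v) by move=> hu hv; exact: (cvL2_axpy oS).
  have b1 := ca (-1) _ _ (hw k).1 (Cg k); have b2 := ca (-1) _ _ (hw k).1 (hw m).1.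
  have b3 := ca (-1) _ _ (hw m).1 (Cg m).
  apply: le_trans (DD_axpy_le oS _ b1 (ca _ _ _ b2 b3)) _.
  have := DD_axpy_le oS 1 b2 b3.
  have [_ _ a1 _] := hg k; have [_ _ a2 _] := hg m.
  move: a1 a2 (hd k m km) (le4 k m km) (g40 k); rewrite -/(w k) -/(w m).
  move: (DD _) (DD _) (DD _) (DD _) (4^-1 ^+ k) (4^-1 ^+ m) => *; lra.
have e0 : 14 * (4^-1 : R) ^+ k @[k --> \oo] --> (0 : R).
  by rewrite -[X in _ --> X](mulr0 (14 : R)); apply: cvgM; [exact: cvg_cst|exact: cvg_geo4].
have [H10f WDf] : H10 f /\ WD f z.
  apply: (H10_intro hvol oS (f_ := g) lf lz e0) => k; split => //.
  have [_ _ _ h] := hg k; apply: le_trans h _; rewrite lee_fin.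
  by move: (g40 k); move: (_ ^+ k) => *; lra.
exists f => //.
(* Each of the two parts of [E1] is at most [2 (14 4^-k) + 2 4^-k], that is thirty times [4^-k]. *)
apply: (@squeeze_cvgr nat \oo _ R (fun=> 0) (fun k => 60 * 4^-1 ^+ k)).
- near=> k; rewrite E1_ge0 /=.
  have Ha := H1_axpy hvol oS (-1) (H10_H1 H10f) (H10_H1 (Hk k)).
  have Wa := WD_axpy hvol oS (-1) lf (Lk k) WDf (hw k).
  rewrite /E1 (ggE hvol oS Ha Ha Wa Wa) -/(DD _).
  have q1 : sq (fun p => -1 * f p + f_ k p) <= 2 * (14 * 4^-1 ^+ k) + 2 * 4^-1 ^+ k.
    rewrite (_ : sq _ = sq (fun p => -1 * (-1 * f_ k p + g k p) + (-1 * f p + g k p))); last first.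
      by apply: RInt_eq => p _; congr (_ ^+ 2); ring.
    apply: le_trans (sq_axpy_le oS _ (La _ _ _ (Lk k) (Lg k)) (La _ _ _ lf (Lg k))) _.
    have [_ a1 _ _] := hg k; move: a1 (fq k).
    by move: (sq _) (sq _) (4^-1 ^+ k) => *; lra.
  have q2 : DD (cv_axpy (-1) z (w k)) <= 2 * (14 * 4^-1 ^+ k) + 2 * 4^-1 ^+ k.
    rewrite (_ : DD _ = DD (cv_axpy (-1) (cv_axpy (-1) (w k) (dform (g k))) (cv_axpy (-1) z (dform (g k))))); last first.
      apply: RInt_eq => p _; apply: covector_inner_eq => i dp; apply/rowP => a.
      by rewrite /cv_axpy !mxE; ring.
    apply: le_trans (DD_axpy_le oS _ (cvL2_axpy oS (-1) (hw k).1 (Cg k)) (cvL2_axpy oS (-1) lz (Cg k))) _.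
    have [_ _ a1 _] := hg k; move: a1 (fd k).
    by move: (DD _) (DD _) (4^-1 ^+ k) => *; lra.
  move: q1 q2; rewrite -/(w k); move: (sq _) (DD _) (_ ^+ k) => *; lra.
- exact: cvg_cst.
- by rewrite -[X in _ --> X](mulr0 (60 : R)); apply: cvgM; [exact: cvg_cst|exact: cvg_geo4].
Unshelve. all: by end_near.
Qed.

End Limit.

End Completeness.

(** * One-sided neighbourhoods of boundary points *)

Section HolderClass.
Variable R : realType.
Local Notation Ck := (of_class (@continuous_in R _)).

Lemma holder_continuous alpha m (D : set 'rV[R]_m) f : 0 < alpha -> open D ->
  locally_holder alpha D f -> continuous_in D f.
Proof.
move=> a0 oD h x Dx; have [U [K [Ux hK]]] := h x Dx.
apply/(@cvgrPdist_lt _ _ _ (nbhs x) (nbhs_filter x)) => e e0; pose K' := `|K| + 1.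
have K'0 : 0 < K' by rewrite ltr_pwDr.
pose d := (e / K') `^ alpha^-1.
have d0 : 0 < d by rewrite powR_gt0// divr_gt0.
have dE : d `^ alpha = e / K'.
  by rewrite -powRrM mulVf ?gt_eqF// powRr1// ltW// divr_gt0.
have nD : nbhs x D by exact: open_nbhs_nbhs.
near=> y.
have Dy : D y by near: y.
have Uy : U y by near: y.
have xy : `|x - y| < d.
  by near: y; apply/nbhs_ballP; exists d => // z; rewrite -ball_normE.
apply: le_lt_trans (hK x y Dx Dy (nbhs_singleton Ux) Uy) _.
apply: (@le_lt_trans _ _ (`|K| * `|x - y| `^ alpha)).
  by rewrite ler_wpM2r ?powR_ge0// ler_norm.
apply: (@le_lt_trans _ _ (`|K| * (e / K'))).
  rewrite ler_wpM2l// -dE; apply: ge0_ler_powR; rewrite ?nnegrE// ?(ltW a0) ?(ltW d0) ?(ltW xy)//.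
rewrite mulrA ltr_pdivrMr// [ltRHS]mulrC ltr_pM2r//.
by rewrite /K' ltrDl.
Unshelve. all: by end_near.
Qed.

Lemma holder_Ck k alpha m (D : set 'rV[R]_m) f : 0 < alpha -> open D ->
  class_Ckalpha k alpha D f -> Ck k D f.
Proof.
move=> a0 oD; rewrite /class_Ckalpha; elim: k f => [|k IH] f /= h.
  exact: holder_continuous h.
by move=> a; have [h1 h2] := h a; split => //; exact: IH.
Qed.

End HolderClass.

(** * The hypersurface meets transversal lines locally at most once *)

Section Graph.
Variables (R : realType) (n : nat) (M : closed_riemannian R n.+1).
Variables (k : nat) (hk : (2 <= k)%N) (alpha : R) (a0 : 0 < alpha) (Y : set M).
Hypothesis hY : closed_hypersurface k alpha Y.
Local Notation Ck := (of_class (@continuous_in R _)).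

(** The [d] rows of [J] cannot span all [d + 1] basis vectors. For a missing [e_a], a combination of
    rows proportional to [e_a] must vanish, and freeness gives [u = 0]. *)
Lemma transversal_direction d (J : 'M[R]_(d, d.+1)) : row_free J ->
  exists a : 'I_d.+1, forall u : 'rV[R]_d, (forall b, b != a -> (u *m J) 0 b = 0) -> u = 0.
Proof.
move=> fJ; have [a ha] : exists a : 'I_d.+1, ~~ ((delta_mx 0 a : 'rV[R]_d.+1) <= J)%MS.
  apply: contrapT => h; have : (1%:M <= J)%MS.
    apply/row_subP => a; rewrite row1; apply: contrapT => /negP ha; apply: h; by exists a.
  move/mxrankS; rewrite mxrank1 => /leq_trans/(_ (rank_leq_row J)).
  by rewrite ltnn.
exists a => u hu; have uJ : u *m J = (u *m J) 0 a *: delta_mx 0 a.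
  apply/rowP => b; rewrite !mxE eqxx /=; have [->|ba] := eqVneq b a; first by rewrite mulr1.
  by have := hu b ba; rewrite mxE => ->; rewrite mulr0.
have [z|nz] := eqVneq ((u *m J) 0 a) 0.
  apply: (row_free_inj fJ); by rewrite mul0mx uJ z scale0r.
case/negP: ha; apply/submxP; exists (((u *m J) 0 a)^-1 *: u).
by rewrite -scalemxAl; move: uJ nz; set c := (u *m J) 0 a => -> nz; rewrite scalerA mulVf// scale1r.
Qed.

(** Deleting column [a] leaves an invertible square matrix, whose inverse provides [C]. *)
Lemma transversal_bound d (J : 'M[R]_(d, d.+1)) a :
  (forall u : 'rV[R]_d, (forall b, b != a -> (u *m J) 0 b = 0) -> u = 0) ->
  exists2 C, 0 < C & forall u : 'rV[R]_d, forall e, 0 <= e ->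
    (forall b, b != a -> `|(u *m J) 0 b| <= e) -> `|u| <= C * e.
Proof.
move=> h; pose J' := col' a J.
have colE (u : 'rV[R]_d) c : (u *m J') 0 c = (u *m J) 0 (lift a c).
  by rewrite !mxE; apply: eq_bigr => l _; rewrite mxE.
have uJ' : J' \in unitmx.
  rewrite -row_free_unit -kermx_eq0; apply/eqP/row_matrixP => b; rewrite row0.
  apply: h => c ca; have [c' ->|] := unliftP a c; last by move=> E; rewrite E eqxx in ca.
  have : (row b (kermx J') *m J') 0 c' = 0.
    by have /sub_kermxP -> : (row b (kermx J') <= kermx J')%MS; rewrite ?row_sub ?mxE.
  by rewrite colE.
pose B := \sum_b \sum_c `|invmx J' b c|.
exists (B + 1) => [|u e e0 hu].
  by rewrite ltr_wpDl// sumr_ge0// => b _; exact: sumr_ge0.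
have -> : u = (u *m J') *m invmx J' by rewrite mulmxK.
have hv b : `|(u *m J') 0 b| <= e.
  by rewrite colE; apply: hu; rewrite eq_sym neq_lift.
apply: (@le_trans _ _ (B * e)); last by rewrite ler_wpM2r// lerDl.
apply: normr_rV_leP => [|c]; first by rewrite mulr_ge0// sumr_ge0// => b _; exact: sumr_ge0.
rewrite mxE (le_trans (ler_norm_sum _ _ _))// /B mulr_suml.
apply: ler_sum => b _; rewrite normrM mulrC ler_pM//.
by rewrite (bigD1 c)//= lerDl sumr_ge0.
Qed.

(** The local graph property is stated as uniqueness on lines parallel to [e_a]. For parameters [y],
    [z] of two points on one line, the increments of the other coordinates are 0, so strict
    differentiability with error [1/(2 C)] and [transversal_bound] give [|z - y| <= |z - y| / 2]. *)
Lemma hypersurface_graph p : Y p -> exists i (a : 'I_n.+1) r,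
  [/\ dom i p, 0 < r, ball (phi i p) r `<=` img i &
    forall x x', ball (phi i p) r x -> ball (phi i p) r x' -> Y (psi i x) -> Y (psi i x') ->
      (forall b, b != a -> x 0 b = x' 0 b) -> x = x'].
Proof.
move=> Yp; have [_ _ /(_ p Yp) [D [X [[oD [cX _] hO CX fX] [y0 Dy0 Xy0]]]]] := hY.
have [i dp] := dom_cover p.
have dX0 : dom i (X y0) by rewrite Xy0.
have oE : open (D `&` X @^-1` dom i).
  by apply: open_preimage => //; exact: dom_open.
have CE c : Ck 1 (D `&` X @^-1` dom i) (fun y => phi i (X y) 0 c).
  by apply: (@Ck_le _ _ 1 k) => //; [exact: ltnW|exact: holder_Ck (CX i c)].
have E0 : (D `&` X @^-1` dom i) y0 by [].
set J := param_jacobian X i y0.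
have JE b c : J b c = partial b (fun y => phi i (X y) 0 c) y0.
  by have [_ ->] := @Ck1_differentiable_rV R n n.+1 (D `&` X @^-1` dom i) (fun z => phi i (X z)) y0 oE CE E0.
have [a ha] := transversal_direction (fX i y0 Dy0 dX0).
have [C C0 hC] := transversal_bound ha.
pose e := (2 * C)^-1; have e0 : 0 < e by rewrite invr_gt0 mulr_gt0.
have hr c : exists2 r, 0 < r & forall y z, ball y0 r y -> ball y0 r z ->
    `|phi i (X z) 0 c - phi i (X y) 0 c - \sum_(b < n) J b c * (z 0 b - y 0 b)| <= e * `|z - y|.
  have [dC pC] := Ck1P (CE c).
  have [r r0 h] := C1_increment oE E0 e0 dC (fun b => pC b y0 E0).
  exists r => // y z hy hz; apply: le_trans (h y z hy hz).
  by rewrite le_eqVlt; apply/orP; left; apply/eqP; congr `|_ - _|; apply: eq_bigr => b _; rewrite JE.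
have /choice[r_ hr_] c : exists r, 0 < r /\ forall y z, ball y0 r y -> ball y0 r z ->
    `|phi i (X z) 0 c - phi i (X y) 0 c - \sum_(b < n) J b c * (z 0 b - y 0 b)| <= e * `|z - y|.
  by have [r r0 h] := hr c; exists r.
have N0 : \forall y \near y0, D y /\ forall c, ball y0 (r_ c) y.
  apply: filterI; first exact: open_nbhs_nbhs.
  apply: (@filter_forall _ _ (fun c y => ball y0 (r_ c) y) (nbhs y0) _) => c.
  by apply: nbhsx_ballx; have [] := hr_ c.
(* [local_param] sends an open parameter set to a relatively open part of [Y], so all points of [Y]
   near [p] come from parameters where the increment estimate holds. *)
have [U oU hXO] := hO _ (@open_interior _ [set y | D y /\ forall c, ball y0 (r_ c) y]) (fun y hy => (interior_subset hy).1).
have Op : U p.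
  have : (X @` interior [set y | D y /\ forall c, ball y0 (r_ c) y]) p by exists y0.
  by rewrite hXO => -[].
have nO : nbhs (phi i p) (img i `&` psi i @^-1` U).
  apply: open_nbhs_nbhs; split; last by split; [exact: img_phi|rewrite /= phiK].
  by apply: open_preimage => //; [exact: img_open|move=> x ix; exact: psi_continuous].
have /nbhs_ballP[r /= r0 hrO] := nO.
exists i, a, r; split=> //; first by move=> x /hrO[].
move=> x x' /hrO[ix Ox] /hrO[ix' Ox'] Yx Yx' xx'.
have [y Ny Ey] : (X @` interior [set y | D y /\ forall c, ball y0 (r_ c) y]) (psi i x) by rewrite hXO.
have [z Nz Ez] : (X @` interior [set y | D y /\ forall c, ball y0 (r_ c) y]) (psi i x') by rewrite hXO.
have [Dy by_] := interior_subset Ny; have [Dz bz] := interior_subset Nz.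
have yz : z - y = 0.
  apply/eqP; rewrite -normr_eq0; apply/eqP.
  have : `|z - y| <= C * (e * `|z - y|).
    apply: hC => [|b ba]; first by rewrite mulr_ge0// ltW.
    have [_ /(_ y z (by_ b) (bz b))] := hr_ b.
    rewrite Ey Ez !psiK// (xx' b ba) subrr sub0r normrN.
    by congr (`|_| <= _); rewrite mxE; apply: eq_bigr => c _; rewrite !mxE mulrC.
  rewrite mulrA /e invfM mulrCA mulfV ?gt_eqF// mulr1 => h.
  by have := normr_ge0 (z - y); lra.
have E : y = z by apply/esym/eqP; rewrite -subr_eq0 yz.
by rewrite -(psiK ix) -(psiK ix') -Ey -Ez E.
Qed.

End Graph.

(** * Sides of the hypersurface along a line *)

Section Sides.
Variables (R : realType) (n : nat) (M : closed_riemannian R n.+1) (Y : set M).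

(** The segment is connected, and the preimage of [T] in it is open and closed as long as the curve
    avoids [Y]. *)
Lemma side_constant (T T' : set M) (g : R -> M) lo hi : open T -> open T' -> T `&` T' = set0 ->
  T `|` T' = ~` Y -> (forall s, lo <= s <= hi -> {for s, continuous g}) ->
  (forall s, lo <= s <= hi -> ~ Y (g s)) ->
  forall s s', lo <= s <= hi -> lo <= s' <= hi -> T (g s) -> T (g s').
Proof.
move=> oT oT' TT' TUT' cg nY s s' hs hs' Ts.
have nT t : lo <= t <= hi -> T (g t) \/ T' (g t).
  by move=> ht; have := nY t ht; rewrite -[~ _]/((~` Y) _) -TUT'.
have nTT' q : T q -> ~ T' q by move=> Tq T'q; have : (T `&` T') q by []; rewrite TT'.
have intP (U : set M) t : open U -> lo <= t <= hi -> U (g t) -> (g @^-1` U)^° t.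
  by move=> oU ht Ut; apply: (cg t ht); exact: open_nbhs_nbhs.
pose B := `[lo, hi]%classic `&` g @^-1` T.
have BE : B = `[lo, hi]%classic.
  apply: (@segment_connected R lo hi).
  - by exists s; split => //; rewrite /= in_itv.
  (* [g] is continuous only at points of the segment, so preimages are replaced by their
     interiors. *)
  - exists (g @^-1` T)^°; first exact: open_interior.
    apply/seteqP; split => [t [ht Tt]|t [ht /interior_subset Tt]] //.
    by split => //; apply: intP => //; move: ht; rewrite /= in_itv.
  - exists (~` (g @^-1` T')^°); first by apply: open_closedC; exact: open_interior.
    apply/seteqP; split => [t [ht Tt]|t [ht Tt]].
      by split => // /interior_subset; exact: nTT'.
    split => //; have ht' : lo <= t <= hi by move: ht; rewrite /= in_itv.
    by have [//|T't] := nT t ht'; case: Tt; exact: intP.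
have : B s' by rewrite BE /= in_itv.
by case.
Qed.

End Sides.

Section OneSided.
Variables (R : realType) (n : nat) (M : closed_riemannian R n.+1) (Y : set M).
Variables (p : M) (i : chart M) (a : 'I_n.+1) (r : R).
Hypothesis (dp : dom i p) (r0 : 0 < r) (br : ball (phi i p) r `<=` img i).
Hypothesis graph : forall x x', ball (phi i p) r x -> ball (phi i p) r x' ->
  Y (psi i x) -> Y (psi i x') -> (forall b, b != a -> x 0 b = x' 0 b) -> x = x'.
Hypothesis Yp : Y p.
Let x0 := phi i p.
Let e : 'rV[R]_n.+1 := delta_mx 0 a.
Let r2 := r / 2.

(* The point with a-th coordinate [x0 0 a + sg * s] on the line through x parallel to e_a. *)
Definition line_point (sg : R) (x : 'rV[R]_n.+1) s : 'rV[R]_n.+1 := x + (x0 0 a + sg * s - x 0 a) *: e.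

Local Notation lin := line_point.

Let lin_b sg x s b : b != a -> lin sg x s 0 b = x 0 b.
Proof. by move=> ba; rewrite !mxE (negbTE ba) andbF mulr0 addr0. Qed.

Let lin_a sg x s : lin sg x s 0 a = x0 0 a + sg * s.
Proof. by rewrite !mxE !eqxx mulr1 addrC subrK. Qed.

Let r20 : 0 < r2. Proof. by rewrite divr_gt0. Qed.
Let r2r : r2 < r. Proof. by rewrite ltr_pdivrMr// ltr_pMr// ltr1n. Qed.

Let sgn (sg : R) := sg = 1 \/ sg = -1.

Let normsg sg s : sgn sg -> `|sg * s| = `|s|.
Proof. by case=> ->; rewrite ?mul1r// mulN1r normrN. Qed.

Let lin_ball sg x s : sgn sg -> ball x0 r x -> `|s| <= r2 -> ball x0 r (lin sg x s).
Proof.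
move=> hs bx sr; apply/ball_rVP => // b; have [->|ba] := eqVneq b a.
  by rewrite lin_a opprD addrA subrr sub0r normrN normsg// (le_lt_trans sr).
by rewrite lin_b//; exact: (ball_rVP x0 x r0).1.
Qed.

Let lin_continuous sg x s : sgn sg -> ball x0 r x -> `|s| <= r2 ->
  {for s, continuous (fun s => psi i (lin sg x s))}.
Proof.
move=> hs bx sr; apply: (@continuous_comp _ _ _ (lin sg x) (psi i)).
  apply: cvgD; first exact: cvg_cst.
  apply: cvgZr_tmp; apply: cvgB; last exact: cvg_cst.
  by apply: cvgD; [exact: cvg_cst|apply: cvgM; [exact: cvg_cst|exact: cvg_id]].
by apply: psi_continuous; apply: br; exact: lin_ball.
Qed.

Let lin_unique sg x s s' : sgn sg -> ball x0 r x -> `|s| <= r2 -> `|s'| <= r2 ->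
  Y (psi i (lin sg x s)) -> Y (psi i (lin sg x s')) -> s = s'.
Proof.
move=> hs bx sr sr' Ys Ys'.
have := graph (lin_ball hs bx sr) (lin_ball hs bx sr') Ys Ys'.
move=> /(_ (fun b ba => etrans (lin_b sg x s ba) (esym (lin_b sg x s' ba)))) /matrixP /(_ 0 a).
rewrite !lin_a => /addrI; case: hs => ->; first by rewrite !mul1r.
by rewrite !mulN1r => /oppr_inj.
Qed.

Let lin_x sg x : sgn sg -> lin sg x (sg * (x 0 a - x0 0 a)) = x.
Proof.
move=> hs; rewrite /line_point mulrA (_ : sg * sg = 1); last by case: hs => ->; rewrite ?mulrNN mulr1.
by rewrite mul1r [x0 0 a + _]addrC subrK subrr scale0r addr0.
Qed.

Variables (T T' : set M).
Hypotheses (oT : open T) (oT' : open T') (TT' : T `&` T' = set0) (TUT' : T `|` T' = ~` Y).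
Hypothesis clT : closure T p.
Hypothesis clT' : closure T' p.

Let nTT' q : T q -> ~ T' q.
Proof. by move=> Tq T'q; have : (T `&` T') q by []; rewrite TT'. Qed.

Let TT'C : T' `&` T = set0. Proof. by rewrite setIC. Qed.
Let TUT'C : T' `|` T = ~` Y. Proof. by rewrite setUC. Qed.

Let YT q : T q -> ~ Y q.
Proof. by move=> Tq; have : (T `|` T') q by [left]; rewrite TUT'. Qed.
Let YT' q : T' q -> ~ Y q.
Proof. by move=> Tq; have : (T `|` T') q by [right]; rewrite TUT'. Qed.

Variable rho : R.
Hypotheses (rho0 : 0 < rho) (rho2 : rho <= r2).

Let bxr x : ball x0 rho x -> ball x0 r x.
Proof. by apply: le_ball; rewrite (le_trans rho2)// ltW. Qed.

Let sx sg x : sgn sg -> ball x0 rho x -> `|sg * (x 0 a - x0 0 a)| < r2.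
Proof.
by move=> hs /(ball_rVP x0 x rho0) h; rewrite normsg// distrC (lt_le_trans (h a)).
Qed.

(** A point of [U'] is off [Y], and its line meets [Y] at most once in the ball; so one of the two
    pieces joining it to the ends avoids [Y], which would put it on the side of the ends. *)
Lemma same_ends_side (U U' : set M) sg x : open U -> open U' -> U `&` U' = set0 -> U `|` U' = ~` Y ->
  sgn sg -> ball x0 rho x ->
  U (psi i (lin sg x (- r2))) -> U (psi i (lin sg x r2)) -> ~ U' (psi i x).
Proof.
move=> oU oU' UU' UUY hs bx Um Up U'x.
have nUY q : U' q -> ~ Y q by move=> Uq; have : (U `|` U') q by [right]; rewrite UUY.
have nUU q : U q -> ~ U' q by move=> Uq U'q; have : (U `&` U') q by []; rewrite UU'.
pose s := sg * (x 0 a - x0 0 a); have sr : `|s| < r2 by exact: sx.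
move: (sr); rewrite ltr_norml => /andP[s1 s2].
have Es : lin sg x s = x by exact: lin_x.
have bxx := bxr bx.
have cont lo hi : - r2 <= lo -> hi <= r2 -> forall s, lo <= s <= hi ->
    {for s, continuous (fun s => psi i (lin sg x s))}.
  move=> h1 h2 t /andP[t1 t2]; apply: lin_continuous => //.
  by rewrite ler_norml (le_trans h1)//= (le_trans t2).
have [h|h] := pselect (forall t, - r2 <= t <= s -> ~ Y (psi i (lin sg x t))).
  apply: (nUU _ _ U'x); rewrite -Es.
  apply: (side_constant oU oU' UU' UUY (cont _ _ (lexx _) (ltW s2)) h _ _ Um).
    by rewrite lexx ltW.
  by rewrite lexx ltW.
have [t [ht Yt]] : exists t, - r2 <= t <= s /\ Y (psi i (lin sg x t)).
  by apply: contrapT => nh; apply: h => t ht Yt; apply: nh; exists t.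
apply: (nUU _ _ U'x); rewrite -Es.
apply: (side_constant oU oU' UU' UUY (cont _ _ (ltW s1) (lexx _)) _ _ _ Up).
- move=> t' /andP[st' t'r] Yt'; have /andP[rt ts] := ht.
  have E : t = t'.
    apply: (@lin_unique sg x) => //; rewrite ler_norml ?rt ?t'r ?andbT//=.
      by rewrite (le_trans ts)// ltW.
    by rewrite (le_trans _ st')// ltW.
  have Est : t = s by apply/eqP; rewrite eq_le ts E.
  by apply: nUY U'x _; rewrite -Es -Est.
- by rewrite lexx ltW.
- by rewrite lexx ltW.
Qed.

(** Let up be the direction of [sg]. The only crossing of a line lies below every point of [T] on
    it: otherwise the piece going down to the end in [T'] would avoid [Y]. Hence moving up from [T],
    or strictly up from [Y], ends in [T]. *)
Lemma above_side sg : sgn sg ->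
  (forall x, ball x0 rho x -> T' (psi i (lin sg x (- r2)))) ->
  (forall x, ball x0 rho x -> T (psi i (lin sg x r2))) ->
  forall x t, 0 <= t -> ball x0 rho x -> ball x0 rho (x + (sg * t) *: e) ->
    (T (psi i x) -> T (psi i (x + (sg * t) *: e))) /\
    (0 < t -> Y (psi i x) -> T (psi i (x + (sg * t) *: e))).
Proof.
move=> hs hm hp x t t0 bx bx'.
pose s := sg * (x 0 a - x0 0 a); have sr : `|s| < r2 by exact: sx.
move: (sr); rewrite ltr_norml => /andP[s1 s2].
have Es : lin sg x s = x by exact: lin_x.
have Est : lin sg x (s + t) = x + (sg * t) *: e.
  rewrite /line_point; congr (x + _ *: _).
  have E : sg * s = x 0 a - x0 0 a by rewrite /s mulrA; case: hs => ->; rewrite ?mulrNN !mul1r.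
  by rewrite mulrDr E; ring.
have st2 : s + t < r2.
  have := sx hs bx'; rewrite ltr_norml => /andP[_]; congr (_ < _).
  rewrite !mxE !eqxx mulr1 /s -addrA [sg * t + _]addrC addrA mulrDr mulrA.
  by case: hs => ->; rewrite ?mulrNN !mul1r.
have bxx := bxr bx.
have cont lo hi : - r2 <= lo -> hi <= r2 -> forall s, lo <= s <= hi ->
    {for s, continuous (fun s => psi i (lin sg x s))}.
  move=> h1 h2 t' /andP[t1 t2]; apply: lin_continuous => //.
  by rewrite ler_norml (le_trans h1)//= (le_trans t2).
split=> [Tx|tp Yx]; rewrite -Est.
  have [h|h] := pselect (forall t, s <= t <= r2 -> ~ Y (psi i (lin sg x t))).
    apply: (side_constant oT oT' TT' TUT' (cont _ _ (ltW s1) (lexx _)) h _ _ (_ : T (psi i (lin sg x s)))).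
    - by rewrite lexx ltW.
    - by rewrite lerDl t0 ltW.
    - by rewrite Es.
  have [t1 [/andP[ht1 ht2] Yt]] : exists t, s <= t <= r2 /\ Y (psi i (lin sg x t)).
    by apply: contrapT => nh; apply: h => t1 ht Yt; apply: nh; exists t1.
  exfalso; apply: (nTT' _ (hm x bx)).
  apply: (side_constant oT oT' TT' TUT' (cont _ _ (lexx _) (ltW s2)) _ _ _ (_ : T (psi i (lin sg x s)))).
  - move=> t' /andP[st' t'r] Yt'.
    have E : t1 = t'.
      apply: (@lin_unique sg x) => //; rewrite ler_norml ?st' ?ht2 ?andbT//=.
        by rewrite (le_trans _ ht1)// ltW.
      by rewrite (le_trans t'r)// ltW.
    have E1 : t1 = s by apply/eqP; rewrite eq_le ht1 E t'r.
    by apply: YT Tx _; rewrite -Es -E1.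
  - by rewrite lexx ltW.
  - by rewrite lexx ltW.
  - by rewrite Es.
have h1 : - r2 <= s + t by rewrite (le_trans (ltW s1))// lerDl.
apply: (side_constant oT oT' TT' TUT' (cont (s + t) r2 h1 (lexx _)) _ _ _ (hp x bx)).
- move=> t' /andP[st' t'r] Yt'.
  have E : s = t'.
    apply: (@lin_unique sg x) => //; rewrite ?(ltW sr) ?Es//.
    by rewrite ler_norml t'r andbT (le_trans h1).
  by move: st'; rewrite -E -[X in _ <= X]addr0 lerD2l leNgt tp.
- by rewrite (ltW st2) lexx.
- by rewrite lexx ltW.
Qed.

End OneSided.

(** Uniqueness on the line through [p] keeps its ends off [Y]. If both ends were on one side,
    [same_ends_side] would exclude the other side near [p], although [p] is in both closures. Hence
    the ends lie on opposite sides, and [sg] records which direction enters [S]. *)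
Lemma one_sided (R : realType) (n : nat) (M : closed_riemannian R n.+1) (k : nat)
    (alpha : R) (Y S S' : set M) p : (2 <= k)%N -> 0 < alpha -> closed_hypersurface k alpha Y ->
  open S -> open S' -> S `&` S' = set0 -> S `|` S' = ~` Y ->
  closure S `\` S = Y -> closure S' `\` S' = Y -> Y p ->
  exists i (a : 'I_n.+1) (sg rho : R), [/\ dom i p, sg = 1 \/ sg = -1, 0 < rho,
    ball (phi i p) rho `<=` img i &
    forall x t, 0 <= t -> ball (phi i p) rho x ->
      ball (phi i p) rho (x + (sg * t) *: delta_mx 0 a) ->
      (S (psi i x) -> S (psi i (x + (sg * t) *: delta_mx 0 a))) /\
      (0 < t -> Y (psi i x) -> S (psi i (x + (sg * t) *: delta_mx 0 a)))].
Proof.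
move=> hk a0 hY oS oS' SS' SUS cS cS' Yp.
have [i [a [r [dp r0 br graph]]]] := hypersurface_graph hk a0 hY Yp.
have clS : closure S p by have : (closure S `\` S) p by [rewrite cS]; case.
have clS' : closure S' p by have : (closure S' `\` S') p by [rewrite cS']; case.
have SS'C : S' `&` S = set0 by rewrite setIC.
have SUSC : S' `|` S = ~` Y by rewrite setUC.
set x0 := phi i p in br graph *.
pose lin := line_point p i a.
have r20 : 0 < r / 2 by rewrite divr_gt0.
have r2r : r / 2 < r by rewrite ltr_pdivrMr// ltr_pMr// ltr1n.
have bx0 : ball x0 r x0 by exact: ballxx.
have Yx0 : Y (psi i x0) by rewrite phiK.
have lin0 s : lin 1 x0 s = x0 + s *: delta_mx 0 a.
  by rewrite /lin /line_point mul1r addrAC subrr add0r.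
have nYs s : `|s| = r / 2 -> ball x0 r (lin 1 x0 s) /\ ~ Y (psi i (lin 1 x0 s)).
  move=> sr; have bs : ball x0 r (lin 1 x0 s).
    apply/ball_rVP => // b; rewrite lin0 !mxE eqxx /= opprD addrA subrr sub0r normrN normrM sr.
    by case: (b == a); rewrite ?normr1 ?normr0 ?mulr1 ?mulr0.
  split => // Ys; have E : x0 = lin 1 x0 s.
    by apply: (graph _ _ bx0 bs Yx0 Ys) => b ba; rewrite lin0 !mxE (negbTE ba) andbF mulr0 addr0.
  move: E; rewrite lin0 => /eqP; rewrite -subr_eq0 opprD addrA subrr sub0r oppr_eq0 => /eqP/matrixP/(_ 0 a).
  by rewrite !mxE !eqxx mulr1 => s0; move: sr r20; rewrite s0 normr0 => <-; rewrite ltxx.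
have side s : `|s| = r / 2 -> exists U, [/\ U = S \/ U = S' & exists2 rh, 0 < rh &
    forall x, ball x0 rh x -> U (psi i (lin 1 x s))].
  move=> sr; have [bs nY] := nYs s sr.
  have [U [oU hU Us]] : exists U, [/\ open U, U = S \/ U = S' & U (psi i (lin 1 x0 s))].
    have : (S `|` S') (psi i (lin 1 x0 s)) by rewrite SUS.
    by case=> h; [exists S|exists S']; split => //; [left|right].
  exists U; split => //.
  have : nbhs (lin 1 x0 s) (psi i @^-1` U).
    by apply: continuous_nbhs; [exact: psi_continuous (br _ bs)|exact: open_nbhs_nbhs].
  move=> /nbhs_ballP[rh rh0 h]; exists rh => // x /(ball_rVP x0 x rh0) bx; apply: h.
  apply/ball_rVP => // b; rewrite !mxE; have [->|ba] := eqVneq b a.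
    by rewrite eqxx !mulr1 [x0 0 a + (_ - _)]addrC [x 0 a + _]addrC !subrK subrr normr0.
  by rewrite andbF !mulr0 !addr0.
have [Up [hUp [rp rp0 hp]]] := side (r / 2) (ger0_norm (ltW r20)).
have [Um [hUm [rm rm0 hm]]] := side (- (r / 2)) (etrans (normrN _) (ger0_norm (ltW r20))).
(* Lines through points this close to [p] have their ends on the same sides as the line through
   [p]. *)
pose rho := Num.min (r / 2) (Num.min rp rm).
have rho0 : 0 < rho by rewrite !lt_min r20 rp0.
have rho2 : rho <= r / 2 by rewrite ge_min lexx.
have hp' x : ball x0 rho x -> Up (psi i (lin 1 x (r / 2))).
  by move=> bx; apply: hp; apply: le_ball bx; rewrite !ge_min lexx orbT.
have hm' x : ball x0 rho x -> Um (psi i (lin 1 x (- (r / 2)))).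
  by move=> bx; apply: hm; apply: le_ball bx; rewrite !ge_min lexx !orbT.
have linN x s : lin (-1) x s = lin 1 x (- s) by rewrite /lin /line_point mulN1r mul1r.
have near_cl (U : set M) : closure U p -> exists2 x, ball x0 rho x & U (psi i x).
  move=> cU; have nb : nbhs p (dom i `&` phi i @^-1` ball x0 rho).
    apply: open_nbhs_nbhs; split; last by split => //; exact: ballxx.
    by apply: preimage_open; exact: ball_open.
  by have [q [Uq [dq bq]]] := cU _ nb; exists (phi i q); rewrite // phiK.
have brho : ball x0 rho `<=` img i.
  by move=> x bx; apply: br; apply: le_ball bx; rewrite (le_trans rho2)// ltW.
have absurd (U U' : set M) : open U -> open U' -> U `&` U' = set0 -> U `|` U' = ~` Y ->
    closure U' p -> Up = U -> Um = U -> False.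
  move=> oU oU' UU' UUY clU E1 E2; have [x bx U'x] := near_cl _ clU.
  apply: (same_ends_side r0 br graph rho0 rho2 oU oU' UU' UUY (or_introl erefl) bx _ _ U'x).
    by rewrite -E2; exact: hm'.
  by rewrite -E1; exact: hp'.
case: hUp => EUp; case: hUm => EUm.
- by case: (absurd S S' oS oS' SS' SUS clS' EUp EUm).
- exists i, a, 1, rho; split => //; first by left.
  apply: (above_side r0 br graph oS oS' SS' SUS rho0 rho2 (or_introl erefl)).
    by rewrite -EUm.
  by rewrite -EUp.
- exists i, a, (-1), rho; split => //; first by right.
  apply: (above_side r0 br graph oS oS' SS' SUS rho0 rho2 (or_intror erefl)) => x bx.
    by rewrite -[line_point _ _ _]/lin linN opprK -EUp; exact: hp'.
  by rewrite -[line_point _ _ _]/lin linN -EUm; exact: hm'.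
- by case: (absurd S' S oS' oS SS'C SUSC clS EUp EUm).
Qed.

(** * Uniform integrability *)

Lemma sqr_sum_le (R : realFieldType) N (a : nat -> R) :
  (\sum_(k < N) a k) ^+ 2 <= N%:R * \sum_(k < N) a k ^+ 2.
Proof.
elim: N => [|N IH]; first by rewrite !big_ord0 mul0r expr0n.
rewrite !big_ord_recr /=; move: IH; set s := \sum_(k < N) a k; set q := \sum_(k < N) a k ^+ 2.
have q0 : 0 <= q by apply: sumr_ge0 => k _; exact: sqr_ge0.
rewrite -natr1; case: N @s @q q0 => [|N] s q q0 IH.
  by rewrite /s /q !big_ord0 !add0r mul1r.
have N0 : 0 < N.+1%:R :> R by rewrite ltr0n.
move: N0 IH; move: (N.+1%:R) => c c0 IH.
have h : 2 * s * a N.+1 <= q + c * a N.+1 ^+ 2.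
  rewrite -(ler_pM2l c0); have := sqr_ge0 (s - c * a N.+1); move: IH; nra.
by move: h IH; nra.
Qed.

Lemma integral_indicE d (T : measurableType d) (R : realType) (mu : {measure set T -> \bar R})
    (A : set T) (f : T -> R) :
  (\int[mu]_(x in A) (f x)%:E = \int[mu]_x (f x * \1_A x)%:E)%E.
Proof.
rewrite integral_mkcond; apply: eq_integral => x _; rewrite patchE indicE.
by case: ifP => _; rewrite ?mulr1// mulr0.
Qed.

Lemma sqr_le_shift (R : realFieldType) (u v : R) : u ^+ 2 <= 2 * v ^+ 2 + 2 * (v - u) ^+ 2.
Proof. by have := sqr_ge0 (2 * v - u); lra. Qed.

(** * Translation estimates for functions of class C^1 *)

Section Shift.
Variables (R : realType) (m : nat).
Local Notation Ck := (of_class (@continuous_in R _)).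
Local Notation E := (bor 'rV[R]_m).
Local Notation mu := (lebV R m).
Implicit Types (F : 'rV[R]_m -> R) (x y v : 'rV[R]_m).

Definition directional F v y : R := \sum_(a < m) partial a F y * v 0 a.

Lemma Ck1_is_derive (D : set 'rV[R]_m) F y v : open D -> Ck 1 D F -> D y ->
  is_derive y v F (directional F v y).
Proof.
move=> oD CF Dy; have [dF dE] := Ck1_differentiable oD CF Dy.
by split; [exact: diff_derivable|rewrite deriveE// dE].
Qed.

Lemma directional_MVT (D : set 'rV[R]_m) F y v t : open D -> Ck 1 D F -> 0 <= t ->
  (forall s, 0 <= s <= t -> D (y + s *: v)) ->
  exists2 s, 0 <= s <= t & F (y + t *: v) - F y = directional F v (y + s *: v) * t.
Proof.
move=> oD CF t0 hD; pose g (s : R) := F (s *: v + y).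
have hd s : 0 <= s <= t -> is_derive s 1 g (directional F v (s *: v + y)).
  by move=> hs; apply: is_derive_line; apply: (Ck1_is_derive v oD CF); rewrite addrC; exact: hD.
have [||c] := @MVT_segment R g (fun s => directional F v (s *: v + y)) 0 t t0.
- by move=> s; rewrite in_itv /= => /andP[s0 st]; apply: hd; rewrite !ltW.
- by apply: derivable_within_continuous => s; rewrite in_itv /= => /hd[].
rewrite in_itv /= subr0 => hc; rewrite /g scale0r add0r => Eg.
by exists c => //; rewrite ![y + _]addrC.
Qed.

Variables (D : set 'rV[R]_m) (oD : open D) (F : E -> R) (CF : Ck 1 D F).

Let mD : measurable (D : set E). Proof. exact: open_bor. Qed.

Let cF x : D x -> {for x, continuous (F : 'rV[R]_m -> R)}.
Proof. exact: (CkW oD CF). Qed.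

Lemma Ck1_measurable : measurable_fun (D : set E) F.
Proof. by apply: continuous_measurable_real => // x Dx; exact: cF. Qed.

Lemma partial_measurable a : measurable_fun (D : set E) (partial a F : E -> R).
Proof. by apply: continuous_measurable_real => // x Dx; have [_ h] := Ck1P CF; exact: h. Qed.

Lemma directional_measurable v : measurable_fun (D : set E) (directional F v : E -> R).
Proof.
apply: measurable_sum => a; apply: measurable_funM => //; exact: partial_measurable.
Qed.

(** Extension by zero, so that translation invariance of Lebesgue measure applies on the whole
    space. *)
Let Fh : E -> R := F \_ D.
Let mFh : measurable_fun setT Fh. Proof. by apply/(measurable_restrictT _ mD); exact: Ck1_measurable. Qed.
Let FhE x : D x -> Fh x = F x. Proof. by move=> Dx; rewrite /Fh patchE mem_set. Qed.

(** The shift is cut into [N + 1] equal steps. Cauchy-Schwarz and translation invariance bound the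
    left side by the integral over [W] of a squared difference quotient, which tends to the squared
    directional derivative. The constant [C] serves for domination and does not enter the bound. *)
Lemma shift_ineq (A W : set E) v C : measurable A -> measurable W -> (mu W < +oo)%E ->
  (forall x s, A x -> 0 <= s <= 1 -> W (x + s *: v)) ->
  (forall y s, W y -> 0 <= s <= 1 -> D (y + s *: v) /\ `|directional F v (y + s *: v)| <= C) ->
  (\int[mu]_(x in A) ((F (x + v) - F x) ^+ 2)%:E <= \int[mu]_(y in W) (directional F v y ^+ 2)%:E)%E.
Proof.
move=> mA mW Wfin hA hW.
have W0 x : A x -> W x by move=> Ax; have := hA x 0 Ax; rewrite scale0r addr0; apply; rewrite lexx ler01.
have WD y : W y -> D y by move=> Wy; have [] := hW y 0 Wy; rewrite ?scale0r ?addr0 ?lexx ?ler01.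
pose t (N : nat) : R := N.+1%:R^-1.
have t0 N : 0 < t N by rewrite invr_gt0.
have t1 N : t N <= 1 by rewrite invf_le1// ler1n.
pose dd N (y : E) := (Fh (y + t N *: v) - Fh y) * N.+1%:R.
pose G N (y : E) := dd N y ^+ 2 * \1_W y.
have mdd N : measurable_fun setT (dd N).
  apply: measurable_funM => //; apply: measurable_funB => //.
  exact: measurableT_comp mFh (measurable_translate (t N *: v)).
have mG N : measurable_fun setT (G N).
  by apply: measurable_funM; [exact: measurable_funX|exact: measurable_indic].
have G0 N y : 0 <= G N y by rewrite mulr_ge0 ?sqr_ge0.
have ddE N y : W y -> exists2 s, 0 <= s <= t N & dd N y = directional F v (y + s *: v).
  move=> Wy; have hs s : 0 <= s <= t N -> D (y + s *: v).
    by move=> /andP[s0 st]; have [|] := hW y s Wy; rewrite ?s0 ?(le_trans st).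
  have [s hst Es] := directional_MVT oD CF (ltW (t0 N)) hs.
  exists s => //; rewrite /dd !FhE; [|exact: WD|by apply: hs; rewrite lexx ltW].
  by rewrite Es mulfVK// pnatr_eq0.
have GC N y : `|G N y| <= C ^+ 2 * \1_W y.
  rewrite ger0_norm// /G indicE; have [/set_mem Wy|_] := boolP (y \in W); last by rewrite !mulr0.
  have [s /andP[s0 st] ->] := ddE N y Wy.
  have [|_ h] := hW y s Wy; first by rewrite s0 (le_trans st).
  rewrite !mulr1 -(real_normK (num_real (directional _ _ _))).
  by rewrite lerXn2r ?nnegrE// (le_trans _ h).
have step N : (\int[mu]_(x in A) ((F (x + v) - F x) ^+ 2)%:E <= \int[mu]_x (G N x)%:E)%E.
  (* Each increment is the quotient [dd] divided by [N + 1], and [sqr_sum_le] costs a factor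
     [N + 1]; the net factor is [t N]. *)
  have pw x : A x -> (F (x + v) - F x) ^+ 2 <= t N * \sum_(k < N.+1) G N (x + (k%:R * t N) *: v).
    move=> Ax; pose a k := Fh (x + (k.+1%:R * t N) *: v) - Fh (x + (k%:R * t N) *: v).
    have Wk (k : nat) : (k <= N.+1)%N -> W (x + (k%:R * t N) *: v).
      move=> kN; apply: hA => //; rewrite mulr_ge0 ?(ltW (t0 N))//=.
      by rewrite /t ler_pdivrMr// mul1r ler_nat.
    have -> : F (x + v) - F x = \sum_(k < N.+1) a k.
      rewrite -(big_mkord xpredT a) telescope_sumr// mul0r scale0r addr0 /t divff ?pnatr_eq0//.
      rewrite scale1r !FhE//; first exact: WD (W0 _ Ax).
      by have := WD _ (Wk N.+1 (leqnn _)); rewrite /t divff ?pnatr_eq0// scale1r.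
    apply: le_trans (sqr_sum_le _ _) _.
    rewrite [leRHS]mulr_sumr mulr_sumr ler_sum// => k _.
    have Wkk : W (x + (k%:R * t N) *: v) by apply: Wk; exact: ltnW.
    rewrite /G indicE mem_set// mulr1 /dd.
    have -> : x + (k%:R * t N) *: v + t N *: v = x + (k.+1%:R * t N) *: v.
      by rewrite -addrA -scalerDl -natr1 mulrDl mul1r.
    rewrite -/(a k) le_eqVlt; apply/orP; left; apply/eqP.
    have : N.+1%:R != 0 :> R by rewrite pnatr_eq0.
    by rewrite /t; move: (N.+1%:R) (a k) => c u c0; field.
  rewrite integral_indicE.
  apply: (@le_trans _ _ (\int[mu]_x (\sum_(k < N.+1) (t N)%:E * (G N (x + (k%:R * t N) *: v))%:E))%E).
    have mGt k : measurable_fun setT (fun x : E => (G N (x + (k%:R * t N) *: v))%:E).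
      by apply/measurable_EFinP; exact: measurableT_comp (mG N) (measurable_translate _).
    have mL : measurable_fun setT (fun x : E => ((F (x + v) - F x) ^+ 2 * \1_A x)%:E).
      apply/measurable_EFinP.
      rewrite (_ : (fun x => _) = fun x => (Fh (x + v) - Fh x) ^+ 2 * \1_A x).
        apply: measurable_funM; last exact: measurable_indic.
        apply: measurable_funX; apply: measurable_funB => //.
        exact: measurableT_comp mFh (measurable_translate v).
      apply/funext => x; rewrite indicE; have [/set_mem Ax|_] := boolP (x \in A); last by rewrite !mulr0.
      rewrite !FhE//; first exact: WD (W0 _ Ax).
      by have := WD _ (hA x 1 Ax _); rewrite scale1r; apply; rewrite ler01 lexx.
    apply: ge0_le_integral => //.
    - by move=> x _; rewrite lee_fin mulr_ge0 ?sqr_ge0.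
    - by apply: emeasurable_sum => k _; apply: emeasurable_funM.
    - move=> x _; under eq_bigr do rewrite -EFinM.
      rewrite sumEFin lee_fin indicE; have [/set_mem Ax|_] := boolP (x \in A).
        by rewrite mulr1 -mulr_sumr; exact: pw.
      by rewrite mulr0 sumr_ge0// => k _; rewrite mulr_ge0// ltW.
  have mGt k : measurable_fun setT (fun x : E => (G N (x + (k%:R * t N) *: v))%:E).
    by apply/measurable_EFinP; exact: measurableT_comp (mG N) (measurable_translate _).
  rewrite (ge0_integral_sum mu measurableT (f := fun (k : 'I_N.+1) (x : E) => ((t N)%:E * (G N (x + (k%:R * t N) *: v))%:E)%E)); last 2 first.
  - by move=> k; apply: emeasurable_funM.
  - by move=> k x _; rewrite mule_ge0 ?lee_fin// ltW.
  rewrite (eq_bigr (fun=> (t N)%:E * \int[mu]_x (G N x)%:E)%E); last first.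
    move=> k _; rewrite ge0_integralZl//; last 2 first.
    - by move=> x _; rewrite lee_fin.
    - by rewrite lee_fin ltW.
    congr (_ * _)%E.
    apply: (@lebV_translate R m (fun x => (G N x)%:E)); first exact/measurable_EFinP.
    by move=> x; rewrite lee_fin.
  rewrite -ge0_sume_distrl; last by move=> k _; rewrite lee_fin ltW.
  by rewrite sumEFin sumr_const card_ord -mulr_natr /t mulVf ?pnatr_eq0// mul1e.
have [|||||_ _ lim] := @dominated_convergence _ _ R mu setT measurableT
  (fun N x => (G N x)%:E) (fun x => (directional F v x ^+ 2 * \1_W x)%:E)
  (fun x => (C ^+ 2 * \1_W x)%:E).
- by move=> N; exact/measurable_EFinP.
- apply/measurable_EFinP.
  rewrite (_ : (fun x => _) = fun x => ((directional F v : E -> R) \_ D) x ^+ 2 * \1_W x).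
    apply: measurable_funM; last exact: measurable_indic.
    apply: measurable_funX; apply/(measurable_restrictT _ mD); exact: directional_measurable.
  apply/funext => x; rewrite indicE; have [/set_mem Wx|_] := boolP (x \in W); last by rewrite !mulr0.
  by rewrite patchE mem_set//; exact: WD.
- apply: aeW => y _; apply: cvg_EFin; first exact: nearW.
  rewrite /G indicE; have [/set_mem Wy|_] := boolP (y \in W); last first.
    by rewrite mulr0 [X in X @ _ --> _](_ : _ = cst 0); [exact: cvg_cst|apply/funext => k /=; rewrite mulr0].
  have cD : {for y, continuous (directional F v)}.
    apply: (@cvg_bigsum R _ (nbhs y) _ _ _ (fun a z => partial a F z * v 0 a)) => a.
    have [_ h] := Ck1P CF; apply: cvgM; [exact: h (WD _ Wy)|exact: cvg_cst].
  have cdd : dd N y @[N --> \oo] --> directional F v y.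
    apply/cvgrPdist_lt => eps eps0.
    have /nbhs_ballP[d /= d0 hd] : nbhs y [set z | `|directional F v y - directional F v z| < eps].
      apply: (continuous_nbhs cD (A := [set u | `|directional F v y - u| < eps])).
      by have := @nbhsx_ballx _ _ (directional F v y) _ eps0; rewrite -ball_normE.
    have v1 : 0 < `|v| + 1 by rewrite ltr_wpDl.
    have dv : 0 < d / (`|v| + 1) by rewrite divr_gt0.
    near=> N; have [s /andP[s0 st] ->] := ddE N y Wy; apply: hd; rewrite -ball_normE /=.
    rewrite opprD addrA subrr sub0r normrN normrZ ger0_norm//.
    apply: (@le_lt_trans _ _ (t N * (`|v| + 1))); first by rewrite ler_pM// lerDl.
    rewrite -ltr_pdivlMr//; near: N; exact: (near_infty_natSinv_lt (PosNum dv)).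
  rewrite mulr1 expr2 [X in X @ _ --> _](_ : _ = fun k => dd k y * dd k y); first exact: cvgM.
  by apply/funext => k /=; rewrite mulr1 expr2.
- apply/integrableP; split; first by apply/measurable_EFinP; apply: measurable_funM => //; exact: measurable_indic.
  rewrite (eq_integral (fun x : E => ((C ^+ 2)%:E * (\1_W x)%:E)%E)); last first.
    by move=> x _; rewrite -EFinM gee0_abs// lee_fin; apply: mulr_ge0; rewrite ?sqr_ge0// indicE ler0n.
  rewrite ge0_integralZl//; last 2 first.
  - by apply/measurable_EFinP; exact: measurable_indic.
  - by rewrite lee_fin sqr_ge0.
  by rewrite integral_indic// setIT lte_mul_pinfty// lee_fin sqr_ge0.
- by apply: aeW => y N _; rewrite /= lee_fin.
rewrite [leRHS]integral_indicE -(cvg_lim _ lim)//; apply: lime_ge.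
  by apply/cvg_ex; eexists; exact: lim.
by apply: nearW => N; exact: step.
Unshelve. all: by end_near.
Qed.

Definition grad_sq y : R := \sum_(a < m) partial a F y ^+ 2.

Lemma directional_le v y h : `|v| <= h -> directional F v y ^+ 2 <= (m%:R * h ^+ 2) * grad_sq y.
Proof.
move=> vh; have h0 : 0 <= h by apply: le_trans vh.
pose b (k : nat) := if insub k is Some a then partial a F y * v 0 a else 0.
have bE (a : 'I_m) : b a = partial a F y * v 0 a by rewrite /b valK.
have -> : directional F v y = \sum_(a < m) b a by apply: eq_bigr => a _; rewrite bE.
apply: le_trans (sqr_sum_le _ _) _; rewrite -mulrA ler_wpM2l// /grad_sq mulr_sumr.
apply: ler_sum => a _; rewrite bE exprMn mulrC ler_wpM2r ?sqr_ge0//.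
rewrite -(real_normK (num_real (v 0 a))) lerXn2r ?nnegrE//.
exact: le_trans (normr_rV_le _ _) vh.
Qed.

Lemma grad_sq_measurable : measurable_fun (D : set E) (grad_sq : E -> R).
Proof. by apply: measurable_sum => a; apply: measurable_funX; exact: partial_measurable. Qed.

Lemma grad_sq_ge0 y : 0 <= grad_sq y.
Proof. by apply: sumr_ge0 => a _; exact: sqr_ge0. Qed.

Lemma directional_continuous v y : D y -> {for y, continuous (directional F v)}.
Proof.
move=> Dy; apply: (@cvg_bigsum R _ (nbhs y) _ _ _ (fun a z => partial a F z * v 0 a)) => a.
by have [_ h] := Ck1P CF; apply: cvgM; [exact: h|exact: cvg_cst].
Qed.

Lemma measurable_ccube x0 r : measurable (ccube x0 r : set E).
Proof. by apply: closed_bor; exact: closed_closed_ball_. Qed.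

Lemma lebV_ccube x0 r : (mu (ccube x0 r : set E) < +oo)%E.
Proof.
apply: (@le_lt_trans _ _ (mu (ball (0%R : 'rV[R]_m) (`|x0| + r + 1)%R : set E))); last exact: lebV_ball.
apply: le_measure; rewrite ?inE; [exact: measurable_ccube|by apply: open_bor; exact: ball_open|].
move=> x; rewrite /ccube /= -ball_normE /= sub0r normrN => h.
rewrite -[x](subrK x0) addrC (le_lt_trans (ler_normD _ _))// -addrA ler_ltD//.
by rewrite distrC (le_lt_trans h)// ltrDl.
Qed.

(** Compactness of [Q] gives the domination constant of [shift_ineq], and [directional_le] passes
    from the directional derivative to the full gradient. *)
Lemma shift_grad (Q : set 'rV[R]_m) (A W : set E) v h : compact Q -> Q `<=` D ->
  measurable A -> measurable W -> (mu W < +oo)%E -> `|v| <= h ->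
  (forall x s, A x -> 0 <= s <= 1 -> W (x + s *: v)) ->
  (forall y s, W y -> 0 <= s <= 1 -> Q (y + s *: v)) ->
  (\int[mu]_(x in A) ((F (x + v) - F x) ^+ 2)%:E <=
    (m%:R * h ^+ 2)%:E * \int[mu]_(y in W) (grad_sq y)%:E)%E.
Proof.
move=> cQ QD mA mW Wfin vh hA hQ.
have [C C0 hC] := bounded_on_compact cQ (fun y Qy => @directional_continuous v y (QD _ Qy)).
have WD : (W : set E) `<=` D.
  by move=> y Wy; apply: QD; have := hQ y 0 Wy; rewrite scale0r addr0; apply; rewrite lexx ler01.
apply: le_trans (shift_ineq mA mW Wfin hA _) _.
  by move=> y s Wy hs; have Qy := hQ y s Wy hs; split; [exact: QD|exact: hC Qy].
have mg : measurable_fun W (fun y => (grad_sq y)%:E).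
  by apply/measurable_EFinP; exact: (measurable_funS mD WD grad_sq_measurable).
rewrite -ge0_integralZl//; last 2 first.
- by move=> y _; rewrite lee_fin grad_sq_ge0.
- by rewrite lee_fin mulr_ge0 ?sqr_ge0.
apply: ge0_le_integral => //.
- by move=> y _; rewrite lee_fin sqr_ge0.
- apply/measurable_EFinP; apply: measurable_funX.
  exact: (measurable_funS mD WD (directional_measurable v)).
- by apply: emeasurable_funM.
- by move=> y _; rewrite -EFinM lee_fin; exact: directional_le.
Qed.

(** The inequality [F(x)^2 <= 2 F(x + t)^2 + 2 (F(x + t) - F(x))^2] is integrated over [x] in [A]
    and [t] in the ball of radius [h]. The first term yields a factor [mu A], small with [A]; the
    second is bounded by [shift_grad], and after division by the measure of the ball it is small
    with [h]. *)
Lemma interior_ineq x0 rho h (A : set E) : 0 < h -> h <= rho / 2 -> ccube x0 (2 * rho) `<=` D ->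
  measurable A -> A `<=` ccube x0 (rho / 2) ->
  (mu (ball (0%R : 'rV[R]_m) h) * \int[mu]_(x in A) (F x ^+ 2)%:E <=
    2%:E * mu A * \int[mu]_(x in (ccube x0 rho : set E)) (F x ^+ 2)%:E +
    2%:E * mu (ball (0%R : 'rV[R]_m) h) *
      ((m%:R * h ^+ 2)%:E * \int[mu]_(x in (ccube x0 rho : set E)) (grad_sq x)%:E))%E.
Proof.
move=> h0 hr QD mA AQ; set T : set E := ball (0 : 'rV[R]_m) h; set W : set E := ccube x0 rho.
have rho0 : 0 < rho by lra.
have mT : measurable T by apply: open_bor; exact: ball_open.
have mW : measurable W by exact: measurable_ccube.
have WD : W `<=` D by move=> x; rewrite /W /ccube /= => hx; apply: QD; rewrite /ccube /=; lra.
have Tn t : T t -> `|t| <= h.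
  by rewrite /T -ball_normE /= sub0r normrN => /ltW.
have AW x t s : A x -> `|t| <= h -> 0 <= s <= 1 -> W (x + s *: t).
  move=> /AQ; rewrite /W /ccube /= => hx ht /andP[s0 s1].
  rewrite opprD addrA (le_trans (ler_normB _ _))// normrZ (ger0_norm s0).
  have : s * `|t| <= 1 * h by rewrite ler_pM.
  by lra.
have WQ y t s : W y -> `|t| <= h -> 0 <= s <= 1 -> ccube x0 (2 * rho) (y + s *: t).
  rewrite /W /ccube /= => hx ht /andP[s0 s1].
  rewrite opprD addrA (le_trans (ler_normB _ _))// normrZ (ger0_norm s0).
  have : s * `|t| <= 1 * h by rewrite ler_pM.
  by lra.
have AWx x t : A x -> T t -> W (x + t).
  by move=> Ax /Tn ht; have := AW x t 1 Ax ht; rewrite scale1r; apply; rewrite lexx ler01.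
pose f0 (p : E * E) : R := Fh p.1 ^+ 2 * \1_A p.1 * \1_T p.2.
pose f1 (p : E * E) : R := 2 * (\1_A p.1 * (Fh (p.1 + p.2) ^+ 2 * \1_W (p.1 + p.2))).
pose f2 (p : E * E) : R := 2 * (\1_T p.2 * ((Fh (p.1 + p.2) - Fh p.1) ^+ 2 * \1_A p.1)).
have m1 (k : E -> R) : measurable_fun setT k -> measurable_fun setT (fun p : E * E => k p.1).
  by move=> mk; exact: measurableT_comp mk measurable_fst.
have m2 (k : E -> R) : measurable_fun setT k -> measurable_fun setT (fun p : E * E => k p.2).
  by move=> mk; exact: measurableT_comp mk measurable_snd.
have madd : measurable_fun setT ((fun p => p.1 + p.2) : E * E -> E).
  apply: measurable_rV => // j; under eq_fun do rewrite mxE.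
  apply: measurable_funD.
    by apply: (m1 (fun x => x 0 j)); exact: measurable_coord.
  by apply: (m2 (fun x => x 0 j)); exact: measurable_coord.
have ms (k : E -> R) : measurable_fun setT k -> measurable_fun setT (fun p : E * E => k (p.1 + p.2)).
  by move=> mk; exact: measurableT_comp mk madd.
have mI (B : set E) : measurable B -> measurable_fun setT (\1_B : E -> R) by exact: measurable_indic.
have mf0 : measurable_fun setT f0.
  by apply: measurable_funM; [apply: measurable_funM; [apply: measurable_funX|]|]; (exact: m1 || (apply: m1; exact: mI) || (apply: m2; exact: mI)).
have mf1 : measurable_fun setT f1.
  apply: measurable_funM => //; apply: measurable_funM; first by apply: m1; exact: mI.
  by apply: measurable_funM; [apply: measurable_funX; exact: ms|apply: ms; exact: mI].
have mf2 : measurable_fun setT f2.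
  apply: measurable_funM => //; apply: measurable_funM; first by apply: m2; exact: mI.
  apply: measurable_funM; last by apply: m1; exact: mI.
  by apply: measurable_funX; apply: measurable_funB; [exact: ms|exact: m1].
have I0 (B : set E) x : 0 <= (\1_B x : R) by rewrite indicE.
have f10 p : 0 <= f1 p.
  by do 3 (apply: mulr_ge0 => //); exact: sqr_ge0.
have f20 p : 0 <= f2 p.
  by do 3 (apply: mulr_ge0 => //); exact: sqr_ge0.
have f00 p : 0 <= f0 p.
  by do 2 (apply: mulr_ge0 => //); exact: sqr_ge0.
have f012 p : f0 p <= f1 p + f2 p.
  have [/set_mem Tp|nT] := boolP (p.2 \in T); last first.
    by rewrite /f0 [X in _ * X]indicE (negbTE nT) mulr0 addr_ge0.
  have [/set_mem Ap|nA] := boolP (p.1 \in A); last first.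
    by rewrite /f0 [X in _ * X * _]indicE (negbTE nA) mulr0 mul0r addr_ge0.
  rewrite /f0 /f1 /f2 !indicE !mem_set//; last exact: AWx.
  rewrite !mulr1 !mul1r; move: (Fh p.1) (Fh (p.1 + p.2)) => u v.
  exact: sqr_le_shift.
have int0 : (\int[mu]_x \int[mu]_t (f0 (x, t))%:E = mu T * \int[mu]_(x in A) (F x ^+ 2)%:E)%E.
  transitivity (\int[mu]_x (mu T * (Fh x ^+ 2 * \1_A x)%:E))%E.
    apply: eq_integral => x _; rewrite /f0 /=.
    under eq_integral do rewrite EFinM.
    rewrite ge0_integralZl//; last 2 first.
    - by apply/measurable_EFinP; exact: mI.
    - by rewrite lee_fin mulr_ge0 ?sqr_ge0.
    by rewrite integral_indic// setIT muleC.
  rewrite ge0_integralZl//; last 2 first.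
  - by apply/measurable_EFinP; apply: measurable_funM; [exact: measurable_funX|exact: mI].
  - by move=> x _; rewrite lee_fin mulr_ge0 ?sqr_ge0.
  congr (_ * _)%E; rewrite [RHS]integral_indicE; apply: eq_integral => x _; congr (_%:E).
  rewrite indicE; have [/set_mem Ax|_] := boolP (x \in A); last by rewrite !mulr0.
  by rewrite FhE//; apply: WD; have := AW x 0 0 Ax; rewrite scaler0 addr0 normr0; apply; rewrite ?(ltW h0)// lexx ler01.
have intW : (\int[mu]_x (Fh x ^+ 2 * \1_W x)%:E = \int[mu]_(x in W) (F x ^+ 2)%:E)%E.
  rewrite [RHS]integral_indicE; apply: eq_integral => x _; congr (_%:E).
  rewrite indicE; have [/set_mem Wx|_] := boolP (x \in W); last by rewrite !mulr0.
  by rewrite FhE//; exact: WD.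
pose G (x : E) := (Fh x ^+ 2 * \1_W x)%:E.
have mG : measurable_fun setT G.
  by apply/measurable_EFinP; apply: measurable_funM; [exact: measurable_funX|exact: mI].
have G0 x : (0 <= G x)%E by rewrite lee_fin mulr_ge0 ?sqr_ge0.
have mGx x : measurable_fun setT (fun t : E => G (t + x)) by exact: measurableT_comp mG (measurable_translate x).
set IW := (\int[mu]_(x in W) (F x ^+ 2)%:E)%E.
have IW0 : (0 <= IW)%E by apply: integral_ge0 => x _; rewrite lee_fin sqr_ge0.
set KW := ((m%:R * h ^+ 2)%:E * _)%E.
have KW0 : (0 <= KW)%E.
  rewrite mule_ge0//; first by rewrite lee_fin mulr_ge0 ?sqr_ge0.
  by apply: integral_ge0 => x _; rewrite lee_fin grad_sq_ge0.
have int2I (B : set E) (K : \bar R) : measurable B -> (0 <= K)%E ->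
    (\int[mu]_x ((2 * \1_B x)%:E * K) = 2%:E * mu B * K)%E.
  move=> mB K0; rewrite (eq_integral (fun x : E => (K * (2%:E * (\1_B x)%:E))%E)); last first.
    by move=> x _; rewrite EFinM muleC.
  have mIB : measurable_fun setT (fun x : E => (\1_B x)%:E : \bar R) by apply/measurable_EFinP; exact: mI.
  rewrite ge0_integralZl//; try (by apply: emeasurable_funM); try (by move=> x _; rewrite mule_ge0// lee_fin).
  rewrite ge0_integralZl//; try (by move=> x _; rewrite lee_fin).
  by rewrite integral_indic// setIT muleC.
have int1 : (\int[mu]_x \int[mu]_t (f1 (x, t))%:E = 2%:E * mu A * IW)%E.
  rewrite -int2I//; apply: eq_integral => x _.
  rewrite (eq_integral (fun t : E => ((2 * \1_A x)%:E * G (t + x)%R)%E)); last first.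
    by move=> t _; rewrite /f1 /G /= -EFinM [x + t]addrC mulrA.
  rewrite ge0_integralZl//; try (by rewrite lee_fin mulr_ge0).
  by rewrite lebV_translate// intW.
have int2 : (\int[mu]_x \int[mu]_t (f2 (x, t))%:E <= 2%:E * mu T * KW)%E.
  rewrite (fubini_tonelli (fun p => (f2 p)%:E)); last 2 first.
  - exact/measurable_EFinP.
  - by move=> p; rewrite lee_fin.
  rewrite -int2I//; apply: ge0_le_integral => //.
  - by move=> t _; apply: integral_ge0 => x _; rewrite lee_fin.
  - apply: (measurable_fun_fubini_tonelli_G (fun p => (f2 p)%:E)); first exact/measurable_EFinP.
    by move=> p; rewrite lee_fin.
  - apply: emeasurable_funM => //; apply/measurable_EFinP; apply: measurable_funM => //; exact: mI.
  - move=> t _; rewrite /f2 /= indicE.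
    have [/set_mem Tt|_] := boolP (t \in T); last first.
      by rewrite mulr0 mul0e integral0_eq// => x _; rewrite mul0r mulr0.
    have mft : measurable_fun setT (fun x : E => ((Fh (x + t) - Fh x) ^+ 2 * \1_A x)%:E).
      apply/measurable_EFinP; apply: measurable_funM; last exact: mI.
      apply: measurable_funX; apply: measurable_funB => //.
      exact: measurableT_comp mFh (measurable_translate t).
    rewrite (eq_integral (fun x : E => (2%:E * ((Fh (x + t) - Fh x) ^+ 2 * \1_A x)%:E)%E)); last first.
      by move=> x _; rewrite mul1r EFinM.
    rewrite ge0_integralZl//; try (by move=> x _; rewrite lee_fin mulr_ge0 ?sqr_ge0).
    rewrite mulr1 lee_pmul2l ?lte_fin//.
    rewrite (_ : (\int[mu]_x _)%E = (\int[mu]_(x in A) ((F (x + t) - F x) ^+ 2)%:E)%E); last first.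
      rewrite [RHS]integral_indicE; apply: eq_integral => x _; congr (_%:E).
      rewrite indicE; have [/set_mem Ax|_] := boolP (x \in A); last by rewrite !mulr0.
      have Dxt : D (x + t) by exact: WD (AWx _ _ Ax Tt).
      have Dx : D x.
        by apply: WD; have := AW x 0 0 Ax; rewrite scaler0 addr0 normr0; apply; rewrite ?(ltW h0)// lexx ler01.
      by rewrite !FhE.
    apply: (shift_grad (@ccube_compact R m x0 (2 * rho)) QD mA mW (lebV_ccube x0 rho) (Tn t Tt)).
    - by move=> x s Ax hs; apply: AW => //; exact: Tn.
    - by move=> y s Wy hs; apply: WQ => //; exact: Tn.
have mfF (k : E * E -> R) : measurable_fun setT k -> (forall p, 0 <= k p) ->
    measurable_fun setT (fun x : E => \int[mu]_t (k (x, t))%:E)%E.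
  move=> mk k0; apply: (measurable_fun_fubini_tonelli_F (fun p => (k p)%:E)); first exact/measurable_EFinP.
  by move=> p; rewrite lee_fin.
have mpair (k : E * E -> R) x : measurable_fun setT k -> measurable_fun setT (fun t : E => (k (x, t))%:E).
  move=> mk; apply/measurable_EFinP; exact: measurable_fun_pair2 mk.
rewrite -int0 -int1.
apply: (@le_trans _ _ (\int[mu]_x \int[mu]_t (f1 (x, t))%:E + \int[mu]_x \int[mu]_t (f2 (x, t))%:E)%E); last by rewrite leeD2l.
rewrite -ge0_integralD//; try exact: mfF; try by move=> x _; apply: integral_ge0 => t _; rewrite lee_fin.
apply: ge0_le_integral => //; first by move=> x _; apply: integral_ge0 => t _; rewrite lee_fin.
- exact: mfF.
- by apply: emeasurable_funD; exact: mfF.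
move=> x _; rewrite -ge0_integralD//; try exact: mpair; try by move=> t _; rewrite lee_fin.
apply: ge0_le_integral => //; first by move=> t _; rewrite lee_fin.
- exact: mpair.
- by apply: emeasurable_funD; exact: mpair.
- by move=> t _; rewrite -EFinD lee_fin.
Qed.

End Shift.

(** These identities carry out the division of constants in [interior_UI] and [boundary_UI]; they
    are kept apart so that [field] works on plain variables. *)
Lemma scaled_measure (R : realFieldType) (c k e t : R) : c != 0 -> k != 0 ->
  c * (e * t / (4 * (c * k))) = e * t / (4 * k).
Proof. by move=> c0 k0; field; rewrite c0 k0. Qed.

Lemma scaled_mass (R : realFieldType) (a b c d e : R) : a != 0 -> b != 0 ->
  2 * (e * d / (4 * (a * b))) * (b * c) = d * (e / (2 * a)) * c.
Proof. by move=> a0 b0; field; rewrite a0 b0. Qed.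

Lemma scaled_gradient (R : realFieldType) (a b c d e : R) : a != 0 ->
  2 * d * (e * (b * c)) = d * (2 * e * (a * b) / a) * c.
Proof. by move=> a0; field. Qed.

Lemma scaled_split (R : realFieldType) (a c d e : R) : a != 0 ->
  d * (e / a * c) = d * (e / (2 * a)) * c + d * (e / 2 / a) * c.
Proof. by move=> a0; field. Qed.

Lemma scaled_shift (R : realFieldType) (a c e : R) : a != 0 ->
  a * (2 * (a * (e / (4 * a * a) * c))) = e / 2 * c.
Proof. by move=> a0; field. Qed.

(** * Uniform integrability of squares under an energy bound *)

Section UniformIntegrability.
Variables (R : realType) (n : nat) (M : closed_riemannian R n.+1).
Variables (vol : {measure set (borel M) -> \bar R}) (hvol : is_volume vol).
Variables (S : set M) (oS : open S).
Implicit Types (i : chart M) (p : M) (f : M -> R).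
Local Notation Ck := (of_class (@continuous_in R _)).
Local Notation mS := (mS oS).
Local Notation sq := (sq vol S).
Local Notation DD := (DD vol S).
Local Notation E := (bor 'rV[R]_n.+1).
Local Notation mu := (lebV R n.+1).

Let volT : (vol setT < +oo)%E := vol_finite hvol.

(** The squared H^1 norm of a smooth function, read off [dform] instead of the chosen
    [weak_diff]. *)
Definition energy1 f := sq f + DD (dform f).

Lemma energy1_ge0 f : 0 <= energy1 f.
Proof. by rewrite addr_ge0 ?sq_ge0 ?DD_ge0. Qed.

(** On the compact [Q] the volume density and its inverse are bounded, so integrals against [vol]
    and against Lebesgue measure are comparable in both directions. *)
Lemma chart_compare i (Q : set 'rV[R]_n.+1) : compact Q -> Q `<=` img i ->
  exists2 C, 0 < C & forall (D : set (borel M)) (g : borel M -> R), measurable D ->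
    D `<=` psi i @` Q -> measurable_fun D g -> (forall p, D p -> 0 <= g p) ->
    (\int[mu]_(x in (img i `&` psi i @^-1` D : set E)) (g (psi i x))%:E <=
       C%:E * \int[vol]_(p in D) (g p)%:E)%E /\
    (\int[vol]_(p in D) (g p)%:E <=
       C%:E * \int[mu]_(x in (img i `&` psi i @^-1` D : set E)) (g (psi i x))%:E)%E.
Proof.
move=> cQ Qi.
have [C1 C10 h1] := bounded_on_compact cQ (fun x Qx => sqdet_continuous (Qi x Qx)).
have [|C2 C20 h2] := bounded_on_compact cQ (f := fun x => (sqdet i x)^-1).
  move=> x Qx; apply: (@cvgV _ _ (nbhs x) (nbhs_filter x)); last exact: sqdet_continuous (Qi x Qx).
  by rewrite gt_eqF// sqdet_gt0//; exact: Qi.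
pose C := C1 + C2 + 1; have C0 : 0 < C by rewrite ltr_wpDl// addr_ge0.
exists C => // D g mD DQ mg g0.
have Dd : D `<=` dom i by move=> p /DQ[x /Qi ix <-]; exact: dom_psi.
set B : set E := _ `&` _.
have mB : measurable B by apply: measurable_psi => //; exact: measurable_img.
have BQ x : B x -> Q x by move=> [ix /DQ[y Qy E]]; rewrite -(psiK ix) -E psiK//; exact: Qi.
have gB x : B x -> 0 <= g (psi i x) by move=> [_ Dx]; exact: g0.
have mgB : measurable_fun B (fun x : E => (g (psi i x))%:E).
  apply/measurable_EFinP; apply: (measurable_comp mD _ mg); first by move=> _ [x [_ Dx] <-].
  exact: (measurable_funS (measurable_img i) (@subIsetl _ _ _) (measurable_psi (i := i))).
have msq : measurable_fun B (fun x : E => (sqdet i x)%:E).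
  apply/measurable_EFinP; apply: (measurable_funS (measurable_img i)) => [x []//|].
  by apply: continuous_measurable_real; [exact: img_open|move=> x; exact: sqdet_continuous].
have mgs : measurable_fun B (fun x : E => (g (psi i x))%:E * (sqdet i x)%:E)%E by exact: emeasurable_funM.
have s0 x : 0 <= sqdet i x by exact: sqrtr_ge0.
rewrite (integral_chart hvol mD Dd); last exact/measurable_EFinP.
rewrite -!ge0_integralZl//; try (by rewrite lee_fin ltW); try (by move=> x Bx; rewrite ?mule_ge0// lee_fin gB).
split; apply: ge0_le_integral => //; try (by move=> x Bx; rewrite ?mule_ge0// lee_fin ?gB ?(ltW C0)); try (by apply: emeasurable_funM).
  move=> x Bx; rewrite -!EFinM lee_fin mulrCA ler_peMr ?gB//.
  have sx : 0 < sqdet i x by apply: sqdet_gt0; case: Bx.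
  rewrite -ler_pdivrMr// mul1r; have := h2 x (BQ x Bx); rewrite ger0_norm ?invr_ge0//.
  by rewrite /C; lra.
  move=> x Bx; rewrite -!EFinM lee_fin mulrC ler_wpM2r ?gB//.
  by have := h1 x (BQ x Bx); rewrite ger0_norm// /C; lra.
by move=> x Bx; apply: mule_ge0; rewrite lee_fin ?gB.
Qed.

Lemma chart_preimage i (B : set E) : measurable B -> B `<=` img i ->
  [/\ measurable (dom i `&` phi i @^-1` B : set (borel M)),
      img i `&` psi i @^-1` (dom i `&` phi i @^-1` B) = B
    & forall Q : set 'rV[R]_n.+1, B `<=` Q -> dom i `&` phi i @^-1` B `<=` psi i @` Q].
Proof.
move=> mB Bi; split.
- by apply: (measurable_phi (i := i)) => //; exact: measurable_dom.
- apply/seteqP; split => [x [ix [_ /=]]|x Bx]; first by rewrite psiK.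
  by split; [exact: Bi|split; [exact/dom_psi/Bi|rewrite /= psiK//; exact: Bi]].
- by move=> Q BQ p [dp Bp]; exists (phi i p); [exact: BQ|exact: phiK].
Qed.

Lemma smooth_measurable f : smooth_fun f -> measurable_fun setT (f : borel M -> R).
Proof.
move=> sf; apply: (continuous_measurable_real (X := M)) => [|p _]; first exact: openT.
exact: smooth_fun_continuous.
Qed.

(** By [covector_coord] the coordinate gradient is bounded by the invariant one times the trace of
    the metric, which is bounded on compact sets; [chart_compare] supplies the rest. *)
Lemma energy_compare i (Q : set 'rV[R]_n.+1) : compact Q -> Q `<=` img i ->
  exists2 C, 0 < C & forall (B : set E) f, measurable B -> B `<=` Q ->
    (forall x, B x -> S (psi i x)) -> smooth_fun f ->
    (\int[mu]_(x in B) ((f \o psi i) x ^+ 2)%:E <= (C * energy1 f)%:E)%E /\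
    (\int[mu]_(x in B) (grad_sq (f \o psi i) x)%:E <= (C * energy1 f)%:E)%E.
Proof.
move=> cQ Qi; have [C C0 hC] := chart_compare cQ Qi.
have cK : compact (psi i @` Q) by exact: image_compact.
have Kd p : (psi i @` Q) p -> dom i p by move=> [x /Qi ix <-]; exact: dom_psi.
have [|K K0 hK] := bounded_on_compact cK (f := fun p => \sum_a metric_at i p a a).
  move=> p /Kd dp; apply: (@cvg_bigsum R _ (nbhs p) _ _ _ (fun a q => metric_at i q a a)) => a.
  exact: metric_continuous.
exists (C * (K + 1)) => [|B f mB BQ BS sf]; first by rewrite mulr_gt0// ltr_wpDl.
have Bi : B `<=` img i by move=> x /BQ /Qi.
have [mD EB hQ] := chart_preimage mB Bi; set D : set (borel M) := dom i `&` phi i @^-1` B in mD EB hQ.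
have DQ := hQ Q BQ.
have DS : D `<=` S by move=> p [dp /BS]; rewrite phiK.
have E0 := energy1_ge0 f.
have mf := smooth_measurable sf.
have Isq := L2_sq (smooth_L2 hvol oS sf).
have Id := cvL2_Int oS (dform_cvL2 hvol oS sf).
split.
  have [] := hC D (fun p => f p ^+ 2) mD DQ.
  - by apply: measurable_funX; exact: measurable_funS mf.
  - by move=> p _; exact: sqr_ge0.
  rewrite EB => h _; apply: (le_trans h).
  rewrite -mulrA EFinM lee_pmul2l ?lte_fin//.
  apply: (@le_trans _ _ (sq f)%:E); last first.
    rewrite lee_fin (@le_trans _ _ (energy1 f))//; first by rewrite lerDl DD_ge0.
    by rewrite ler_peMl// lerDr.
  rewrite (RIntE mS Isq); apply: ge0_subset_integral => //.
  - exact: mS.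
  - by have [] := integrableP _ _ _ Isq.
  - by move=> p _; rewrite lee_fin sqr_ge0.
have [] := hC D (fun p => \sum_a dform f i p 0 a ^+ 2) mD DQ.
- apply: measurable_sum => a; apply: measurable_funX.
  apply: (measurable_funS (measurable_dom i)) => [p []//|].
  have := dform_measurable sf (measurableT : measurable (setT : set (borel M))) a.
  by move=> /(_ i); rewrite setTI.
- by move=> p _; apply: sumr_ge0 => a _; exact: sqr_ge0.
rewrite EB => h _; apply: le_trans (le_trans h _).
  rewrite le_eqVlt; apply/orP; left; apply/eqP; apply: eq_integral => x /[!inE] Bx; congr (_%:E).
  by apply: eq_bigr => a _; rewrite mxE psiK//; exact: Bi.
rewrite -mulrA EFinM lee_pmul2l ?lte_fin//.
have Kd0 p : 0 <= covector_inner (dform f) (dform f) p by exact: covector_inner_ge0.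
have mD2 : measurable_fun D (fun p => (covector_inner (dform f) (dform f) p)%:E).
  by apply/measurable_EFinP; exact: (measurable_funS mS DS (Int_meas Id)).
apply: (@le_trans _ _ (K%:E * \int[vol]_(p in D) (covector_inner (dform f) (dform f) p)%:E)%E).
  rewrite -ge0_integralZl//; try (by move=> p _; rewrite lee_fin).
  apply: ge0_le_integral => //.
  - by move=> p _; rewrite lee_fin; apply: sumr_ge0 => a _; exact: sqr_ge0.
  - apply/measurable_EFinP; apply: measurable_sum => a; apply: measurable_funX.
    apply: (measurable_funS (measurable_dom i)) => [p []//|].
    have := dform_measurable sf (measurableT : measurable (setT : set (borel M))) a.
    by move=> /(_ i); rewrite setTI.
  - by apply: emeasurable_funM.
  - move=> p Dp; have dp : dom i p by case: Dp.
    rewrite -EFinM lee_fin; apply: le_trans (_ : (\sum_a metric_at i p a a) * _ <= _).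
      rewrite mulr_suml; apply: ler_sum => a _.
      by apply: covector_coord => //; exact: dform_covector.
    by rewrite ler_wpM2r//; apply: le_trans (hK p (DQ p Dp)); exact: ler_norm.
apply: (@le_trans _ _ (K%:E * (DD (dform f))%:E)%E).
  rewrite lee_wpmul2l ?lee_fin// (RIntE mS Id); apply: ge0_subset_integral => //.
  - exact: mS.
  - by have [] := integrableP _ _ _ Id.
  - by move=> p _; rewrite lee_fin.
rewrite -EFinM lee_fin ler_pM ?DD_ge0//; first by rewrite lerDl.
by rewrite lerDr sq_ge0.
Qed.

(** Uniform integrability, over the part of [S] near [P], of the squares of smooth functions of
    bounded energy. The measurable superset [P'] makes the property hereditary, so that
    [compact_union_induction] applies. *)
Definition UI (P : set M) := exists P' : set (borel M), [/\ measurable P', P `<=` P' &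
  forall eta, 0 < eta -> exists2 del, 0 < del & forall A : set (borel M), measurable A ->
    A `<=` S `&` P' -> (vol A <= del%:E)%E -> forall f, smooth_fun f ->
    (\int[vol]_(p in A) (f p ^+ 2)%:E <= (eta * energy1 f)%:E)%E].

Lemma UI0 (P : set M) : S `&` P = set0 -> measurable (P : set (borel M)) -> UI P.
Proof.
move=> SP mP; exists P; split => // eta eta0; exists 1 => // A mA; rewrite SP => A0 _ f sf.
have -> : A = set0 by apply/seteqP; split.
by rewrite integral_set0 lee_fin mulr_ge0 ?energy1_ge0// ltW.
Qed.

Lemma UI_sub (P Q : set M) : P `<=` Q -> UI Q -> UI P.
Proof. by move=> PQ [P' [mP QP h]]; exists P'; split => //; exact: subset_trans QP. Qed.

Lemma UIU (P Q : set M) : UI P -> UI Q -> UI (P `|` Q).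
Proof.
move=> [P' [mP PP hP]] [Q' [mQ QQ hQ]]; exists (P' `|` Q'); split.
- exact: measurableU.
- exact: setUSS.
move=> eta eta0; have e2 : 0 < eta / 2 by rewrite divr_gt0.
have [d1 d10 h1] := hP _ e2; have [d2 d20 h2] := hQ _ e2.
exists (Num.min d1 d2) => [|A mA AS vA f sf]; first by rewrite lt_min d10.
have mf : measurable_fun setT (fun p : borel M => (f p ^+ 2)%:E).
  by apply/measurable_EFinP; apply: measurable_funX; exact: smooth_measurable.
have mA1 : measurable (A `&` P') by exact: measurableI.
have mA2 : measurable (A `\` P') by exact: measurableD.
have -> : A = (A `&` P') `|` (A `\` P') by rewrite setUIDK.
rewrite ge0_integral_setU//; last 3 first.
- exact: measurable_funS mf.
- by move=> p _; rewrite lee_fin sqr_ge0.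
- by apply/disj_setPS => p [[_ ?] [_ ?]].
have -> : (eta * energy1 f)%:E = ((eta / 2 * energy1 f)%:E + (eta / 2 * energy1 f)%:E)%E.
  by rewrite -EFinD -mulrDl -splitr.
apply: leeD; [apply: h1 => //|apply: h2 => //].
- by move=> p [/AS[Sp _] Pp].
- apply: le_trans (le_measure _ _ _ (@subIsetl _ _ _)) _; rewrite ?inE//.
  by apply: le_trans vA _; rewrite lee_fin ge_min lexx.
- by move=> p [/AS[Sp [//|Qp]] nP].
- apply: le_trans (le_measure _ _ _ (@subDsetl _ _ _)) _; rewrite ?inE//.
  by apply: le_trans vA _; rewrite lee_fin ge_min lexx orbT.
Qed.

Lemma lebV_shift (v : 'rV[R]_n.+1) (B : set E) : measurable B ->
  mu ((fun y : E => y + v) @^-1` B) = mu B.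
Proof.
move=> mB; have mB' : measurable ((fun y : E => y + v) @^-1` B).
  by rewrite -[_ @^-1` _]setTI; exact: (measurable_translate v).
have h1 : mu B = (\int[mu]_y (\1_B y)%:E)%E by rewrite integral_indic// setIT.
have h2 : mu ((fun y : E => y + v) @^-1` B) = (\int[mu]_y (\1_((fun y : E => y + v) @^-1` B) y)%:E)%E.
  by rewrite integral_indic// setIT.
rewrite h1 h2 -(@lebV_translate R n.+1 (fun y => (\1_B y)%:E) v)//.
by apply/measurable_EFinP; exact: measurable_indic.
Qed.

(** If one ball were null, so would be all its translates, and finitely many of them cover a cube.
    This settles the degenerate case of [interior_UI], where the measure of the ball is a
    divisor. *)
Lemma lebV_ball0 h : 0 < h -> mu (ball (0%R : 'rV[R]_n.+1) h : set E) = 0%E ->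
  forall x0 r, mu (ccube x0 r : set E) = 0%E.
Proof.
move=> h0 mu0 x0 r.
have mb x : measurable (ball (x : 'rV[R]_n.+1) h : set E) by apply: open_bor; exact: ball_open.
have mu0x x : mu (ball (x : 'rV[R]_n.+1) h : set E) = 0%E.
  rewrite -(lebV_shift x (mb x)) -mu0; congr (mu _).
  by apply/seteqP; split => y; rewrite /preimage /= -!ball_normE /= opprD addrCA subrr addr0 sub0r.
suff [B [mB cB B0]] : exists B : set E, [/\ measurable B, ccube x0 r `<=` B & mu B = 0%E].
  apply/eqP; rewrite eq_le measure_ge0 andbT -B0; apply: le_measure => //; rewrite inE//.
  exact: measurable_ccube.
apply: (@compact_union_induction _ _ (fun A => exists B : set E, [/\ measurable B, A `<=` B & mu B = 0%E]) (@ccube_compact R n.+1 x0 r)).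
- by exists set0; split.
- move=> A1 A2 [B1 [m1 s1 z1]] [B2 [m2 s2 z2]]; exists (B1 `|` B2); split.
  + exact: measurableU.
  + exact: setUSS.
  + by apply/eqP; rewrite eq_le measure_ge0 andbT; apply: (le_trans (measureU2 mu m1 m2)); change (mu B1 + mu B2 <= 0)%E; rewrite z1 z2 adde0.
- by move=> A1 A2 AB [B [mB s z]]; exists B; split => //; exact: subset_trans s.
- move=> x _; exists (ball (x : 'rV[R]_n.+1) h); first exact: nbhsx_ballx.
  by exists (ball (x : 'rV[R]_n.+1) h); split.
Qed.

(** [interior_ineq] in a chart cube inside [S]: [h] is fixed so that the gradient term takes at most
    half of [eta], and then the bound on [vol A] gives the other half to the mass term. *)
Lemma interior_UI p : S p -> exists2 U, nbhs p U & UI U.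
Proof.
move=> Sp; have [i dp] := dom_cover p; set x0 := phi i p.
have : nbhs x0 (img i `&` psi i @^-1` S).
  apply: open_nbhs_nbhs; split; last by split; [exact: img_phi|rewrite /= phiK].
  by apply: open_preimage => //; [exact: img_open|move=> x ix; exact: psi_continuous].
move=> /nbhs_ballP[r /= r0 hr]; pose rho := r / 4; have rho0 : 0 < rho by rewrite divr_gt0.
pose Q := ccube x0 (2 * rho).
have Qr : Q `<=` img i `&` psi i @^-1` S.
  apply: subset_trans hr => x; rewrite /Q /ccube -ball_normE /= => h.
  by apply: le_lt_trans h _; rewrite /rho; lra.
have Qi : Q `<=` img i by move=> x /Qr[].
have cQ : compact Q := @ccube_compact R n.+1 x0 (2 * rho).
have [C C0 hC] := chart_compare cQ Qi; have [C2 C20 hC2] := energy_compare cQ Qi.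
pose P : set E := ccube x0 (rho / 2).
have mP : measurable P by exact: measurable_ccube.
have PQ : P `<=` Q by move=> x; rewrite /P /Q /ccube /=; lra.
have WQ : ccube x0 rho `<=` Q by move=> x; rewrite /Q /ccube /=; lra.
have [mU _ hU] := chart_preimage mP (subset_trans PQ Qi).
have UQ := hU Q PQ; set U : set (borel M) := dom i `&` phi i @^-1` P in mU hU UQ.
exists U.
  have r2 : 0 < rho / 2 by exact: divr_gt0.
  have nb : nbhs p (dom i `&` phi i @^-1` ball x0 (rho / 2)).
    apply: open_nbhs_nbhs; split; last by split => //; exact: ballxx.
    by apply: preimage_open; exact: ball_open.
  by apply: filterS nb => q [dq bq]; split => //; exact: ball_ccube.
exists U; split => // eta eta0.
pose N : R := n.+1%:R.
have N0 : 0 < N by rewrite ltr0n.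
pose K := C * C2; have K0 : 0 < K by rewrite mulr_gt0.
(* [h <= 1] gives [h^2 <= h], and the last bound makes the gradient term at most [eta / 2]; [K]
   collects the two chart constants. *)
pose h := Num.min (Num.min 1 (rho / 2)) (eta / (4 * N * K)).
have den0 : 0 < 4 * N * K by rewrite !mulr_gt0.
have h0 : 0 < h by rewrite !lt_min ltr01 !divr_gt0.
have h1 : h <= 1 by rewrite !ge_min lexx.
have hr2 : h <= rho / 2 by rewrite !ge_min lexx orbT.
have he : 2 * (N * h ^+ 2) * K <= eta / 2.
  have : h <= eta / (4 * N * K) by rewrite !ge_min lexx orbT.
  rewrite ler_pdivlMr// => hh.
  have : h ^+ 2 <= h by rewrite expr2 ler_piMr// ltW.
  have NK : 0 < N * K by rewrite mulr_gt0.
  by move=> h2h; have := ler_wpM2l (ltW NK) h2h; lra.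
set T : set E := ball (0 : 'rV[R]_n.+1) h.
have main (A : set (borel M)) f : measurable A -> A `<=` S `&` U -> smooth_fun f ->
    let B : set E := img i `&` psi i @^-1` A in
    [/\ (mu B <= C%:E * vol A)%E, (\int[vol]_(p in A) (f p ^+ 2)%:E <=
       C%:E * \int[mu]_(x in B) ((f \o psi i) x ^+ 2)%:E)%E, measurable B & B `<=` P].
  move=> mA AS sf B; have AQ : A `<=` psi i @` Q by move=> q /AS[_ /UQ].
  have mf : measurable_fun A (fun p : borel M => f p ^+ 2).
    by apply: measurable_funX; exact: (measurable_funS measurableT _ (smooth_measurable sf)).
  have mB : measurable B by apply: measurable_psi => //; exact: measurable_img.
  have [h1' _] := hC A (fun=> 1) mA AQ (measurable_cst _) (fun _ _ => ler01).
  have [_ h2'] := hC A (fun p => f p ^+ 2) mA AQ mf (fun p _ => sqr_ge0 _).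
  split => //; last by move=> x [ix /AS[_ [_ /=]]]; rewrite psiK.
  by move: h1'; rewrite !integral_cst// !mul1e.
have Qfin : (mu T < +oo)%E by exact: lebV_ball.
have mT : measurable T by apply: open_bor; exact: ball_open.
have [T0|T0] := eqVneq (mu T) 0%E.
  exists 1 => // A mA AS _ f sf; have [_ hA mB BP] := main A f mA AS sf.
  apply: le_trans hA _; rewrite null_set_integral//.
  - by rewrite mule0 lee_fin mulr_ge0 ?energy1_ge0 ?(ltW eta0).
  - apply/measurable_EFinP; apply: measurable_funX.
    apply: (measurable_funS (measurable_img i)) => [x []//|].
    by apply: Ck1_measurable; [exact: img_open|exact: (sf i 1%N)].
  - apply/eqP; rewrite eq_le measure_ge0 andbT -(lebV_ball0 h0 T0 x0 (rho / 2)).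
    by apply: le_measure; rewrite ?inE.
have Tfin : mu T \is a fin_num by rewrite ge0_fin_numE.
pose tau := fine (mu T); have tauE : mu T = tau%:E by rewrite fineK.
have tau0 : 0 < tau by rewrite -lte_fin -tauE lt_neqAle eq_sym T0 measure_ge0.
(* One factor [C] converts [vol A] into the Lebesgue measure of the image [B]; the rest makes
   [2 C C2 (mu B) / tau] at most [eta / 2]. *)
exists (eta * tau / (4 * (C * K))) => [|A mA AS vA f sf]; first by rewrite divr_gt0 ?mulr_gt0.
have [hm hA mB BP] := main A f mA AS sf.
set B : set E := img i `&` psi i @^-1` A in hm hA mB BP.
have QD : ccube x0 (2 * rho) `<=` img i by [].
have := interior_ineq (@img_open _ _ M i) (sf i 1%N) h0 hr2 QD mB BP.
have [e1 e2] := hC2 (ccube x0 rho) f (measurable_ccube x0 rho) WQ (fun x Wx => (Qr _ (WQ x Wx)).2) sf.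
rewrite -/T tauE => ineq.
set IB := (\int[mu]_(x in B) _)%E in hA ineq.
have IB0 : (0 <= IB)%E by apply: integral_ge0 => x _; rewrite lee_fin sqr_ge0.
have muB : (mu B <= (eta * tau / (4 * K))%:E)%E.
  apply: le_trans hm _; apply: le_trans (lee_wpmul2l _ vA) _; first by rewrite lee_fin ltW.
  rewrite -EFinM lee_fin le_eqVlt; apply/orP; left; apply/eqP.
  have c1 : C != 0 by rewrite gt_eqF. have k1 : K != 0 by rewrite gt_eqF.
  exact: scaled_measure.
have E0 := energy1_ge0 f.
have step : (tau%:E * IB <= (tau * (eta / C * energy1 f))%:E)%E.
  apply: (le_trans ineq).
  apply: (@le_trans _ _ (2%:E * (eta * tau / (4 * K))%:E * (C2 * energy1 f)%:E +
     2%:E * tau%:E * ((N * h ^+ 2)%:E * (C2 * energy1 f)%:E))%E).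
    apply: leeD.
      apply: lee_pmul => //.
      - by rewrite mule_ge0 ?measure_ge0// lee_fin.
      - by apply: integral_ge0 => x _; rewrite lee_fin sqr_ge0.
      - by rewrite lee_pmul2l ?lte_fin.
    rewrite lee_pmul2l//; last by rewrite -EFinM lte_fin mulr_gt0.
    by rewrite lee_wpmul2l// lee_fin mulr_ge0 ?sqr_ge0 ?(ltW N0).
  rewrite -!EFinM -EFinD lee_fin.
  have c1 : C != 0 by rewrite gt_eqF. have c2 : C2 != 0 by rewrite gt_eqF.
  have -> : 2 * (eta * tau / (4 * K)) * (C2 * energy1 f) = tau * (eta / (2 * C)) * energy1 f.
    exact: scaled_mass.
  have -> : 2 * tau * (N * h ^+ 2 * (C2 * energy1 f)) = tau * ((2 * (N * h ^+ 2) * K) / C) * energy1 f.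
    exact: scaled_gradient.
  have -> : tau * (eta / C * energy1 f) = tau * (eta / (2 * C)) * energy1 f + tau * (eta / 2 / C) * energy1 f.
    exact: scaled_split.
  by rewrite lerD2l ler_wpM2r// ler_wpM2l ?(ltW tau0)// ler_wpM2r// invr_ge0 ltW.
apply: le_trans hA _.
have : (IB <= (eta / C * energy1 f)%:E)%E by move: step; rewrite EFinM lee_pmul2l// lte_fin.
move=> /(lee_wpmul2l (_ : (0 <= C%:E)%E)) h'; apply: le_trans (h' _) _; first by rewrite lee_fin ltW.
rewrite -EFinM lee_fin mulrA [C * _]mulrCA mulfV ?gt_eqF// mulr1.
exact: lexx.
Qed.

Lemma compact_UI (K : set M) : compact K -> K `<=` S -> UI K.
Proof.
move=> cK KS; apply: (@compact_union_induction _ _ UI cK).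
- by apply: UI0; rewrite ?setI0.
- exact: UIU.
- exact: UI_sub.
- by move=> p /KS; exact: interior_UI.
Qed.

(** * The estimate up to the hypersurface *)

Section Boundary.
Variables (k : nat) (alpha : R) (Y S' : set M).
Hypotheses (hk : (2 <= k)%N) (a0 : 0 < alpha) (hY : closed_hypersurface k alpha Y).
Hypotheses (oS' : open S') (SS' : S `&` S' = set0) (SUS : S `|` S' = ~` Y).
Hypotheses (cS : closure S `\` S = Y) (cS' : closure S' `\` S' = Y).

(** Points of [S] close to [Y] are pushed inward by [v = sg h e_a]. The images lie in a compact
    subset [G] of [S], where [compact_UI] controls the shifted values; the error of the shift is a
    gradient term of order [h^2], because by [one_sided] the segments stay in [S]. *)
Lemma boundary_UI p : Y p -> exists2 U, nbhs p U & UI U.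
Proof.
move=> Yp.
have [i [a [sg [rho [dp hsg rho0 br side]]]]] := one_sided hk a0 hY oS oS' SS' SUS cS cS' Yp.
set x0 := phi i p in br side.
pose Q := ccube x0 (3 / 4 * rho).
have Qb : Q `<=` ball x0 rho by move=> x; rewrite /Q /ccube -ball_normE /= => h; lra.
have Qi : Q `<=` img i := subset_trans Qb br.
have cQ : compact Q := @ccube_compact R n.+1 x0 _.
have [C C0 hC] := chart_compare cQ Qi; have [C2 C20 hC2] := energy_compare cQ Qi.
pose P : set E := ccube x0 (rho / 4); have mP : measurable P by exact: measurable_ccube.
have PQ : P `<=` Q by move=> x; rewrite /P /Q /ccube /=; lra.
have Pb : P `<=` ball x0 rho := subset_trans PQ Qb.
have [mU _ hU] := chart_preimage mP (subset_trans PQ Qi).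
have UQ := hU Q PQ; set U : set (borel M) := dom i `&` phi i @^-1` P in mU hU UQ.
exists U.
  have r2 : 0 < rho / 4 by exact: divr_gt0.
  have nb : nbhs p (dom i `&` phi i @^-1` ball x0 (rho / 4)).
    apply: open_nbhs_nbhs; split; last by split => //; exact: ballxx.
    by apply: preimage_open; exact: ball_open.
  by apply: filterS nb => q [dq bq]; split => //; exact: ball_ccube.
exists U; split => // eta eta0.
pose N : R := n.+1%:R; have N0 : 0 < N by rewrite ltr0n.
pose K := C * C2; have K0 : 0 < K by rewrite mulr_gt0.
have den0 : 0 < 4 * N * K by rewrite !mulr_gt0.
pose h := Num.min (Num.min 1 (rho / 4)) (eta / (4 * N * K)).
have h0 : 0 < h by rewrite !lt_min ltr01 !divr_gt0.
have h1 : h <= 1 by rewrite !ge_min lexx.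
have hr : h <= rho / 4 by rewrite !ge_min lexx orbT.
have he : 2 * (N * h ^+ 2) * K <= eta / 2.
  have : h <= eta / (4 * N * K) by rewrite !ge_min lexx orbT.
  rewrite ler_pdivlMr// => hh.
  have : h ^+ 2 <= h by rewrite expr2 ler_piMr// ltW.
  have NK : 0 < N * K by rewrite mulr_gt0.
  by move=> h2h; have := ler_wpM2l (ltW NK) h2h; lra.
pose e : 'rV[R]_n.+1 := delta_mx 0 a; pose v := (sg * h) *: e.
have ve s : 0 <= s -> `|(sg * s) *: e| <= s.
  move=> s0; apply: normr_rV_leP => // b; rewrite !mxE eqxx /= normrM.
  have -> : `|sg * s| = s by case: hsg => ->; rewrite ?mul1r ?mulN1r ?normrN ger0_norm.
  by case: (b == a); rewrite ?normr1 ?normr0 ?mulr1 ?mulr0.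
have vh : `|v| <= h by apply: ve; exact: ltW.
have shiftQ x s : P x -> 0 <= s <= h -> ccube x0 (rho / 2) (x + (sg * s) *: e).
  rewrite /P /ccube /= => hx /andP[s0 sh]; rewrite opprD addrA (le_trans (ler_normB _ _))//.
  by have := ve s s0; lra.
have half : ccube x0 (rho / 2) `<=` Q by move=> x; rewrite /Q /ccube /=; lra.
(* [closure S] adds only points of [Y], which [one_sided] also moves into [S]; passing to the
   closure makes the image compact. *)
pose G := (fun q => psi i (phi i q + v)) @` (closure S `&` psi i @` P).
have Pd q : (psi i @` P) q -> dom i q /\ P (phi i q).
  by move=> [x Px <-]; have ix := Qi _ (PQ _ Px); split; [exact: dom_psi|rewrite psiK].
have GS : G `<=` S.
  move=> _ [q [cq /Pd[dq Pq]] <-].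
  have bq := Pb _ Pq; have bq' : ball x0 rho (phi i q + v).
    by apply: Qb; apply: half; apply: shiftQ; rewrite ?(ltW h0)//=.
  have [hS hYq] := side (phi i q) h (ltW h0) bq bq'; rewrite phiK// in hS hYq.
  have [Sq|nSq] := pselect (S q); first exact: hS.
  by apply: hYq => //; rewrite -cS.
have cG : compact G.
  apply: continuous_compact.
    apply: continuous_in_subspaceT => q /[!inE] -[_ /Pd[dq Pq]].
    apply: (@continuous_comp _ _ _ (fun q => phi i q + v) (psi i)).
      by apply: cvgD; [exact: phi_continuous|exact: cvg_cst].
    by apply: psi_continuous; apply: Qi; apply: half; apply: shiftQ; rewrite ?(ltW h0)//=.
  rewrite setIC; apply: compact_closedI; last exact: closed_closure.
  by apply: image_compact; [exact: ccube_compact|exact: subset_trans PQ Qi].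
have [P' [mP' GP hG]] := compact_UI cG GS.
(* Two chart comparisons cost [C] each and [sqr_le_shift] a factor 2, so the shifted values
   contribute [eta / 2]. *)
have e0 : 0 < eta / (4 * C * C) by rewrite divr_gt0 ?mulr_gt0.
have [del del0 hdel] := hG _ e0.
(* The volume of [A] is compared with Lebesgue measure, translated, and compared back, at a cost of
   [C] each way. *)
exists (del / (C * C)) => [|A mA AS vA f sf]; first by rewrite divr_gt0 ?mulr_gt0.
have AQ : A `<=` psi i @` Q by move=> q /AS[_ /UQ].
have mf2 (D : set (borel M)) : measurable_fun D (fun p : borel M => f p ^+ 2).
  by apply: measurable_funX; exact: (measurable_funS measurableT _ (smooth_measurable sf)).
set B : set E := img i `&` psi i @^-1` A.
have mB : measurable B by apply: measurable_psi => //; exact: measurable_img.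
have BP x : B x -> P x by move=> [ix /AS[_ [_ /=]]]; rewrite psiK.
have BS x : B x -> S (psi i x) by move=> [_ /AS[]].
have muB : (mu B <= C%:E * vol A)%E.
  have [h1' _] := hC A (fun=> 1) mA AQ (measurable_cst _) (fun _ _ => ler01).
  by move: h1'; rewrite !integral_cst// !mul1e.
have [_ hA] := hC A (fun p => f p ^+ 2) mA AQ (mf2 A) (fun p _ => sqr_ge0 _).
pose F : E -> R := (f \o psi i) \_ (img i).
have CF : Ck 1 (img i) (f \o psi i) := sf i 1%N.
have mF : measurable_fun setT F.
  apply/(measurable_restrictT _ (measurable_img i)).
  by apply: Ck1_measurable; [exact: img_open|exact: CF].
have FE x : img i x -> F x = f (psi i x) by move=> ix; rewrite /F patchE mem_set.
pose B' : set E := (fun y : E => y + - v) @^-1` B.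
have mB' : measurable B' by rewrite -[B']setTI; exact: (measurable_translate (- v)).
have B'half x : B' x -> ccube x0 (rho / 2) x.
  move=> B'x; have := shiftQ (x + - v) h (BP _ B'x); rewrite subrK; apply.
  by rewrite (ltW h0) lexx.
have B'Q : B' `<=` Q by move=> x /B'half; exact: half.
have [mA' EA' hA'] := chart_preimage mB' (subset_trans B'Q Qi).
have A'Q := hA' Q B'Q; set A' : set (borel M) := dom i `&` phi i @^-1` B' in mA' EA' hA' A'Q.
have A'G : A' `<=` G.
  move=> q [dq B'q]; exists (psi i (phi i q + - v)).
    by split; [apply: subset_closure; exact: BS|exists (phi i q + - v) => //; exact: BP].
  by rewrite psiK ?subrK ?phiK//; case: B'q.
have vA' : (vol A' <= del%:E)%E.
  have [_ h2'] := hC A' (fun=> 1) mA' A'Q (measurable_cst _) (fun _ _ => ler01).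
  move: h2'; rewrite EA' !integral_cst// !mul1e => h2'.
  have E2 : mu B' = mu B by exact: lebV_shift.
  have h3 : (C%:E * mu B' <= C%:E * (C%:E * vol A))%E by rewrite E2 lee_pmul2l ?lte_fin.
  have h4 : (C%:E * (C%:E * vol A) <= del%:E)%E.
    apply: (@le_trans _ _ (C%:E * (C%:E * (del / (C * C))%:E))%E).
      by rewrite lee_pmul2l ?lte_fin// lee_pmul2l ?lte_fin.
    by rewrite -!EFinM lee_fin mulrA mulrC divfK// mulf_neq0 ?gt_eqF.
  exact: (le_trans h2' (le_trans h3 h4)).
have I1 := hdel A' mA' (fun q A'q => conj (GS _ (A'G _ A'q)) (GP _ (A'G _ A'q))) vA' f sf.
have [I2 _] := hC A' (fun p => f p ^+ 2) mA' A'Q (mf2 A') (fun p _ => sqr_ge0 _).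
rewrite EA' in I2.
pose W : set E := ccube x0 (rho / 2) `&` (img i `&` psi i @^-1` S).
have mW : measurable W.
  apply: measurableI; first exact: measurable_ccube.
  by apply: measurable_psi; [exact: measurable_img|exact: mS].
have Wfin : (mu W < +oo)%E.
  apply: le_lt_trans (lebV_ccube x0 (rho / 2)).
  by apply: le_measure; rewrite ?inE//; [exact: measurable_ccube|exact: subIsetl].
have I3 := shift_grad (@img_open _ _ M i) CF cQ Qi mB mW Wfin vh.
have {}I3 : (\int[mu]_(x in B) (((f \o psi i) (x + v) - (f \o psi i) x) ^+ 2)%:E <=
   (N * h ^+ 2 * (C2 * energy1 f))%:E)%E.
  apply: (le_trans (I3 _ _)).
  - move=> x s Bx /andP[s0 s1].
    have sE : s *: v = (sg * (s * h)) *: e by rewrite /v scalerA mulrCA.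
    have sh : 0 <= s * h <= h by rewrite mulr_ge0 ?(ltW h0)//= ler_piMl// ltW.
    have xs := shiftQ x (s * h) (BP x Bx) sh; rewrite -sE in xs; split => //; split; first exact/Qi/half.
    have /andP[sh0 _] := sh.
    have bx' : ball x0 rho (x + (sg * (s * h)) *: delta_mx 0 a) by rewrite -/e -sE; exact/Qb/half.
    by have [hS _] := side x (s * h) sh0 (Pb _ (BP x Bx)) bx'; rewrite /= sE; exact: hS (BS x Bx).
  - move=> y s [hy _] /andP[s0 s1]; move: hy; rewrite /Q /ccube /= => hy.
    rewrite opprD addrA (le_trans (ler_normB _ _))// normrZ (ger0_norm s0).
    have : s * `|v| <= 1 * h by rewrite ler_pM.
    by lra.
  have [_ hg] := hC2 W f mW (fun x Wx => half _ Wx.1) (fun x Wx => Wx.2.2) sf.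
  rewrite [X in (_ <= X)%E]EFinM lee_wpmul2l// lee_fin mulr_ge0 ?sqr_ge0// ltW//.
have I4 : (\int[mu]_(x in B) ((f \o psi i) x ^+ 2)%:E <=
    2%:E * \int[mu]_(x in B') (f (psi i x) ^+ 2)%:E +
    2%:E * \int[mu]_(x in B) (((f \o psi i) (x + v) - (f \o psi i) x) ^+ 2)%:E)%E.
  pose H (y : E) := (F y ^+ 2 * \1_B' y)%:E.
  have mH : measurable_fun setT H.
    by apply/measurable_EFinP; apply: measurable_funM; [exact: measurable_funX|exact: measurable_indic].
  have H0 y : (0 <= H y)%E by rewrite lee_fin; apply: mulr_ge0 => //; exact: sqr_ge0.
  have Bi x : B x -> img i x by case.
  have Biv x : B x -> img i (x + v).
    by move=> Bx; apply: Qi; apply: half; apply: shiftQ (BP x Bx) _; rewrite (ltW h0) lexx.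
  have -> : (\int[mu]_(x in B') (f (psi i x) ^+ 2)%:E = \int[mu]_(x in B) (F (x + v) ^+ 2)%:E)%E.
    rewrite integral_indicE [RHS]integral_indicE.
    transitivity (\int[mu]_x H x)%E.
      apply: eq_integral => x _; congr (_%:E); rewrite indicE.
      have [/set_mem Bx|_] := boolP (x \in B'); last by rewrite !mulr0.
      by rewrite FE//; exact/Qi/B'Q.
    rewrite -(@lebV_translate R n.+1 H v)//; apply: eq_integral => x _; congr (_%:E); congr (_ * _).
    by rewrite !indicE; congr (_%:R); congr nat_of_bool; apply/idP/idP => /[!inE]; rewrite /B' /preimage /= addrK.
  have mFv : measurable_fun B (fun x : E => (F (x + v) ^+ 2)%:E).
    apply/measurable_EFinP; apply: measurable_funX.
    apply: (measurable_funS measurableT (@subsetT _ _)).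
    exact: measurableT_comp mF (measurable_translate v).
  have mFd : measurable_fun B (fun x : E => ((F (x + v) - F x) ^+ 2)%:E).
    apply/measurable_EFinP; apply: measurable_funX.
    apply: (measurable_funS measurableT (@subsetT _ _)); apply: measurable_funB => //.
    exact: measurableT_comp mF (measurable_translate v).
  have -> : (\int[mu]_(x in B) (((f \o psi i) (x + v) - (f \o psi i) x) ^+ 2)%:E =
      \int[mu]_(x in B) ((F (x + v) - F x) ^+ 2)%:E)%E.
    by apply: eq_integral => x /[!inE] Bx; rewrite (FE _ (Biv _ Bx)) (FE _ (Bi _ Bx)).
  have -> : (\int[mu]_(x in B) ((f \o psi i) x ^+ 2)%:E = \int[mu]_(x in B) (F x ^+ 2)%:E)%E.
    by apply: eq_integral => x /[!inE] Bx; rewrite FE//; exact: Bi.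
  rewrite -!ge0_integralZl//; try (by move=> x _; rewrite lee_fin sqr_ge0).
  have two0 (u : R) : (0 <= 2%:E * (u ^+ 2)%:E)%E by rewrite -EFinM lee_fin; apply: mulr_ge0 => //; exact: sqr_ge0.
  rewrite -ge0_integralD//; try (by apply: emeasurable_funM).
  apply: ge0_le_integral => //.
  - by move=> x _; rewrite lee_fin sqr_ge0.
  - apply/measurable_EFinP; apply: measurable_funX.
    exact: (measurable_funS measurableT (@subsetT _ _) mF).
  - by apply: emeasurable_funD; apply: emeasurable_funM.
  - by move=> x _; rewrite -!EFinM -EFinD lee_fin; exact: sqr_le_shift.
apply: (le_trans hA).
have E0 := energy1_ge0 f.
apply: (@le_trans _ _ (C%:E * (2%:E * (C%:E * (eta / (4 * C * C) * energy1 f)%:E) +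
    2%:E * (N * h ^+ 2 * (C2 * energy1 f))%:E))%E).
  rewrite lee_pmul2l ?lte_fin//; apply: (le_trans I4); apply: leeD; rewrite lee_pmul2l ?lte_fin//.
  by apply: (le_trans I2); rewrite lee_pmul2l ?lte_fin.
rewrite [X in (X <= _)%E](_ : _ = (C * (2 * (C * (eta / (4 * C * C) * energy1 f)) +
  2 * (N * h ^+ 2 * (C2 * energy1 f))))%:E)//.
rewrite lee_fin; have c1 : C != 0 by rewrite gt_eqF.
rewrite mulrDr (scaled_shift _ _ c1).
have -> : C * (2 * (N * h ^+ 2 * (C2 * energy1 f))) = 2 * (N * h ^+ 2) * K * energy1 f by rewrite /K; ring.
by rewrite [leRHS](_ : _ = eta / 2 * energy1 f + eta / 2 * energy1 f) ?lerD2l ?ler_wpM2r// -mulrDl -splitr.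
Qed.

(** Local estimates at points of [S] and of [Y] are joined by compactness of the manifold; around
    points of [S'] there is nothing to integrate. *)
Lemma uniform_integrability eta : 0 < eta -> exists2 del, 0 < del &
  forall A : set (borel M), measurable A -> A `<=` S -> (vol A <= del%:E)%E ->
  forall f, smooth_fun f -> (\int[vol]_(p in A) (f p ^+ 2)%:E <= (eta * energy1 f)%:E)%E.
Proof.
move=> eta0; have [P' [_ PT h]] : UI setT.
  apply: (@compact_union_induction _ _ UI (@carrier_compact _ _ M)).
  - by apply: UI0; rewrite ?setI0.
  - exact: UIU.
  - exact: UI_sub.
  move=> p _; have [Yp|nY] := pselect (Y p); first exact: boundary_UI.
  have : (S `|` S') p by rewrite SUS.
  case=> [Sp|S'p]; first exact: interior_UI.
  exists S'; first exact: open_nbhs_nbhs.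
  by apply: UI0 => //; exact: (@open_bor M).
have [del del0 hd] := h _ eta0; exists del => // A mA AS vA f sf.
by apply: hd => // p Ap; split; [exact: AS|exact: PT].
Qed.

End Boundary.

End UniformIntegrability.

(** * Smooth truncations and the Riesz representation *)

Section RegularizedNorm.
Variable R : realType.
Implicit Types a m t x y : R.

(** A Euclidean norm regularized by [t > 0]: smooth, Lipschitz with constant 1 in each argument, and
    equal to [t] at the origin. *)
Definition rho t x y := Num.sqrt (x ^+ 2 + y ^+ 2 + t ^+ 2).

Lemma rho_sqr t x y : rho t x y ^+ 2 = x ^+ 2 + y ^+ 2 + t ^+ 2.
Proof. by rewrite sqr_sqrtr// !addr_ge0 ?sqr_ge0. Qed.

Lemma rho_ge0 t x y : 0 <= rho t x y. Proof. exact: sqrtr_ge0. Qed.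

Lemma rho_gel t x y : `|x| <= rho t x y.
Proof. by rewrite -sqrtr_sqr ler_wsqrtr// -addrA lerDl addr_ge0 ?sqr_ge0. Qed.

Lemma rho_ger t x y : `|y| <= rho t x y.
Proof. by rewrite -sqrtr_sqr ler_wsqrtr// addrAC lerDr addr_ge0 ?sqr_ge0. Qed.

Lemma rho_ge t x y : t <= rho t x y.
Proof.
rewrite (le_trans (ler_norm t))// -sqrtr_sqr ler_wsqrtr// lerDr.
by rewrite addr_ge0 ?sqr_ge0.
Qed.

Lemma rho_gt0 t x y : 0 < t -> 0 < rho t x y.
Proof. by move=> t0; apply: lt_le_trans t0 (rho_ge _ _ _). Qed.

Lemma rho_le t x y : 0 <= t -> rho t x y <= `|x| + `|y| + t.
Proof.
move=> t0; rewrite -ler_sqr ?nnegrE ?rho_ge0 ?addr_ge0// rho_sqr.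
rewrite -(real_normK (num_real x)) -(real_normK (num_real y)).
move: (normr_ge0 x) (normr_ge0 y); move: `|x| `|y| => b c b0 c0.
have := mulr_ge0 b0 c0; have := mulr_ge0 b0 t0; have := mulr_ge0 c0 t0.
rewrite !expr2; nra.
Qed.

Lemma rho_lip t x y x' y' : 0 < t ->
  `|rho t x y - rho t x' y'| <= `|x - x'| + `|y - y'|.
Proof.
move=> t0; have r0 := rho_gt0 x y t0; have r0' := rho_gt0 x' y' t0.
have s0 : 0 < rho t x y + rho t x' y' by rewrite addr_gt0.
rewrite -(ler_pM2r s0) -{1}(gtr0_norm s0) -normrM.
have -> : (rho t x y - rho t x' y') * (rho t x y + rho t x' y') =
    (x - x') * (x + x') + (y - y') * (y + y').
  by rewrite -(subr_sqr (rho t x y)) !rho_sqr; ring.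
rewrite (le_trans (ler_normD _ _))// !normrM mulrDl lerD// ler_wpM2l//.
  by rewrite (le_trans (ler_normD _ _))// lerD ?rho_gel.
by rewrite (le_trans (ler_normD _ _))// lerD ?rho_ger.
Qed.

Lemma rho_cvg t (u v : nat -> R) x y : u k @[k --> \oo] --> x -> v k @[k --> \oo] --> y ->
  rho t (u k) (v k) @[k --> \oo] --> rho t x y.
Proof.
move=> hu hv; apply: (@cvg_comp _ _ _ (fun k => u k ^+ 2 + v k ^+ 2 + t ^+ 2) (@Num.sqrt R) _
  (nbhs (x ^+ 2 + y ^+ 2 + t ^+ 2))); last exact: sqrt_continuous.
apply: cvgD; last exact: cvg_cst.
rewrite !expr2; under eq_fun do rewrite !expr2.
by apply: cvgD; apply: cvgM.
Qed.

Lemma rho_div_le x t y z : 0 < t -> `|z| <= rho t x y -> `|z / rho t x y| <= 1.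
Proof.
by move=> t0 h; rewrite normrM normfV (gtr0_norm (rho_gt0 x y t0)) ler_pdivrMr ?mul1r ?rho_gt0.
Qed.

(** A smooth odd truncation with height [2 a m] and slope at most [2 a], obtained from the formula
    of [clamp] by regularizing the absolute values. The choice [a = 1/2] approximates [clamp m]; a
    general [a] absorbs the factor [sqrt s] of the variation. *)
Definition soft_clamp a m t x := a * (rho t (x + m) 0 - rho t (x - m) 0).

Lemma soft_clamp_lip a m t x y : 0 <= a -> 0 < t ->
  `|soft_clamp a m t x - soft_clamp a m t y| <= 2 * a * `|x - y|.
Proof.
move=> a0 t0; rewrite /soft_clamp -mulrBr normrM (ger0_norm a0) -mulrA mulrCA ler_wpM2l//.
rewrite (_ : _ - _ - _ = (rho t (x + m) 0 - rho t (y + m) 0) -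
   (rho t (x - m) 0 - rho t (y - m) 0)); last by ring.
rewrite (le_trans (ler_normB _ _))// mulr2n mulrDl !mul1r lerD//.
  by rewrite (le_trans (rho_lip _ _ _ _ t0))// subrr normr0 addr0 opprD addrACA subrr addr0.
by rewrite (le_trans (rho_lip _ _ _ _ t0))// subrr normr0 addr0 opprB addrA subrK.
Qed.

Lemma soft_clamp_bounded a m t x : 0 <= a -> 0 <= m -> 0 < t -> `|soft_clamp a m t x| <= 2 * a * m.
Proof.
move=> a0 m0 t0; rewrite /soft_clamp normrM (ger0_norm a0) [2 * a]mulrC -mulrA ler_wpM2l//.
rewrite (le_trans (rho_lip _ _ _ _ t0))// subrr normr0 addr0.
by rewrite opprB addrC addrA subrK -mulr2n mulr_natl ger0_norm// mulrn_wge0.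
Qed.

Lemma soft_clamp_le a m t x : 0 <= a -> 0 < t -> `|soft_clamp a m t x| <= 2 * a * `|x|.
Proof.
move=> a0 t0; rewrite -[x in leRHS]subr0; have -> : soft_clamp a m t x = soft_clamp a m t x - soft_clamp a m t 0.
  by rewrite /soft_clamp !add0r /rho sqrrN subrr mulr0 subr0.
exact: soft_clamp_lip.
Qed.

Lemma soft_clamp0 a m t : soft_clamp a m t 0 = 0.
Proof. by rewrite /soft_clamp !add0r /rho sqrrN subrr mulr0. Qed.

(** For [m >= 0], the projection onto [[-m, m]], in a form that uses only absolute values. *)
Definition clamp m x := 2^-1 * (`|x + m| - `|x - m|).

Lemma clamp_id m x : `|x| <= m -> clamp m x = x.
Proof.
by rewrite ler_norml => /andP[h1 h2]; rewrite /clamp ger0_norm; [rewrite ler0_norm|]; lra.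
Qed.

Lemma clamp_le1 x : `|clamp 1 x| <= 1.
Proof.
have [h|h] := leP `|x| 1; first by rewrite clamp_id.
rewrite /clamp; move: h; rewrite ltr_normr => /orP[h|h].
  by rewrite !ger0_norm; [rewrite (_ : 2^-1 * _ = 1) ?normr1//; field|lra..].
by rewrite [`|x + 1|]ler0_norm ?[`|x - 1|]ler0_norm; [rewrite (_ : 2^-1 * _ = -1) ?normrN1//; field|lra..].
Qed.

Lemma soft_clamp_clamp m t x : 0 < t -> `|soft_clamp 2^-1 m t x - clamp m x| <= t.
Proof.
move=> t0; have h z : `|z| <= rho t z 0 <= `|z| + t.
  by rewrite rho_gel /= (le_trans (rho_le _ _ (ltW t0)))// normr0 addr0.
rewrite /soft_clamp /clamp ler_norml; have /andP[] := h (x + m); have /andP[] := h (x - m); lra.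
Qed.

Lemma soft_clamp_clamp_cvg m x : soft_clamp 2^-1 m k.+1%:R^-1 x @[k --> \oo] --> clamp m x.
Proof.
apply/subr_cvg0/norm_cvg0P.
apply: (@squeeze_cvgr nat \oo _ R (fun=> 0) (fun k => k.+1%:R^-1)).
- by apply: nearW => k; rewrite normr_ge0 soft_clamp_clamp.
- exact: cvg_cst.
- exact: cvg_harmonic.
Qed.

Lemma soft_clamp_cvg_id x : soft_clamp 2^-1 k%:R k.+1%:R^-1 x @[k --> \oo] --> x.
Proof.
apply/subr_cvg0/norm_cvg0P.
apply: (@squeeze_cvgr nat \oo _ R (fun=> 0) (fun k => k.+1%:R^-1)).
- exists (Num.Def.archi_bound x) => // k /= Nk; rewrite normr_ge0 /= -{2}(@clamp_id k%:R x) ?soft_clamp_clamp//.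
  by apply: le_trans (ltW (unstable.ltr_norm_bound x)) _; rewrite ler_nat.
- exact: cvg_cst.
- exact: cvg_harmonic.
Qed.

End RegularizedNorm.

(** * Riesz representation for a form on a set of functions *)

Section RieszRepresentation.
(** Functions equal almost everywhere are not identified, so in the application [E] is only the
    square of a seminorm and [a] a semidefinite form equivalent to it; completeness is asked for
    sequences with Cauchy rate [4^-k]. *)
Variables (X : Type) (R : realType) (H : (X -> R) -> Prop).
Variables (a : (X -> R) -> (X -> R) -> R) (E : (X -> R) -> R) (C : R).
Hypothesis Hlin : forall c f h, H f -> H h -> H (fun p => c * f p + h p).
Hypothesis asym : forall f h, a f h = a h f.
Hypothesis alin : forall c f h g, H f -> H h -> H g ->
  a (fun p => c * f p + h p) g = c * a f g + a h g.
Hypothesis C0 : 0 < C.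
Hypothesis E0 : forall f, 0 <= E f.
Hypothesis coercive : forall f, H f -> E f <= C * a f f.
Hypothesis bounded : forall f, H f -> a f f <= C * E f.

Lemma form_ge0 f : H f -> 0 <= a f f.
Proof. by move=> Hf; have := le_trans (E0 f) (coercive Hf); rewrite pmulr_rge0. Qed.

Lemma form_quad c f h : H f -> H h ->
  a (fun p => c * f p + h p) (fun p => c * f p + h p) =
  c ^+ 2 * a f f + 2 * c * a f h + a h h.
Proof.
move=> Hf Hh; have Hg := Hlin c Hf Hh; rewrite alin// (asym f) (asym h) !alin// (asym h f).
move: (a f f) (a f h) (a h h) => x y z; ring.
Qed.

Lemma form_CS f h : H f -> H h -> a f h ^+ 2 <= a f f * a h h.
Proof.
move=> Hf Hh; rewrite mulrC; apply: quadratic_discriminant => t.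
have := form_ge0 (Hlin t Hf Hh); rewrite form_quad//.
move: (a f f) (a f h) (a h h) => x y z; lra.
Qed.

Hypothesis complete : forall f_ : nat -> X -> R, (forall k, H (f_ k)) ->
  (forall k m, (k <= m)%N -> E (fun p => -1 * f_ k p + f_ m p) <= 4^-1 ^+ k) ->
  exists2 f, H f & E (fun p => -1 * f p + f_ k p) @[k --> \oo] --> (0 : R).
Variables (F : (X -> R) -> R) (N : R).
Hypothesis N0 : 0 <= N.
Hypothesis Flin : forall c f h, H f -> H h -> F (fun p => c * f p + h p) = c * F f + F h.
Hypothesis Fbound : forall h, H h -> F h ^+ 2 <= N * a h h.

(** The quadratic functional whose minimizer represents [F]. *)
Let J f := a f f - 2 * F f.

Let J_ge f : H f -> - N <= J f.
Proof.
move=> Hf; have h := Fbound Hf; have a0 := form_ge0 Hf; rewrite /J.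
move: (a f f) (F f) h a0 => x y h x0; have [x1|x1] := eqVneq x 0.
  have y0 : y = 0 by apply/eqP; rewrite -sqrf_eq0 eq_le sqr_ge0 andbT -(mulr0 N) -x1.
  by rewrite x1 y0 mulr0 subr0 oppr_le0.
have xp : 0 < x by rewrite lt_neqAle eq_sym x1.
rewrite -(ler_pM2r xp); have := sqr_ge0 (x - y); rewrite !expr2 in h *; nra.
Qed.

(* A minimizing sequence of [J] is Cauchy by the parallelogram identity. *)
Lemma riesz_representation h0 : H h0 -> exists f, H f /\ forall h, H h -> a f h = F h.
Proof.
move=> Hh0; pose B : set R := [set J f | f in H].
have hB : has_inf B.
  by split; [exists (J h0), h0|exists (- N) => _ [f Hf <-]; exact: J_ge].
(* The parallelogram identity gives [a(f_m - f_k, f_m - f_k) <= 2 r_k + 2 r_m <= 4 r_k], and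
   coercivity costs the factor [C]. *)
pose r (k : nat) : R := (4 * C)^-1 * 4^-1 ^+ k.
have C4 : 0 < 4 * C by rewrite mulr_gt0.
have r0 k : 0 < r k by rewrite mulr_gt0 ?invr_gt0 ?exprn_gt0 ?invr_gt0.
have [f_ hf] : {f_ : nat -> X -> R & forall k, H (f_ k) /\ J (f_ k) <= inf B + r k}.
  apply: (@choice nat (X -> R) (fun k f => H f /\ J f <= inf B + r k)) => k.
  by have [_ [f Hf <-] hl] := inf_adherent (r0 k) hB; exists f; split => //; exact: ltW.
have Hf k : H (f_ k) := (hf k).1.
have Jle f : H f -> inf B <= J f by move=> Hg; apply: ge_inf; [exact: hB.2|exists f].
have hc k m : (k <= m)%N -> E (fun p => -1 * f_ k p + f_ m p) <= 4^-1 ^+ k.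
  move=> km; apply: le_trans (coercive (Hlin _ (Hf k) (Hf m))) _; rewrite form_quad//.
  have rm : r m <= r k.
    rewrite /r ler_wpM2l ?invr_ge0 ?(ltW C4)//; apply: ler_wiXn2l => //.
    by rewrite invf_le1// ler1n.
  (* This is the zero function, which lets half the sum be written in the form [c f + h]. *)
  have Hz := Hlin (-1) (Hf k) (Hf k).
  have h1 := Jle _ (Hlin 2^-1 (Hlin 1 (Hf k) (Hf m)) Hz).
  have Hs := Hlin 1 (Hf k) (Hf m).
  have h2 := (hf k).2; have h3 := (hf m).2.
  have -> : 4^-1 ^+ k = C * (4 * r k).
    by rewrite /r; move: (4^-1 ^+ k) => q; field; rewrite gt_eqF.
  rewrite ler_pM2l//; move: h1 h2 h3; rewrite /J (form_quad _ Hs Hz) !Flin//.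
  rewrite (form_quad _ (Hf k) (Hf k)) (form_quad _ (Hf k) (Hf m)).
  rewrite (alin _ (Hf k) (Hf m) Hz) (asym (f_ k) (fun p => -1 * _ + _)).
  rewrite (asym (f_ m) (fun p => -1 * _ + _)) !(alin _ (Hf k) (Hf k))//.
  move: rm; move: (r k) (r m) (a (f_ k) (f_ k)) (a (f_ k) (f_ m)) (a (f_ m) (f_ m)).
  move: (F (f_ k)) (F (f_ m)) (inf B) => *; lra.
have [f Hg fcvg] := complete Hf hc; exists f; split => // h Hh.
(* Approximate minimality in the direction [h] controls the first variation at [f_k] through the
   discriminant. *)
have hk k : (a (f_ k) h - F h) ^+ 2 <= r k * a h h.
  apply: quadratic_discriminant => t.
  have := Jle _ (Hlin t Hh (Hf k)); have := (hf k).2; rewrite /J form_quad// Flin//.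
  rewrite (asym h (f_ k)); move: (a h h) (a (f_ k) h) (a (f_ k) (f_ k)) (F h) (F (f_ k)) => *; lra.
have hb k : (a f h - F h) ^+ 2 <= 2 * (r k * a h h) +
    2 * (C * E (fun p => -1 * f p + f_ k p) * a h h).
  have h1 := form_CS (Hlin (-1) Hg (Hf k)) Hh; have h2 := bounded (Hlin (-1) Hg (Hf k)).
  have h3 := ler_wpM2r (form_ge0 Hh) h2; have h4 := hk k; move: h1; rewrite alin// => h1.
  have {h3}h1 := le_trans h1 h3.
  move: (C * _ * _) (r k * _) (a f h) (a (f_ k) h) (F h) h1 h4 => x y b c d h1 h4.
  have := sqr_ge0 (- 1 * b + c - (d - c) *+ 1 - 0); have := sqr_ge0 (-1 * b + c + (c - d)).
  have := sqr_ge0 (-1 * b + c - (d - c)); have := sqr_ge0 (-1 * b + c + (d - c)).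
  move: h1 h4; rewrite !expr2; nra.
apply/eqP; rewrite -subr_eq0 -sqrf_eq0 eq_le sqr_ge0 andbT.
have hr : 2 * (r k * a h h) + 2 * (C * E (fun p => -1 * f p + f_ k p) * a h h) @[k --> \oo] --> (0 : R).
  rewrite (_ : (0 : R) = 2 * ((4 * C)^-1 * 0 * a h h) + 2 * (C * 0 * a h h)); last by ring.
  apply: cvgD; apply: cvgMr => //; apply: cvgMl => //; apply: cvgMr => //.
  exact: cvg_geo4.
by apply: (cvgr_to_ge hr); apply: nearW.
Qed.

End RieszRepresentation.

(** * Competitors and hidden convexity *)

Section Competitors.
Variables (R : realType) (n : nat) (M : closed_riemannian R n.+1).
Implicit Types (i : chart M) (p : M) (t a m : R).

Lemma cv_mulE (g : M -> R) w z p :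
  covector_inner (cv_mul g w) z p = g p * covector_inner w z p.
Proof. by rewrite /covector_inner; have [i dp H] := in_chart_pick p; rewrite !H /cv_mul bilinZl. Qed.

(** The identity is [|g w + h z|^2 + |h w - g z|^2 = (g^2 + h^2) (|w|^2 + |z|^2)]. With [g] and [h]
    the partial derivatives of [rho], this is the gradient half of the hidden convexity. *)
Lemma cv_mul_combination_le (g h : M -> R) w z p : g p ^+ 2 + h p ^+ 2 <= 1 ->
  covector_inner (cv_axpy 1 (cv_mul g w) (cv_mul h z)) (cv_axpy 1 (cv_mul g w) (cv_mul h z)) p
    <= covector_inner w w p + covector_inner z z p.
Proof.
move=> gh; have := covector_inner_ge0 (cv_axpy 1 (cv_mul h w) (cv_mul (fun p => - g p) z)) p.
have a0 := covector_inner_ge0 w p; have c0 := covector_inner_ge0 z p.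
rewrite !covector_inner_axpyl !(covector_innerC _ (cv_axpy _ _ _)) !covector_inner_axpyl.
rewrite !cv_mulE !(covector_innerC _ (cv_mul _ _)) !cv_mulE (covector_innerC z w).
move: (covector_inner w w p) (covector_inner w z p) (covector_inner z z p) a0 c0 (g p) (h p) gh.
move=> a b c a0 c0 x y gh; rewrite !expr2 in gh *.
have h1 : 0 <= (a + c) * (1 - (x * x + y * y)) by apply: mulr_ge0; [apply: addr_ge0|rewrite subr_ge0].
move: h1; move=> ? ?; lra.
Qed.

(** Written as [t (1 + q) / sqrt (1 + q)] to reduce to [smooth_fun_invsqrt]. *)
Lemma rho_smooth t (f h : M -> R) : 0 < t -> smooth_fun f -> smooth_fun h ->
  smooth_fun (fun p => rho t (f p) (h p)).
Proof.
move=> t0 sf sh; pose q p := t ^- 2 * (f p * f p + h p * h p).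
have q0 p : 0 <= q p.
  by rewrite mulr_ge0 ?invr_ge0 ?exprn_ge0 ?(ltW t0)// addr_ge0// -expr2 sqr_ge0.
have sq_ : smooth_fun q by apply: smooth_funZ; apply: smooth_funD; apply: smooth_funM.
apply: (@smooth_fun_eq _ _ _ (fun p => t * ((1 + q p) * (Num.sqrt (1 + q p))^-1))); last first.
  apply: smooth_funZ; apply: smooth_funM; last exact: smooth_fun_invsqrt.
  by apply: smooth_funD => //; exact: smooth_fun_cst.
move=> p; have z0 : 0 < 1 + q p by rewrite ltr_pwDl.
rewrite -{1}(sqr_sqrtr (ltW z0)) expr2 mulfK ?gt_eqF ?sqrtr_gt0//.
rewrite -{1}(gtr0_norm t0) -sqrtr_sqr -sqrtrM ?sqr_ge0// /rho; congr Num.sqrt.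
by rewrite /q; move: (f p) (h p) => x y; field; rewrite gt_eqF.
Qed.

(** Obtained by differentiating [rho^2 = f^2 + h^2 + t^2] and dividing by [2 rho]. *)
Lemma rho_dform t (f h : M -> R) i p : 0 < t -> smooth_fun f -> smooth_fun h -> dom i p ->
  dform (fun p => rho t (f p) (h p)) i p =
  (f p / rho t (f p) (h p)) *: dform f i p + (h p / rho t (f p) (h p)) *: dform h i p.
Proof.
move=> t0 sf sh dp; have sr := rho_smooth t0 sf sh.
have r0 := rho_gt0 (f p) (h p) t0.
have E : (fun p => rho t (f p) (h p) * rho t (f p) (h p)) =
    fun p => 1 * (f p * f p) + (1 * (h p * h p) + t ^+ 2).
  by apply/funext => q; rewrite -expr2 rho_sqr !mul1r addrA.
have sff := smooth_funM sf sf; have shh := smooth_funM sh sh.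
have sc := @smooth_fun_cst _ _ M (t ^+ 2).
have sht : smooth_fun (fun p => 1 * (h p * h p) + t ^+ 2).
  by apply: smooth_funD => //; exact: smooth_funZ.
have := congr1 (fun F => dform F i p) E.
rewrite /= dform_M// dform_axpy// dform_axpy// dform_cst addr0 !scale1r !dform_M//.
rewrite -!mulr2n -mulrnDl => /eqP; rewrite -subr_eq0 -mulrnBl -scaler_nat scaler_eq0 pnatr_eq0 /=.
rewrite subr_eq0 => /eqP E2.
apply: (scalerI (lt0r_neq0 r0)); rewrite E2 scalerDr !scalerA.
by rewrite !(mulrC (rho _ _ _)) !divfK ?gt_eqF.
Qed.

Variables (vol : {measure set (borel M) -> \bar R}) (hvol : is_volume vol).
Variables (S : set M) (oS : open S).
Variables (Y : set M) (cY : closed Y) (area : {measure set (borel M) -> \bar R}).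
Local Notation WD := (WD vol S).
Local Notation mS := (mS oS).
Local Notation sq := (sq vol S).
Local Notation gg := (gg vol S).
Local Notation H10 := (H10 vol Y area (S : set (borel M))).
Local Notation mfun f := (measurable_fun (S : set (borel M)) (f : borel M -> R)).

Lemma rho_measurable t f h : 0 < t -> mfun f -> mfun h ->
  mfun (fun p => rho t (f p) (h p)) /\ mfun (fun p => (rho t (f p) (h p))^-1).
Proof.
move=> t0 mf mh; pose q (p : borel M) := f p * f p + h p * h p.
have mq : measurable_fun (S : set (borel M)) q by apply: measurable_funD; apply: measurable_funM.
have c1 : continuous (fun z : R => Num.sqrt (`|z| + t ^+ 2)).
  move=> z; apply: (@cvg_comp _ _ _ (fun z : R => `|z| + t ^+ 2) (@Num.sqrt R) _
    (nbhs (`|z| + t ^+ 2))); last exact: sqrt_continuous.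
  by apply: cvgD; [exact: norm_continuous|exact: cvg_cst].
have c2 : continuous (fun z : R => (Num.sqrt (`|z| + t ^+ 2))^-1).
  move=> z; apply: (@cvgV _ _ (nbhs z) (nbhs_filter z)); last exact: c1.
  by rewrite gt_eqF// sqrtr_gt0 ltr_wpDl ?exprn_gt0.
have E p : rho t (f p) (h p) = Num.sqrt (`|q p| + t ^+ 2).
  by rewrite /q -!expr2 ger0_norm// addr_ge0 ?sqr_ge0.
split.
- rewrite (_ : (fun p => _) = (fun z : R => Num.sqrt (`|z| + t ^+ 2)) \o q).
    exact: (measurableT_comp (continuous_measurable_fun c1) mq).
  by apply/funext => p; rewrite /= -E.
- rewrite (_ : (fun p => _) = (fun z : R => (Num.sqrt (`|z| + t ^+ 2))^-1) \o q).
    exact: (measurableT_comp (continuous_measurable_fun c2) mq).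
  by apply/funext => p; rewrite /= -E.
Qed.

Lemma rho_div_cvg t (z u v : nat -> R) (c x y : R) : 0 < t -> z k @[k --> \oo] --> c ->
  u k @[k --> \oo] --> x -> v k @[k --> \oo] --> y ->
  z k / rho t (u k) (v k) @[k --> \oo] --> c / rho t x y.
Proof.
move=> t0 hz hu hv; apply: cvgM => //; apply: cvgV; last exact: rho_cvg.
by rewrite gt_eqF// rho_gt0.
Qed.

(** Subtracting [t] makes the function of two variables vanish at the origin, as the zero trace
    requires. *)
Lemma H10_rho t f h : 0 < t -> H10 f -> H10 h ->
  H10 (fun p => rho t (f p) (h p) - t) /\
  gg (fun p => rho t (f p) (h p) - t) (fun p => rho t (f p) (h p) - t) <= gg f f + gg h h.
Proof.
move=> t0 Hf Hh; have [w hw] := H10_WD Hf; have [z hz] := H10_WD Hh.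
have [H1 H2] : H10 (fun p => rho t (f p) (h p) - t) /\
  WD (fun p => rho t (f p) (h p) - t)
    (cv_axpy 1 (cv_mul (fun p => f p / rho t (f p) (h p)) w)
               (cv_mul (fun p => h p / rho t (f p) (h p)) z)).
  apply: (@H10_comp _ _ _ _ hvol _ oS _ cY _ (fun x y => rho t x y - t)
    (fun x y => x / rho t x y) (fun x y => y / rho t x y) 1) => //.
  - by move=> f' h' sf sh; apply: smooth_funD; [exact: rho_smooth|exact: smooth_fun_cst].
  - move=> f' h' sf sh i p dp.
    rewrite -rho_dform// (_ : (fun p0 => _) = fun p => 1 * rho t (f' p) (h' p) + (- t)).
      by rewrite dform_axpy// ?scale1r ?dform_cst ?addr0//; [exact: rho_smooth|exact: smooth_fun_cst].
    by apply/funext => q; rewrite mul1r.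
  - move=> x y x' y'; rewrite mul1r (_ : _ - t - _ = rho t x y - rho t x' y'); last by ring.
    exact: rho_lip.
  - by rewrite /rho expr0n /= !add0r sqrtr_sqr gtr0_norm// subrr.
  - by move=> x y; apply: rho_div_le => //; exact: rho_gel.
  - by move=> x y; apply: rho_div_le => //; exact: rho_ger.
  - move=> f' h' mf mh; have [m1 m2] := rho_measurable t0 mf mh; split.
    + exact: measurable_funB m1 (measurable_cst _).
    + exact: measurable_funM.
    + exact: measurable_funM.
  - by move=> u v x y hu hv; split; exact: rho_div_cvg.
split => //; rewrite (ggE hvol oS (H10_H1 H1) (H10_H1 H1) H2 H2).
rewrite (ggE hvol oS (H10_H1 Hf) (H10_H1 Hf) hw hw) (ggE hvol oS (H10_H1 Hh) (H10_H1 Hh) hz hz).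
have Iw := cvL2_Int oS hw.1; have Iz := cvL2_Int oS hz.1.
rewrite -(RIntD mS Iw Iz); apply: (RInt_le mS); [exact: (cvL2_Int oS H2.1)|exact: (IntD mS Iw Iz)|].
move=> p _; apply: (@cv_mul_combination_le (fun p => f p / rho t (f p) (h p)) (fun p => h p / rho t (f p) (h p))).
have r0 : 0 < rho t (f p) (h p) ^+ 2 by rewrite exprn_gt0 ?rho_gt0.
rewrite !expr_div_n -mulrDl ler_pdivrMr// mul1r rho_sqr lerDl; exact: sqr_ge0.
Qed.

(** The second argument of [H10_comp] is a dummy with derivative 0, filled with [f] itself. *)
Lemma H10_comp1 (F G : R -> R) (K : R) f w : 0 <= K ->
  (forall f, smooth_fun f -> smooth_fun (fun p : M => F (f p))) ->
  (forall f, smooth_fun f -> forall i p, dom i p ->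
    dform (fun p : M => F (f p)) i p = G (f p) *: dform f i p) ->
  (forall x y, `|F x - F y| <= K * `|x - y|) -> F 0 = 0 -> (forall x, `|G x| <= K) ->
  (forall f, mfun f -> mfun (fun p => F (f p)) /\ mfun (fun p => G (f p))) ->
  (forall (v : nat -> R) (x : R), v k @[k --> \oo] --> x -> G (v k) @[k --> \oo] --> G x) ->
  H10 f -> WD f w ->
  H10 (fun p => F (f p)) /\
  WD (fun p => F (f p)) (cv_axpy 1 (cv_mul (fun p => G (f p)) w) (cv_mul (fun p => 0) w)).
Proof.
move=> K0 sF dF FL F0 Gb Fm Gc Hf hw.
have A1 f' h' : smooth_fun f' -> smooth_fun h' -> smooth_fun (fun p : M => (fun x y => F x) (f' p) (h' p)).
  by move=> sf _; exact: sF.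
have A2 f' h' : smooth_fun f' -> smooth_fun h' -> forall i p, dom i p ->
    dform (fun p : M => (fun x y => F x) (f' p) (h' p)) i p =
    (fun x y : R => G x) (f' p) (h' p) *: dform f' i p + (fun x y : R => 0) (f' p) (h' p) *: dform h' i p.
  by move=> sf _ i p dp; rewrite /= scale0r addr0; exact: dF.
have A3 (x y x' y' : R) : `|(fun x y => F x) x y - (fun x y => F x) x' y'| <= K * (`|x - x'| + `|y - y'|).
  by apply: le_trans (FL _ _) _; rewrite ler_wpM2l// lerDl.
have A4 (x y : R) : `|(fun x y : R => 0 : R) x y| <= K by rewrite normr0.
have A5 f' h' : mfun f' -> mfun h' -> [/\ mfun (fun p => (fun x y : R => F x) (f' p) (h' p)),
    mfun (fun p => (fun x y : R => G x) (f' p) (h' p)) & mfun (fun p => (fun x y : R => 0 : R) (f' p) (h' p))].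
  by move=> mf _; have [m1 m2] := Fm _ mf; split => //; exact: measurable_cst.
have A6 (u v : nat -> R) (x y : R) : u k @[k --> \oo] --> x -> v k @[k --> \oo] --> y ->
   (fun x y : R => G x) (u k) (v k) @[k --> \oo] --> (fun x y : R => G x) x y /\
   (fun x y : R => 0 : R) (u k) (v k) @[k --> \oo] --> (fun x y : R => 0 : R) x y.
  by move=> hu _; split; [exact: Gc|exact: cvg_cst].
exact: (@H10_comp _ _ _ _ hvol _ oS _ cY _ (fun x y => F x) (fun x y => G x) (fun x y => 0) K K0
  A1 A2 A3 F0 (fun x _ => Gb x) A4 A5 A6 f f w w Hf Hf hw hw).
Qed.

Lemma H10_soft_clamp a m t f : 0 <= a -> 0 < t -> H10 f ->
  H10 (fun p => soft_clamp a m t (f p)) /\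
  gg (fun p => soft_clamp a m t (f p)) (fun p => soft_clamp a m t (f p)) <= (2 * a) ^+ 2 * gg f f.
Proof.
move=> a0 t0 Hf; have [w hw] := H10_WD Hf.
pose G x := a * ((x + m) / rho t (x + m) 0 - (x - m) / rho t (x - m) 0).
have Gb x : `|G x| <= 2 * a.
  rewrite /G normrM (ger0_norm a0) mulrC ler_wpM2r// (le_trans (ler_normB _ _))//.
  by rewrite (_ : 2 = 1 + 1 :> R) ?lerD// rho_div_le ?rho_gel.
have a20 : 0 <= 2 * a by rewrite mulr_ge0.
have [H1 H2] : H10 (fun p => soft_clamp a m t (f p)) /\
  WD (fun p => soft_clamp a m t (f p))
    (cv_axpy 1 (cv_mul (fun p => G (f p)) w) (cv_mul (fun p => 0) w)).
  refine (@H10_comp1 (soft_clamp a m t) G (2 * a) f w a20 _ _ _ (soft_clamp0 a m t) Gb _ _ Hf hw).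
  - move=> f' sf; apply: smooth_funZ; apply: smooth_funD.
      by apply: rho_smooth => //; [apply: smooth_funD => //|]; exact: smooth_fun_cst.
    apply: (@smooth_fun_eq _ _ _ (fun p => -1 * rho t (f' p - m) 0)) => [p|]; first by rewrite mulN1r.
    apply: smooth_funZ.
    by apply: rho_smooth => //; [apply: smooth_funD => //|]; exact: smooth_fun_cst.
  - move=> f' sf i p dp; have s0 := @smooth_fun_cst _ _ M 0.
    have ds (c : R) : smooth_fun (fun p => 1 * f' p + c) /\ dform (fun p => 1 * f' p + c) i p = dform f' i p.
      have sc := @smooth_fun_cst _ _ M c; split; first by apply: smooth_funD => //; exact: smooth_funZ.
      by rewrite dform_axpy// dform_cst scale1r addr0.
    have [s1 d1] := ds m; have [s2 d2] := ds (- m).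
    have r1 := rho_smooth t0 s1 s0; have r2 := rho_smooth t0 s2 s0.
    rewrite (_ : (fun p0 => _) = fun p => a * rho t (1 * f' p + m) 0 +
       ((- a) * rho t (1 * f' p + - m) 0 + 0)); last first.
      by apply/funext => q; rewrite /soft_clamp mul1r; ring.
    have s3 : smooth_fun (fun p => - a * rho t (1 * f' p + - m) 0 + 0).
      by apply: smooth_funD => //; exact: smooth_funZ.
    rewrite dform_axpy// dform_axpy// dform_cst addr0 !rho_dform// d1 d2 !mul0r !scale0r !addr0 !scalerA.
    rewrite -scalerDl mul1r; congr (_ *: _); rewrite /G.
    move: (rho _ _ _)^-1 (rho _ _ _)^-1 => y z; ring.
  - by move=> x y; exact: soft_clamp_lip.
  - move=> f' mf.
    have mp : mfun (fun p => f' p + m) by apply: measurable_funD => //; exact: measurable_cst.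
    have mm : mfun (fun p => f' p - m) by apply: measurable_funB => //; exact: measurable_cst.
    have m0 : mfun (fun=> 0) by exact: measurable_cst.
    have [m1 m2] := rho_measurable t0 mp m0; have [m3 m4] := rho_measurable t0 mm m0.
    split => //.
    + by apply: measurable_funM; [exact: measurable_cst|exact: measurable_funB].
    + apply: measurable_funM; first exact: measurable_cst.
      by apply: measurable_funB; apply: measurable_funM.
  - move=> v x hv; apply: cvgMr; apply: cvgB; apply: rho_div_cvg => //; try exact: cvg_cst.
    + by apply: cvgD => //; exact: cvg_cst.
    + by apply: cvgD => //; exact: cvg_cst.
    + by apply: cvgB => //; exact: cvg_cst.
    + by apply: cvgB => //; exact: cvg_cst.
split => //; rewrite (ggE hvol oS (H10_H1 H1) (H10_H1 H1) H2 H2).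
rewrite (ggE hvol oS (H10_H1 Hf) (H10_H1 Hf) hw hw).
have Iw := cvL2_Int oS hw.1; rewrite -(RIntZ mS _ Iw).
apply: (RInt_le mS); [exact: (cvL2_Int oS H2.1)|exact: (IntZ mS _ Iw)|].
move=> p _; rewrite !covector_inner_axpyl !(covector_innerC _ (cv_axpy _ _ _)) !covector_inner_axpyl.
rewrite !cv_mulE !(covector_innerC _ (cv_mul _ _)) !cv_mulE.
have := covector_inner_ge0 w p; move: (covector_inner w w p) => x x0.
move: (G (f p)) (Gb (f p)) => g gb; rewrite [leLHS](_ : _ = g ^+ 2 * x); last by ring.
by rewrite ler_wpM2r// -(real_normK (num_real g)) lerXn2r ?nnegrE.
Qed.

End Competitors.

(** * Pointwise estimates for the double well *)

Section DoubleWell.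
Variable R : realType.
Implicit Types x y s : R.
Local Notation W := (@double_well R).

Lemma well_ge0 x : 0 <= W x.
Proof. by rewrite /double_well divr_ge0 ?sqr_ge0. Qed.

Lemma well_bounded (K x : R) : `|x| <= K -> `|W x| <= (1 + K ^+ 2) ^+ 2 / 4.
Proof.
move=> h; have K0 : 0 <= K := le_trans (normr_ge0 x) h.
have x2 : x ^+ 2 <= K ^+ 2 by rewrite -(real_normK (num_real x)) lerXn2r ?nnegrE.
rewrite ger0_norm ?well_ge0// /double_well ler_pM2r ?invr_gt0//.
have := sqr_ge0 x; move: (x ^+ 2) (K ^+ 2) x2 => a b ab a0; rewrite !expr2; nra.
Qed.

Lemma well_cvg (v : nat -> R) x : v k @[k --> \oo] --> x -> W (v k) @[k --> \oo] --> W x.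
Proof.
move=> h; rewrite /double_well !expr2; under eq_fun do rewrite !expr2.
have h1 : 1 - v k * v k @[k --> \oo] --> 1 - x * x by apply: cvgB; [exact: cvg_cst|exact: cvgM].
by apply: cvgM; [exact: cvgM|exact: cvg_cst].
Qed.

(** Where [|x| > 1] the clamp lands on [1] or [-1], the only zeros of [W]. *)
Lemma well_clamp_lt x : 1 < `|x| -> W (clamp 1 x) < W x.
Proof.
move=> h; have -> : W (clamp 1 x) = 0.
  rewrite /clamp /double_well; move: h; rewrite ltr_normr => /orP[h|h].
    by rewrite !ger0_norm; [field|lra..].
  by rewrite [`|x + 1|]ler0_norm ?[`|x - 1|]ler0_norm; [field|lra..].
rewrite /double_well divr_gt0// exprn_even_gt0//= subr_eq0 eq_sym -(real_normK (num_real x)).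
by rewrite gt_eqF// expr_gt1// ltW.
Qed.

Lemma well_clamp_le x : W (clamp 1 x) <= W x.
Proof.
by have [h|h] := leP `|x| 1; [rewrite clamp_id|exact: ltW (well_clamp_lt h)].
Qed.

Lemma well_second_derivative x : derive1 (derive1 W) x = 3 * x ^+ 2 - 1.
Proof.
have d1 y : derive1 W y = y ^+ 3 - y.
  rewrite derive1E; have h : is_derive y (1 : R) W (y ^+ 3 - y).
    rewrite (_ : W = (4^-1 : R) \*: ((cst 1 - (@id R) ^+ 2) ^+ 2)); last first.
      by apply/funext => z; rewrite /double_well /= mulrC.
    apply: is_derive_eq; rewrite /GRing.scale /= (_ : (cst 1 - id ^+ 2) y = 1 - y ^+ 2)//.
    by field.
  exact: derive_val.
rewrite (_ : derive1 W = fun y => y ^+ 3 - y); last exact/funext.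
rewrite derive1E; have h : is_derive x (1 : R) (fun y : R => y ^+ 3 - y) (3 * x ^+ 2 - 1).
  rewrite (_ : (fun y => _) = (@id R) ^+ 3 - (@id R))//.
  by apply: is_derive_eq; rewrite /GRing.scale /=; ring.
exact: derive_val.
Qed.

(** [W] is a quadratic polynomial in the square of its argument, and the square of [rho - s^2] is
    [x^2 + s e] with [e = y^2 + O(s)]. Regularizing by [s^2], of higher order than the step [s],
    keeps its effect in the [s^2] remainder. *)
Lemma well_competitor x y s (k : R) : `|x| <= 1 -> `|y| <= k -> 0 < s <= 1 ->
  W (rho (s ^+ 2) x (Num.sqrt s * y) - s ^+ 2) <=
  W x - s * (2^-1 * ((1 - x ^+ 2) * y ^+ 2)) +
  s ^+ 2 * (4^-1 * (k ^+ 2 + 2 * (k + 2)) ^+ 2 + (k + 2)).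
Proof.
move=> x1 yk /andP[s0 s1]; have k0 : 0 <= k := le_trans (normr_ge0 y) yk.
have t0 : 0 < s ^+ 2 by rewrite exprn_gt0.
have q0 : 0 <= Num.sqrt s := sqrtr_ge0 s.
have q1 : Num.sqrt s <= 1 by rewrite -sqrtr1 ler_wsqrtr.
have t1 : s ^+ 2 <= 1 by rewrite exprn_ile1// ltW.
have := rho_le x (Num.sqrt s * y) (ltW t0); have := rho_ge (s ^+ 2) x (Num.sqrt s * y).
have := rho_sqr (s ^+ 2) x (Num.sqrt s * y); rewrite normrM (ger0_norm q0) exprMn (sqr_sqrtr (ltW s0)).
have h1 : Num.sqrt s * `|y| <= k.
  by rewrite (le_trans _ yk)// ler_piMl.
move: (rho _ _ _) => r r2 rge rle; have {}rle : r <= k + 2 by move: rle h1 x1 t1; lra.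
have y2 : y ^+ 2 <= k ^+ 2 by rewrite -(real_normK (num_real y)) lerXn2r ?nnegrE.
have x2 : x ^+ 2 <= 1 by rewrite -(real_normK (num_real x)) exprn_ile1.
have x20 := sqr_ge0 x; have y20 := sqr_ge0 y.
(* Defined by [(r - s^2)^2 = x^2 + s e]. *)
pose e := y ^+ 2 + 2 * (s * s * s) - 2 * (s * r).
have r0 : 0 <= r by exact: le_trans (ltW t0) rge.
have sr1 : s * r <= k + 2 by rewrite (le_trans _ rle)// ler_piMl.
have sr2 : s * (s ^+ 2) <= s * r by rewrite ler_wpM2l// ltW.
have e1 : `|e| <= k ^+ 2 + 2 * (k + 2).
  have k20 := sqr_ge0 k; have s3 : 0 <= s * s ^+ 2 by rewrite mulr_ge0 ?ltW.
  rewrite ler_norml /e; move: sr1 sr2 s3; rewrite (expr2 s) mulrA => sr1 sr2 s3; lra.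
have e2 : e ^+ 2 <= (k ^+ 2 + 2 * (k + 2)) ^+ 2.
  by rewrite -(real_normK (num_real e)) lerXn2r ?nnegrE// (le_trans (normr_ge0 e)).
have E : W (r - s ^+ 2) = W x + s ^+ 2 * (4^-1 * e ^+ 2) - s * (2^-1 * ((1 - x ^+ 2) * e)).
  rewrite /double_well (_ : (r - s ^+ 2) ^+ 2 = x ^+ 2 + s * e).
    by field.
  rewrite sqrrB r2 /e; move: (x ^+ 2) (y ^+ 2) => a b; ring.
rewrite E; have h2 : s ^+ 2 * (4^-1 * e ^+ 2) <= s ^+ 2 * (4^-1 * (k ^+ 2 + 2 * (k + 2)) ^+ 2).
  by rewrite ler_wpM2l ?(ltW t0)// ler_wpM2l.
have h3 : (1 - x ^+ 2) * (y ^+ 2 - e) <= 2 * (s * (k + 2)).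
  have p0 : 0 <= y ^+ 2 - e by rewrite /e; move: sr2; rewrite (expr2 s) mulrA => sr2; lra.
  have p1 : y ^+ 2 - e <= 2 * (s * (k + 2)).
    have := ler_wpM2l (ltW s0) rle; have s3 : 0 <= s * s * s by rewrite !mulr_ge0 ?ltW.
    rewrite /e; lra.
  apply: le_trans p1; rewrite ler_piMl// lerBlDr lerDl//.
have h4 := ler_wpM2l (ltW s0) h3; rewrite (_ : s ^+ 2 * (_ + _) = s ^+ 2 * (4^-1 * (k ^+ 2 + 2 * (k + 2)) ^+ 2) +
  2^-1 * (s * (2 * (s * (k + 2))))); last by rewrite (expr2 s); field.
move: h2 h4; move: (s ^+ 2 * (4^-1 * e ^+ 2)) (s ^+ 2 * (4^-1 * (k ^+ 2 + _) ^+ 2)) => a b h2.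
move: (s * (2 * (s * (k + 2)))) => c; rewrite (mulrBr (1 - x ^+ 2)) (mulrBr s).
rewrite (mulrCA s 2^-1) (mulrCA s 2^-1); move: (s * ((1 - x ^+ 2) * y ^+ 2)) (s * ((1 - x ^+ 2) * e)) (W x).
move=> *; lra.
Qed.

Lemma affine_limit_ge0 (X c : R) : 0 <= c -> (forall s, 0 < s <= 1 -> 0 <= X + s * c) -> 0 <= X.
Proof.
move=> c0 h; rewrite leNgt; apply/negP => X0; have d0 : 0 < - X + c + 1 by lra.
have : 0 < - X / (- X + c + 1) <= 1.
  by rewrite divr_gt0 ?oppr_gt0//= ler_pdivrMr// mul1r; lra.
move=> /h; rewrite -(pmulr_lge0 _ d0) mulrDl mulrAC divfK ?gt_eqF//; nra.
Qed.

Lemma potential_le (e a b x y : R) : 0 < e -> a + e^-1 * x <= b + e^-1 * y -> b <= a -> x <= y.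
Proof.
move=> e0 h1 h2; have h : e^-1 * x <= e^-1 * y by lra.
by move: h; rewrite ler_pM2l ?invr_gt0.
Qed.

(** Here [a], [b], [d] are the Dirichlet integrals of [u], of the competitor and of [f]; [x] and [y]
    are the potential terms of [u] and of the competitor; [z] integrates [(1 - u^2) g^2] for the
    truncation [g] of [f]; [V] is the volume. Division by [s] leaves the second-order inequality up
    to [O(s)]. *)
Lemma competitor_comparison (e s a b d x y z K V : R) : 0 < e -> 0 < s -> b <= a + s * d ->
  y <= x - s * (2^-1 * z) + s ^+ 2 * K * V ->
  e / 2 * a + e^-1 * x <= e / 2 * b + e^-1 * y ->
  0 <= 2^-1 * (e ^+ 2 * d - z) + s * (K * V).
Proof.
move=> e0 s0 h1 h2 h3; have e20 : 0 <= e / 2 by rewrite divr_ge0 ?ltW.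
have ei : 0 <= e^-1 by rewrite invr_ge0 ltW.
have := le_trans h3 (lerD (ler_wpM2l e20 h1) (ler_wpM2l ei h2)).
rewrite -subr_ge0 -(pmulr_rge0 _ e0) -(pmulr_rge0 (_ * _ + _) s0) => h.
apply: le_trans h _; rewrite le_eqVlt; apply/orP; left; apply/eqP.
by field; rewrite gt_eqF.
Qed.

End DoubleWell.

(** * Bounds and the second-order inequality for the minimizer *)

Section Minimizer.
Variables (R : realType) (n : nat) (M : closed_riemannian R n.+1).
Variables (vol : {measure set (borel M) -> \bar R}) (hvol : is_volume vol).
Variables (S : set M) (oS : open S).
Variables (Y : set M) (cY : closed Y) (area : {measure set (borel M) -> \bar R}).
Variables (eps : R) (eps0 : 0 < eps) (u : M -> R).
Hypothesis umin : minimizer vol Y area eps (S : set (borel M)) u.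
Local Notation WD := (WD vol S).
Local Notation mS := (mS oS).
Local Notation sq := (sq vol S).
Local Notation gg := (gg vol S).
Local Notation H10 := (H10 vol Y area (S : set (borel M))).
Local Notation W := (@double_well R).
Local Notation IntS f := (Int vol (S : set (borel M)) f).
Local Notation mfun f := (measurable_fun (S : set (borel M)) (f : borel M -> R)).
Local Notation "∫ f" := (\int[vol]_(p in (S : set (borel M))) f p) (at level 36, f at level 36).
Local Notation aeS P := {ae vol, forall p : borel M, S p -> P p}.

Let volT : (vol setT < +oo)%E := vol_finite hvol.
Let Hu : H10 u := umin.1.

Lemma Int_ae_le (f g : M -> R) : mfun f -> IntS g -> aeS (fun p => `|f p| <= g p) -> IntS f.
Proof.
move=> mf Ig fg; have h1 : aeS (fun p => (fun _ : nat => f p) k @[k --> \oo] --> f p).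
  by apply: aeW => p _; exact: cvg_cst.
have h2 : {ae vol, forall p : borel M, S p -> forall k : nat, `|f p| <= g p}.
  by apply: (@filterS _ (almost_everywhere vol) _ _ _ _ fg) => p h Sp _; exact: h.
by have [] := RInt_dct mS (fun _ : nat => mf) mf h1 Ig h2.
Qed.

Lemma H10_measurable f : H10 f -> mfun f. Proof. by move/H10_H1/H1_L2 => -[]. Qed.

Lemma well_measurable f : mfun f -> mfun (fun p => W (f p)).
Proof.
move=> mf; rewrite /double_well; apply: measurable_funM; last exact: measurable_cst.
apply: measurable_funX; apply: measurable_funB; [exact: measurable_cst|exact: measurable_funX].
Qed.

Lemma well_Int f K : mfun f -> aeS (fun p => `|f p| <= K) -> IntS (fun p => W (f p)).
Proof.
move=> mf fK; apply: (Int_ae_le (well_measurable mf) (Int_cst mS volT ((1 + K ^+ 2) ^+ 2 / 4))).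
by apply: (@filterS _ (almost_everywhere vol) _ _ _ _ fK) => p h Sp; apply: well_bounded; exact: h.
Qed.

Lemma clamp_measurable f : mfun f -> mfun (fun p => clamp 1 (f p)).
Proof.
have mn : measurable_fun setT (fun z : R => `|z|) := continuous_measurable_fun (@norm_continuous _ R).
move=> mf; apply: measurable_funM; first exact: measurable_cst.
apply: measurable_funB.
- by apply: (measurableT_comp mn); apply: measurable_funD => //; exact: measurable_cst.
- by apply: (measurableT_comp mn); apply: measurable_funB => //; exact: measurable_cst.
Qed.

Let density f p := eps / 2 * grad_inner vol (S : set (borel M)) f f p + eps^-1 * W (f p).

Let grad_Int f : H10 f -> IntS (grad_inner vol (S : set (borel M)) f f).
Proof. move=> Hf; have h := H10_H1 Hf; exact (grad_inner_Int oS h h). Qed.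

(** A competitor of finite energy makes the energy of [u] finite, so [W(u)] is integrable before any
    bound on [u] is known, and the comparison can be written with real integrals. *)
Lemma energy_le v : H10 v -> IntS (fun p => W (v p)) ->
  IntS (fun p => W (u p)) /\
  eps / 2 * gg u u + eps^-1 * ∫ (fun p => W (u p)) <=
  eps / 2 * gg v v + eps^-1 * ∫ (fun p => W (v p)).
Proof.
move=> Hv IW; have Iv : IntS (density v) := IntD mS (IntZ mS _ (grad_Int Hv)) (IntZ mS _ IW).
have le := umin.2 v Hv.
have mWu := well_measurable (H10_measurable Hu).
have Iu : IntS (density u).
  apply: Int_ge0P.
  - apply: measurable_funD; first exact: (Int_meas (IntZ mS _ (grad_Int Hu))).
    by apply: measurable_funM => //; exact: measurable_cst.
  - move=> p _; apply: addr_ge0; apply: mulr_ge0; rewrite ?well_ge0 ?divr_ge0 ?invr_ge0 ?(ltW eps0)//.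
    exact: covector_inner_ge0.
  - exact: (le_lt_trans le (Int_lty mS Iv)).
have IWu : IntS (fun p => W (u p)).
  apply: (@Int_eq _ _ _ _ _ mS (fun p => eps * (density u p - eps / 2 * grad_inner vol (S : set (borel M)) u u p))).
    by move=> p _; rewrite /density addrAC subrr add0r mulVKf ?gt_eqF.
  exact: (IntZ mS _ (IntB mS Iu (IntZ mS _ (grad_Int Hu)))).
split => //; move: le; rewrite /energy -(RIntE mS Iu) -(RIntE mS Iv) lee_fin.
rewrite (RIntD mS (IntZ mS _ (grad_Int Hu)) (IntZ mS _ IWu)) (RIntZ mS _ (grad_Int Hu)) (RIntZ mS _ IWu).
by rewrite (RIntD mS (IntZ mS _ (grad_Int Hv)) (IntZ mS _ IW)) (RIntZ mS _ (grad_Int Hv)) (RIntZ mS _ IW).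
Qed.

(** Soft clamps of [u] at height 1 are admissible and do not increase the Dirichlet integral, so in
    the limit minimality bounds the potential of [u] by that of its clamp. As clamping strictly
    lowers [W] wherever [|u| > 1], that set is null. *)
Lemma minimizer_bounded : aeS (fun p => `|u p| <= 1).
Proof.
have mu_ := H10_measurable Hu; have mc := clamp_measurable mu_.
pose v (k : nat) p := soft_clamp 2^-1 1 k.+1%:R^-1 (u p).
have h0 : 0 <= 2^-1 :> R by rewrite invr_ge0.
have t0 (k : nat) : 0 < (k.+1%:R^-1 : R) by rewrite invr_gt0 ltr0n.
have vb k p : `|v k p| <= 1 by apply: le_trans (soft_clamp_bounded _ h0 ler01 (t0 k)) _; rewrite mulr1 divff.
have Hv k := H10_soft_clamp hvol oS cY 1 h0 (t0 k) Hu.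
have mv k : mfun (v k) := H10_measurable (Hv k).1.
have IWv k : IntS (fun p => W (v k p)) by apply: (@well_Int (v k) 1 (mv k)); apply: aeW => p _; exact: vb.
have Wle k : ∫ (fun p => W (u p)) <= ∫ (fun p => W (v k p)).
  have [_] := energy_le (Hv k).1 (IWv k); have := (Hv k).2.
  rewrite divff// expr1n mul1r => h1 h2.
  exact: (potential_le eps0 h2 (ler_wpM2l (divr_ge0 (ltW eps0) (ler0n _ 2)) h1)).
have [IWu _] := energy_le (Hv 0%N).1 (IWv 0%N).
have h1 : {ae vol, forall p : borel M, S p -> W (v k p) @[k --> \oo] --> W (clamp 1 (u p))}.
  by apply: aeW => p _; apply: well_cvg; exact: soft_clamp_clamp_cvg.
have h2 : {ae vol, forall p : borel M, S p -> forall k, `|W (v k p)| <= (1 + 1 ^+ 2) ^+ 2 / 4}.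
  by apply: aeW => p _ k; exact: well_bounded.
have [IWc cW] := RInt_dct mS (fun k => well_measurable (mv k)) (well_measurable mc) h1 (Int_cst mS volT _) h2.
have le : ∫ (fun p => W (u p)) <= ∫ (fun p => W (clamp 1 (u p))).
  by apply: (cvgr_to_ge cW); apply: nearW.
(* The square root puts the nonnegative difference into the form handled by [L2_ae0]. *)
pose g (p : borel M) := Num.sqrt (W (u p) - W (clamp 1 (u p))).
have g2 p : g p ^+ 2 = W (u p) - W (clamp 1 (u p)) by rewrite sqr_sqrtr// subr_ge0 well_clamp_le.
have Lg : L2 vol (S : set (borel M)) g.
  apply: (L2P mS).
    apply: (measurableT_comp (continuous_measurable_fun (@sqrt_continuous R))).
    by apply: measurable_funB; exact: well_measurable.
  by apply: (Int_eq mS _ (IntB mS IWu IWc)) => p _; rewrite g2.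
have g0 : ∫ (fun p => g p ^+ 2) = 0.
  apply/eqP; rewrite eq_le; apply/andP; split; last by apply: Rintegral_ge0 => p _; exact: sqr_ge0.
  rewrite (@RInt_eq _ _ _ vol _ _ (fun p => W (u p) - W (clamp 1 (u p)))) => [|p _]; last exact: g2.
  by rewrite (RIntB mS IWu IWc) subr_le0.
apply: (@filterS _ (almost_everywhere vol) _ _ _ _ (L2_ae0 mS Lg g0)) => p h Sp.
rewrite leNgt; apply/negP => /well_clamp_lt; rewrite -subr_gt0 -g2 h//.
by rewrite expr0n ltxx.
Qed.

(** The clamped representative is bounded at every point, so the coefficients built from it need no
    almost everywhere bounds. *)
Lemma minimizer_clamp : aeS (fun p => u p = clamp 1 (u p)).
Proof.
apply: (@filterS _ (almost_everywhere vol) _ _ _ _ minimizer_bounded) => p h Sp.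
by rewrite clamp_id//; exact: h.
Qed.

Local Notation c p := (clamp 1 (u p)).

Lemma coefficient_Int f h (q : M -> R) (K : R) : H10 f -> H10 h -> mfun q ->
  (forall p, `|q p| <= K) -> IntS (fun p => q p * (f p * h p)).
Proof.
move=> Hf Hh mq qK; have I := L2_prod mS (H1_L2 (H10_H1 Hf)) (H1_L2 (H10_H1 Hh)).
have I2 := IntZ mS K (Int_norm I).
have m2 : mfun (fun p => q p * (f p * h p)) by apply: measurable_funM => //; exact: Int_meas I.
have b2 p : S p -> `|q p * (f p * h p)| <= K * `|f p * h p| by move=> _; rewrite normrM ler_wpM2r.
exact (Int_le mS m2 b2 I2).
Qed.

Lemma one_minus_sqr_clamp p : 0 <= 1 - c p ^+ 2 <= 1.
Proof. by rewrite subr_ge0 -(real_normK (num_real (c p))) exprn_ile1 ?clamp_le1// gerBl sqr_ge0. Qed.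

Let mc : mfun (fun p => c p). Proof. exact: (clamp_measurable (H10_measurable Hu)). Qed.

Let mq : mfun (fun p => 1 - c p ^+ 2).
Proof. by apply: measurable_funB; [exact: measurable_cst|exact: measurable_funX]. Qed.

Let qb p : `|1 - c p ^+ 2| <= 1.
Proof. by have /andP[h1 h2] := one_minus_sqr_clamp p; rewrite ger0_norm. Qed.

(* The regularization by [s^2] makes the competitor smooth in [(u, f)]. *)
Lemma soft_clamp_convexity f (k : nat) : H10 f ->
  ∫ (fun p => (1 - c p ^+ 2) * soft_clamp 2^-1 k%:R k.+1%:R^-1 (f p) ^+ 2) <= eps ^+ 2 * gg f f.
Proof.
move=> Hf; have h0 : 0 <= 2^-1 :> R by rewrite invr_ge0.
have t0 : 0 < (k.+1%:R^-1 : R) by rewrite invr_gt0 ltr0n.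
have [H1 _] := H10_soft_clamp hvol oS cY k%:R h0 t0 Hf.
set g := fun p => soft_clamp 2^-1 k%:R k.+1%:R^-1 (f p).
have gb p : `|g p| <= k%:R.
  by apply: le_trans (soft_clamp_bounded _ h0 (ler0n _ k) t0) _; rewrite divff// mul1r.
have I0 : IntS (fun p => (1 - c p ^+ 2) * g p ^+ 2).
  by apply: (Int_eq mS _ (coefficient_Int H1 H1 mq qb)) => p _; rewrite expr2.
pose K : R := 4^-1 * (k%:R ^+ 2 + 2 * (k%:R + 2)) ^+ 2 + (k%:R + 2).
have K0 : 0 <= K by rewrite addr_ge0 ?mulr_ge0 ?sqr_ge0 ?invr_ge0 ?addr_ge0.
have V0 : 0 <= ∫ (fun _ => 1 : R) by apply: Rintegral_ge0.
rewrite -subr_ge0 -(pmulr_rge0 _ (_ : 0 < 2^-1)) ?invr_gt0//.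
apply: (affine_limit_ge0 (mulr_ge0 K0 V0)) => s hs; have /andP[s0 s1] := hs.
(* With [a = sqrt s / 2] the soft clamp is [sqrt s g], and its Dirichlet integral is at most [s]
   times that of [f]. *)
have q0 : 0 <= Num.sqrt s * 2^-1 by rewrite mulr_ge0 ?sqrtr_ge0.
have [H2 G2] := H10_soft_clamp hvol oS cY k%:R q0 t0 Hf.
have E2 : (fun p => soft_clamp (Num.sqrt s * 2^-1) k%:R k.+1%:R^-1 (f p)) = fun p => Num.sqrt s * g p.
  by apply/funext => p; rewrite /g /soft_clamp mulrA.
have Es : (2 * (Num.sqrt s * 2^-1)) ^+ 2 = s.
  by rewrite mulrCA divff// mulr1 (sqr_sqrtr (ltW s0)).
rewrite Es E2 in G2; rewrite E2 in H2.
have s20 : 0 < s ^+ 2 by rewrite exprn_gt0.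
have [H3 G3] := H10_rho hvol oS cY s20 Hu H2.
set v := fun p => rho (s ^+ 2) (u p) (Num.sqrt s * g p) - s ^+ 2 in H3 G3.
(* [v] with [u] replaced by its clamp: [well_competitor] needs the first argument bounded by 1 at
   every point. *)
pose v' p := rho (s ^+ 2) (c p) (Num.sqrt s * g p) - s ^+ 2.
have vv' : aeS (fun p => v p = v' p).
  apply: (@filterS _ (almost_everywhere vol) _ _ _ _ minimizer_clamp) => p h Sp.
  by rewrite /v {1}h.
have mv' : mfun v'.
  apply: measurable_funB; last exact: measurable_cst.
  by have [] := rho_measurable s20 mc (H10_measurable H2).
have vb p : `|v' p| <= 1 + Num.sqrt s * k%:R.
  rewrite /v' ger0_norm ?subr_ge0 ?rho_ge// lerBlDr; apply: le_trans (rho_le _ _ (ltW s20)) _.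
  by rewrite lerD2r lerD ?clamp_le1// normrM (ger0_norm (sqrtr_ge0 s)) ler_wpM2l ?sqrtr_ge0.
have IWv' : IntS (fun p => W (v' p)) by apply: (well_Int mv'); apply: aeW => p _; exact: vb.
have vb' : aeS (fun p => `|v p| <= 1 + Num.sqrt s * k%:R).
  by apply: (@filterS _ (almost_everywhere vol) _ _ _ _ vv') => p h Sp; rewrite h.
have IWv := well_Int (H10_measurable H3) vb'.
have IWc : IntS (fun p => W (c p)) by apply: (well_Int mc); apply: aeW => p _; exact: clamp_le1.
have [_] := energy_le H3 IWv.
have -> : ∫ (fun p => W (v p)) = ∫ (fun p => W (v' p)).
  apply: (RInt_ae_eq (mS : measurable (S : set (borel M)))); [exact: Int_meas IWv|exact: Int_meas IWv'|].
  by apply: (@filterS _ (almost_everywhere vol) _ _ _ _ vv') => p h Sp; rewrite h.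
have -> : ∫ (fun p => W (u p)) = ∫ (fun p => W (c p)).
  apply: (RInt_ae_eq (mS : measurable (S : set (borel M)))); [exact: (well_measurable (H10_measurable Hu))|exact: Int_meas IWc|].
  by apply: (@filterS _ (almost_everywhere vol) _ _ _ _ minimizer_clamp) => p h Sp; rewrite {1}h.
have I1 := IntZ mS 2^-1 I0; have I2 := IntZ mS s I1; have I3 := IntB mS IWc I2.
have I4 := IntZ mS (s ^+ 2 * K) (Int_cst mS volT 1).
have : ∫ (fun p => W (v' p)) <= ∫ (fun p => W (c p) - s * (2^-1 * ((1 - c p ^+ 2) * g p ^+ 2)) + s ^+ 2 * K * 1).
  apply: (RInt_le mS IWv' (IntD mS I3 I4)) => p _; rewrite mulr1.
  exact: (well_competitor (clamp_le1 (u p)) (gb p) hs).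
rewrite (RIntD mS I3 I4) (RIntB mS IWc I2).
rewrite (RIntZ mS _ I1) (RIntZ mS _ I0) (RIntZ mS _ (Int_cst mS volT 1)).
move=> h2 h3; exact: (competitor_comparison eps0 s0 (le_trans G3 (lerD (lexx _) G2)) h2 h3).
Qed.

(** The truncations of [f] are at most [|f|] in absolute value and tend to [f], so the inequality
    for them passes to the limit by dominated convergence. *)
Lemma hidden_convexity f : H10 f -> ∫ (fun p => (1 - c p ^+ 2) * f p ^+ 2) <= eps ^+ 2 * gg f f.
Proof.
move=> Hf; have h0 : 0 <= 2^-1 :> R by rewrite invr_ge0.
pose g (k : nat) p := soft_clamp 2^-1 k%:R k.+1%:R^-1 (f p).
have t0 (k : nat) : 0 < (k.+1%:R^-1 : R) by rewrite invr_gt0 ltr0n.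
have mg k : mfun (g k) := H10_measurable (H10_soft_clamp hvol oS cY k%:R h0 (t0 k) Hf).1.
have h1 : {ae vol, forall p : borel M, S p ->
    (1 - c p ^+ 2) * g k p ^+ 2 @[k --> \oo] --> (1 - c p ^+ 2) * f p ^+ 2}.
  apply: aeW => p _; apply: cvgMr; rewrite expr2 (_ : (fun k => _) = fun k => g k p * g k p).
    by apply: cvgM; exact: soft_clamp_cvg_id.
  by apply/funext => k; rewrite expr2.
have h2 : {ae vol, forall p : borel M, S p -> forall k, `|(1 - c p ^+ 2) * g k p ^+ 2| <= f p ^+ 2}.
  apply: aeW => p _ k; rewrite normrM -[leRHS]mul1r; apply: ler_pM => //.
  rewrite normrX -(real_normK (num_real (f p))) lerXn2r ?nnegrE//.
  by apply: le_trans (soft_clamp_le _ _ h0 (t0 k)) _; rewrite divff// mul1r.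
have mgq k : mfun (fun p => (1 - c p ^+ 2) * g k p ^+ 2).
  by apply: measurable_funM => //; exact: measurable_funX.
have mfq : mfun (fun p => (1 - c p ^+ 2) * f p ^+ 2).
  by apply: measurable_funM => //; apply: measurable_funX; exact: H10_measurable.
have [_ cv] := RInt_dct mS mgq mfq h1 (L2_sq (H1_L2 (H10_H1 Hf))) h2.
by apply: (cvgr_to_le cv); apply: nearW => k; exact: soft_clamp_convexity.
Qed.

End Minimizer.

(** * Coercivity and the inverse *)

(** Here [i = eps^-2], [B] and [D] are the squared norms of [f] and of its gradient, [P] integrates
    [u^2 f^2], [Q] is the value of the form, and [j] is the inverse of the threshold below which
    [u^2] counts as small. The condition on [th] allows [B] to be absorbed. *)
Lemma coercivity_estimate (R : realFieldType) (i j th B D P Q : R) :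
  0 < i -> 0 < j -> 0 <= B -> 0 <= th -> th * (1 + i) <= 2^-1 ->
  D = i * (Q + B - 3 * P) -> 2 * P <= Q -> 0 <= P -> B <= th * (B + D) + j * P ->
  B + D <= (1 + j + i * (2 + j)) * Q.
Proof.
move=> i0 j0 B0 th0 hth hD hQ P0 hB; have Q0 : 0 <= Q by apply: le_trans hQ; rewrite mulr_ge0.
have D1 : D <= i * (Q + B) by rewrite hD ler_wpM2l ?(ltW i0)// gerBl mulr_ge0.
have h1 := ler_wpM2l th0 D1; have h2 := ler_wpM2r B0 hth.
have thi : th * i <= 2^-1 by apply: le_trans hth; rewrite mulrDr mulr1 lerDr.
have h3 := ler_wpM2r Q0 thi; have h4 := ler_wpM2l (ltW j0) hQ.
have B1 : B <= Q + j * Q.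
  move: hB h1 h2 h4 h3; rewrite !(mulrDr th) !mulrDl mulr1 (mulrDr i) (mulrDr th) !mulrA.
  rewrite !mul1r mulrDr -!mulrA.
  move: (th * B) (th * D) (th * (i * Q)) (th * (i * B)) (j * P) (j * Q) => *; lra.
have h5 := ler_wpM2l (ltW i0) B1.
rewrite (_ : (1 + j + i * (2 + j)) * Q = Q + j * Q + 2 * (i * Q) + i * (j * Q)); last by ring.
move: D1 B1 h5; rewrite (mulrDr i Q B) (mulrDr i Q).
move: (i * Q) (i * B) (i * (j * Q)) (j * Q) => *; lra.
Qed.

(** * Coercivity of the second variation *)

Section Coercivity.
Variables (R : realType) (n : nat) (M : closed_riemannian R n.+1).
Variables (vol : {measure set (borel M) -> \bar R}) (hvol : is_volume vol).
Variables (S : set M) (oS : open S).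
Variables (Y : set M) (cY : closed Y) (area : {measure set (borel M) -> \bar R}).
Variables (eps : R) (eps0 : 0 < eps) (u : M -> R).
Hypothesis umin : minimizer vol Y area eps (S : set (borel M)) u.
Hypothesis u0 : {ae vol, forall p : borel M, S p -> u p != 0}.
Hypothesis UI_smooth : forall eta : R, 0 < eta -> exists2 del : R, 0 < del &
  forall A : set (borel M), measurable A -> A `<=` S -> (vol A <= del%:E)%E ->
  forall f : M -> R, smooth_fun f ->
  (\int[vol]_(p in A) (f p ^+ 2)%:E <= (eta * energy1 vol S f)%:E)%E.
Local Notation WD := (WD vol S).
Local Notation mS := (mS oS).
Local Notation sq := (sq vol S).
Local Notation DD := (DD vol S).
Local Notation gg := (gg vol S).
Local Notation E1 := (E1 vol S).
Local Notation H10 := (H10 vol Y area (S : set (borel M))).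
Local Notation IntS f := (Int vol (S : set (borel M)) f).
Local Notation mfun f := (measurable_fun (S : set (borel M)) (f : borel M -> R)).
Local Notation "∫ f" := (\int[vol]_(p in (S : set (borel M))) f p) (at level 36, f at level 36).
Local Notation c p := (clamp 1 (u p)).

Let volT : (vol setT < +oo)%E := vol_finite hvol.
Let mc : mfun (fun p => c p). Proof. exact: (clamp_measurable (H10_measurable umin.1)). Qed.

(** Smooth approximants transfer the bound from smooth functions; the factor 4 comes from two uses
    of [(a + b)^2 <= 2 a^2 + 2 b^2]. *)
Lemma smooth_bound_H10 (eta : R) (A : set (borel M)) f : 0 <= eta -> measurable A -> A `<=` S ->
  (forall f : M -> R, smooth_fun f ->
    (\int[vol]_(p in A) (f p ^+ 2)%:E <= (eta * energy1 vol S f)%:E)%E) ->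
  H10 f -> \int[vol]_(p in A) (f p ^+ 2) <= 4 * eta * E1 f.
Proof.
move=> e0 mA AS hA Hf; have [w hw] := H10_WD Hf; have [f_ hf] := H10_elim hvol oS Hf hw.
have Lf := H1_L2 (H10_H1 Hf).
suff key k : \int[vol]_(p in A) (f p ^+ 2) <= 4 * eta * E1 f + 4^-1 ^+ k * (8 * eta + 2).
  have cv : 4 * eta * E1 f + 4^-1 ^+ k * (8 * eta + 2) @[k --> \oo] --> 4 * eta * E1 f + 0 * (8 * eta + 2).
    by apply: cvgD; [exact: cvg_cst|apply: cvgMl; exact: cvg_geo4].
  rewrite mul0r addr0 in cv.
  by apply: (cvgr_to_ge cv); apply: nearW.
have [sf h1 h2 _] := hf k; have Lk : L2 vol (S : set (borel M)) (f_ k) := smooth_L2 hvol oS sf.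
pose g (p : borel M) := -1 * f p + f_ k p.
have Lg : L2 vol (S : set (borel M)) g := L2D mS (L2Z mS (-1) Lf) Lk.
have If := Int_subset mA mS AS (L2_sq Lf); have Ik := Int_subset mA mS AS (L2_sq Lk).
have Ig := Int_subset mA mS AS (L2_sq Lg).
have g1 : \int[vol]_(p in A) (g p ^+ 2) <= 4^-1 ^+ k.
  apply: le_trans h1; apply: (RInt_subset mA mS AS (L2_sq Lg)) => p _; exact: sqr_ge0.
have f1 : sq (f_ k) <= 2 * sq f + 2 * 4^-1 ^+ k.
  have := sq_axpy_le oS 1 Lf Lg; rewrite (_ : (fun p => 1 * f p + g p) = f_ k) ?expr1n ?mulr1.
    by move=> h; apply: le_trans h _; rewrite lerD2l ler_pM2l.
  by apply/funext => p; rewrite /g mul1r mulN1r addrA subrr add0r.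
have d1 : DD (dform (f_ k)) <= 2 * gg f f + 2 * 4^-1 ^+ k.
  have := DD_axpy_le oS 1 hw.1 (cvL2_axpy oS (-1) hw.1 (dform_cvL2 hvol oS sf)).
  rewrite (_ : cv_axpy 1 w (cv_axpy (-1) w (dform (f_ k))) = dform (f_ k)) ?expr1n ?mulr1.
    rewrite (ggE hvol oS (H10_H1 Hf) (H10_H1 Hf) hw hw) => h; apply: le_trans h _.
    by rewrite lerD2l ler_pM2l.
  by apply/funext => i; apply/funext => p; rewrite /cv_axpy scale1r scaleN1r addrA subrr add0r.
have k1 : \int[vol]_(p in A) (f_ k p ^+ 2) <= eta * (sq (f_ k) + DD (dform (f_ k))).
  by have := hA _ sf; rewrite -(RIntE mA Ik) lee_fin.
have : \int[vol]_(p in A) (f p ^+ 2) <= \int[vol]_(p in A) (2 * f_ k p ^+ 2 + 2 * g p ^+ 2).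
  apply: (RInt_le mA If (IntD mA (IntZ mA 2 Ik) (IntZ mA 2 Ig))) => p _.
  rewrite /g; move: (f p) (f_ k p) => x y; have := sqr_ge0 (2 * y - x); rewrite !expr2; lra.
rewrite (RIntD mA (IntZ mA 2 Ik) (IntZ mA 2 Ig)) (RIntZ mA _ Ik) (RIntZ mA _ Ig) => h.
have h3 := le_trans k1 (ler_wpM2l e0 (lerD f1 d1)).
apply: le_trans h _; rewrite /E1; move: g1 h3.
move: (\int[vol]_(p in A) (f_ k p ^+ 2)) (\int[vol]_(p in A) (g p ^+ 2)) (4^-1 ^+ k) (sq f) (gg f f).
move=> a b q s d h3 h4; rewrite (_ : 4 * eta * _ + _ = 2 * (eta * (2 * s + 2 * q + (2 * d + 2 * q))) + 2 * q).
  by rewrite lerD// ler_pM2l.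
ring.
Qed.

Lemma sublevel_measurable (x : R) :
  measurable ((S : set (borel M)) `&` [set p : borel M | (c p ^+ 2 <= x)%R]).
Proof.
have E : (S : set (borel M)) `&` (fun p : borel M => c p ^+ 2) @^-1` `]-oo, x]%classic =
    (S : set (borel M)) `&` [set p : borel M | (c p ^+ 2 <= x)%R].
  by apply/seteqP; split => p; rewrite /= in_itv.
rewrite -E; exact: (measurable_funX 2 mc mS (measurable_itv _)).
Qed.

(** The sets where the clamped [u] satisfies [u^2 <= 1/(k+1)] decrease to its zero set in [S], which
    is null; finite volume allows continuity from above. *)
Lemma small_sublevel (del : R) : 0 < del -> exists2 d : R, 0 < d &
  (vol ((S : set (borel M)) `&` [set p : borel M | (c p ^+ 2 <= d)%R]) <= del%:E)%E.
Proof.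
move=> d0; pose F (k : nat) : set (borel M) := (S : set (borel M)) `&` [set p : borel M | (c p ^+ 2 <= k.+1%:R^-1)%R].
have mF k : measurable (F k) by exact: sublevel_measurable.
have [A [mA A0 hA]] : {ae vol, forall p : borel M, S p -> c p != 0}.
  apply: filterS2 u0 (minimizer_clamp hvol oS cY eps0 umin) => p h1 h2 Sp.
  by rewrite -h2//; exact: h1.
have mB : measurable (\bigcap_k F k) by exact: bigcap_measurable.
have B0 : vol (\bigcap_k F k) = 0.
  apply/eqP; rewrite eq_le measure_ge0 andbT -A0; apply: le_measure; rewrite ?inE//.
  move=> p Fp; apply: hA => /= h.
  have Sp : S p by have [] := Fp 0%N I.
  have := h Sp; rewrite -sqrf_eq0 => /eqP; apply.
  apply/eqP; rewrite eq_le sqr_ge0 andbT.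
  by apply: (@cvgr_to_ge _ _ _ _ _ _ _ (@cvg_harmonic R)); apply: nearW => k; have [] := Fp k I.
apply: contrapT => h.
have F1 k : (del%:E <= vol (F k))%E.
  rewrite leNgt; apply/negP => hl; apply: h; exists k.+1%:R^-1; first by rewrite invr_gt0 ltr0n.
  exact: ltW.
have ni : {homo F : k m / (k <= m)%N >-> (m <= k)%O}.
  move=> k m km; rewrite subsetEset => p [Sp h1]; split => //=; apply: le_trans h1 _.
  by rewrite lef_pV2 ?posrE ?ltr0n// ler_nat ltnS.
have F0 : (vol (F 0%N) < +oo)%E.
  by apply: le_lt_trans volT; apply: le_measure; rewrite ?inE.
have := nonincreasing_cvg_mu F0 mF mB ni; rewrite B0 => cv.
have : (del%:E <= 0)%E by apply: (cvge_to_ge cv); apply: nearW => k; exact: F1.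
by rewrite lee_fin leNgt d0.
Qed.

(** The bilinear form of [-L], with [W''(u) = 3 u^2 - 1] and [u] replaced by its clamp. *)
Definition second_variation f h :=
  eps ^+ 2 * gg f h + ∫ (fun p => (3 * c p ^+ 2 - 1) * (f p * h p)).

Let mP : mfun (fun p => c p ^+ 2). Proof. exact: measurable_funX. Qed.
Let m3 : mfun (fun p => 3 * c p ^+ 2 - 1).
Proof.
by apply: measurable_funB; last exact: measurable_cst; apply: measurable_funM => //; exact: measurable_cst.
Qed.

Lemma sqr_clamp_le1 p : 0 <= c p ^+ 2 <= 1.
Proof. by have := one_minus_sqr_clamp u p; move: (c p ^+ 2) => x; lra. Qed.

Let Pb p : `|c p ^+ 2| <= 1. Proof. by have := sqr_clamp_le1 p; rewrite ler_norml; lra. Qed.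
Let b3 p : `|3 * c p ^+ 2 - 1| <= 2. Proof. by have := sqr_clamp_le1 p; rewrite ler_norml; lra. Qed.

Lemma second_variation_Int f h : H10 f -> H10 h -> IntS (fun p => (3 * c p ^+ 2 - 1) * (f p * h p)).
Proof. by move=> Hf Hh; exact: (coefficient_Int oS Hf Hh m3 b3). Qed.

Lemma second_variation_sym f h : second_variation f h = second_variation h f.
Proof.
rewrite /second_variation (ggC vol S f h); congr (_ + _).
by apply: RInt_eq => p _; rewrite (mulrC (f p)).
Qed.

Lemma second_variation_axpy a f h g : H10 f -> H10 h -> H10 g ->
  second_variation (fun p => a * f p + h p) g = a * second_variation f g + second_variation h g.
Proof.
move=> Hf Hh Hg; have I1 := second_variation_Int Hf Hg; have I2 := second_variation_Int Hh Hg.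
rewrite /second_variation (gg_axpy hvol oS a (H10_H1 Hf) (H10_H1 Hh) (H10_H1 Hg)).
rewrite (@RInt_eq _ _ _ vol _ _ (fun p => a * ((3 * c p ^+ 2 - 1) * (f p * g p)) + (3 * c p ^+ 2 - 1) * (h p * g p))).
  by rewrite (RIntD mS (IntZ mS a I1) I2) (RIntZ mS _ I1); move: (gg f g) (gg h g) => x y; ring.
by move=> p _; ring.
Qed.

Lemma second_variation_bounded f : H10 f -> second_variation f f <= (eps ^+ 2 + 2) * E1 f.
Proof.
move=> Hf; have I1 := second_variation_Int Hf Hf; have I2 := L2_sq (H1_L2 (H10_H1 Hf)).
have h : ∫ (fun p => (3 * c p ^+ 2 - 1) * (f p * f p)) <= 2 * sq f.
  rewrite -(RIntZ mS _ I2); apply: (RInt_le mS I1 (IntZ mS _ I2)) => p _.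
  by rewrite -expr2 ler_wpM2r ?sqr_ge0//; have := b3 p; rewrite ler_norml => /andP[].
rewrite /second_variation /E1; have := sq_ge0 vol S f; have := gg_ge0 vol S f; have := sqr_ge0 eps.
move: h; move: (\int[vol]_(p in (S : set (borel M))) ((3 * c p ^+ 2 - 1) * (f p * f p))) (sq f) (gg f f) (eps ^+ 2) => x s g e h e0 g0 s0.
have := mulr_ge0 e0 s0; rewrite mulrDl mulrDr; lra.
Qed.

Lemma second_variation_coercive : exists2 C, 0 < C & forall f, H10 f -> E1 f <= C * second_variation f f.
Proof.
pose i := (eps ^+ 2)^-1; have i0 : 0 < i by rewrite invr_gt0 exprn_gt0.
(* [th (1 + i) = 1/2] is the absorption condition of [coercivity_estimate]; the factor [1/4] on the
   next line undoes the 4 of [smooth_bound_H10]. *)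
pose th := (2 * (1 + i))^-1; have th0 : 0 < th by rewrite invr_gt0 mulr_gt0 ?addr_gt0.
have eta0 : 0 < 4^-1 * th by apply: mulr_gt0 => //; rewrite invr_gt0.
have [del del0 hdel] := UI_smooth eta0; have [d d0 hd] := small_sublevel del0.
set A := _ `&` _ in hd; have mA : measurable A by exact: sublevel_measurable.
have AS : A `<=` S by move=> p [].
exists (1 + d^-1 + i * (2 + d^-1)).
  have j0 : 0 < d^-1 by rewrite invr_gt0.
  by apply: addr_gt0; [apply: addr_gt0|apply: mulr_gt0 => //; apply: addr_gt0].
move=> f Hf; have Lf := H1_L2 (H10_H1 Hf); have I2 := L2_sq Lf.
have hA := smooth_bound_H10 (ltW eta0) mA AS (hdel A mA AS hd) Hf.
have IP : IntS (fun p => c p ^+ 2 * f p ^+ 2).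
  by apply: (Int_eq mS _ (coefficient_Int oS Hf Hf mP Pb)) => p _; rewrite expr2.
pose P := ∫ (fun p => c p ^+ 2 * f p ^+ 2).
have hc := hidden_convexity hvol oS cY eps0 umin Hf.
have E3 : ∫ (fun p => (1 - c p ^+ 2) * f p ^+ 2) = sq f - P.
  rewrite -(RIntB mS I2 IP); apply: RInt_eq => p _; ring.
have EQ : second_variation f f = eps ^+ 2 * gg f f + 3 * P - sq f.
  rewrite /second_variation -addrA -(RIntZ mS _ IP) -(RIntB mS (IntZ mS 3 IP) I2).
  by congr (_ + _); apply: RInt_eq => p _; ring.
have P0 : 0 <= P.
  by apply: Rintegral_ge0 => p _; apply: mulr_ge0; exact: sqr_ge0.
apply: (@coercivity_estimate _ i d^-1 th _ _ P _ i0 _ _ (ltW th0)) => //.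
- by rewrite invr_gt0.
- exact: sq_ge0.
- by rewrite /th invfM -mulrA mulVf ?mulr1// gt_eqF// addr_gt0.
- have ar (e x y z : R) : e != 0 -> x = e^-1 * (e * x + 3 * z - y + y - 3 * z) by move=> h; field.
  by rewrite EQ /i; apply: ar; rewrite gt_eqF// exprn_gt0.
- have ar (x y z : R) : y - z <= x -> 2 * z <= x + 3 * z - y by lra.
  by rewrite EQ; apply: ar; rewrite -E3.
rewrite (_ : th = 4 * (4^-1 * th)); last by rewrite mulrA divff ?mul1r.
pose g (p : borel M) := f p ^+ 2 * \1_A p.
have Eg : ∫ g = \int[vol]_(p in A) (f p ^+ 2).
  rewrite /Rintegral; congr fine; rewrite [LHS]integral_indicE [RHS]integral_indicE.
  apply: eq_integral => p _; congr EFin; rewrite /g !indicE; have [pA|] := boolP (p \in A).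
    by rewrite (_ : p \in _) ?mulr1//; move: pA; rewrite !inE => /AS.
  by rewrite mulr0 mul0r.
have Ig : IntS g.
  have m1 : measurable_fun (S : set (borel M)) (\1_A : borel M -> R) by exact: measurable_indic.
  apply: (@Int_le _ _ _ vol _ mS g (fun p => f p ^+ 2) _ _ I2).
    by apply: measurable_funM => //; exact: Int_meas I2.
  move=> p _; have g0 : 0 <= g p by apply: mulr_ge0; [exact: sqr_ge0|rewrite indicE ler0n].
  by rewrite (ger0_norm g0) /g indicE ler_piMr ?sqr_ge0// lern1; case: (_ \in _).
(* On [A] the term [g] is [f^2]; off [A] the clamp satisfies [c^2 > d], so [f^2 <= d^-1 c^2 f^2]. *)
apply: (@le_trans _ _ (∫ (fun p => g p + d^-1 * (c p ^+ 2 * f p ^+ 2)))).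
  apply: (RInt_le mS I2 (IntD mS Ig (IntZ mS _ IP))) => p Sp.
  rewrite /g indicE; have [pA|pA] := boolP (p \in A).
    rewrite mulr1 lerDl; apply: mulr_ge0; first by rewrite invr_ge0 ltW.
    by apply: mulr_ge0; exact: sqr_ge0.
  rewrite mulr0 add0r mulrA ler_peMl ?sqr_ge0// mulrC ler_pdivlMr// mul1r ltW// ltNge.
  by apply/negP => hp; move/negP: pA; apply; rewrite inE; split.
by rewrite (RIntD mS Ig (IntZ mS _ IP)) (RIntZ mS _ IP) Eg lerD2r.
Qed.

End Coercivity.

Lemma weighted_norm_le (R : realFieldType) (e s g : R) : 0 < e -> 0 <= s -> 0 <= g ->
  e * s + e ^+ 3 * g <= (e + e ^+ 3) * (s + g).
Proof.
move=> e0 s0 g0; have h1 := mulr_ge0 (ltW e0) g0; have h2 := mulr_ge0 (exprn_ge0 3 (ltW e0)) s0.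
rewrite mulrDr !mulrDl; lra.
Qed.

Lemma weighted_norm_ge (R : realFieldType) (e s g : R) : 0 < e -> 0 <= s -> 0 <= g ->
  s + g <= (e^-1 + e ^- 3) * (e * s + e ^+ 3 * g).
Proof.
move=> e0 s0 g0; rewrite (_ : _ * (e * s + _) = s + g + (e ^+ 2 * g + e ^- 2 * s)).
  by rewrite lerDl addr_ge0 ?mulr_ge0 ?invr_ge0 ?exprn_ge0 ?(ltW e0).
by field; rewrite gt_eqF.
Qed.

Lemma opp_le_of_double (R : realFieldType) (x y : R) : -2 * x + x <= y -> - x <= y.
Proof. lra. Qed.

(** * Inversion of the linearized operator *)

Section Inverse.
Variables (R : realType) (n : nat) (M : closed_riemannian R n.+1).
Variables (vol : {measure set (borel M) -> \bar R}) (hvol : is_volume vol).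
Variables (S : set M) (oS : open S).
Variables (Y : set M) (cY : closed Y) (area : {measure set (borel M) -> \bar R}).
Variables (eps : R) (eps0 : 0 < eps) (u : M -> R).
Hypothesis umin : minimizer vol Y area eps (S : set (borel M)) u.
Hypothesis u0 : {ae vol, forall p : borel M, S p -> u p != 0}.
Hypothesis UI_smooth : forall eta : R, 0 < eta -> exists2 del : R, 0 < del &
  forall A : set (borel M), measurable A -> A `<=` S -> (vol A <= del%:E)%E ->
  forall f : M -> R, smooth_fun f ->
  (\int[vol]_(p in A) (f p ^+ 2)%:E <= (eta * energy1 vol S f)%:E)%E.
Local Notation mS := (mS oS).
Local Notation sq := (sq vol S).
Local Notation gg := (gg vol S).
Local Notation E1 := (E1 vol S).
Local Notation H10 := (H10 vol Y area (S : set (borel M))).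
Local Notation Hm1 := (Hm1 vol Y area eps (S : set (borel M))).
Local Notation dual_norm := (dual_norm vol Y area eps (S : set (borel M))).
Local Notation norm := (H1_norm vol eps (S : set (borel M))).
Local Notation Q := (second_variation vol S eps u).
Local Notation L := (linearized vol eps (S : set (borel M)) u).
Local Notation mfun f := (measurable_fun (S : set (borel M)) (f : borel M -> R)).

Lemma linearizedE f h : H10 f -> H10 h -> L f h = - Q f h.
Proof.
move=> Hf Hh; rewrite /linearized /second_variation.
have mu_ := H10_measurable umin.1; have I := second_variation_Int oS umin Hf Hh.
have mfh := Int_meas (L2_prod mS (H1_L2 (H10_H1 Hf)) (H1_L2 (H10_H1 Hh))).
have -> : \int[vol]_(p in (S : set (borel M))) (derive1 (derive1 (@double_well R)) (u p) * f p * h p) =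
  \int[vol]_(p in (S : set (borel M))) ((3 * clamp 1 (u p) ^+ 2 - 1) * (f p * h p)).
  rewrite (@RInt_eq _ _ _ vol _ _ (fun p => (3 * u p ^+ 2 - 1) * (f p * h p))) => [|p _]; last first.
    by rewrite well_second_derivative mulrA.
  apply: (RInt_ae_eq (mS : measurable (S : set (borel M)))); last 1 first.
  - apply: (@filterS _ (almost_everywhere vol) _ _ _ _ (minimizer_clamp hvol oS cY eps0 umin)) => p h1 Sp.
    by rewrite {1}h1.
  - apply: measurable_funM => //; apply: measurable_funB; last exact: measurable_cst.
    by apply: measurable_funM; [exact: measurable_cst|exact: measurable_funX].
  - exact: Int_meas I.
by rewrite mulrN opprD.
Qed.

Lemma form_norm_equivalence : exists C K : R, [/\ 0 < C, 0 < K,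
  forall f, H10 f -> E1 f <= C * Q f f, forall f, H10 f -> Q f f <= C * E1 f &
  forall f, H10 f -> norm f ^+ 2 <= K * Q f f /\ Q f f <= K * norm f ^+ 2].
Proof.
have [C C0 hC] := second_variation_coercive hvol oS cY eps0 umin u0 UI_smooth.
have hB f (Hf : H10 f) := second_variation_bounded oS umin Hf.
have e2 : 0 < eps ^+ 2 + 2 by rewrite addr_gt0 ?exprn_gt0.
have Q0 f : H10 f -> 0 <= Q f f.
  by move=> Hf; have := le_trans (E1_ge0 vol S f) (hC f Hf); rewrite pmulr_rge0.
have a0 : 0 < (eps + eps ^+ 3) * C by rewrite mulr_gt0 ?addr_gt0 ?exprn_gt0.
have b0 : 0 < (eps ^+ 2 + 2) * (eps^-1 + eps ^- 3).
  by rewrite mulr_gt0 ?addr_gt0 ?invr_gt0 ?exprn_gt0.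
exists (C + (eps ^+ 2 + 2)), ((eps + eps ^+ 3) * C + (eps ^+ 2 + 2) * (eps^-1 + eps ^- 3)).
split; [exact: addr_gt0|exact: addr_gt0| | |].
- move=> f Hf; apply: le_trans (hC f Hf) _; rewrite mulrDl lerDl mulr_ge0 ?(ltW e2)//; exact: Q0.
- move=> f Hf; apply: le_trans (hB f Hf) _; rewrite [leRHS]mulrDl lerDr mulr_ge0 ?(ltW C0)//; exact: E1_ge0.
move=> f Hf; have s0 := sq_ge0 vol S f; have g0 := gg_ge0 vol S f.
have h1 := weighted_norm_le eps0 s0 g0; have h2 := weighted_norm_ge eps0 s0 g0.
have n0 : 0 <= eps * sq f + eps ^+ 3 * gg f f.
  by rewrite addr_ge0 ?mulr_ge0 ?exprn_ge0 ?(ltW eps0).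
have nE : norm f ^+ 2 = eps * sq f + eps ^+ 3 * gg f f := sqr_sqrtr n0.
rewrite nE; split.
  have c1 : 0 <= eps + eps ^+ 3 by rewrite addr_ge0 ?exprn_ge0 ?(ltW eps0).
  apply: le_trans h1 _; apply: le_trans (ler_wpM2l c1 (hC f Hf)) _.
  by rewrite mulrA [leRHS]mulrDl lerDl mulr_ge0 ?(ltW b0)//; exact: Q0.
apply: le_trans (hB f Hf) _; apply: le_trans (ler_wpM2l (ltW e2) h2) _.
by rewrite mulrA [leRHS]mulrDl lerDr mulr_ge0 ?(ltW a0).
Qed.

(** Linearity is stated in the form [c f + h], so [-h] is written [-2 h + h]. *)
Lemma H1_norm_opp h : H10 h -> norm (fun p => -2 * h p + h p) = norm h.
Proof.
move=> Hh; have e1 : sq (fun p => -2 * h p + h p) = sq h.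
  by apply: RInt_eq => p _; ring.
have e2 : gg (fun p => -2 * h p + h p) (fun p => -2 * h p + h p) = gg h h.
  rewrite (gg_quad hvol oS (-2) (H10_H1 Hh) (H10_H1 Hh)); move: (gg h h) => x; ring.
have nE f : norm f = Num.sqrt (eps * sq f + eps ^+ 3 * gg f f) by [].
by rewrite !nE e1 e2.
Qed.

(** When every norm vanishes, the supremum is over the empty set and [dual_norm F] is [-oo]. The
    constant is then 0, and its identification with [dual_norm F] is claimed only in the other
    case. *)
Lemma Hm1_bound F : Hm1 F -> exists r : R, [/\ 0 <= r,
  forall h, H10 h -> `|F h| <= r * norm h &
  (exists h, H10 h /\ norm h != 0) -> dual_norm F = r%:E].
Proof.
move=> [Flin F0 Ffin]; have N0 h : 0 <= norm h := sqrtr_ge0 _.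
have [[h1 [Hh1 n1]]|no] := pselect (exists h, H10 h /\ norm h != 0); last first.
  exists 0; split => // h Hh; rewrite mul0r F0 ?normr0//.
  by apply/eqP; apply: contrapT => /negP n1; apply: no; exists h.
have ub h : H10 h -> norm h != 0 -> ((F h / norm h)%:E <= dual_norm F)%E.
  by move=> Hh nh; apply: ereal_sup_ubound; exists h.
have [r Er] : exists r : R, dual_norm F = r%:E.
  move: (ub _ Hh1 n1) Ffin; case: (dual_norm F) => [r _ _|//|//].
  by exists r.
have le h : H10 h -> norm h != 0 -> F h <= r * norm h.
  move=> Hh nh; have := ub _ Hh nh; rewrite Er lee_fin ler_pdivrMr//.
  by rewrite lt_neqAle eq_sym nh N0.
have le2 h : H10 h -> norm h != 0 -> `|F h| <= r * norm h.
  move=> Hh nh; rewrite ler_norml le// andbT lerNl.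
  have := le (fun p => -2 * h p + h p) (H10_axpy hvol oS cY (-2) Hh Hh).
  by rewrite (H1_norm_opp Hh) (Flin _ _ _ Hh Hh) => /(_ nh); exact: opp_le_of_double.
have r0 : 0 <= r.
  have := le_trans (normr_ge0 _) (le2 _ Hh1 n1).
  by rewrite pmulr_lge0// lt_neqAle eq_sym n1 N0.
exists r; split => // h Hh; have [nh|nh] := eqVneq (norm h) 0; last exact: le2.
by rewrite F0// normr0 nh mulr0.
Qed.

Lemma linearized_bounded_inverse : has_bounded_inverse vol Y area eps (S : set (borel M)) L.
Proof.
have [C [K [C0 K0 hE hQ hN]]] := form_norm_equivalence.
have Hlin c f h : H10 f -> H10 h -> H10 (fun p => c * f p + h p) by exact: (H10_axpy hvol oS cY c).
have Qsym := second_variation_sym vol S eps u.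
have Qlin c f h g : H10 f -> H10 h -> H10 g ->
    Q (fun p => c * f p + h p) g = c * Q f g + Q h g.
  by move=> Hf Hh Hg; exact: (second_variation_axpy hvol oS umin c Hf Hh Hg).
have E0 f : 0 <= E1 f by exact: E1_ge0.
have CS f h (Hf : H10 f) (Hh : H10 h) : Q f h ^+ 2 <= Q f f * Q h h :=
  form_CS Hlin Qsym Qlin C0 E0 hE Hf Hh.
have Q0 f (Hf : H10 f) : 0 <= Q f f := form_ge0 C0 E0 hE Hf.
have N0 h : 0 <= norm h := sqrtr_ge0 _.
have LHm1 f : H10 f -> Hm1 (L f).
  move=> Hf; split.
  - move=> a g h Hg Hh; rewrite (linearizedE Hf (Hlin a _ _ Hg Hh)) (linearizedE Hf Hg) (linearizedE Hf Hh).
    by rewrite Qsym (Qlin a _ _ _ Hg Hh Hf) (Qsym g) (Qsym h) opprD mulrN.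
  - move=> h Hh nh; have [_ h1] := hN h Hh; rewrite nh expr0n mulr0 in h1.
    rewrite (linearizedE Hf Hh); apply/eqP; rewrite oppr_eq0 -sqrf_eq0 eq_le sqr_ge0 andbT.
    apply: le_trans (CS f h Hf Hh) _; rewrite mulr_ge0_le0//; exact: Q0.
  - pose B := Num.sqrt (Q f f * K).
    apply: (@le_lt_trans _ _ B%:E); last exact: ltry.
    apply: ge_ereal_sup => _ [h [Hh nh ->]]; rewrite lee_fin ler_pdivrMr; last first.
      by rewrite lt_neqAle eq_sym nh N0.
    rewrite (linearizedE Hf Hh) (le_trans (ler_norm _))// normrN.
    rewrite -ler_sqr ?nnegrE ?mulr_ge0 ?sqrtr_ge0// real_normK ?num_real// exprMn.
    rewrite sqr_sqrtr ?mulr_ge0 ?Q0 ?(ltW K0)//.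
    apply: le_trans (CS f h Hf Hh) _; rewrite -mulrA ler_wpM2l ?Q0//.
    by have [] := hN h Hh.
split => //.
pose sol F : set (M -> R) := [set g | H10 g /\ forall h, H10 h -> L g h = F h].
pose inv F := xget (fun _ => 0) (sol F).
pose T := exists h, H10 h /\ norm h != 0.
have invP F : Hm1 F -> sol F (inv F).
  move=> HF; have [Flin _ _] := HF; have [r [r0 Fr _]] := Hm1_bound HF.
  have rK : 0 <= r ^+ 2 * K by rewrite mulr_ge0 ?sqr_ge0 ?(ltW K0).
  have lin2 c f h : H10 f -> H10 h -> - F (fun p => c * f p + h p) = c * - F f + - F h.
    by move=> Hf Hh; rewrite Flin// opprD mulrN.
  have bd h : H10 h -> (- F h) ^+ 2 <= r ^+ 2 * K * Q h h.
    move=> Hh; rewrite sqrrN -(real_normK (num_real (F h))).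
    apply: (@le_trans _ _ ((r * norm h) ^+ 2)).
      by rewrite ler_sqr ?nnegrE ?mulr_ge0//; exact: Fr.
    by rewrite exprMn -mulrA ler_wpM2l ?sqr_ge0//; have [] := hN h Hh.
  (* [L] is minus the form, so the functional to represent is [- F]. *)
  have [g [Hg gE]] := @riesz_representation M R H10 Q E1 C Hlin Qsym Qlin C0 E0 hE hQ
    (fun f_ h1 h2 => H10_complete hvol oS h1 h2) (fun h => - F h) (r ^+ 2 * K) rK lin2 bd u umin.1.
  have : sol F g by split => // h Hh; rewrite (linearizedE Hg Hh) (gE h Hh) opprK.
  by move=> sg; rewrite /inv; apply: (@xgetPex _ (fun _ => 0) (sol F)); exists g.
(* If no function has nonzero norm, [dual_norm] is [-oo], and the constant 0 makes the right side
   0. *)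
exists inv, (if pselect T then K else 0); split.
  move=> F HF; have [Hg gE] := invP F HF; split => //.
  have [r [r0 Fr hr]] := Hm1_bound HF.
  case: pselect => [yes|no]; last first.
    rewrite mul0e lee_fin; have [->//|n1] := eqVneq (norm (inv F)) 0.
    by exfalso; apply: no; exists (inv F).
  rewrite (hr yes) -EFinM lee_fin; have [->|n1] := eqVneq (norm (inv F)) 0.
    by rewrite mulr_ge0// ltW.
  have np : 0 < norm (inv F) by rewrite lt_neqAle eq_sym n1 N0.
  rewrite -(ler_pM2r np) -expr2; have [h1 _] := hN _ Hg; apply: le_trans h1 _.
  rewrite -mulrA ler_wpM2l ?(ltW K0)//; have := gE _ Hg; rewrite (linearizedE Hg Hg) => h2.
  by rewrite -(opprK (Q _ _)) h2 (le_trans (ler_norm _))// normrN; exact: Fr.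
move=> f Hf; have [Hg gE] := invP _ (LHm1 f Hf).
(* [Q d d = 0], so coercivity makes the L^2 norm of [d] vanish; this gives equality almost
   everywhere. *)
pose d p := -1 * inv (L f) p + f p; have Hd : H10 d := Hlin (-1) _ _ Hg Hf.
have Qd : Q d d = 0.
  have := gE _ Hd; rewrite (linearizedE Hg Hd) (linearizedE Hf Hd) => /oppr_inj e.
  by rewrite {1}/d (Qlin _ _ _ _ Hg Hf Hd) e mulN1r addNr.
have sd : sq d = 0.
  apply/eqP; rewrite eq_le sq_ge0 andbT; have := hE d Hd; rewrite Qd mulr0 /E1.
  by apply: le_trans; rewrite lerDl gg_ge0.
apply: (@filterS _ (almost_everywhere vol) _ _ _ _ (L2_ae0 mS (H1_L2 (H10_H1 Hd)) sd)) => p h Sp.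
by have := h Sp; rewrite /d mulN1r => /eqP; rewrite addrC subr_eq0 => /eqP ->.
Qed.

End Inverse.

Theorem mainTheorem8 (R : realType) (n : nat) (M : closed_riemannian R n.+1)
    (vol : {measure set (borel M) -> \bar R}) (hvol : is_volume vol)
    (k : nat) (hk : (2 <= k)%N) (alpha : R) (halpha : 0 < alpha < 1)
    (C rho : R) (hC : 0 < C) (hrho : 0 < rho) :
  exists eps0 : R, 0 < eps0 /\
    forall (eps : R) (Y Mp Mm : set M)
      (area : {measure set (borel M) -> \bar R}),
      0 < eps < eps0 ->
      closed_hypersurface k alpha Y ->
      separates Y Mp Mm ->
      is_area k alpha Y area ->
      (holder_norm_A k alpha Y Mp <= C%:E)%E ->
      (rho%:E <= normal_injectivity_radius k alpha Y)%E ->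
      (forall u, positive_minimizer vol Y area eps Mp u ->
         has_bounded_inverse vol Y area eps Mp (linearized vol eps Mp u)) /\
      (forall u, negative_minimizer vol Y area eps Mm u ->
         has_bounded_inverse vol Y area eps Mm (linearized vol eps Mm u)).
Proof.
exists 1; split => // eps Y Mp Mm area /andP[e0 _] hY [oMp oMm disj union [cMp cMm]] _ _ _.
have /andP[a0 _] := halpha.
have cY : closed Y by rewrite -(setCK Y) -union; apply: open_closedC; exact: openU.
have disj' : Mm `&` Mp = set0 by rewrite setIC.
have union' : Mm `|` Mp = ~` Y by rewrite setUC.
split => u [umin usign].
- apply: (linearized_bounded_inverse hvol oMp cY e0 umin).
    apply: (@filterS _ (almost_everywhere vol) _ _ _ _ usign) => p h Sp.
    by rewrite gt_eqF//; exact: h.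
  exact: (uniform_integrability hvol oMp hk a0 hY oMm disj union cMp cMm).
- apply: (linearized_bounded_inverse hvol oMm cY e0 umin).
    apply: (@filterS _ (almost_everywhere vol) _ _ _ _ usign) => p h Sp.
    by rewrite lt_eqF//; exact: h.
  exact: (uniform_integrability hvol oMm hk a0 hY oMp disj' union' cMm cMp).
Qed.
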